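(* Let $n\ge 2$. The moduli space of all cohomogeneity one actions on the complex hyperbolic space $\mathbb{C}H^n$ with a non-totally geodesic singular orbit (up to orbit equivalence) is isomorphic to the disjoint union $$\{2,\ldots,n-1\}\ \cup\ \big((0,\pi/2)\times\{2k\mid k\in\mathbb{Z},\ 0<2k<n\}\big).$$ Here the integer in $\{2,\ldots,n-1\}$ indicates the codimension of the singular orbit if the normal spaces of the singular orbit are real, and the integer in $\{2k\mid k\in\mathbb{Z},\ 0<2k<n\}$ indicates the codimension of the singular orbit if its normal spaces have constant Kähler angle $\varphi\in(0,\pi/2)$ (the corresponding element of the moduli space being $(\varphi,2k)$).
   Context: An isometric action on a Riemannian manifold is of cohomogeneity one if its orbit space is one-dimensional; an orbit is singular if its codimension is at least $2$ (a cohomogeneity one action on $\mathbb{C}H^n$ has at most one singular orbit). Two cohomogeneity one actions are orbit equivalent if there is an isometry of the manifold mapping the orbits of one onto the orbits of the other. The moduli space is the set of orbit equivalence classes; ''isomorphic'' means that the indicated assignment is a bijection. The set $\{2,\dots,n-1\}$ is empty for $n=2$. Let $J$ be the complex structure of $\mathbb{C}H^n$ and $V$ a real linear subspace of a tangent space. The Kähler angle of a nonzero vector $v\in V$ with respect to $V$ is the angle between $Jv$ and $V$. $V$ has constant Kähler angle $\varphi$ if every nonzero $v\in V$ has Kähler angle $\varphi$; $V$ is real if $JV\perp V$, i.e. it has constant Kähler angle $\pi/2$. *)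

(* Defs.v *)
From mathcomp Require Import all_boot all_order all_algebra.
From mathcomp Require Import all_classical all_reals all_analysis.
Set Implicit Arguments.
Unset Strict Implicit.
Unset Printing Implicit Defensive.
Import Order.TTheory GRing.Theory Num.Theory.
Import numFieldNormedType.Exports.

Local Open Scope classical_set_scope.
Local Open Scope ring_scope.

(* [Ck k U f], for [U] open: [f] is of class C^k on [U]. *)
Fixpoint Ck (R : realType) (V W : normedModType R) (k : nat) (U : set V)
    (f : V -> W) : Prop :=
  match k with
  | 0 => forall z, U z -> {for z, continuous f}
  | k'.+1 => (forall z, U z -> differentiable f z) /\
             (forall v, Ck k' U (fun z => 'd f z v))
  end.

Definition smooth_on (R : realType) (V W : normedModType R) (U : set V)
  (f : V -> W) : Prop := forall k, Ck k U f.

Definition smooth_curve (R : realType) (V : normedModType R) (c : R -> V) :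
  Prop := smooth_on [set: R] c.

(* Riemannian geometry in a single global chart: [G z] is the Gram matrix   *)
(* of the metric at the point [z] in the coordinate basis.                  *)

Section Chart.
Variables (R : realType) (m : nat).
Local Notation V := 'rV[R]_m.
Implicit Types (G : V -> 'M[R]_m) (M W : set V) (z u v w : V).

Definition metric G z v w : R := (v *m G z *m w^T) 0 0.

Definition partial (i : 'I_m) (f : V -> R) z : R :=
  'D_(delta_mx 0 i : V) f z.

(* The Christoffel symbol Gamma^k_{ij} of the Levi-Civita connection of [G]. *)
Definition christoffel G z (k i j : 'I_m) : R :=
  2^-1 * \sum_(l < m) invmx (G z) k l *
    (partial i (fun x => G x j l) z + partial j (fun x => G x i l) z
     - partial l (fun x => G x i j) z).

(* The covariant derivative of the velocity of [c] along [c]. *)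
Definition covariant_acceleration G (c : R -> V) (t : R) : V :=
  \row_k ((derive1 (derive1 c) t) 0 k +
    \sum_(i < m) \sum_(j < m)
      christoffel G (c t) k i j * (derive1 c t) 0 i * (derive1 c t) 0 j).

(* The tangent space at [z] of a submanifold [M] (meant for embedded        *)
(* submanifolds, such as the orbits of closed groups of isometries).        *)
Definition tangent_space M z : set V :=
  [set v | exists c : R -> V,
     [/\ smooth_curve c, forall t, M (c t), c 0 = z & derive1 c 0 = v]].

Definition normal_space G M z : set V :=
  [set w | forall v, tangent_space M z v -> metric G z v w = 0].

Definition has_codim M (k : nat) : Prop :=
  forall z, M z -> exists T : {vspace V},
    [set v | v \in T] = tangent_space M z /\ (\dim T + k = m)%N.

(* Vanishing of the second fundamental form II: by the Gauss formula the    *)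
(* normal part of the covariant acceleration of a curve [c] in [M] is       *)
(* II(c', c'), and II is symmetric.                                         *)
Definition totally_geodesic G M : Prop :=
  forall c : R -> V, smooth_curve c -> (forall t, M (c t)) ->
    forall t, tangent_space M (c t) (covariant_acceleration G c t).

Definition angle G z u v : R :=
  acos (metric G z u v /
        (Num.sqrt (metric G z u u) * Num.sqrt (metric G z v v))).

Definition angle_to_subspace G z u W : R :=
  inf [set angle G z u w | w in [set w | W w /\ w != 0]].

End Chart.

(* C^n as a real vector space: [row_mx x y] stands for x + i y. *)
Notation realCn R n := 'rV[R]_(n + n).

Section ComplexHyperbolic.
Variables (R : realType) (n : nat).
Local Notation V := (realCn R n).
Implicit Types (z v w : V) (M W : set V) (A H : set (V -> V)).

Definition Jmul v : V := row_mx (- rsubmx v) (lsubmx v).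

Definition sqnorm z : R := (z *m z^T) 0 0.

(* The ball model of CH^n. *)
Definition CH : set V := [set z | sqnorm z < 1].

(* The Bergman metric of constant holomorphic sectional curvature -1,       *)
(*   4 Re ((1 - |z|^2) <v, w> + <v, z> <z, w>) / (1 - |z|^2)^2,             *)
(* where <., .> is the standard Hermitian product; in real terms,           *)
(* Re (<v, z> <z, w>) = (v . z) (w . z) + (v . Jz) (w . Jz).                *)
Definition bergman z : 'M[R]_(n + n) :=
  (4 / (1 - sqnorm z) ^+ 2) *:
    ((1 - sqnorm z)%:M + z^T *m z + (Jmul z)^T *m Jmul z).

(* Isometries (holomorphic or not) are extended by the identity outside the *)
(* ball, so that they compose as total functions and are determined by      *)
(* their restriction to the ball.                                           *)
Definition CH_isometry (f : V -> V) : Prop :=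
  [/\ forall z, ~ CH z -> f z = z,
      set_bij CH CH f,
      smooth_on CH f,
      exists g : V -> V, smooth_on CH g /\ forall z, CH z -> g (f z) = z &
      forall z v w, CH z ->
        metric bergman (f z) ('d f z v) ('d f z w) = metric bergman z v w].

(* Isometric actions are represented by the corresponding closed subgroups  *)
(* of the isometry group, the latter with its usual (metrizable) topology   *)
(* of uniform convergence on compact sets.                                  *)
Definition isometric_action A : Prop :=
  [/\ forall f, A f -> CH_isometry f,
      A id,
      forall f g, A f -> A g -> A (f \o g),
      forall f, A f -> exists2 g, A g & g \o f = id &
      forall (u : nat -> V -> V) (f : V -> V),
        (forall k, A (u k)) -> CH_isometry f ->
        (forall K : set V, compact K -> K `<=` CH ->
           {uniform K, u @ \oo --> f}) -> A f].

Definition orbit A z : set V := [set f z | f in A].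

Definition orbits A : set (set V) := [set orbit A z | z in CH].

(* The open sets of the orbit space, for the quotient topology. *)
Definition orbits_open A (U : set (set V)) : Prop :=
  U `<=` orbits A /\ open [set z | CH z /\ U (orbit A z)].

(* Lebesgue covering dimension of the space [X] with open sets [op]. *)
Definition covering_dim_le (T : Type) (X : set T) (op : set (set T))
    (d : nat) : Prop :=
  forall (p : nat) (U : 'I_p -> set T),
    (forall i, op (U i)) -> X `<=` \bigcup_i U i ->
    exists (q : nat) (W : 'I_q -> set T),
      [/\ forall j, op (W j),
          X `<=` \bigcup_j W j,
          forall j, exists i, W j `<=` U i &
          forall x, X x -> (#|[set j | `[< W j x >]]%SET| <= d.+1)%N].

Definition one_dimensional (T : Type) (X : set T) (op : set (set T)) : Prop :=
  covering_dim_le X op 1 /\ ~ covering_dim_le X op 0.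

Definition cohomogeneity_one A : Prop :=
  isometric_action A /\ one_dimensional (orbits A) (orbits_open A).

Definition singular_orbit A M : Prop :=
  orbits A M /\ exists2 k, (2 <= k)%N & has_codim M k.

(* The Kähler angle of [v] with respect to the subspace [W] of T_z CH^n. *)
Definition kahler_angle z W v : R := angle_to_subspace bergman z (Jmul v) W.

Definition constant_kahler_angle z W (phi : R) : Prop :=
  forall v, W v -> v != 0 -> kahler_angle z W v = phi.

Definition real_subspace z W : Prop :=
  forall v w, W v -> W w -> metric bergman z (Jmul v) w = 0.

Definition orbit_equivalent A H : Prop :=
  exists2 f, CH_isometry f & [set f @` M | M in orbits A] = orbits H.

Definition has_nontg_singular_orbit A : Prop :=
  exists M, singular_orbit A M /\ ~ totally_geodesic bergman M.

Definition orbit_class A : set (set (V -> V)) :=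
  [set H | cohomogeneity_one H /\ orbit_equivalent A H].

Definition moduli_space : set (set (set (V -> V))) :=
  [set orbit_class A | A in
     [set A | cohomogeneity_one A /\ has_nontg_singular_orbit A]].

(* The disjoint union of {2, ..., n-1} and                                  *)
(* (0, pi/2) x {2k | 0 < 2k < n}.                                           *)
Definition model_space : set (nat + R * nat)%type :=
  [set s | match s with
           | inl k => (2 <= k <= n.-1)%N
           | inr (phi, l) => 0 < phi < pi / 2 /\
                             exists2 k, l = (2 * k)%N & (0 < 2 * k < n)%N
           end].

(* The geometric meaning of a parameter, for the singular orbit [M]. *)
Definition has_parameter M (s : nat + R * nat) : Prop :=
  match s with
  | inl k =>
      has_codim M k /\
      forall z, M z -> real_subspace z (normal_space bergman M z)
  | inr (phi, l) =>
      has_codim M l /\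
      forall z, M z -> constant_kahler_angle z (normal_space bergman M z) phi
  end.

End ComplexHyperbolic.

Arguments CH {R n} _.
Arguments bergman {R n} _.
Arguments moduli_space R n : clear implicits.
Arguments model_space R n : clear implicits.

(* Main.v *)
(** The isometries of the ball are induced by the matrices, linear or antilinear over the complex
numbers, that preserve the Hermitian form h of signature (1, n). Let A be a closed group of
isometries with a singular orbit M, and move a point of M to 0.

By Sperner's lemma an orbit space of covering dimension at most 1 does not contain a square, which
forces the isotropy group of A at 0 to act transitively on the unit normal vectors of M. Let mu be
the vector that represents v |-> Tr (P ad(Y_v) P), with P the orthogonal projector onto the Lie
algebra of A and Y_v the infinitesimal boost in the direction v. It is fixed by the isotropy group,
hence tangent to M. Up to constant factors, X + X^T is the boost along the velocity v of exp(tX) 0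
and [X, X^T] the one along its acceleration a(X), and the failure of ad(X^T) to preserve the Lie
algebra is measured by - mu . a(X); so mu . a(X) <= 0, with equality only if ad(Y_v) preserves the
Lie algebra. If mu = 0, all the accelerations are tangent and M is totally geodesic. Otherwise, with
e = - mu / |mu|, the derivation X |-> [X, Y_e] has only the eigenvalues 0, 1, 2 on the Lie algebra,
and A fixes the boundary point with null vector q = e0 + e.

It follows that the orbits are the level sets of the function rho(x) = |P_V (h(q, x) x)|^2 / (|h(x,
q)|^2 (- h(x, x))), where P_V is the orthogonal projection to the normal space V at 0. Transitivity
on the unit vectors of V implies that V has a constant Kaehler angle. Adapted frames and Witt's
theorem carry one pair (e, V) to any other one with the same angle and dimension, and the isometries
that preserve rho realize every pair. The singular orbit is unique: at another one, the isotropy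
group would reverse the direction towards M. *)
From HB Require Import structures.
Require Import Defs.
From mathcomp Require Import all_boot all_order all_algebra.
From mathcomp Require Import all_classical all_reals all_analysis.
From mathcomp Require Import ring lra zify.
Set Implicit Arguments.
Unset Strict Implicit.
Unset Printing Implicit Defensive.
Import Order.TTheory GRing.Theory Num.Theory.
Import numFieldNormedType.Exports.
Local Open Scope classical_set_scope.
Local Open Scope ring_scope.

(** * Convergence and derivatives of matrices *)

(** [A] is only a closed set of isometries; neither connectedness nor a Lie structure is given. The
    differential geometry of its orbits is therefore extracted from sequences: group elements close
    to 1 are rescaled and converge into the Lie algebra, and tangent vectors of an orbit come from
    the Lie algebra because nearby points of the orbit are reached by group elements at a linear
    rate. As the Lie algebra controls the identity component only, the fixed null line and the
    invariance of rho are established for single group elements, by conjugating elements of the Lie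
    algebra with them. The form h is kept in real terms: [B x y] and, up to sign, [B x (Jmul y)] are
    its real and imaginary parts. Vectors are rows and matrices act from the right, which reverses
    products in the action. The Kaehler angle phi enters as [c] = cos^2 phi, the constant with |P_V
    J v|^2 = c |v|^2 on V. The value 0 is the real case, and 1 is the case of a complex V, where the
    singular orbit is totally geodesic. So the assumption of the theorem amounts to c < 1, which
    also forces dim V < n. *)

Section Dot.
Variables (R : realType) (m : nat).
Local Notation V := 'rV[R]_m.
Implicit Types (x y z : V) (a b : R).

Definition dot x y : R := (x *m y^T) 0 0.

Lemma dotE x y : dot x y = \sum_i x 0 i * y 0 i.
Proof. by rewrite /dot mxE; apply: eq_bigr => i _; rewrite mxE. Qed.
Lemma dotC x y : dot x y = dot y x.
Proof. by rewrite !dotE; apply: eq_bigr => i _; rewrite mulrC. Qed.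
Lemma dotDl x y z : dot (x + y) z = dot x z + dot y z.
Proof. by rewrite /dot mulmxDl mxE. Qed.
Lemma dotDr x y z : dot z (x + y) = dot z x + dot z y.
Proof. by rewrite /dot linearD mulmxDr mxE. Qed.
Lemma dotZl a x z : dot (a *: x) z = a * dot x z.
Proof. by rewrite /dot -scalemxAl mxE. Qed.
Lemma dotZr a x z : dot z (a *: x) = a * dot z x.
Proof. by rewrite dotC dotZl dotC. Qed.
Lemma dotNl x z : dot (- x) z = - dot x z.
Proof. by rewrite -scaleN1r dotZl mulN1r. Qed.
Lemma dotNr x z : dot z (- x) = - dot z x.
Proof. by rewrite dotC dotNl dotC. Qed.
Lemma dotBl x y z : dot (x - y) z = dot x z - dot y z.
Proof. by rewrite dotDl dotNl. Qed.
Lemma dotBr x y z : dot z (x - y) = dot z x - dot z y.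
Proof. by rewrite dotDr dotNr. Qed.
Lemma dot0l x : dot 0 x = 0.
Proof. by rewrite -(scale0r 0) dotZl mul0r. Qed.
Lemma dot0r x : dot x 0 = 0.
Proof. by rewrite dotC dot0l. Qed.
Lemma dot_ge0 x : 0 <= dot x x.
Proof. by rewrite dotE sumr_ge0 // => i _; rewrite -expr2 sqr_ge0. Qed.
Lemma dot_eq0 x : (dot x x == 0) = (x == 0).
Proof.
apply/eqP/eqP => [|->]; last exact: dot0l.
rewrite dotE => /eqP; rewrite psumr_eq0; last by move=> i _; rewrite -expr2 sqr_ge0.
move=> /allP h; apply/rowP => i; rewrite mxE.
by have := h i (mem_index_enum _); rewrite /= mulf_eq0 orbb => /eqP.
Qed.
Lemma dot_gt0 x : (0 < dot x x) = (x != 0).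
Proof. by rewrite lt_def dot_ge0 andbT dot_eq0. Qed.
Lemma dot_CS x y : dot x y ^+ 2 <= dot x x * dot y y.
Proof.
have [->|y0] := eqVneq y 0; first by rewrite !dot0r mulr0 expr2 mulr0.
have yy : 0 < dot y y by rewrite dot_gt0.
have := dot_ge0 (dot y y *: x - dot x y *: y).
rewrite !(dotBl, dotBr, dotZl, dotZr) (dotC y x) => h.
have : 0 <= dot y y * (dot x x * dot y y - dot x y ^+ 2).
  by apply: le_trans h _; rewrite le_eqVlt; apply/orP; left; apply/eqP; ring.
by rewrite pmulr_rge0 // subr_ge0.
Qed.

Lemma dot_CS_eq x y : dot x y = dot x x -> dot y y = dot x x -> x = y.
Proof.
move=> h1 h2; apply/eqP; rewrite -subr_eq0 -dot_eq0.
by rewrite !(dotBl, dotBr) (dotC y x) h1 h2; apply/eqP; ring.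
Qed.

Lemma coord_norm_le (k l : nat) (x : 'M[R]_(k, l)) i j : `|x i j| <= `|x|.
Proof. by rewrite [leRHS]/Num.norm /= mx_normrE (le_bigmax _ _ (i, j)). Qed.
Lemma mx_norm_le (k l : nat) (x : 'M[R]_(k, l)) c :
  0 <= c -> (forall i j, `|x i j| <= c) -> `|x| <= c.
Proof. by move=> c0 h; rewrite [leLHS]/Num.norm /= mx_normrE bigmax_le. Qed.

Lemma norm_le_dot x : `|x| <= Num.sqrt (dot x x).
Proof.
apply: mx_norm_le => [|i j]; first exact: sqrtr_ge0.
rewrite -sqrtr_sqr ler_sqrt ?dot_ge0 // dotE ord1.
by rewrite (bigD1 j) //= -expr2 lerDl sumr_ge0 // => l _; rewrite -expr2 sqr_ge0.
Qed.
Lemma sqr_norm_le x : `|x| ^+ 2 <= dot x x.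
Proof.
rewrite -[leRHS]sqr_sqrtr ?dot_ge0 // lerXn2r ?nnegrE ?sqrtr_ge0 //.
exact: norm_le_dot.
Qed.
End Dot.

Section MxCvg.
Variable (R : realType).

Lemma cvg_mxP (k l : nat) (u : nat -> 'M[R]_(k, l)) (x : 'M[R]_(k, l)) :
  (u @ \oo --> x) <-> (forall i j, (fun p => u p i j) @ \oo --> x i j).
Proof.
split=> [h i j|h].
  exact: (cvg_comp u (fun M : 'M[R]_(k, l) => M i j) h (@coord_continuous _ _ _ i j x)).
apply/cvgrPdist_le => e e0; near=> p.
apply: mx_norm_le => [|i j]; first exact: ltW.
rewrite !mxE; move: i j.
near: p; apply: filter_forall => i; apply: filter_forall => j.
by have /cvgrPdist_le/(_ _ e0) := h i j.
Unshelve. all: by end_near. Qed.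

Lemma cvg_bigsum (I : Type) (r : seq I) (P : pred I) (F : I -> nat -> R) (G : I -> R) :
  (forall i, P i -> F i @ \oo --> G i) ->
  (fun p => \sum_(i <- r | P i) F i p) @ \oo --> \sum_(i <- r | P i) G i.
Proof.
move=> h; elim: r => [|i r IH].
  by rewrite big_nil; under eq_fun do rewrite big_nil; exact: cvg_cst.
rewrite big_cons; under eq_fun do rewrite big_cons.
by case: ifP => // Pi; apply: cvgD => //; exact: h.
Qed.

Lemma cvg_mulmx (k l q : nat) (u : nat -> 'M[R]_(k, l)) (v : nat -> 'M[R]_(l, q))
    (x : 'M[R]_(k, l)) (y : 'M[R]_(l, q)) :
  u @ \oo --> x -> v @ \oo --> y -> (fun p => u p *m v p) @ \oo --> x *m y.
Proof.
move=> /cvg_mxP hu /cvg_mxP hv; apply/cvg_mxP => i j.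
rewrite mxE; under eq_fun do rewrite mxE.
apply: cvg_bigsum => s _; apply: cvgM; [exact: hu|exact: hv].
Qed.

Lemma cvg_trmx (k l : nat) (u : nat -> 'M[R]_(k, l)) (x : 'M[R]_(k, l)) :
  u @ \oo --> x -> (fun p => (u p)^T) @ \oo --> x^T.
Proof.
move=> /cvg_mxP hu; apply/cvg_mxP => i j; rewrite mxE.
by rewrite (_ : (fun p => _) = (fun p => u p j i)) //; apply/funext => p; rewrite mxE.
Qed.

Lemma cvg_dot (k : nat) (u v : nat -> 'rV[R]_k) (x y : 'rV[R]_k) :
  u @ \oo --> x -> v @ \oo --> y -> (fun p => dot (u p) (v p)) @ \oo --> dot x y.
Proof.
by move=> hu hv; have /cvg_mxP := cvg_mulmx hu (cvg_trmx hv); apply.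
Qed.

Lemma subseq_ge (phi : nat -> nat) : (forall i, phi i < phi i.+1)%N -> forall i, (i <= phi i)%N.
Proof. by move=> h; elim=> // i IH; apply: leq_ltn_trans IH (h i). Qed.

Lemma subseq_cvgoo (phi : nat -> nat) :
  (forall i, phi i < phi i.+1)%N -> phi @ \oo --> \oo.
Proof.
move=> h A [N _ hN]; exists N => // i /= iN; apply: hN => /=.
exact: leq_trans iN (subseq_ge h i).
Qed.

Lemma cvg_subseq (T : topologicalType) (u : nat -> T) (x : T) (phi : nat -> nat) :
  (forall i, phi i < phi i.+1)%N -> u @ \oo --> x -> (u \o phi) @ \oo --> x.
Proof. by move=> h hu; apply: cvg_comp hu; exact: subseq_cvgoo. Qed.

Lemma subseq_cauchy_choice (P : nat -> nat -> Prop) :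
  (forall k N, exists n, (N <= n)%N /\ P k n) ->
  exists phi : nat -> nat, (forall i, phi i < phi i.+1)%N /\ forall k, P k (phi k).
Proof.
move=> h; pose f k N := sval (cid (h k N)).
have fP k N : (N <= f k N)%N /\ P k (f k N) by exact: (svalP (cid (h k N))).
pose phi := fix F k := match k with 0 => f 0 0 | k'.+1 => f k (F k').+1 end.
exists phi; split=> [i|[|k]]; [|by have [] := fP 0%N 0%N|by have [] := fP k.+1 (phi k).+1].
by have [] := fP i.+1 (phi i).+1.
Qed.

Lemma cvg_harmonic_bound (V : normedModType R) (u : nat -> V) (x : V) :
  (forall k, `|x - u k| < k.+1%:R^-1) -> u @ \oo --> x.
Proof.
move=> h; apply/cvgrPdist_lt => e e0.
have := @cvg_harmonic R => /cvgrPdist_lt/(_ _ e0) [N _ hN].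
exists N => // k /= kN; apply: lt_trans (h k) _.
by have := hN k kN; rewrite /= sub0r normrN ger0_norm.
Qed.

Lemma Bolzano_rV (k : nat) (u : nat -> 'rV[R]_k) (B : R) :
  (forall p, `|u p| <= B) ->
  exists (phi : nat -> nat) (l : 'rV[R]_k),
    (forall i, phi i < phi i.+1)%N /\ (u \o phi) @ \oo --> l.
Proof.
move=> hB.
have cpt : compact [set x : 'rV[R]_k | `|x| <= B].
  apply: bounded_closed_compact.
    by exists B; split; [exact: num_real|move=> M BM x /= xB; exact: le_trans xB (ltW BM)].
  apply: (@closed_comp _ _ (fun x : 'rV[R]_k => `|x|) [set r : R | r <= B]).
    by move=> x _; exact: norm_continuous.
  exact: closed_le.
have [|l [_ hl]] := cpt (u @ \oo) _.
  by exists 0%N => // p _; exact: hB.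
have [|phi [inc hphi]] := @subseq_cauchy_choice (fun k n => `|l - u n| < k.+1%:R^-1).
  move=> j N.
  have [||y [[n Nn <-] /= yl]] := hl [set u n | n in [set n | (N <= n)%N]] (ball l j.+1%:R^-1).
  - by exists N => // n /= Nn; exists n.
  - by apply: nbhsx_ballx; rewrite invr_gt0.
  by exists n; split=> //; move: yl; rewrite -ball_normE.
exists phi, l; split=> //; exact: cvg_harmonic_bound.
Qed.

Lemma Bolzano_mx (k l : nat) (u : nat -> 'M[R]_(k, l)) (B : R) :
  (forall p, `|u p| <= B) ->
  exists (phi : nat -> nat) (x : 'M[R]_(k, l)),
    (forall i, phi i < phi i.+1)%N /\ (u \o phi) @ \oo --> x.
Proof.
move=> hB; have [|phi [x [inc hx]]] := @Bolzano_rV _ (fun p => mxvec (u p)) B.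
  move=> p; apply: mx_norm_le => [|i j]; first exact: le_trans (hB p).
  rewrite ord1; case/mxvec_indexP: j => i' j'; rewrite mxvecE.
  exact: le_trans (coord_norm_le _ _ _) (hB p).
exists phi, (vec_mx x); split=> //; apply/cvg_mxP => i j; rewrite mxE.
by move/cvg_mxP: hx => /(_ 0 (mxvec_index i j)); under eq_fun do rewrite /= mxvecE.
Qed.

End MxCvg.

(** * The matrix exponential *)

Section MxDerive.
Variables (R : realType) (V : normedModType R).

Lemma is_derive_mxP (m n : nat) (M : V -> 'M[R]_(m, n)) t v (D : 'M[R]_(m, n)) :
  is_derive t v M D <-> forall i j, is_derive t v (fun x => M x i j) (D i j).
Proof.
split=> [[dM eM] i j|h].
  apply: DeriveDef; first by move/derivable_mxP: dM; apply.
  by have := derive_mx dM; rewrite eM => ->; rewrite mxE.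
have dM : derivable M t v by apply/derivable_mxP => i j; have [] := h i j.
apply: DeriveDef => //; rewrite derive_mx //; apply/matrixP => i j; rewrite mxE.
by have [_] := h i j.
Qed.

Lemma is_derive_bigsum (I : Type) (r : seq I) (P : pred I) (F : I -> V -> R) (t v : V) (D : I -> R) :
  (forall i, P i -> is_derive t v (F i) (D i)) ->
  is_derive t v (fun x => \sum_(i <- r | P i) F i x) (\sum_(i <- r | P i) D i).
Proof.
move=> h; elim: r => [|i r IH].
  rewrite big_nil (_ : (fun x => _) = cst 0); first exact: is_derive_cst.
  by apply/funext => x; rewrite big_nil.
rewrite big_cons (_ : (fun x => _) = if P i then F i + (fun x => \sum_(i <- r | P i) F i x)
   else (fun x => \sum_(i <- r | P i) F i x)); last first.
  by apply/funext => x; rewrite big_cons; case: ifP.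
by case: ifP => // Pi; apply: is_deriveD => //; exact: h.
Qed.

Lemma is_derive_mulmx (m n p : nat) (A : V -> 'M[R]_(m, n)) (B : V -> 'M[R]_(n, p)) t v dA dB :
  is_derive t v A dA -> is_derive t v B dB ->
  is_derive t v (fun x => A x *m B x) (dA *m B t + A t *m dB).
Proof.
move=> /is_derive_mxP hA /is_derive_mxP hB; apply/is_derive_mxP => i j.
rewrite (_ : (fun x => _) = (fun x => \sum_k A x i k * B x k j)); last first.
  by apply/funext => x; rewrite mxE.
rewrite !mxE -big_split /=; apply: is_derive_bigsum => k _.
rewrite addrC [dA i k * _]mulrC; exact: (is_deriveM (hA i k) (hB k j)).
Qed.

Lemma is_derive_cstmx (W : normedModType R) (A : W) (t v : V) : is_derive t v (fun _ => A) 0.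
Proof. exact: is_derive_cst. Qed.

Lemma is_derive_trmx (m n : nat) (A : V -> 'M[R]_(m, n)) t v dA :
  is_derive t v A dA -> is_derive t v (fun x => (A x)^T) dA^T.
Proof.
move=> /is_derive_mxP h; apply/is_derive_mxP => i j; rewrite mxE.
by rewrite (_ : (fun x => _) = (fun x => A x j i)) //; apply/funext => x; rewrite mxE.
Qed.
End MxDerive.

Lemma is_derive0_mx (R : realType) (m n : nat) (M : R -> 'M[R]_(m, n)) :
  (forall t, is_derive t (1 : R) M 0) -> forall s t, M s = M t.
Proof.
move=> h s t; apply/matrixP => i j.
apply: (is_derive_0_is_cst (f := fun x => M x i j)) => x.
by have /is_derive_mxP/(_ i j) := h x; rewrite mxE.
Qed.

Lemma is_derive_lin (R : realType) (W : normedModType R) (f : R -> W) (a t : R) (df : W) :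
  is_derive (a * t) (1 : R) f df -> is_derive t (1 : R) (fun s => f (a * s)) (a *: df).
Proof.
move=> [/derivable1_diffP hf ef].
have hg : is_derive t (1 : R) (fun s : R => a * s) a.
  have := @is_deriveZ _ _ _ id a t 1 1 (is_derive_id _ _).
  by rewrite /GRing.scale /= mulr1.
have [/derivable1_diffP dg eg] := hg.
have dfg := differentiable_comp dg hf.
apply: DeriveDef; first by apply/derivable1_diffP.
rewrite deriveE // diff_comp //=.
rewrite -(deriveE (1 : R) dg) eg.
rewrite -[a in 'd _ _ a]mulr1 -[a * 1]/(a *: (1 : R)) linearZ /=.
by rewrite -deriveE // ef.
Qed.

Section Expm.
Variables (R : realType) (N : nat).
Implicit Types (X Y : 'M[R]_N) (t : R).

Definition mpow X k := iter k (mulmx X) 1%:M.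

Lemma mpowSr X k : mpow X k.+1 = mpow X k *m X.
Proof. by elim: k => [|k IH]; rewrite /mpow /= -/(mpow X _) ?mulmx1 ?mul1mx // -mulmxA -IH. Qed.

(** The coefficients of the entries of A exp(tX). The factor [A] makes the family stable under
    termwise differentiation, which replaces [A] by [A *m X]. *)
Definition ecoef (A X : 'M[R]_N) i j : nat -> R := fun k => (A *m mpow X k) i j / k`!%:R.

Definition expm X t : 'M[R]_N :=
  \matrix_(i, j) limn (pseries (ecoef 1%:M X i j) t).

Lemma mulmx_norm_le (m n p : nat) (A : 'M[R]_(m, n)) (B : 'M[R]_(n, p)) :
  `|A *m B| <= n%:R * `|A| * `|B|.
Proof.
apply: mx_norm_le => [|i j]; first by rewrite !mulr_ge0.
rewrite mxE; apply: le_trans (ler_norm_sum _ _ _) _.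
apply: (@le_trans _ _ (\sum_(k < n) `|A| * `|B|)).
  by apply: ler_sum => k _; rewrite normrM ler_pM ?coord_norm_le.
by rewrite sumr_const card_ord -mulrA mulr_natl.
Qed.

Lemma mpow_norm_le X k : `|mpow X k| <= (N%:R * `|X|) ^+ k * `|1%:M : 'M[R]_N|.
Proof.
elim: k => [|k IH]; first by rewrite expr0 mul1r.
apply: le_trans (mulmx_norm_le _ _) _; rewrite exprS -[leRHS]mulrA.
by apply: ler_wpM2l => //; rewrite mulr_ge0.
Qed.

Lemma ecoef_cvg A X i j t : cvgn (pseries (ecoef A X i j) t).
Proof.
apply: normed_cvg; rewrite /=.
pose c := N%:R * `|A| * `|1%:M : 'M[R]_N|.
apply: (@series_le_cvg _ _ (fun k => c * exp_coeff (N%:R * `|X| * `|t|) k)) => [k|k|k|].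
- exact: normr_ge0.
- by rewrite mulr_ge0 ?mulr_ge0 // exp_coeff_ge0 // !mulr_ge0.
- rewrite /ecoef /exp_coeff /= !normrM normfV normrX normr_nat.
  rewrite [leRHS](_ : _ = c * (N%:R * `|X|) ^+ k / k`!%:R * `|t| ^+ k); last by rewrite exprMn; ring.
  apply: ler_wpM2r; first exact: exprn_ge0.
  apply: ler_wpM2r; first by rewrite invr_ge0.
  apply: le_trans (coord_norm_le _ _ _) _; apply: le_trans (mulmx_norm_le _ _) _.
  rewrite /c -!mulrA; apply: ler_wpM2l => //; apply: ler_wpM2l => //.
  by rewrite [leRHS]mulrC; exact: mpow_norm_le.
- apply: (@is_cvg_seriesZ _ _ c); exact: is_cvg_series_exp_coeff.
Qed.

Lemma lim_ecoef (A X : 'M[R]_N) i j t : limn (pseries (ecoef A X i j) t) = (A *m expm X t) i j.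
Proof.
rewrite mxE; apply: cvg_lim => //.
rewrite (_ : pseries _ _ = (fun n => \sum_k A i k * pseries (ecoef 1%:M X k j) t n)); last first.
  apply/funext => n; rewrite /pseries /series /=.
  under [RHS]eq_bigr do rewrite mulr_sumr.
  rewrite exchange_big /=; apply: eq_bigr => k _.
  rewrite /ecoef mxE !mulr_suml; apply: eq_bigr => l _.
  by rewrite mul1mx; ring.
apply: cvg_bigsum => k _; apply: cvgMr; rewrite mxE.
exact: ecoef_cvg.
Qed.

Lemma ecoef_diffs A X i j : pseries_diffs (ecoef A X i j) = ecoef (A *m X) X i j.
Proof.
apply/funext => k; rewrite /pseries_diffs /ecoef /= factS natrM invfM.
rewrite mulmxA mulrCA [k.+1%:R * _]mulrA divff ?mul1r //.
Qed.

Lemma is_derive_expm X t : is_derive t (1 : R) (expm X) (X *m expm X t).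
Proof.
apply/is_derive_mxP => i j.
rewrite (_ : (fun x => _) = (fun x => limn (pseries (ecoef 1%:M X i j) x))); last first.
  by apply/funext => x; rewrite mxE.
have e : ecoef X X i j = pseries_diffs (ecoef 1%:M X i j) by rewrite ecoef_diffs mul1mx.
rewrite -lim_ecoef e.
apply: (@pseries_snd_diffs _ _ (`|t| + 1)); rewrite ?ecoef_diffs; try exact: ecoef_cvg.
by rewrite (ger0_norm (addr_ge0 _ _)) // ltrDl.
Qed.

Lemma expm_commX X t : X *m expm X t = expm X t *m X.
Proof.
apply/matrixP => i j; rewrite -lim_ecoef mxE; apply: cvg_lim => //.
rewrite (_ : pseries _ _ = (fun n => \sum_k pseries (ecoef 1%:M X i k) t n * X k j)); last first.
  apply/funext => n; rewrite /pseries /series /=.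
  under [RHS]eq_bigr do rewrite mulr_suml.
  rewrite exchange_big /=; apply: eq_bigr => k _.
  rewrite /ecoef -[X *m mpow X k]/(mpow X k.+1) mpowSr mxE !mulr_suml; apply: eq_bigr => l _.
  by rewrite mul1mx; ring.
apply: cvg_bigsum => k _; apply: cvgMl; rewrite mxE.
exact: ecoef_cvg.
Qed.

Lemma expm0 X : expm X 0 = 1%:M.
Proof.
apply/matrixP => i j; rewrite mxE; apply: cvg_lim => //.
apply: (cvg_near_cst ((1%:M : 'M[R]_N) i j)); exists 1%N => // -[//|n] _ /=.
rewrite /pseries /series /= big_nat_recl // expr0 /ecoef fact0 invr1 !mulr1 mul1mx.
by rewrite big1 ?addr0 // => k _; rewrite expr0n mulr0.
Qed.

Lemma is_derive_expm_opp X t : is_derive t (1 : R) (fun s => expm X (- s)) (- (X *m expm X (- t))).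
Proof.
have := @is_derive_lin _ _ (expm X) (-1) t (X *m expm X (-1 * t)) (is_derive_expm X _).
rewrite scaleN1r mulN1r.
by rewrite (_ : (fun s => expm X (-1 * s)) = (fun s => expm X (- s))) //; apply/funext => s; rewrite mulN1r.
Qed.

Lemma expmN_mul X t : expm X t *m expm X (- t) = 1%:M.
Proof.
rewrite (@is_derive0_mx _ _ _ (fun t => expm X t *m expm X (- t)) _ t 0).
  by rewrite oppr0 expm0 mulmx1.
move=> s; apply: is_derive_eq (is_derive_mulmx (is_derive_expm X s) (is_derive_expm_opp X s)) _.
by rewrite expm_commX mulmxN -!mulmxA subrr.
Qed.

(** [Y t *m expm X (- t)] has derivative 0. Most identities between exponentials below are instances
    of this uniqueness. *)
Lemma expm_ode (p : nat) (Y : R -> 'M[R]_(p, N)) X :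
  (forall t, is_derive t (1 : R) Y (Y t *m X)) -> forall t, Y t = Y 0 *m expm X t.
Proof.
move=> h t.
suff e : Y t *m expm X (- t) = Y 0.
  by have := expmN_mul X (- t); rewrite opprK -e -mulmxA => ->; rewrite mulmx1.
rewrite (@is_derive0_mx _ _ _ (fun t => Y t *m expm X (- t)) _ t 0).
  by rewrite oppr0 expm0 mulmx1.
move=> s; apply: is_derive_eq (is_derive_mulmx (h s) (is_derive_expm_opp X s)) _.
by rewrite mulmxN -!mulmxA subrr.
Qed.

Lemma expm_ode1 (Y : R -> 'M[R]_N) X t : Y 0 = 1%:M ->
  (forall t, is_derive t (1 : R) Y (Y t *m X)) -> Y t = expm X t.
Proof. by move=> Y0 h; rewrite (expm_ode h t) Y0 mul1mx. Qed.

Lemma is_derive_shift (W : normedModType R) (f : R -> W) (a t : R) (df : W) :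
  is_derive (a + t) (1 : R) f df -> is_derive t (1 : R) (fun s => f (a + s)) df.
Proof.
move=> [/derivable1_diffP hf ef].
have hg : is_derive t (1 : R) (fun s : R => a + s) 1.
  have := @is_deriveD _ _ _ (cst a) id t 1 0 1 (is_derive_cst _ _ _) (is_derive_id _ _).
  by rewrite add0r.
have [/derivable1_diffP dg eg] := hg.
have dfg := differentiable_comp dg hf.
apply: DeriveDef; first by apply/derivable1_diffP.
by rewrite deriveE // diff_comp //= -(deriveE (1 : R) dg) eg -deriveE // ef.
Qed.

Lemma expmD X s t : expm X (s + t) = expm X s *m expm X t.
Proof.
have := @expm_ode _ (fun t => expm X (s + t)) X; rewrite addr0; apply=> u.
by rewrite -expm_commX; exact: is_derive_shift (is_derive_expm X _).
Qed.

Lemma expm_unit X t : expm X t \in unitmx.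
Proof. by have [] := mulmx1_unit (expmN_mul X t). Qed.

Lemma expm_inv X t : invmx (expm X t) = expm X (- t).
Proof. by rewrite -[RHS]mul1mx -(mulVmx (expm_unit X t)) -mulmxA expmN_mul mulmx1. Qed.

Lemma is_derive_expm_mul (p : nat) (A : 'M[R]_(p, N)) X t :
  is_derive t (1 : R) (fun t => A *m expm X t) (A *m expm X t *m X).
Proof.
apply: is_derive_eq (is_derive_mulmx (is_derive_cstmx _ _ _) (is_derive_expm X t)) _.
by rewrite mul0mx add0r expm_commX mulmxA.
Qed.

Lemma expm_mulC (Z : 'M[R]_N) X t : Z *m X = X *m Z -> Z *m expm X t = expm X t *m Z.
Proof.
move=> h; symmetry; rewrite -[Z in RHS]mul1mx -(expm0 X).
apply: (@expm_ode _ (fun t => expm X t *m Z)) => s.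
apply: is_derive_eq (is_derive_mulmx (is_derive_expm X s) (is_derive_cstmx _ _ _)) _.
by rewrite mulmx0 addr0 expm_commX -!mulmxA h.
Qed.

Lemma expm_conj (g : 'M[R]_N) X t : g \in unitmx ->
  g *m expm X t *m invmx g = expm (g *m X *m invmx g) t.
Proof.
move=> ug; apply: (@expm_ode1 (fun t => g *m expm X t *m invmx g)).
  by rewrite expm0 mulmx1 mulmxV.
move=> s; apply: is_derive_eq (is_derive_mulmx (is_derive_expm_mul g X s) (is_derive_cstmx _ _ _)) _.
by rewrite mulmx0 addr0 !mulmxA mulmxKV.
Qed.

Lemma expm_scale X (a t : R) : expm (a *: X) t = expm X (a * t).
Proof.
symmetry; apply: (@expm_ode1 (fun t => expm X (a * t))).
  by rewrite mulr0 expm0.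
move=> s; by rewrite -scalemxAr -expm_commX; exact: is_derive_lin (is_derive_expm X _).
Qed.

Lemma expm_continuous X : continuous (expm X).
Proof.
move=> t; have [/derivable1_diffP d _] := is_derive_expm X t.
exact: differentiable_continuous.
Qed.
End Expm.

(** * Powers of matrices close to the identity *)

Section PowerCvg.
Variables (R : realType) (N : nat).
Implicit Types (X a b Z : 'M[R]_N) (t : R).

(** The maximum norm of the entries becomes submultiplicative after multiplication by the size of
    the matrices. *)
Let nrm (X : 'M[R]_N) : R := N%:R * `|X|.
Let nrm_ge0 X : 0 <= nrm X. Proof. by rewrite mulr_ge0. Qed.
Let nrmD X Y : nrm (X + Y) <= nrm X + nrm Y.
Proof. by rewrite /nrm -mulrDr ler_wpM2l // ler_normD. Qed.
Let nrmM X Y : nrm (X *m Y) <= nrm X * nrm Y.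
Proof.
rewrite /nrm [leRHS](_ : _ = N%:R * (N%:R * `|X| * `|Y|)); last by ring.
by rewrite ler_wpM2l // mulmx_norm_le.
Qed.

Lemma mpow_expm Z t k : mpow (expm Z t) k = expm Z (k%:R * t).
Proof.
elim: k => [|k IH]; first by rewrite mul0r expm0.
by rewrite /mpow /= -/(mpow _ k) IH -expmD -natr1 mulrDl mul1r addrC.
Qed.

Let nrm_step a b : nrm (a *m b) <= (1 + nrm (a - 1%:M)) * nrm b.
Proof.
rewrite -{1}[a](subrK 1%:M) mulmxDl mul1mx addrC mulrDl mul1r.
by apply: le_trans (nrmD _ _) _; rewrite lerD2l nrmM.
Qed.

Let nrm_mpow a k : nrm (mpow a k) <= (1 + nrm (a - 1%:M)) ^+ k * nrm 1%:M.
Proof.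
elim: k => [|k IH]; first by rewrite mul1r.
apply: le_trans (nrm_step _ _) _; rewrite exprS -mulrA ler_wpM2l //.
by rewrite addr_ge0.
Qed.

Lemma expR_bound (x : R) k : 0 <= x -> (1 + x) ^+ k <= expR (k%:R * x).
Proof.
move=> x0; rewrite mulrC expRM_natr lerXn2r ?nnegrE ?addr_ge0 ?expR_ge0 //.
exact: expR_ge1Dx.
Qed.

(** Telescoping: a^(k+1) - b^(k+1) = a (a^k - b^k) + (a - b) b^k. *)
Let mpow_diff a b k (C : R) : 0 <= C -> (forall j, (j <= k)%N -> nrm (mpow b j) <= C) ->
  nrm (mpow a k - mpow b k) <= k%:R * (1 + nrm (a - 1%:M)) ^+ k * C * nrm (a - b).
Proof.
move=> C0; elim: k => [|k IH] hb.
  by rewrite /mpow /= subrr /nrm normr0 mulr0 !mul0r.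
have -> : mpow a k.+1 - mpow b k.+1 = a *m (mpow a k - mpow b k) + (a - b) *m mpow b k.
  by rewrite /mpow /= -/(mpow a k) -/(mpow b k) mulmxBr mulmxBl addrA subrK.
apply: le_trans (nrmD _ _) _.
have h1 := IH (fun j jk => hb j (leqW jk)).
have h2 : nrm ((a - b) *m mpow b k) <= nrm (a - b) * C.
  by apply: le_trans (nrmM _ _) _; rewrite ler_wpM2l // hb.
have h3 : nrm (a *m (mpow a k - mpow b k)) <=
    (1 + nrm (a - 1%:M)) * (k%:R * (1 + nrm (a - 1%:M)) ^+ k * C * nrm (a - b)).
  by apply: le_trans (nrm_step _ _) _; rewrite ler_wpM2l // addr_ge0.
apply: le_trans (lerD h3 h2) _.
rewrite -natr1 [leRHS](_ : _ = (1 + nrm (a - 1%:M)) * (k%:R * (1 + nrm (a - 1%:M)) ^+ k * C * nrm (a - b))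
  + (1 + nrm (a - 1%:M)) ^+ k.+1 * (nrm (a - b) * C)); last by rewrite exprS; ring.
rewrite lerD2l ler_peMl ?mulr_ge0 // exprn_ege1 // lerDl //.
Qed.

Lemma is_derive_seq (W : normedModType R) (f : R -> W) (x : R) (df : W) (h : nat -> R) :
  is_derive x (1 : R) f df -> (forall k, h k != 0) -> h @ \oo --> (0 : R) ->
  (fun k => (h k)^-1 *: (f (h k + x) - f x)) @ \oo --> df.
Proof.
move=> [dv <-] h0 hc.
have : (fun k => h k) @ \oo --> (0 : R)^'.
  move=> A hA; have hB : \forall k \near \oo, h k != 0 -> A (h k) := hc [set y | y != 0 -> A y] hA.
  by rewrite nbhs_filterE; apply: filterS hB => k; apply.
move=> hc'; have := cvg_comp _ _ hc' dv.
rewrite /comp; under eq_fun do rewrite -[h _ *: (1 : R)]/(h _ * 1) mulr1; exact.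
Qed.

(** Euler's limit (1 + r Z + o(r))^(t/r) -> exp(t Z). The powers of [a i] are compared with those of
    [expm Z (r i)]: the bases differ by o(r), about t/r factors occur, and all partial powers stay
    bounded. *)
Lemma mpow_cvg (a : nat -> 'M[R]_N) (r : nat -> R) Z t :
  0 <= t -> (forall i, 0 < r i) -> r @ \oo --> (0 : R) ->
  (fun i => (r i)^-1 *: (a i - 1%:M)) @ \oo --> Z ->
  (fun i => mpow (a i) (Num.truncn (t / r i))) @ \oo --> expm Z t.
Proof.
move=> t0 r0 rc ac.
pose b i := expm Z (r i).
have bc : (fun i => (r i)^-1 *: (b i - 1%:M)) @ \oo --> Z.
  have := @is_derive_seq _ (expm Z) 0 _ r (is_derive_expm Z 0) _ rc.
  rewrite expm0 mulmx1 => h; have {}h := h (fun k => lt0r_neq0 (r0 k)).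
  by move: h; under eq_fun do rewrite addr0.
have tr i : (Num.truncn (t / r i))%:R * r i <= t.
  by rewrite -ler_pdivlMr // truncn_le divr_ge0 // ltW.
have bdd (c : nat -> 'M[R]_N) : (fun i => (r i)^-1 *: (c i - 1%:M)) @ \oo --> Z ->
    exists2 K : R, 0 <= K & forall i, nrm (c i - 1%:M) <= K * r i.
  move=> /cvgP/cvg_seq_bounded[K [_ hK]]; exists (N%:R * (`|K| + 1)) => [|i].
    by rewrite mulr_ge0 // addr_ge0.
  have K1 : K < `|K| + 1 by rewrite (le_lt_trans (ler_norm _)) // ltrDl.
  have /= := hK _ K1 i I.
  rewrite normrZ gtr0_norm ?invr_gt0 // ler_pdivrMl // mulrC => h.
  by rewrite /nrm -mulrA ler_wpM2l.
have [K K0 hK] := bdd a ac; have [L L0 hL] := bdd b bc.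
have pw (c : nat -> 'M[R]_N) M : 0 <= M -> (forall i, nrm (c i - 1%:M) <= M * r i) ->
   forall i j, (j <= Num.truncn (t / r i))%N -> (1 + nrm (c i - 1%:M)) ^+ j <= expR (M * t).
  move=> M0 hM i j jt; apply: le_trans (expR_bound _ (nrm_ge0 _)) _.
  rewrite ler_expR; apply: le_trans (_ : j%:R * (M * r i) <= _); first by rewrite ler_wpM2l.
  rewrite mulrCA ler_wpM2l //; apply: le_trans (tr i).
  by rewrite ler_wpM2r ?ler_nat // ltW.
pose C : R := expR (L * t) * nrm 1%:M.
have C0 : 0 <= C by rewrite mulr_ge0 ?expR_ge0.
have est i : nrm (mpow (a i) (Num.truncn (t / r i)) - mpow (b i) (Num.truncn (t / r i)))
   <= t * expR (K * t) * C * (N%:R * `|(r i)^-1 *: (a i - 1%:M) - (r i)^-1 *: (b i - 1%:M)|).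
  apply: le_trans (mpow_diff _ C0 _) _ => [j jt|].
    by apply: le_trans (nrm_mpow _ _) _; rewrite ler_wpM2r // (pw b L).
  rewrite -scalerBr opprB addrA subrK normrZ gtr0_norm ?invr_gt0 //.
  rewrite [leRHS](_ : _ = (t / r i) * expR (K * t) * C * nrm (a i - b i)); last by rewrite /nrm; ring.
  apply: ler_wpM2r => //; apply: ler_wpM2r => //; apply: ler_pM => //.
  - by rewrite exprn_ge0 // addr_ge0.
  - by rewrite truncn_le divr_ge0 // ltW.
  - exact: (pw a K).
have c1 : (fun i => mpow (a i) (Num.truncn (t / r i)) - mpow (b i) (Num.truncn (t / r i))) @ \oo --> (0 : 'M[R]_N).
  have [N0|N0] := posnP N.
    rewrite (_ : (fun i => _) = (fun _ => 0)); first exact: cvg_cst.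
    by apply/funext => i; apply/matrixP => -[k kN]; exfalso; move: kN; rewrite N0.
  apply: norm_cvg0.
  have c2 : (fun i => t * expR (K * t) * C * (N%:R * `|(r i)^-1 *: (a i - 1%:M) - (r i)^-1 *: (b i - 1%:M)|)) @ \oo --> (0 : R).
    rewrite -[X in _ --> X](mulr0 (t * expR (K * t) * C)); apply: cvgMr.
    rewrite -[X in _ --> X](mulr0 N%:R); apply: cvgMr.
    by rewrite -[X in _ --> X](@normr0 _ 'M[R]_N) -(subrr Z); apply: cvg_norm; apply: cvgB.
  apply: squeeze_cvgr c2; last exact: (cvg_cst (0 : R)).
  near=> i; rewrite normr_ge0 /=; apply: le_trans (est i).
  by rewrite /nrm ler_peMl // ler1n.
have c3 : (fun i => mpow (b i) (Num.truncn (t / r i))) @ \oo --> expm Z t.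
  rewrite /b; under eq_fun do rewrite mpow_expm.
  suff c5 : (fun i => (Num.truncn (t / r i))%:R * r i) @ \oo --> t.
    exact: (cvg_comp _ _ c5 (@expm_continuous R N Z t)).
  have c4 : (fun i => t - r i) @ \oo --> t.
    by rewrite -[X in _ --> X]subr0; apply: cvgB => //; exact: cvg_cst.
  apply: squeeze_cvgr c4 (cvg_cst _); near=> i; rewrite tr andbT.
  rewrite lerBlDr -[X in _ + X]mul1r -mulrDl -ler_pdivrMr // natr1.
  by rewrite ltW // truncnS_gt.
have c6 := cvgD c1 c3; move: c6; rewrite add0r.
set f := (fun i => _) + _; set g := fun i => mpow (a i) _.
have -> : f = g by apply/funext => i; rewrite /f /g /GRing.add /= -/(GRing.add _ _) subrK.
by apply.
Unshelve. all: by end_near. Qed.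
End PowerCvg.

(** * Calculus of maps of class C^k *)

Section CkToolkit.
Variables (R : realType) (V : normedModType R).
Implicit Types (U : set V).

(** Applied to [g - f], this moves a differential from [f] to a function [g] that agrees with [f]
    near [x]. *)
Lemma is_diff_near0 (W : normedModType R) (h : V -> W) x :
  (\forall y \near x, h y = 0) -> is_diff x h 0.
Proof.
move=> h0; have hx : h x = 0 := nbhs_singleton h0.
have e : h \o shift x = cst (h x) + (\0 : {linear V -> W}) +o_ 0 id.
  apply/eqaddoP => e e0; near=> y.
  rewrite [X in `|X|](_ : _ = h (y + x)); last by rewrite !fctE /= hx addr0 subr0.
  rewrite (_ : h (y + x) = 0) ?normr0 ?mulr_ge0 // ?ltW //.
  near: y; have := h0; rewrite (near_shift 0) /=; apply: filterS => y.
  by rewrite /= subr0.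
have c0 : continuous (\0 : {linear V -> W}) by move=> y; exact: cst_continuous.
have de := diff_unique c0 e.
apply: DiffDef => //; apply/diff_locallyP; split; first by rewrite de.
by rewrite de.
Unshelve. all: by end_near. Qed.

Lemma is_diff_ext (W : normedModType R) (f g : V -> W) x df :
  (\forall y \near x, f y = g y) -> is_diff x f df -> is_diff x g df.
Proof.
move=> fg hf.
have h0 : is_diff x (g - f) 0.
  apply: is_diff_near0; apply: filterS fg => y e.
  by rewrite !fctE /= e subrr.
have := is_diffD hf h0; rewrite addr0.
by rewrite (_ : f + (g - f) = g) //; apply/funext => y; rewrite !fctE /= addrC subrK.
Qed.

Lemma is_diffP (W : normedModType R) (f : V -> W) x : differentiable f x -> is_diff x f ('d f x).
Proof. by move=> h; apply: DiffDef. Qed.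

Lemma Ck_ext (W : normedModType R) k U (f g : V -> W) : open U ->
  (forall z, U z -> f z = g z) -> Ck k U f -> Ck k U g.
Proof.
move=> oU; elim: k f g => [|k IH] f g fg.
  move=> h z Uz; have nz : \forall y \near z, f y = g y.
    by have := open_nbhs_nbhs (conj oU Uz); apply: filterS => y; exact: fg.
  have hz := h z Uz; rewrite /prop_for /continuous_at -(fg z Uz).
  by apply: cvg_trans hz; apply: near_eq_cvg.
move=> [hd hk].
have nz z : U z -> \forall y \near z, f y = g y.
  by move=> Uz; have := open_nbhs_nbhs (conj oU Uz); apply: filterS => y; exact: fg.
have dg z : U z -> is_diff z g ('d f z).
  by move=> Uz; apply: is_diff_ext (nz z Uz) (is_diffP (hd z Uz)).
split=> [z Uz|v]; first by have [] := dg z Uz.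
apply: IH (hk v) => z Uz; by have [_ ->] := dg z Uz.
Qed.

Lemma CkS (W : normedModType R) k U (f : V -> W) : Ck k.+1 U f -> Ck k U f.
Proof.
elim: k f => [|k IH] f [hd hk].
  by move=> z Uz; apply: differentiable_continuous; exact: hd.
by split=> // v; apply: IH; exact: hk.
Qed.

Lemma Ck_cst (W : normedModType R) k U (a : W) : Ck k U (fun _ => a).
Proof.
elim: k a => [|k IH] a; first by move=> z _; exact: cst_continuous.
split=> [z _|v]; first exact: differentiable_cst.
rewrite (_ : (fun z => _) = (fun _ => 0)) //; apply/funext => z.
by rewrite (diff_cst a z).
Qed.

Lemma CkD (W : normedModType R) k U (f g : V -> W) : open U ->
  Ck k U f -> Ck k U g -> Ck k U (fun z => f z + g z).
Proof.
move=> oU; elim: k f g => [|k IH] f g.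
  by move=> hf hg z Uz; apply: cvgD; [exact: hf|exact: hg].
move=> [df hf] [dg hg].
have dfg z : U z -> is_diff z (fun z => f z + g z) (('d f z : V -> W) + ('d g z : V -> W)).
  by move=> Uz; exact: is_diffD (is_diffP (df z Uz)) (is_diffP (dg z Uz)).
split=> [z Uz|v]; first by have [] := dfg z Uz.
apply: (@Ck_ext _ k U (fun z => 'd f z v + 'd g z v)) => //; last exact: IH (hf v) (hg v).
by move=> z Uz; have [_ ->] := dfg z Uz.
Qed.

Lemma Ck_sum (W : normedModType R) (I : Type) (r : seq I) (P : pred I) (F : I -> V -> W) k U :
  open U -> (forall i, P i -> Ck k U (F i)) -> Ck k U (fun z => \sum_(i <- r | P i) F i z).
Proof.
move=> oU h; elim: r => [|i r IH].
  rewrite (_ : (fun z => _) = (fun _ => 0)); first exact: Ck_cst.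
  by apply/funext => z; rewrite big_nil.
rewrite (_ : (fun z => _) = (if P i then (fun z => F i z + \sum_(i <- r | P i) F i z)
   else (fun z => \sum_(i <- r | P i) F i z))); last first.
  by apply/funext => z; rewrite big_cons; case: ifP.
by case: ifP => // Pi; apply: CkD => //; exact: h.
Qed.

Lemma CkM k U (f g : V -> R) : open U ->
  Ck k U f -> Ck k U g -> Ck k U (fun z => f z * g z).
Proof.
move=> oU; elim: k f g => [|k IH] f g.
  by move=> hf hg z Uz; apply: cvgM; [exact: hf|exact: hg].
move=> cf cg; have [df hf] := cf; have [dg hg] := cg.
have dfg z : U z -> is_diff z (fun z => f z * g z) (f z *: ('d g z : V -> R) + g z *: ('d f z : V -> R)).
  by move=> Uz; apply: is_diffM; apply: is_diffP; [exact: df|exact: dg].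
split=> [z Uz|v]; first by have [] := dfg z Uz.
apply: (@Ck_ext _ k U (fun z => f z * 'd g z v + g z * 'd f z v)) => //.
  by move=> z Uz; have [_ ->] := dfg z Uz.
apply: (CkD oU); [exact: IH (CkS cf) (hg v)|exact: IH (CkS cg) (hf v)].
Qed.

Lemma CkV k U (f : V -> R) : open U -> (forall z, U z -> f z != 0) ->
  Ck k U f -> Ck k U (fun z => (f z)^-1).
Proof.
move=> oU f0; elim: k => [|k IH].
  by move=> hf z Uz; apply: cvgV; [exact: f0|exact: hf].
move=> cf; have [df hf] := cf.
have dV z : U z -> 'd (fun z => (f z)^-1) z = - f z ^- 2 \*: 'd f z :> (V -> R).
  by move=> Uz; rewrite diffV //; [exact: df|exact: f0].
split=> [z Uz|v]; first by apply: differentiableV; [exact: df|exact: f0].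
apply: (@Ck_ext _ k U (fun z => (-1) * ((f z)^-1 * (f z)^-1 * 'd f z v))) => //.
  by move=> z Uz; rewrite dV //= /GRing.scale /= expr2 invfM !mulN1r mulNr.
have IH' := IH (CkS cf).
apply: CkM => //; first exact: Ck_cst.
exact: (CkM oU (CkM oU IH' IH') (hf v)).
Qed.

Lemma Ck_comp_lin (W W' : normedModType R) (L : {linear W -> W'}) k U (f : V -> W) : open U ->
  continuous L -> Ck k U f -> Ck k U (fun z => L (f z)).
Proof.
move=> oU cL; elim: k f => [|k IH] f.
  by move=> hf z Uz; apply: (cvg_comp _ _ (hf z Uz)); exact: cL.
move=> [df hf].
have dL z : U z -> is_diff z (fun z => L (f z)) (L \o 'd f z).
  move=> Uz; have dl : is_diff (f z) L L.
    by apply: DiffDef; [exact: linear_differentiable|exact: diff_lin].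
  exact: (is_diff_comp (is_diffP (df z Uz)) dl).
split=> [z Uz|v]; first by have [] := dL z Uz.
apply: (@Ck_ext _ k U (fun z => L ('d f z v))) => //; last exact: IH (hf v).
by move=> z Uz; have [_ ->] := dL z Uz.
Qed.

Lemma Ck_id k U : Ck k U (fun z : V => z).
Proof.
case: k => [|k]; first by move=> z _; exact: cvg_id.
split=> [z _|v]; first by have [] := is_diff_id z.
rewrite (_ : (fun z => _) = (fun _ => v)); first exact: Ck_cst.
by apply/funext => z; have [_ ->] := is_diff_id z.
Qed.

Lemma CkZl (W : normedModType R) k U (f : V -> R) (w : W) : open U ->
  Ck k U f -> Ck k U (fun z => f z *: w).
Proof.
move=> oU; elim: k f => [|k IH] f.
  by move=> hf z Uz; apply: cvgZl; exact: hf.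
move=> [df hf].
have dL z : U z -> is_diff z (fun z => f z *: w) (( *:%R^~ w) \o 'd f z).
  by move=> Uz; exact: (is_diff_comp (is_diffP (df z Uz)) (is_diff_scalel _ _)).
split=> [z Uz|v]; first by have [] := dL z Uz.
apply: (@Ck_ext _ k U (fun z => 'd f z v *: w)) => //; last exact: IH (hf v).
by move=> z Uz; have [_ ->] := dL z Uz.
Qed.

Lemma Ck_coord (m n : nat) k U (f : V -> 'M[R]_(m, n)) i j : open U ->
  Ck k U f -> Ck k U (fun z => f z i j).
Proof.
move=> oU hf.
have @L : {linear 'M[R]_(m, n) -> R}.
  by exists (fun N : 'M[R]_(_, _) => N i j); do 2![eexists]; do ?[constructor];
     rewrite ?mxE// => ? *; rewrite ?mxE//; move=> ?; rewrite !mxE.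
exact: (@Ck_comp_lin _ _ L k U f oU (@coord_continuous _ _ _ i j) hf).
Qed.

Lemma Ck_mx (m n : nat) k U (f : V -> 'M[R]_(m, n)) : open U ->
  (forall i j, Ck k U (fun z => f z i j)) -> Ck k U f.
Proof.
move=> oU hf.
rewrite (_ : f = (fun z => \sum_i \sum_j f z i j *: delta_mx i j)).
  by apply: Ck_sum => // i _; apply: Ck_sum => // j _; apply: CkZl.
by apply/funext => z; exact: matrix_sum_delta.
Qed.

Lemma CkZ (m n : nat) k U (f : V -> R) (g : V -> 'M[R]_(m, n)) : open U ->
  Ck k U f -> Ck k U g -> Ck k U (fun z => f z *: g z).
Proof.
move=> oU hf hg; apply: Ck_mx => // i j.
rewrite (_ : (fun z => _) = (fun z => f z * g z i j)); last by apply/funext => z; rewrite mxE.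
by apply: CkM => //; exact: Ck_coord.
Qed.

Lemma Ck_mulmx (m n p : nat) k U (f : V -> 'M[R]_(m, n)) (g : V -> 'M[R]_(n, p)) : open U ->
  Ck k U f -> Ck k U g -> Ck k U (fun z => f z *m g z).
Proof.
move=> oU hf hg; apply: Ck_mx => // i j.
rewrite (_ : (fun z => _) = (fun z => \sum_l f z i l * g z l j)); last by apply/funext => z; rewrite mxE.
by apply: Ck_sum => // l _; apply: CkM => //; exact: Ck_coord.
Qed.

Lemma Ck_trmx (m n : nat) k U (f : V -> 'M[R]_(m, n)) : open U ->
  Ck k U f -> Ck k U (fun z => (f z)^T).
Proof.
move=> oU hf; apply: Ck_mx => // i j.
rewrite (_ : (fun z => _) = (fun z => f z j i)); last by apply/funext => z; rewrite mxE.
exact: Ck_coord.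
Qed.
End CkToolkit.

Section SmoothCurves.
Variable R : realType.

Lemma Ck_curve (W : normedModType R) (c dc : R -> W) k :
  (forall t, is_derive t (1 : R) c (dc t)) -> Ck k [set: R] dc -> Ck k.+1 [set: R] c.
Proof.
move=> h hd; split=> [t _|v]; first by apply/derivable1_diffP; have [] := h t.
rewrite (_ : (fun z => _) = (fun z => v *: dc z)).
  pose L := GRing.scale v : {linear W -> W}.
  by apply: (@Ck_comp_lin _ _ _ _ L) => //; [exact: openT|move=> x; exact: scaler_continuous].
apply/funext => t; have [/derivable1_diffP d <-] := h t.
by rewrite deriveE // -linearZ /= /GRing.scale /= mulr1.
Qed.

Lemma smooth_expm (N : nat) (X : 'M[R]_N) : smooth_curve (expm X).
Proof.
elim=> [|k IH]; first by move=> t _; exact: expm_continuous.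
apply: Ck_curve (is_derive_expm X) _; apply: Ck_mulmx => //; first exact: openT.
exact: Ck_cst.
Qed.
End SmoothCurves.

(** * The hyperboloid model *)

Ltac vec := repeat match goal with |- context [Jmul ?x] =>
    let u := fresh "u" in set u := Jmul x; clearbody u end;
  apply/rowP => ?; rewrite !mxE; ring.

Section ComplexStructure.
Variables (R : realType) (n : nat).
Implicit Types (x y z : realCn R n) (a b : R).

Definition Jmx : 'M[R]_(n + n) := block_mx 0 1%:M (- 1%:M) 0.

Lemma JmulE x : Jmul x = x *m Jmx.
Proof.
by rewrite -{2}[x]hsubmxK mul_row_block !mulmx0 mulmxN !mulmx1 add0r addr0.
Qed.
Lemma JmulD x y : Jmul (x + y) = Jmul x + Jmul y.
Proof. by rewrite !JmulE mulmxDl. Qed.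
Lemma JmulZ a x : Jmul (a *: x) = a *: Jmul x.
Proof. by rewrite !JmulE -scalemxAl. Qed.
Lemma JmulN x : Jmul (- x) = - Jmul x.
Proof. by rewrite !JmulE mulNmx. Qed.
Lemma JmulB x y : Jmul (x - y) = Jmul x - Jmul y.
Proof. by rewrite JmulD JmulN. Qed.
Lemma Jmul0 : Jmul 0 = 0 :> realCn R n.
Proof. by rewrite JmulE mul0mx. Qed.
Lemma JmulJ x : Jmul (Jmul x) = - x.
Proof. by rewrite /Jmul row_mxKl row_mxKr -opp_row_mx hsubmxK. Qed.
Lemma dot_row (k l : nat) (x y : 'rV[R]_k) (x' y' : 'rV[R]_l) :
  dot (row_mx x x') (row_mx y y') = dot x y + dot x' y'.
Proof. by rewrite /dot tr_row_mx mul_row_col mxE. Qed.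
Lemma dotJJ x y : dot (Jmul x) (Jmul y) = dot x y.
Proof.
by rewrite /Jmul dot_row dotNl dotNr opprK addrC -dot_row !hsubmxK.
Qed.
Lemma dotJl x y : dot (Jmul x) y = - dot x (Jmul y).
Proof. by rewrite -dotJJ JmulJ dotNl. Qed.
Lemma dotJs x y : dot x (Jmul y) = - dot y (Jmul x).
Proof. by rewrite dotC dotJl. Qed.
Lemma dotxJx x : dot x (Jmul x) = 0.
Proof. by have := dotJs x x => h; lra. Qed.
Lemma dotJxx x : dot (Jmul x) x = 0.
Proof. by rewrite dotC dotxJx. Qed.

Definition JmulX := (JmulD, JmulB, JmulN, JmulZ, JmulJ, Jmul0).

(** Multiplication of [x] by the complex number a + i b. *)
Definition cs a b x := a *: x + b *: Jmul x.
Lemma cs_cs a b a' b' x : cs a b (cs a' b' x) = cs (a * a' - b * b') (a * b' + b * a') x.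
Proof.
by rewrite /cs !JmulX; vec.
Qed.
Lemma csZ a b k x : cs a b (k *: x) = k *: cs a b x.
Proof. by rewrite /cs JmulZ scalerDr !scalerA ![_ * k]mulrC. Qed.
Lemma cs_inv a b x : a ^+ 2 + b ^+ 2 != 0 ->
  cs (a / (a ^+ 2 + b ^+ 2)) (- b / (a ^+ 2 + b ^+ 2)) (cs a b x) = x.
Proof.
move=> h; rewrite cs_cs /cs.
rewrite (_ : _ * _ - _ = 1) ?scale1r; last by field.
by rewrite (_ : _ * _ + _ * _ = 0) ?scale0r ?addr0 //; field.
Qed.
Lemma cs_inv2 a b x : a ^+ 2 + b ^+ 2 != 0 ->
  cs a b (cs (a / (a ^+ 2 + b ^+ 2)) (- b / (a ^+ 2 + b ^+ 2)) x) = x.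
Proof. by move=> h; rewrite -[RHS](cs_inv x h) !cs_cs; congr cs; ring. Qed.
End ComplexStructure.

Definition dotX := (dotDl, dotDr, dotBl, dotBr, dotNl, dotNr, dotZl, dotZr).

Section Lift.
Variables (R : realType) (n : nat).
Local Notation V := (realCn R n).
Local Notation W := (realCn R n.+1).
Implicit Types (x y : W) (z v w : V).

(** C^n as the last n coordinates of C^(1+n); [n.+1] is read as 1 + n in the real and in the
    imaginary half. *)
Definition iotamx : 'M[R]_(n + n, n.+1 + n.+1) :=
  let r := row_mx 0 1%:M : 'M[R]_(n, 1 + n) in block_mx r 0 0 r.
Definition iota_ z : W := z *m iotamx.
Definition pi_ x : V := x *m iotamx^T.
Definition e0 : W := row_mx (row_mx 1%:M 0 : 'rV[R]_(1 + n)) 0.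
Definition f0 : W := Jmul e0.

Lemma iotamxK : iotamx *m iotamx^T = 1%:M.
Proof.
rewrite /iotamx tr_block_mx mulmx_block !trmx0 !mulmx0 !mul0mx addr0 add0r.
by rewrite (@tr_row_mx _ n 1 n) (@mul_row_col _ n 1 n) !trmx1 mulmx1 trmx0 mulmx0 !add0r -scalar_mx_block.
Qed.
Lemma iotaK z : pi_ (iota_ z) = z.
Proof. by rewrite /pi_ /iota_ -mulmxA iotamxK mulmx1. Qed.
Lemma dot_iota_l z x : dot (iota_ z) x = dot z (pi_ x).
Proof. by rewrite /dot /iota_ /pi_ trmx_mul trmxK mulmxA. Qed.
Lemma iotaD z w : iota_ (z + w) = iota_ z + iota_ w. Proof. by rewrite /iota_ mulmxDl. Qed.
Lemma iotaZ a z : iota_ (a *: z) = a *: iota_ z. Proof. by rewrite /iota_ -scalemxAl. Qed.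
Lemma iotaN z : iota_ (- z) = - iota_ z. Proof. by rewrite /iota_ mulNmx. Qed.
Lemma iota0 : iota_ 0 = 0. Proof. by rewrite /iota_ mul0mx. Qed.
Lemma piD x y : pi_ (x + y) = pi_ x + pi_ y. Proof. by rewrite /pi_ mulmxDl. Qed.
Lemma piZ a x : pi_ (a *: x) = a *: pi_ x. Proof. by rewrite /pi_ -scalemxAl. Qed.
Lemma piN x : pi_ (- x) = - pi_ x. Proof. by rewrite /pi_ mulNmx. Qed.
Lemma piB x y : pi_ (x - y) = pi_ x - pi_ y. Proof. by rewrite piD piN. Qed.
Lemma iotaJ z : iota_ (Jmul z) = Jmul (iota_ z).
Proof.
rewrite /iota_ !JmulE -!mulmxA; congr (_ *m _).
rewrite /Jmx /iotamx !mulmx_block !mul1mx !mulmx1 !mulNmx !mulmxN.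
by rewrite !(mulmx0, mul0mx, add0r, addr0, mulmx1, mul1mx, oppr0).
Qed.
Lemma iota_cs a b z : iota_ (cs a b z) = cs a b (iota_ z).
Proof. by rewrite /cs iotaD !iotaZ iotaJ. Qed.
Lemma pi_e0 : pi_ e0 = 0.
Proof.
rewrite /pi_ /e0 /iotamx tr_block_mx mul_row_block !trmx0 !mulmx0 !addr0 !mul0mx.
by rewrite (@tr_row_mx _ n 1 n) (@mul_row_col _ 1 1 n) !trmx0 mulmx0 mul0mx !addr0 row_mx0.
Qed.
Lemma piJ x : pi_ (Jmul x) = Jmul (pi_ x).
Proof.
apply/eqP; rewrite -subr_eq0 -dot_eq0; apply/eqP.
suff h z : dot z (pi_ (Jmul x)) = dot z (Jmul (pi_ x)) by rewrite dotBr !h subrr.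
by rewrite -dot_iota_l -[RHS]opprK -dotJl -dot_iota_l iotaJ dotJl opprK.
Qed.
Lemma pi_f0 : pi_ f0 = 0.
Proof. by rewrite /f0 piJ pi_e0 Jmul0. Qed.
Lemma dot_e0 : dot e0 e0 = 1.
Proof. by rewrite /e0 !dot_row (@dot_row _ 1 n) !dot0l !addr0 /dot (@trmx1 _ 1) mulmx1 mxE. Qed.
Lemma dot_f0 : dot f0 f0 = 1.
Proof. by rewrite /f0 dotJJ dot_e0. Qed.
Lemma dot_e0f0 : dot e0 f0 = 0.
Proof. exact: dotxJx. Qed.
Lemma dot_f0e0 : dot f0 e0 = 0.
Proof. exact: dotJxx. Qed.
Lemma dot_iota_e0 z : dot (iota_ z) e0 = 0.
Proof. by rewrite dot_iota_l pi_e0 dot0r. Qed.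
Lemma dot_iota_f0 z : dot (iota_ z) f0 = 0.
Proof. by rewrite dot_iota_l pi_f0 dot0r. Qed.

Definition c0 x := dot x e0.
Definition c1 x := dot x f0.
Lemma decompE x : x = c0 x *: e0 + c1 x *: f0 + iota_ (pi_ x).
Proof.
have hx : x = row_mx (row_mx (lsubmx (lsubmx x : 'rV_(1 + n))) (rsubmx (lsubmx x : 'rV_(1 + n))))
   (row_mx (lsubmx (rsubmx x : 'rV_(1 + n))) (rsubmx (rsubmx x : 'rV_(1 + n)))).
  by rewrite !hsubmxK.
move: hx; set a := lsubmx _; set u := rsubmx _; set b := lsubmx _; set v := rsubmx _ => ->.
have f0E : f0 = row_mx 0 (row_mx 1%:M 0 : 'rV[R]_(1 + n)).
  by rewrite /f0 /Jmul /e0 row_mxKl row_mxKr oppr0.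
rewrite /c0 /c1 f0E /e0 !dot_row !(@dot_row _ 1 n) !dot0r !addr0 !add0r /dot !(@trmx1 _ 1) !mulmx1.
rewrite /pi_ /iota_ /iotamx tr_block_mx mul_row_block !trmx0 !mulmx0 !addr0 add0r.
rewrite !(@tr_row_mx _ n 1 n) !(@mul_row_col _ 1 1 n) !trmx0 !trmx1 !mulmx0 !mulmx1 !add0r.
rewrite mul_row_block !mulmx0 addr0 add0r !(@mul_mx_row _ 1 n 1 n) !mulmx0 !mulmx1.
rewrite !scale_row_mx !scaler0 !add_row_mx !addr0 !add0r.
have sc (c : 'rV[R]_1) : c 0 0 *: 1%:M = c by rewrite scalemx1 -mx11_scalar.
by rewrite !(@scale_row_mx _ 1 1 n) !(@add_row_mx _ 1 1 n) !scaler0 !addr0 !add0r !sc.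
Qed.
Lemma dotW x y : dot x y = c0 x * c0 y + c1 x * c1 y + dot (pi_ x) (pi_ y).
Proof.
rewrite {1}(decompE x) !dotDl !dotZl dot_iota_l.
by rewrite (dotC e0) (dotC f0).
Qed.

Lemma c0D x y : c0 (x + y) = c0 x + c0 y. Proof. exact: dotDl. Qed.
Lemma c0Z a x : c0 (a *: x) = a * c0 x. Proof. exact: dotZl. Qed.
Lemma c0N x : c0 (- x) = - c0 x. Proof. exact: dotNl. Qed.
Lemma c1D x y : c1 (x + y) = c1 x + c1 y. Proof. exact: dotDl. Qed.
Lemma c1Z a x : c1 (a *: x) = a * c1 x. Proof. exact: dotZl. Qed.
Lemma c1N x : c1 (- x) = - c1 x. Proof. exact: dotNl. Qed.
Lemma c0J x : c0 (Jmul x) = - c1 x. Proof. exact: dotJl. Qed.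
Lemma c1J x : c1 (Jmul x) = c0 x. Proof. exact: dotJJ. Qed.
Lemma c0e : c0 e0 = 1. Proof. exact: dot_e0. Qed.
Lemma c0f : c0 f0 = 0. Proof. exact: dot_f0e0. Qed.
Lemma c1e : c1 e0 = 0. Proof. exact: dot_e0f0. Qed.
Lemma c1f : c1 f0 = 1. Proof. exact: dot_f0. Qed.
Lemma c0i z : c0 (iota_ z) = 0. Proof. exact: dot_iota_e0. Qed.
Lemma c1i z : c1 (iota_ z) = 0. Proof. exact: dot_iota_f0. Qed.

Definition cX := (c0D, c0Z, c0N, c0J, c1D, c1Z, c1N, c1J, c0e, c0f, c1e, c1f, c0i, c1i).
Definition piX := (piD, piZ, piN, piJ, pi_e0, pi_f0, iotaK).

Lemma Wext x y : c0 x = c0 y -> c1 x = c1 y -> pi_ x = pi_ y -> x = y.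
Proof. by move=> h0 h1 h2; rewrite (decompE x) (decompE y) h0 h1 h2. Qed.

(** The real part of h, with [e0] as negative direction; the imaginary part is [B x (Jmul y)] up to
    sign. *)
Definition B x y := dot (pi_ x) (pi_ y) - c0 x * c0 y - c1 x * c1 y.
Lemma BC x y : B x y = B y x.
Proof. by rewrite /B dotC mulrC [c1 x * _]mulrC. Qed.
Lemma BDl x y y' : B (x + y) y' = B x y' + B y y'.
Proof. by rewrite /B !piX !cX !dotX; ring. Qed.
Lemma BDr x y y' : B y' (x + y) = B y' x + B y' y.
Proof. by rewrite BC BDl !(BC y'). Qed.
Lemma BZl a x y : B (a *: x) y = a * B x y.
Proof. by rewrite /B !piX !cX !dotX; ring. Qed.
Lemma BZr a x y : B y (a *: x) = a * B y x.
Proof. by rewrite BC BZl BC. Qed.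
Lemma BNl x y : B (- x) y = - B x y.
Proof. by rewrite -scaleN1r BZl mulN1r. Qed.
Lemma BNr x y : B y (- x) = - B y x.
Proof. by rewrite BC BNl BC. Qed.
Lemma BJJ x y : B (Jmul x) (Jmul y) = B x y.
Proof. by rewrite /B !piX !cX dotJJ; ring. Qed.
Lemma BJl x y : B (Jmul x) y = - B x (Jmul y).
Proof. by rewrite -BJJ JmulJ BNl. Qed.
Lemma BJs x y : B x (Jmul y) = - B y (Jmul x).
Proof. by rewrite BC BJl. Qed.
Lemma BxJx x : B x (Jmul x) = 0.
Proof. by have := BJs x x => h; lra. Qed.
Lemma Bee : B e0 e0 = -1.
Proof. by rewrite /B pi_e0 c0e c1e dot0l; ring. Qed.
Lemma Bei z : B e0 (iota_ z) = 0.
Proof. by rewrite /B pi_e0 c0i c1i dot0l; ring. Qed.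
Lemma Bii z w : B (iota_ z) (iota_ w) = dot z w.
Proof. by rewrite /B !iotaK !c0i !c1i; ring. Qed.
Definition BX := (BDl, BDr, BNl, BNr, BZl, BZr).

(** [lift] is the affine chart z |-> (1, z) of projective space and [pr] its inverse x |-> x' / x_0;
    [q2 x] is |x_0|^2. *)
Definition lift z : W := e0 + iota_ z.
Definition q2 x := c0 x ^+ 2 + c1 x ^+ 2.
Definition pr x : V := (q2 x)^-1 *: (c0 x *: pi_ x - c1 x *: Jmul (pi_ x)).

Lemma c0_lift z : c0 (lift z) = 1. Proof. by rewrite /lift !cX addr0. Qed.
Lemma c1_lift z : c1 (lift z) = 0. Proof. by rewrite /lift !cX addr0. Qed.
Lemma pi_lift z : pi_ (lift z) = z. Proof. by rewrite /lift !piX add0r. Qed.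
Lemma pr_lift z : pr (lift z) = z.
Proof.
by rewrite /pr /q2 c0_lift c1_lift pi_lift expr1n expr0n addr0 invr1 !scale1r scale0r subr0.
Qed.
Lemma B_lift z w : B (lift z) (lift w) = dot z w - 1.
Proof. by rewrite /B !c0_lift !c1_lift !pi_lift; ring. Qed.

Lemma prK x : q2 x != 0 -> cs (c0 x) (c1 x) (lift (pr x)) = x.
Proof.
move=> qx; apply: Wext; rewrite /cs.
- by rewrite !cX; ring.
- by rewrite !cX; ring.
rewrite !piX add0r; have := cs_inv2 (pi_ x) qx; rewrite -/(q2 x) => e.
by rewrite -[RHS]e /cs /pr !JmulX; move: (q2 x)^-1 => r; vec.
Qed.
Lemma pi_prE x : q2 x != 0 -> pi_ x = cs (c0 x) (c1 x) (pr x).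
Proof. by move=> h; rewrite -[x in LHS](prK h) /cs /lift piD !piZ piJ piD pi_e0 iotaK add0r. Qed.
Lemma q2_ge0 x : 0 <= q2 x. Proof. by rewrite addr_ge0 ?sqr_ge0. Qed.
Lemma B_q2 x : B x x = dot (pi_ x) (pi_ x) - q2 x.
Proof. by rewrite /B /q2; ring. Qed.
Lemma q2_gt0 x : B x x < 0 -> 0 < q2 x.
Proof. by rewrite B_q2; have := dot_ge0 (pi_ x); lra. Qed.
Lemma q2_cs a b x : q2 (cs a b x) = (a ^+ 2 + b ^+ 2) * q2 x.
Proof. by rewrite /q2 /cs !cX; ring. Qed.
Lemma B_cs a b x y : B (cs a b x) (cs a b y) = (a ^+ 2 + b ^+ 2) * B x y.
Proof. by rewrite /cs !BX BJJ BJl; ring. Qed.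
Lemma B_pr x : q2 x != 0 -> B x x = q2 x * (dot (pr x) (pr x) - 1).
Proof. by move=> qx; rewrite -{1 2}(prK qx) B_cs B_lift. Qed.
Lemma pr_cs a b x : a ^+ 2 + b ^+ 2 != 0 -> pr (cs a b x) = pr x.
Proof.
move=> h; have [q0|q0] := eqVneq (q2 x) 0; first by rewrite /pr q2_cs q0 mulr0 invr0 !scale0r.
rewrite -{1}(prK q0) cs_cs.
set a' := a * _ - _; set b' := a * _ + _.
have h' : a' ^+ 2 + b' ^+ 2 != 0.
  rewrite (_ : _ + _ = (a ^+ 2 + b ^+ 2) * q2 x); last by rewrite /q2 /a' /b'; ring.
  by rewrite mulf_neq0.
rewrite {1}/pr q2_cs /q2 c0_lift c1_lift expr1n expr0n addr0 mulr1.
have -> : c0 (cs a' b' (lift (pr x))) = a' by rewrite /cs !cX; ring.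
have -> : c1 (cs a' b' (lift (pr x))) = b' by rewrite /cs !cX; ring.
have -> : pi_ (cs a' b' (lift (pr x))) = cs a' b' (pr x) by rewrite /cs !piX add0r.
have := cs_inv (pr x) h'; move: (pr x) => y e; rewrite -[RHS]e /cs !JmulX.
by move: (a' ^+ 2 + b' ^+ 2)^-1 => r; vec.
Qed.

Definition Qmx : 'M[R]_(n.+1 + n.+1) := iotamx^T *m iotamx - e0^T *m e0 - f0^T *m f0.
Lemma BE x y : B x y = (x *m Qmx *m y^T) 0 0.
Proof.
have sub (A C : 'M[R]_1) : (A - C) 0 0 = A 0 0 - C 0 0 by rewrite !mxE.
rewrite /Qmx !mulmxBr !mulmxBl !mulmxA !sub /B /pi_ {1}/dot trmx_mul trmxK !mulmxA.
have h (u v : W) : (x *m u^T *m v *m y^T) 0 0 = dot x u * dot y v.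
  by rewrite -mulmxA -[in RHS](dotC v) /dot mxE big_ord1.
by rewrite !h.
Qed.
Lemma Qmx_sqr : Qmx *m Qmx = 1%:M.
Proof.
apply/row_matrixP => i; rewrite !rowE mulmx1 mulmxA.
set x := delta_mx 0 i.
have QE (y : W) : y *m Qmx = iota_ (pi_ y) - c0 y *: e0 - c1 y *: f0.
  apply/eqP; rewrite -subr_eq0 -dot_eq0; apply/eqP.
  set u := _ - _; have : dot (y *m Qmx) u = B y u by rewrite BE.
  rewrite {1}/u dotBl => ->; rewrite /B !dotBl !dotZl dot_iota_l.
  by rewrite (dotC e0) (dotC f0) -/(c0 u) -/(c1 u) subrr.
rewrite !QE !piX !cX [RHS]decompE !scaler0 !subr0; move: (iota_ _) (c0 x) (c1 x) e0 f0 => u a b v w.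
by vec.
Qed.

(** The sign [s] is 1 for complex linear and -1 for antilinear matrices, so that [Ghat] also covers
    the isometries that are not holomorphic. *)
Definition uni (s : R) (g : 'M[R]_(n.+1 + n.+1)) :=
  (forall x y, B (x *m g) (y *m g) = B x y) /\ forall x, Jmul (x *m g) = s *: (Jmul x *m g).
Definition Ghat (g : 'M[R]_(n.+1 + n.+1)) := exists2 s : R, s ^+ 2 = 1 & uni s g.

Lemma uni_Q s g : uni s g -> g *m Qmx *m g^T = Qmx.
Proof.
move=> [h _]; apply/matrixP => i j.
have := h (delta_mx 0 i) (delta_mx 0 j); rewrite !BE trmx_mul.
rewrite !mulmxA -!mulmxA !(mulmxA g) => e.
have d (A : 'M[R]_(n.+1 + n.+1)) : ((delta_mx 0 i : W) *m (A *m (delta_mx 0 j : W)^T)) 0 0 = A i j.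
  by rewrite mulmxA -rowE trmx_delta -colE !mxE.
by rewrite (mulmxA (g *m Qmx) g^T) !d in e.
Qed.
Lemma uni_unit s g : uni s g -> g \in unitmx.
Proof.
move=> /uni_Q h.
have [] := @mulmx1_unit _ _ g (Qmx *m g^T *m Qmx); last by [].
by rewrite !mulmxA h Qmx_sqr.
Qed.
Lemma Ghat_unit g : Ghat g -> g \in unitmx.
Proof. by move=> [s _ h]; exact: uni_unit h. Qed.
Lemma uniM s t g h : uni s g -> uni t h -> uni (s * t) (g *m h).
Proof.
move=> [g1 g2] [h1 h2]; split=> [x y|x]; first by rewrite !mulmxA h1 g1.
by rewrite !mulmxA h2 g2 -scalemxAl scalerA mulrC.
Qed.
Lemma Ghat1 : Ghat 1%:M.
Proof. by exists 1; [rewrite expr1n|split=> [x y|x]; rewrite ?mulmx1 ?scale1r]. Qed.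
Lemma GhatM g h : Ghat g -> Ghat h -> Ghat (g *m h).
Proof.
move=> [s s1 hg] [t t1 hh]; exists (s * t); first by rewrite exprMn s1 t1 mulr1.
exact: uniM.
Qed.
Lemma uniV s g : s ^+ 2 = 1 -> uni s g -> uni s (invmx g).
Proof.
move=> s1 ug; have U := uni_unit ug; have [g1 g2] := ug.
split=> [x y|x]; first by rewrite -g1 !mulmxKV.
apply: (can_inj (mulmxK U)); rewrite -scalemxAl mulmxKV //.
have := g2 (x *m invmx g); rewrite mulmxKV // => ->.
by rewrite scalerA -expr2 s1 scale1r.
Qed.
Lemma GhatV g : Ghat g -> Ghat (invmx g).
Proof. by move=> [s s1 h]; exists s => //; exact: uniV. Qed.

Definition act (g : 'M[R]_(n.+1 + n.+1)) (z : V) : V :=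
  if `[< CH z >] then pr (lift z *m g) else z.

Lemma CHE z : CH z <-> dot z z < 1. Proof. by []. Qed.
Lemma B_lift_lt0 z : CH z -> B (lift z) (lift z) < 0.
Proof. by rewrite B_lift => /CHE; rewrite subr_lt0. Qed.
Lemma act_in g z : CH z -> act g z = pr (lift z *m g).
Proof. by move=> h; rewrite /act asboolT. Qed.
Lemma act_out g z : ~ CH z -> act g z = z.
Proof. by move=> h; rewrite /act asboolF. Qed.
Lemma pr_CH x : B x x < 0 -> CH (pr x).
Proof.
move=> h; have q := q2_gt0 h; apply/CHE.
by move: h; rewrite B_pr ?gt_eqF // pmulr_rlt0 // subr_lt0.
Qed.
Lemma B_mulg g x y : Ghat g -> B (x *m g) (y *m g) = B x y.
Proof. by move=> [s _ [h _]]. Qed.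
Lemma act_CH g z : Ghat g -> CH z -> CH (act g z).
Proof. by move=> hg hz; rewrite act_in //; apply: pr_CH; rewrite B_mulg //; exact: B_lift_lt0. Qed.
Lemma pr_mul_cs g a b x : Ghat g -> a ^+ 2 + b ^+ 2 != 0 -> pr (cs a b x *m g) = pr (x *m g).
Proof.
move=> [s s1 [_ h]] ab; have -> : cs a b x *m g = cs a (s * b) (x *m g).
  rewrite /cs mulmxDl -!scalemxAl h scalerA; congr (_ + _ *: _).
  by rewrite mulrAC -expr2 s1 mul1r.
by apply: pr_cs; rewrite exprMn s1 mul1r.
Qed.
Lemma pr_mul_lift g x : Ghat g -> B x x < 0 -> pr (lift (pr x) *m g) = pr (x *m g).
Proof.
move=> hg hx; have q0 := q2_gt0 hx.
by rewrite -{2}(prK (lt0r_neq0 q0)) pr_mul_cs // -/(q2 x) lt0r_neq0.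
Qed.
Lemma act_pr g x : Ghat g -> B x x < 0 -> act g (pr x) = pr (x *m g).
Proof. by move=> hg hx; rewrite act_in ?pr_mul_lift //; exact: pr_CH. Qed.
Lemma actM g h z : Ghat g -> Ghat h -> act (g *m h) z = act h (act g z).
Proof.
move=> hg hh; have [hz|hz] := pselect (CH z); last by rewrite !act_out.
rewrite (act_in _ hz) (act_in g hz) act_pr ?mulmxA // B_mulg //; exact: B_lift_lt0.
Qed.
Lemma act1 z : act 1%:M z = z.
Proof.
have [hz|hz] := pselect (CH z); last by rewrite act_out.
by rewrite act_in // mulmx1 pr_lift.
Qed.
Lemma actK g z : Ghat g -> act (invmx g) (act g z) = z.
Proof.
by move=> hg; rewrite -actM //; [rewrite mulmxV ?act1 //; exact: Ghat_unit|exact: GhatV].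
Qed.
Lemma actKV g z : Ghat g -> act g (act (invmx g) z) = z.
Proof.
by move=> hg; rewrite -actM //; [rewrite mulVmx ?act1 //; exact: Ghat_unit|exact: GhatV].
Qed.
Lemma CH0 : CH (0 : V). Proof. by apply/CHE; rewrite dot0l ltr01. Qed.
End Lift.

Section DeriveMore.
Variables (R : realType) (V : normedModType R).

Lemma is_derive_ext (W : normedModType R) (f g : V -> W) x v df :
  (\forall y \near x, f y = g y) -> is_derive x v f df -> is_derive x v g df.
Proof.
move=> fg hf.
have h0 : is_derive x v (g - f) 0.
  have [d e] : is_diff x (g - f) 0.
    apply: is_diff_near0; apply: filterS fg => y e.
    by rewrite !fctE /= e subrr.
  by apply: DeriveDef; [exact: diff_derivable|rewrite deriveE // e].
have := is_deriveD hf h0; rewrite addr0.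
by rewrite (_ : f + (g - f) = g) //; apply/funext => y; rewrite !fctE /= addrC subrK.
Qed.

Lemma is_derive_uniq (W : normedModType R) (f : V -> W) x v d1 d2 :
  is_derive x v f d1 -> is_derive x v f d2 -> d1 = d2.
Proof. by move=> [_ <-] [_ <-]. Qed.

Lemma is_derive_scale (m n : nat) (a : V -> R) (M : V -> 'M[R]_(m, n)) x v da dM :
  is_derive x v a da -> is_derive x v M dM ->
  is_derive x v (fun y => a y *: M y) (da *: M x + a x *: dM).
Proof.
move=> ha /is_derive_mxP hM; apply/is_derive_mxP => i j.
rewrite (_ : (fun y => _) = (fun y => a y * M y i j)); last by apply/funext => y; rewrite mxE.
rewrite !mxE addrC [da * _]mulrC; exact: (is_deriveM ha (hM i j)).
Qed.

Lemma is_derive_dot (m : nat) (f g : V -> 'rV[R]_m) x v df dg :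
  is_derive x v f df -> is_derive x v g dg ->
  is_derive x v (fun y => dot (f y) (g y)) (dot df (g x) + dot (f x) dg).
Proof.
move=> hf hg; have /is_derive_mxP/(_ 0 0) := is_derive_mulmx hf (is_derive_trmx hg).
by rewrite mxE.
Qed.

Lemma is_derive_addmx (W : normedModType R) (f g : V -> W) x v df dg :
  is_derive x v f df -> is_derive x v g dg ->
  is_derive x v (fun y => f y + g y) (df + dg).
Proof. exact: is_deriveD. Qed.

Lemma is_derive_J (n : nat) (f : V -> realCn R n) x v df :
  is_derive x v f df -> is_derive x v (fun y => Jmul (f y)) (Jmul df).
Proof.
move=> hf; have := is_derive_mulmx hf (is_derive_cstmx (@Jmx R n) x v).
rewrite mulmx0 addr0 -JmulE.
by rewrite (_ : (fun y => _ *m _) = (fun y => Jmul (f y))) //; apply/funext => y; rewrite JmulE.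
Qed.

Lemma Ck_dot (m : nat) k U (f g : V -> 'rV[R]_m) : open U ->
  Ck k U f -> Ck k U g -> Ck k U (fun y => dot (f y) (g y)).
Proof. by move=> oU hf hg; apply: Ck_coord => //; apply: Ck_mulmx => //; exact: Ck_trmx. Qed.

Lemma Ck_J (n : nat) k U (f : V -> realCn R n) : open U ->
  Ck k U f -> Ck k U (fun y => Jmul (f y)).
Proof.
move=> oU hf; rewrite (_ : (fun y => _) = (fun y => f y *m @Jmx R n)).
  by apply: Ck_mulmx => //; exact: Ck_cst.
by apply/funext => y; rewrite JmulE.
Qed.

Lemma Ck_pr (n : nat) k U (X : V -> realCn R n.+1) : open U ->
  (forall z, U z -> q2 (X z) != 0) -> Ck k U X -> Ck k U (fun z => pr (X z)).
Proof.
move=> oU q0 hX; rewrite /pr.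
have h0 : Ck k U (fun z => c0 (X z)) by apply: Ck_dot => //; exact: Ck_cst.
have h1 : Ck k U (fun z => c1 (X z)) by apply: Ck_dot => //; exact: Ck_cst.
have hp : Ck k U (fun z => pi_ (X z)) by apply: Ck_mulmx => //; exact: Ck_cst.
have hq : Ck k U (fun z => q2 (X z)).
  rewrite /q2; under eq_fun do rewrite !expr2; exact: (CkD oU (CkM oU h0 h0) (CkM oU h1 h1)).
apply: CkZ => //; first exact: CkV.
apply: CkD => //; first exact: CkZ.
under eq_fun do rewrite -scaleNr -mulN1r.
apply: CkZ => //; last exact: Ck_J.
by apply: CkM => //; exact: Ck_cst.
Qed.

Lemma Ck_lift (n : nat) k U (X : V -> realCn R n) : open U ->
  Ck k U X -> Ck k U (fun z => lift (X z)).
Proof.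
move=> oU h; apply: CkD => //; first exact: Ck_cst.
by apply: Ck_mulmx => //; exact: Ck_cst.
Qed.
End DeriveMore.

(** * Invariance of the Bergman metric *)

Section PrDerive.
Variables (R : realType) (n : nat).
Local Notation VV := (realCn R n).
Local Notation W := (realCn R n.+1).

(** The differential of [pr] at [X] in the direction [X']. It is characterized by [prdE]: modulo
    complex multiples of [lift (pr X)], the vector [X'] is x_0 times it. *)
Definition prd (X X' : W) : VV :=
  let Y := pi_ X' - c0 X' *: pr X - c1 X' *: Jmul (pr X) in
  cs (c0 X / q2 X) (- c1 X / q2 X) Y.

Lemma prdE (X X' : W) : q2 X != 0 ->
  X' = cs (c0 X') (c1 X') (lift (pr X)) + cs (c0 X) (c1 X) (iota_ (prd X X')).
Proof.
move=> q0; apply: Wext; rewrite /cs.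
- by rewrite !cX; ring.
- by rewrite !cX; ring.
rewrite !piX add0r.
have := cs_inv2 (pi_ X' - c0 X' *: pr X - c1 X' *: Jmul (pr X)) q0.
rewrite -/(q2 X) -/(prd X X') /cs => ->.
by vec.
Qed.

Lemma prd_uniq (X X' : W) (D : VV) (a b : R) : q2 X != 0 ->
  X' = cs a b (lift (pr X)) + cs (c0 X) (c1 X) (iota_ D) -> D = prd X X'.
Proof.
move=> q0 e; have ea : c0 X' = a by rewrite e /cs !cX; ring.
have eb : c1 X' = b by rewrite e /cs !cX; ring.
have ep : pi_ X' - a *: pr X - b *: Jmul (pr X) = cs (c0 X) (c1 X) D.
  by rewrite e /cs !piX add0r; move: (pr X) => y; vec.
by rewrite /prd ea eb ep /q2 cs_inv.
Qed.

(** The explicit formula for [pr] only serves to see that a derivative exists. Its value is read off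
    from the product rule for x = x_0 lift (pr x) and from [prd_uniq]. *)
Lemma is_derive_pr (V : normedModType R) (X : V -> W) x v X' :
  (\forall y \near x, q2 (X y) != 0) -> is_derive x v X X' ->
  is_derive x v (fun y => pr (X y)) (prd (X x) X').
Proof.
move=> q0 hX; have q0x : q2 (X x) != 0 := nbhs_singleton q0.
have h0 : is_derive x v (fun y => c0 (X y)) (c0 X').
  by have := is_derive_dot hX (is_derive_cstmx (e0 R n) x v); rewrite dot0r addr0.
have h1 : is_derive x v (fun y => c1 (X y)) (c1 X').
  by have := is_derive_dot hX (is_derive_cstmx (f0 R n) x v); rewrite dot0r addr0.
have hp : is_derive x v (fun y => pi_ (X y)) (pi_ X').
  by have := is_derive_mulmx hX (is_derive_cstmx (iotamx R n)^T x v); rewrite mulmx0 addr0.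
have [d hd] : exists d, is_derive x v (fun y => pr (X y)) d.
  have hq : derivable (fun y => (q2 (X y))^-1) x v.
    apply: derivableV; [exact: q0x|].
    have [dq _] := is_deriveD (is_deriveM h0 h0) (is_deriveM h1 h1).
    have e : (fun y => q2 (X y)) = (fun y : V => c0 (X y)) * (fun y => c0 (X y)) +
      (fun y => c1 (X y)) * (fun y => c1 (X y)).
      by apply/funext => y; rewrite !fctE /q2 !expr2.
    by rewrite e.
  have hq' : is_derive x v (fun y => (q2 (X y))^-1) ('D_v (fun y => (q2 (X y))^-1) x).
    exact: DeriveDef.
  have hJ := is_derive_scale h1 (is_derive_J hp).
  have hs := is_derive_scale hq' (is_deriveB (is_derive_scale h0 hp) hJ).
  by eexists; exact: hs.
suff <- : d = prd (X x) X' by [].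
have hl : is_derive x v (fun y => lift (pr (X y))) (iota_ d).
  have := is_derive_mulmx hd (is_derive_cstmx (iotamx R n) x v).
  rewrite mulmx0 addr0 => hh.
  by have := is_derive_addmx (is_derive_cstmx (e0 R n) x v) hh; rewrite add0r.
apply: (@prd_uniq _ _ _ (c0 X') (c1 X')) => //.
have hr := is_derive_addmx (is_derive_scale h0 hl) (is_derive_scale h1 (is_derive_J hl)).
have e : \forall y \near x, c0 (X y) *: lift (pr (X y)) + c1 (X y) *: Jmul (lift (pr (X y))) = X y.
  by apply: filterS q0 => y qy; have := prK qy.
rewrite [LHS](is_derive_uniq hX (is_derive_ext e hr)) /cs.
by move: (lift _) (iota_ d) => y u; vec.
Qed.
Implicit Types (z v w : VV).

Lemma metricE z v w : metric bergman z v w =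
  4 / (1 - dot z z) ^+ 2 * ((1 - dot z z) * dot v w + dot v z * dot w z
     + dot v (Jmul z) * dot w (Jmul z)).
Proof.
rewrite /metric /bergman -scalemxAr -scalemxAl mxE; congr (_ * _).
have h (u : VV) : (v *m (u^T *m u) *m w^T) 0 0 = dot v u * dot w u.
  by rewrite mulmxA -mulmxA [in RHS](dotC w) /dot mxE big_ord1.
have add (A C : 'M[R]_1) : (A + C) 0 0 = A 0 0 + C 0 0 by rewrite !mxE.
by rewrite !mulmxDr !mulmxDl !add !h mul_mx_scalar -scalemxAl mxE.
Qed.

Lemma metric0 v w : metric bergman 0 v w = 4 * dot v w.
Proof. by rewrite metricE Jmul0 !dot0l !dot0r !mulr0 !addr0 subr0 expr1n divr1 mul1r. Qed.

Lemma continuous_dot_self (m : nat) : continuous (fun x : 'rV[R]_m => dot x x).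
Proof.
have h : Ck 0 [set: 'rV[R]_m] (fun x => dot x x).
  by apply: Ck_dot; [exact: openT|exact: Ck_id|exact: Ck_id].
by move=> z; exact: h.
Qed.

Lemma open_CH : open (CH : set VV).
Proof.
apply: (@open_comp _ _ (fun z : VV => dot z z) [set r : R | r < 1]).
  by move=> z _; exact: continuous_dot_self.
exact: open_lt.
Qed.

Lemma near_CH z : CH z -> \forall y \near z, CH y.
Proof. by move=> h; exact: (open_nbhs_nbhs (conj open_CH h)). Qed.

Lemma q2_lift g z : Ghat g -> CH z -> 0 < q2 (lift z *m g).
Proof. by move=> hg hz; apply: q2_gt0; rewrite B_mulg //; exact: B_lift_lt0. Qed.

Lemma Ck_act (V : normedModType R) k (U : set V) (c : V -> VV) (g : 'M[R]_(n.+1 + n.+1)) :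
  Ghat g -> open U -> (forall x, U x -> CH (c x)) -> Ck k U c -> Ck k U (fun x => act g (c x)).
Proof.
move=> hg oU hU hc; apply: (@Ck_ext _ _ _ k U (fun x => pr (lift (c x) *m g))) => //.
  by move=> x Ux; rewrite act_in //; exact: hU.
apply: Ck_pr => //; first by move=> x Ux; rewrite lt0r_neq0 // q2_lift //; exact: hU.
by apply: Ck_mulmx => //; [exact: Ck_lift|exact: Ck_cst].
Qed.

Lemma smooth_act g : Ghat g -> smooth_on (CH : set VV) (act g).
Proof. by move=> hg k; apply: (Ck_act (c := id)) => //; [exact: open_CH|exact: Ck_id]. Qed.

Lemma is_derive_lift (V : normedModType R) (c : V -> VV) (x v : V) (dc : VV) (g : 'M[R]_(n.+1 + n.+1)) :
  is_derive x v c dc -> is_derive x v (fun y => lift (c y) *m g) (iota_ dc *m g).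
Proof.
move=> hc; have := is_derive_mulmx hc (is_derive_cstmx (iotamx R n) x v).
rewrite mulmx0 addr0 => hh.
have := is_derive_addmx (is_derive_cstmx (e0 R n) x v) hh; rewrite add0r => h2.
by have := is_derive_mulmx h2 (is_derive_cstmx g x v); rewrite mulmx0 addr0.
Qed.

Lemma is_derive_act (V : normedModType R) (c : V -> VV) (x v : V) (dc : VV) (g : 'M[R]_(n.+1 + n.+1)) : Ghat g ->
  (\forall y \near x, CH (c y)) -> is_derive x v c dc ->
  is_derive x v (fun y => act g (c y)) (prd (lift (c x) *m g) (iota_ dc *m g)).
Proof.
move=> hg hn hc.
apply: (@is_derive_ext _ _ _ (fun y => pr (lift (c y) *m g))).
  by apply: filterS hn => y hy; rewrite act_in.
apply: is_derive_pr; last exact: is_derive_lift.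
by apply: filterS hn => y hy; rewrite lt0r_neq0 // q2_lift.
Qed.

Lemma B_iota_l v (x : W) : B (iota_ v) x = dot v (pi_ x).
Proof. by rewrite /B iotaK c0i c1i; ring. Qed.

Definition dact (g : 'M[R]_(n.+1 + n.+1)) z v : VV := prd (lift z *m g) (iota_ v *m g).

Lemma diff_act g z v : Ghat g -> CH z -> 'd (act g) z v = dact g z v.
Proof.
move=> hg hz; have [d _] := smooth_act hg 1.
have [_ /= e] := @is_derive_act _ id z v v g hg (near_CH hz) (is_derive_id _ _).
by rewrite /dact -e deriveE //; exact: d.
Qed.

(** The metric is a quotient of polynomials in the values of h on [lift z], [iota_ v] and [iota_ w].
    It does not change if all three are scaled by a complex number, nor if multiples of the lift are
    added to the tangent vectors. Antilinearity changes the signs of two imaginary parts, which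
    occur as a product. *)
Lemma metric_dact g z v w : Ghat g -> CH z ->
  metric bergman (act g z) (dact g z v) (dact g z w) = metric bergman z v w.
Proof.
move=> hg hz; rewrite act_in // !metricE /dact.
set X := lift z *m g; set D := prd _ _; set E := prd _ _; set F := pr X.
have qp := q2_lift hg hz; have q0 := lt0r_neq0 qp; rewrite -/X in qp q0.
have [s s1 [_ gJ]] := hg.
have eX : X = cs (c0 X) (c1 X) (lift F) by rewrite prK.
have eD : iota_ v *m g = _ := prdE _ q0; rewrite -/D -/F in eD.
have eE : iota_ w *m g = _ := prdE _ q0; rewrite -/E -/F in eE.
have b0 : B X X = dot z z - 1 by rewrite B_mulg // B_lift.
have b1 : B (iota_ v *m g) X = dot v z by rewrite B_mulg // B_iota_l pi_lift.
have b2 : B (iota_ w *m g) X = dot w z by rewrite B_mulg // B_iota_l pi_lift.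
have b3 : B (iota_ v *m g) (Jmul X) = s * dot v (Jmul z).
  by rewrite gJ BZr B_mulg // B_iota_l piJ pi_lift.
have b4 : B (iota_ w *m g) (Jmul X) = s * dot w (Jmul z).
  by rewrite gJ BZr B_mulg // B_iota_l piJ pi_lift.
have b5 : B (iota_ v *m g) (iota_ w *m g) = dot v w by rewrite B_mulg // Bii.
have bF : 1 - dot z z = q2 X * (1 - dot F F).
  by have := B_pr q0; rewrite b0 -/F => e; lra.
have F1 : 1 - dot F F != 0.
  by apply/eqP => e; have := hz; move/CHE; rewrite -subr_gt0 bF e mulr0 ltxx.
rewrite (_ : (1 - dot z z) * dot v w + dot v z * dot w z + dot v (Jmul z) * dot w (Jmul z)
  = q2 X ^+ 2 * ((1 - dot F F) * dot D E + dot D F * dot E F + dot D (Jmul F) * dot E (Jmul F))).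
  have gen (p q r : R) : q != 0 -> r != 0 -> 4 / r ^+ 2 * p = 4 / (q * r) ^+ 2 * (q ^+ 2 * p).
    by move=> h1 h2; field; rewrite h1 h2.
  by rewrite bF -gen.
rewrite (_ : dot v (Jmul z) * dot w (Jmul z) = (s * dot v (Jmul z)) * (s * dot w (Jmul z))); last first.
  by rewrite mulrACA -expr2 s1 mul1r.
rewrite -b3 -b4 -b1 -b2 -b5 -[1 - dot z z]opprK opprB -b0.
move: (c0 (iota_ v *m g)) (c1 (iota_ v *m g)) (c0 (iota_ w *m g)) (c1 (iota_ w *m g)) eD eE => a1 b1' a2 b2' -> ->.
rewrite {}/q2; move: (c0 X) (c1 X) eX => a b eX.
clearbody F D E; rewrite eX.
rewrite /cs /lift /B ?piX ?cX ?JmulX ?dotX ?dotJJ ?dotJl ?JmulX ?dotX ?dot0l ?dot0r.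
rewrite !dotxJx ?(dotC F E) ?(dotJs F E).
move: (dot F F) (dot D F) (dot E F) (dot D E) (dot D (Jmul E)) (dot D (Jmul F)) (dot E (Jmul F)) => ? ? ? ? ? ? ?.
ring.
Qed.

Lemma act_isometry g : Ghat g -> CH_isometry (act g : VV -> VV).
Proof.
move=> hg; split.
- exact: act_out.
- split=> [z|z1 z2 _ _|z hz].
  + exact: act_CH.
  + by move=> e; rewrite -(actK z1 hg) e actK.
  + exists (act (invmx g) z); last by rewrite actKV.
    by apply: act_CH => //; exact: GhatV.
- exact: smooth_act.
- exists (act (invmx g)); split; first by apply: smooth_act; exact: GhatV.
  by move=> z hz; rewrite actK.
- by move=> z v w hz; rewrite !diff_act // metric_dact.
Qed.
End PrDerive.

(** * Witt's theorem for the Hermitian form *)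

Section ComplexCS.
Variables (R : realType) (n : nat).
Lemma dot_CCS (p d : realCn R n) :
  dot p d ^+ 2 + dot p (Jmul d) ^+ 2 <= dot p p * dot d d.
Proof.
set a := dot p d; set b := dot p (Jmul d).
have := dot_CS p (a *: d + b *: Jmul d).
rewrite !dotX !dotJJ (dotC (Jmul d) d) !dotxJx -/a -/b => h.
have h0 : 0 <= a ^+ 2 + b ^+ 2 by rewrite addr_ge0 ?sqr_ge0.
have [e|e] := eqVneq (a ^+ 2 + b ^+ 2) 0; first by rewrite e mulr_ge0 ?dot_ge0.
have h1 : 0 < a ^+ 2 + b ^+ 2 by rewrite lt_def e h0.
rewrite -(ler_pM2l h1); apply: le_trans (le_trans _ h) _; rewrite le_eqVlt; apply/orP; left; apply/eqP; ring.
Qed.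
End ComplexCS.

Section Witt.
Variables (R : realType) (n : nat).
Local Notation W := (realCn R n.+1).
Implicit Types (x y d t : W).

(** The h-orthogonal complement of a timelike vector is positive definite: h(t, d) = 0 and the
    complex Cauchy-Schwarz inequality bound |d_0| by the norm of the remaining coordinates. *)
Lemma B_timelike t d : B t t < 0 -> B t d = 0 -> B t (Jmul d) = 0 ->
  0 <= B d d /\ (B d d = 0 -> d = 0).
Proof.
rewrite [B t t]B_q2 [B d d]B_q2 /B piJ !cX => ht h1 h2.
have cs := dot_CCS (pi_ t) (pi_ d).
have e1 : dot (pi_ t) (pi_ d) = c0 t * c0 d + c1 t * c1 d by lra.
have e2 : dot (pi_ t) (Jmul (pi_ d)) = - (c0 t * c1 d) + c1 t * c0 d by lra.
have e : q2 t * q2 d <= dot (pi_ t) (pi_ t) * dot (pi_ d) (pi_ d).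
  by apply: le_trans cs; rewrite e1 e2 /q2 le_eqVlt; apply/orP; left; apply/eqP; ring.
have qt : 0 < q2 t by have := dot_ge0 (pi_ t); lra.
have [d0|d0] := eqVneq (pi_ d) 0.
  have qd : q2 d = 0.
    apply/eqP; rewrite eq_le q2_ge0 andbT -(pmulr_rle0 _ qt).
    by apply: le_trans e _; rewrite d0 dot0l mulr0.
  split=> [|_]; first by rewrite d0 dot0l qd subrr.
  move: qd => /eqP; rewrite paddr_eq0 ?sqr_ge0 // !sqrf_eq0 => /andP[/eqP c0d /eqP c1d].
  by rewrite (decompE d) d0 c0d c1d iota0 !scale0r !addr0.
have dp : 0 < dot (pi_ d) (pi_ d) by rewrite dot_gt0.
have lt : q2 d < dot (pi_ d) (pi_ d).
  rewrite -(ltr_pM2l qt); apply: le_lt_trans e _; rewrite ltr_pM2r //.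
  by lra.
by split=> [|h]; [lra|exfalso; lra].
Qed.

(** The complex reflection y |-> y - h(y, d) h(x, d)^-1 d in real terms. It sends [x] to [x - d] and
    is unitary if [B d d = 2 * B x d]. *)
Definition refl x d : 'M[R]_(n.+1 + n.+1) :=
  let a := B x d in let b := B x (Jmul d) in let k := (a ^+ 2 + b ^+ 2)^-1 in
  1%:M - @Qmx R n *m d^T *m (k *: (a *: d - b *: Jmul d))
   - @Qmx R n *m (Jmul d)^T *m (k *: (b *: d + a *: Jmul d)).

Lemma reflE x d y : let a := B x d in let b := B x (Jmul d) in let k := (a ^+ 2 + b ^+ 2)^-1 in
  y *m refl x d = y - B y d *: (k *: (a *: d - b *: Jmul d))
   - B y (Jmul d) *: (k *: (b *: d + a *: Jmul d)).
Proof.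
move=> a b k; rewrite /refl !mulmxBr mulmx1 !mulmxA -/a -/b -/k.
have h (u w : W) : y *m @Qmx R n *m u^T *m w = B y u *: w.
  by rewrite BE -mul_scalar_mx -mx11_scalar.
by rewrite !h.
Qed.

Lemma refl_uni x d : B d d = 2 * B x d -> B x d ^+ 2 + B x (Jmul d) ^+ 2 != 0 ->
  uni 1 (refl x d).
Proof.
move=> hd hN; split=> [y z|y]; last first.
  rewrite scale1r !reflE BJJ BJl; set k := (_ + _)^-1; clearbody k.
  by rewrite !JmulX; move: (B y d) (B y (Jmul d)) (B x d) (B x (Jmul d)) => p p' a b; vec.
rewrite !reflE; move: hN hd; set a := B x d; set b := B x (Jmul d) => hN hd.
rewrite !BX (BC d z) (BC (Jmul d) z) (BC (Jmul d) d) !BJJ !BxJx hd.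
move: (B y z) (B y d) (B y (Jmul d)) (B z d) (B z (Jmul d)) => p p1 p2 p3 p4.
by field.
Qed.

Lemma refl_move x y : B x x = B y y -> B x (x - y) ^+ 2 + B x (Jmul (x - y)) ^+ 2 != 0 ->
  x *m refl x (x - y) = y.
Proof.
move=> h hN; rewrite reflE; move: hN; move: (B x (x - y)) (B x (Jmul _)) => a b hN.
rewrite -[RHS](subKr x); move: (x - y) => d.
set k := (_ + _)^-1; have hk : k * (a ^+ 2 + b ^+ 2) = 1 by rewrite mulVf.
clearbody k; transitivity (x - (k * (a ^+ 2 + b ^+ 2)) *: d); first by vec.
by rewrite hk scale1r.
Qed.

Lemma refl_fix x d y : B y d = 0 -> B y (Jmul d) = 0 -> y *m refl x d = y.
Proof. by move=> h1 h2; rewrite reflE h1 h2 !scale0r !subr0. Qed.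

(** Induction on the number of vectors, with a reflection along d = x - y at each step. It is
    defined unless h(x, d) = 0; then B d d = 2 B x d = 0, and as [d] is orthogonal to a timelike
    vector, d = 0. The vectors matched before are orthogonal to [d] and stay fixed. *)
Lemma Witt (m : nat) (xs ys : nat -> W) :
  (0 < m)%N -> B (xs 0%N) (xs 0%N) < 0 ->
  (forall i j, (i < m)%N -> (j < m)%N -> B (xs i) (xs j) = B (ys i) (ys j)) ->
  (forall i j, (i < m)%N -> (j < m)%N -> B (xs i) (Jmul (xs j)) = B (ys i) (Jmul (ys j))) ->
  exists2 g, uni 1 g & forall i, (i < m)%N -> xs i *m g = ys i.
Proof.
case: m => [//|m] _ x0; elim: m => [|m IH] h1 h2.
  have [e|e] := eqVneq (xs 0%N) (ys 0%N).
    exists 1%:M; first by split=> [x y|x]; rewrite ?mulmx1 ?scale1r.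
    by move=> [|i] // _; rewrite mulmx1.
  have B00 := h1 0%N 0%N isT isT; set x := xs 0%N in e x0 B00; set y := ys 0%N in e B00.
  have Bd : B (x - y) (x - y) = 2 * B x (x - y).
    by rewrite !BX (BC y x) -B00; ring.
  have N0 : B x (x - y) ^+ 2 + B x (Jmul (x - y)) ^+ 2 != 0.
    apply/eqP => /eqP; rewrite paddr_eq0 ?sqr_ge0 // !sqrf_eq0 => /andP[/eqP n1 /eqP n2].
    have [_ h] := B_timelike x0 n1 n2; move: e; rewrite -subr_eq0 => /eqP; apply.
    by apply: h; rewrite Bd n1 mulr0.
  exists (refl x (x - y)); first exact: refl_uni.
  by move=> [|i] // _; exact: refl_move.
have [||g ug hg] := IH.
- by move=> i j im jm; apply: h1; exact: leqW.
- by move=> i j im jm; apply: h2; exact: leqW.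
set x := xs m.+1 *m g; set y := ys m.+1.
have [e|e] := eqVneq x y.
  by exists g => // i; rewrite ltnS leq_eqVlt => /orP[/eqP ->|/hg].
have [gB gJ] := ug.
have B00 : B x x = B y y by rewrite gB h1.
have Bd : B (x - y) (x - y) = 2 * B x (x - y).
  by rewrite !BX (BC y x) -B00; ring.
have oi i : (i < m.+1)%N -> B (ys i) (x - y) = 0 /\ B (ys i) (Jmul (x - y)) = 0.
  move=> im; rewrite JmulB !BDr !BNr -{1 3}(hg i im) gB gJ scale1r gB.
  rewrite h1 ?h2 ?subrr //; exact: leqW.
have y0 : B (ys 0%N) (ys 0%N) < 0 by rewrite -h1.
have N0 : B x (x - y) ^+ 2 + B x (Jmul (x - y)) ^+ 2 != 0.
  apply/eqP => /eqP; rewrite paddr_eq0 ?sqr_ge0 // !sqrf_eq0 => /andP[/eqP n1 /eqP n2].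
  have [p1 p2] := oi 0%N isT.
  have [_ h] := B_timelike y0 p1 p2; move: e; rewrite -subr_eq0 => /eqP; apply.
  by apply: h; rewrite Bd n1 mulr0.
exists (g *m refl x (x - y)).
  by rewrite -[1]mulr1; apply: uniM => //; exact: refl_uni.
move=> i; rewrite ltnS leq_eqVlt mulmxA => /orP[/eqP ->|im].
  exact: refl_move.
by have [p1 p2] := oi i im; rewrite hg // refl_fix.
Qed.

Lemma uni_Ghat (g : 'M[R]_(n.+1 + n.+1)) : uni 1 g -> Ghat g.
Proof. by move=> h; exists 1; rewrite ?expr1n. Qed.

Lemma lift0 : lift 0 = e0 R n. Proof. by rewrite /lift iota0 addr0. Qed.

Lemma transitive_CH (z : realCn R n) : CH z -> exists2 g, uni 1 g & act g 0 = z.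
Proof.
move=> hz; have := hz => /CHE; rewrite -subr_gt0 => s0.
pose k : R := (Num.sqrt (1 - dot z z))^-1.
have k0 : k != 0 by rewrite invr_eq0 gt_eqF // sqrtr_gt0.
have k2 : k ^+ 2 * (1 - dot z z) = 1.
  by rewrite exprVn sqr_sqrtr ?ltW // mulVf // gt_eqF.
have hB : B (e0 R n) (e0 R n) = B (k *: lift z) (k *: lift z).
  have -> : B (k *: lift z) (k *: lift z) = - (k ^+ 2 * (1 - dot z z)) by rewrite BZl BZr B_lift; ring.
  by rewrite Bee k2.
have [|||g ug hg] := @Witt 1%N (fun _ => e0 R n) (fun _ => k *: lift z) isT.
- by rewrite Bee ltrN10.
- by move=> i j _ _; exact: hB.
- by move=> i j _ _; rewrite !BxJx.
exists g => //; have h := hg 0%N isT.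
rewrite act_in ?lift0 ?h; last exact: CH0.
have := @pr_cs _ _ k 0 (lift z); rewrite /cs scale0r addr0 => -> //; first exact: pr_lift.
by rewrite expr0n addr0 sqrf_eq0.
Qed.
End Witt.

(** * Isometries of the ball *)

Section DiffLocal.
Variables (R : realType) (V W : normedModType R).

Lemma diff_right_inv (f : W -> V) (g : V -> W) z v : (\forall y \near z, f (g y) = y) ->
  differentiable g z -> differentiable f (g z) -> 'd f (g z) ('d g z v) = v.
Proof.
move=> nz dg df; have [_ e] := is_diff_ext nz (is_diffP (differentiable_comp dg df)).
have [_ eid] := is_diff_id z.
have : 'd id z v = 'd (f \o g) z v by rewrite -e.
by rewrite eid diff_comp.
Qed.
End DiffLocal.

Section Isometries.
Variables (R : realType) (n : nat).
Local Notation V := (realCn R n).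
Implicit Types (z w v : V) (f : V -> V).

(* A local form of [CH_isometry] that is stable under composition with [act g]. *)
Definition wiso f := [/\ forall z, CH z -> CH (f z),
  forall z, CH z -> differentiable f z,
  forall z w, CH z -> CH w -> f z = f w -> z = w &
  forall z v w, CH z -> metric bergman (f z) ('d f z v) ('d f z w) = metric bergman z v w].

Lemma wiso_CH f : CH_isometry f -> wiso f.
Proof.
move=> [_ [f1 f2 _] fs _ fm]; split=> // [z hz|z w hz hw e].
  by have [d _] := fs 1%N; exact: d.
by apply: f2 => //; rewrite inE.
Qed.

Lemma wiso_act g : Ghat g -> wiso (@act R n g).
Proof. by move=> hg; apply: wiso_CH; exact: act_isometry. Qed.

Lemma wiso_comp f g : wiso f -> wiso g -> wiso (g \o f).
Proof.
move=> [f1 f2 f3 f4] [g1 g2 g3 g4]; split=> [z hz|z hz|z w hz hw e|z v w hz].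
- by apply: g1; exact: f1.
- by apply: differentiable_comp; [exact: f2|exact/g2/f1].
- by apply: f3 => //; apply: g3 => //; exact: f1.
- have d1 := f2 z hz; have d2 := g2 _ (f1 z hz).
  by rewrite diff_comp //= g4 ?f4 //; exact: f1.
Qed.

Lemma wiso_inv f : CH_isometry f -> exists g, [/\ wiso g, forall z, CH z -> g (f z) = z &
  forall z, CH z -> f (g z) = z].
Proof.
move=> fi; have [f1 f2 f3 f4] := wiso_CH fi.
have [_ [_ _ fsurj] _ [g [gs gf]] _] := fi.
have gi w : CH w -> CH (g w) /\ f (g w) = w.
  by move=> hw; have [z hz <-] := fsurj w hw; rewrite gf.
have dg w : CH w -> differentiable g w by move=> hw; have [d _] := gs 1%N; exact: d.
exists g; split; [|exact: gf|by move=> z /gi[]].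
split=> [z /gi[]//|z hz|z w /gi[_ ez] /gi[_ ew] e|z v w hz]; first exact: dg.
  by rewrite -ez e ew.
have [hgz ez] := gi z hz.
have dfg u : 'd f (g z) ('d g z u) = u.
  apply: diff_right_inv; [|exact: dg|exact: f2].
  by apply: filterS (near_CH hz) => y /gi[].
transitivity (metric bergman (f (g z)) ('d f (g z) ('d g z v)) ('d f (g z) ('d g z w))).
  by symmetry; exact: f4.
by congr (metric bergman _ _ _); [exact: ez|exact: dfg|exact: dfg].
Qed.

(** The contribution of the radial component of [v]; for radial [v] there is equality. *)
Lemma metric_radial z v : CH z -> z != 0 ->
  4 * dot v z ^+ 2 / (dot z z * (1 - dot z z) ^+ 2) <= metric bergman z v v.
Proof.
move=> /CHE hz z0; have zp : 0 < dot z z by rewrite dot_gt0.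
have sp : 0 < 1 - dot z z by lra.
rewrite metricE -!expr2.
rewrite [leLHS](_ : _ = 4 / (1 - dot z z) ^+ 2 * (dot v z ^+ 2 / dot z z)); last first.
  by field; rewrite !gt_eqF.
apply: ler_wpM2l; first by rewrite divr_ge0 // sqr_ge0.
rewrite ler_pdivrMr //.
have := dot_CS v z; have := sqr_ge0 (dot v (Jmul z)); move: (dot v (Jmul z) ^+ 2) => x x0 h.
have h1 : (1 - dot z z) * dot v z ^+ 2 <= (1 - dot z z) * (dot v v * dot z z) by rewrite ler_pM2l.
have h2 : 0 <= x * dot z z by rewrite mulr_ge0 // ltW.
by move: h1 h2; clear; nra.
Qed.

Lemma metric_scale (t : R) z : CH (t *: z) ->
  metric bergman (t *: z) z z = 4 * dot z z / (1 - t ^+ 2 * dot z z) ^+ 2.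
Proof.
move=> /CHE h; rewrite metricE JmulZ !dotZr !dotZl dotxJx mulr0 mulr0 addr0.
rewrite mulrA -expr2 mulrAC; have h0 : 1 - t ^+ 2 * dot z z != 0.
  by rewrite gt_eqF // subr_gt0; move: h; rewrite dotZl dotZr mulrA -expr2.
by field.
Qed.

(** A comparison of distances without lengths of curves. Along the image of the segment from 0 to z,
    with r = |z|, the Euclidean norm N satisfies N' / (1 - N^2) <= r / (1 - t^2 r^2), because the
    speed is preserved and bounds its radial part by [metric_radial]. *)
Lemma wiso_contract f z : wiso f -> f 0 = 0 -> CH z -> dot (f z) (f z) <= dot z z.
Proof.
move=> [f1 f2 f3 f4] f00 hz.
have [->|z0] := eqVneq z 0; first by rewrite f00.
pose r : R := Num.sqrt (dot z z).
have zp : 0 < dot z z by rewrite dot_gt0.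
have r0 : 0 < r by rewrite sqrtr_gt0.
have r2 : r ^+ 2 = dot z z by rewrite sqr_sqrtr // ltW.
have r1 : r < 1 by rewrite /r -[X in _ < X]sqrtr1 ltr_sqrt //; exact/CHE.
pose c (t : R) := f (t *: z); pose u t := dot (c t) (c t); pose N t := Num.sqrt (u t).
have hc t : 0 <= t <= 1 -> CH (t *: z).
  move=> /andP[t0 t1]; apply/CHE; rewrite dotZl dotZr mulrA -expr2 -r2 -exprMn.
  rewrite expr_lt1 // ?mulr_ge0 // ?ltW //.
  by apply: le_lt_trans r1; rewrite ler_piMl // ltW.
have hf t : 0 <= t <= 1 -> CH (c t) by move=> ht; apply: f1; exact: hc.
have c_ne t : 0 < t <= 1 -> c t != 0.
  move=> /andP[t0 t1]; apply/eqP => e; have : t *: z = 0.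
    by apply: f3; rewrite ?f00 //; [apply: hc; rewrite ltW|exact: CH0].
  by move=> /eqP; rewrite scaler_eq0 (negPf z0) orbF gt_eqF.
have dc (t : R) : 0 <= t <= 1 -> is_derive t (1 : R) c ('d f (t *: z) z).
  move=> ht; have [_ dl] := is_diff_scalel t z.
  have dd : differentiable (fun s : R => s *: z) t by have [] := is_diff_scalel t z.
  have df := f2 _ (hc t ht).
  have dcomp := differentiable_comp dd df.
  apply: DeriveDef; first exact/derivable1_diffP.
  by rewrite deriveE // diff_comp //= dl /= scale1r.
have du (t : R) : 0 <= t <= 1 -> is_derive t (1 : R) u (2 * dot ('d f (t *: z) z) (c t)).
  move=> ht; apply: is_derive_eq (is_derive_dot (dc t ht) (dc t ht)) _.
  by rewrite [X in _ + X]dotC; ring.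
have up (t : R) : 0 < t <= 1 -> 0 < u t by move=> ht; rewrite dot_gt0; exact: c_ne.
have u1 (t : R) : 0 <= t <= 1 -> u t < 1 by move=> /hf/CHE.
have dN (t : R) : 0 < t <= 1 -> is_derive t (1 : R) N (dot ('d f (t *: z) z) (c t) / N t).
  move=> ht; have ht' : 0 <= t <= 1 by case/andP: ht => /ltW -> ->.
  apply: is_derive_eq (is_derive1_comp (is_derive1_sqrt (up t ht)) (du t ht')) _.
  have N0 : N t != 0 by rewrite gt_eqF // sqrtr_gt0 up.
  by rewrite -/(N t); field.
have N1 (t : R) : 0 <= t <= 1 -> 0 <= N t < 1.
  move=> ht; rewrite sqrtr_ge0 /= -[X in _ < X]sqrtr1 ltr_sqrt // u1 //.
have key (t : R) : 0 < t <= 1 -> dot ('d f (t *: z) z) (c t) / N t * (1 - (t * r) ^+ 2) <= r * (1 - N t ^+ 2).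
  move=> ht; have ht' : 0 <= t <= 1 by case/andP: ht => /ltW -> ->.
  have Np : 0 < N t by rewrite sqrtr_gt0 up.
  have N2 : N t ^+ 2 = u t by rewrite sqr_sqrtr // ltW // up.
  have := metric_radial ('d f (t *: z) z) (hf t ht') (c_ne t ht).
  rewrite -/(c t) f4 ?metric_scale; try exact: hc.
  rewrite -/(u t) -N2 exprMn -r2; set k := dot _ _ => h.
  have s1 : 0 < 1 - t ^+ 2 * r ^+ 2.
    by rewrite subr_gt0; have := hc t ht' => /CHE; rewrite dotZl dotZr mulrA -expr2 -r2.
  have s2 : 0 < 1 - N t ^+ 2 by rewrite N2 subr_gt0 u1.
  rewrite leNgt; apply/negP => lt.
  have : (r * (1 - N t ^+ 2)) ^+ 2 < (k / N t * (1 - t ^+ 2 * r ^+ 2)) ^+ 2.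
    by rewrite ltrXn2r // ?nnegrE ?ltW // ?(lt_trans _ lt) // mulr_gt0.
  apply/negP; rewrite -leNgt.
  move: h; rewrite ler_pdivrMr ?mulr_gt0 ?exprn_gt0 // mulrAC ler_pdivlMr ?exprn_gt0 //.
  move=> h; rewrite !exprMn exprVn mulrAC ler_pdivrMr ?exprn_gt0 //.
  by move: h; move: (N t ^+ 2) (k ^+ 2) ((1 - t ^+ 2 * r ^+ 2) ^+ 2) => x y w; clear; lra.
have den (t : R) : 0 <= t <= 1 -> 0 < 1 - t * r * N t.
  move=> ht; have /andP[n0 n1] := N1 t ht; case/andP: ht => t0 t1; rewrite subr_gt0.
  by apply: le_lt_trans n1; rewrite ler_piMl // mulr_ile1 // ltW.
pose g (t : R) := (N t - t * r) / (1 - t * r * N t).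
have dg (t : R) : 0 < t <= 1 -> exists2 d, is_derive t (1 : R) g d & d <= 0.
  move=> ht; have ht' : 0 <= t <= 1 by case/andP: ht => /ltW -> ->.
  have hN := dN t ht; set k := _ / N t in hN; have dt := den t ht'.
  have hr : is_derive t (1 : R) (fun s : R => s * r) r.
    have := is_deriveM (is_derive_id t (1 : R)) (is_derive_cst r t (1 : R)).
    by rewrite scaler0 add0r /GRing.scale /= mulr1.
  have h2 : is_derive t (1 : R) (cst 1 - (fun s : R => s * r) * N) (0 - (t * r *: k + N t *: r)).
    by apply: is_deriveB; apply: is_deriveM hr hN.
  have e2 : (cst 1 - (fun s : R => s * r) * N) t != 0 by rewrite !fctE /= gt_eqF.
  have hd := is_deriveM (is_deriveB hN hr) (is_deriveV e2 h2).
  eexists; first exact: hd.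
  rewrite !fctE /= /GRing.scale /=.
  rewrite [leLHS](_ : _ = (k * (1 - (t * r) ^+ 2) - r * (1 - N t ^+ 2)) / (1 - t * r * N t) ^+ 2); last first.
    by field; rewrite gt_eqF.
  by apply: mulr_le0_ge0; [rewrite subr_le0; exact: key|rewrite invr_ge0 sqr_ge0].
have g1 : g 1 <= g 0.
  apply: (@ler0_derive1_nincr _ g 0 1) => //.
  - move=> t; rewrite in_itv /= => /andP[t0 t1].
    by have [|d [] //] := dg t; rewrite t0 ltW.
  - move=> t; rewrite in_itv /= => /andP[t0 t1]; rewrite derive1E.
    by have [|d [_ ->] //] := dg t; rewrite t0 ltW.
  - apply: continuous_in_subspaceT => t; rewrite inE /= in_itv /= => ht.
    have uc : u s @[s --> t] --> u t.
      have [d _] := du t ht; have /derivable1_diffP dd := d.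
      exact: (differentiable_continuous dd).
    have cN : N s @[s --> t] --> N t by exact: (cvg_comp _ _ uc (@sqrt_continuous R (u t))).
    have cr : (fun s : R => s * r) s @[s --> t] --> t * r by apply: cvgMl; exact: cvg_id.
    apply: cvgM; first exact: cvgB.
    by apply: cvgV; [rewrite gt_eqF ?den|apply: cvgB; [exact: cvg_cst|exact: cvgM]].
have N00 : N 0 = 0 by rewrite /N /u /c scale0r f00 dot0l sqrtr0.
have I1 : 0 <= (1 : R) <= 1 by rewrite ler01 lexx.
have /andP[n0 _] := N1 1 I1; have := den 1 I1.
move: g1; rewrite /g N00 !mul0r subr0 mul0r mul1r => g1 d1.
have Nr : N 1 <= r by move: g1; rewrite pmulr_lle0 ?invr_gt0 // subr_le0.
have : N 1 ^+ 2 <= r ^+ 2 by rewrite lerXn2r // nnegrE ltW.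
rewrite r2 /N sqr_sqrtr ?dot_ge0 //.
by rewrite /u /c scale1r.
Qed.
End Isometries.

(** * Every isometry is induced by a matrix *)

Section IsometryMatrix.
Variables (R : realType) (n : nat).
Local Notation V := (realCn R n).
Local Notation W := (realCn R n.+1).
Implicit Types (z w v x y : V) (f : V -> V).

Definition hsq (X Y : W) := B X Y ^+ 2 + B X (Jmul Y) ^+ 2.
(* cosh^2 of half the distance from [x] to [y] *)
Definition Dch x y : R := hsq (lift x) (lift y) / ((1 - dot x x) * (1 - dot y y)).

Lemma hsq_cs a b c d (X Y : W) :
  hsq (cs a b X) (cs c d Y) = (a ^+ 2 + b ^+ 2) * (c ^+ 2 + d ^+ 2) * hsq X Y.
Proof. by rewrite /hsq /cs !JmulX !BX !BJJ !BJl; ring. Qed.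

Lemma hsq_mulg g (X Y : W) : Ghat g -> hsq (X *m g) (Y *m g) = hsq X Y.
Proof.
move=> hg; have [s s1 [h1 h2]] := hg.
by rewrite /hsq h2 BZr !h1 exprMn s1 mul1r.
Qed.

Lemma hsq_lift z w : hsq (lift z) (lift w) = (1 - dot z w) ^+ 2 + dot z (Jmul w) ^+ 2.
Proof.
rewrite /hsq B_lift -[dot z w - 1]opprB sqrrN; congr (_ + _ ^+ 2).
by rewrite {1}/lift BDl B_iota_l piJ pi_lift /B pi_e0 c0e c1e dot0l c0J c1_lift; ring.
Qed.

Lemma Dch_act g x y : Ghat g -> CH x -> CH y -> Dch (act g x) (act g y) = Dch x y.
Proof.
move=> hg hx hy.
have key z : CH z -> let X := lift z *m g in
    X = cs (c0 X) (c1 X) (lift (act g z)) /\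
    1 - dot z z = q2 X * (1 - dot (act g z) (act g z)).
  move=> hz X; have q0 := lt0r_neq0 (q2_lift hg hz).
  rewrite act_in //; split; first by rewrite prK.
  by have := B_pr q0; rewrite B_mulg // B_lift -/X => e; lra.
have [eX nX] := key x hx; have [eY nY] := key y hy.
have q0 := lt0r_neq0 (q2_lift hg hx); have q1 := lt0r_neq0 (q2_lift hg hy).
rewrite /Dch nX nY -(hsq_mulg (lift x) (lift y) hg) eX eY hsq_cs -!/(q2 _).
have /CHE a1 := act_CH hg hx; have /CHE a2 := act_CH hg hy.
have b1 : 1 - dot (act g x) (act g x) != 0 by rewrite gt_eqF // subr_gt0.
have b2 : 1 - dot (act g y) (act g y) != 0 by rewrite gt_eqF // subr_gt0.
move: q0 q1 b1 b2; rewrite -eX -eY.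
move: (q2 _) (q2 _) (1 - _) (1 - _) (hsq _ _) => a b c d e a0 b0 c0 d0.
by field; rewrite a0 b0 c0 d0.
Qed.

Lemma Dch0 z : Dch 0 z = (1 - dot z z)^-1.
Proof. by rewrite /Dch hsq_lift !dot0l !subr0 expr1n expr0n addr0 !mul1r. Qed.

(** Transitivity moves [x] and [f x] to 0, where [wiso_contract] applies. *)
Lemma wiso_Dch f x y : wiso f -> CH x -> CH y -> Dch (f x) (f y) <= Dch x y.
Proof.
move=> hf hx hy; have [f1 _ _ _] := hf.
have [g /uni_Ghat hg gx] := transitive_CH hx.
have [h /uni_Ghat hh hfx] := transitive_CH (f1 x hx).
pose F z := act (invmx h) (f (act g z)).
have hF : wiso F.
  exact: (wiso_comp (wiso_comp (wiso_act hg) hf) (wiso_act (GhatV hh))).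
have F0 : F 0 = 0 by rewrite /F gx -hfx actK.
pose z := act (invmx g) y.
have hz : CH z by apply: act_CH => //; exact: GhatV.
have ey : y = act g z by rewrite actKV.
have hFz : CH (F z) by have [F1 _ _ _] := hF; exact: F1.
have efy : f y = act h (F z) by rewrite /F -ey actKV.
rewrite efy -hfx [in leRHS]ey -gx !Dch_act //; try exact: (CH0 R n).
rewrite !Dch0 lef_pV2 ?posrE ?subr_gt0; try exact/CHE.
by rewrite lerD2l lerN2; exact: wiso_contract.
Qed.

Lemma isometry_Dch f x y : CH_isometry f -> CH x -> CH y -> Dch (f x) (f y) = Dch x y.
Proof.
move=> fi hx hy; have wf := wiso_CH fi; have [g [wg gf fg]] := wiso_inv fi.
apply/eqP; rewrite eq_le wiso_Dch //=.
have [f1 _ _ _] := wf.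
by rewrite -{1}(gf x hx) -{1}(gf y hy); apply: wiso_Dch => //; exact: f1.
Qed.

Section FixZero.
Variables (f : V -> V).
Hypothesis f00 : f 0 = 0.
Hypothesis fD : forall x y, CH x -> CH y -> Dch (f x) (f y) = Dch x y.

Let f_norm z : CH z -> dot (f z) (f z) = dot z z.
Proof.
move=> hz; have := fD (CH0 R n) hz; rewrite f00 !Dch0 => /invr_inj.
by move=> e; lra.
Qed.

Let f_hsq z w : CH z -> CH w ->
  (1 - dot (f z) (f w)) ^+ 2 + dot (f z) (Jmul (f w)) ^+ 2 = (1 - dot z w) ^+ 2 + dot z (Jmul w) ^+ 2.
Proof.
move=> hz hw; have := fD hz hw; rewrite /Dch !hsq_lift !f_norm //.
apply: divIf; rewrite mulf_neq0 // gt_eqF // subr_gt0; exact/CHE.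
Qed.

Let CH_scale (t : R) z : 0 <= t <= 1 -> CH z -> CH (t *: z).
Proof.
move=> /andP[t0 t1] /CHE hz; apply/CHE; rewrite dotZl dotZr mulrA.
apply: le_lt_trans hz; rewrite ler_piMl ?dot_ge0 //.
by rewrite -[leRHS]mulr1 ler_pM.
Qed.

(** For the Hermitian product of C^n, the modulus of 1 - <f (t z), f z> equals 1 - t |z|^2, while
    the real part of the product is at most t |z|^2 by the Cauchy-Schwarz inequality; hence there is
    equality. *)
Let f_scale (t : R) z : 0 <= t <= 1 -> CH z -> f (t *: z) = t *: f z.
Proof.
move=> ht hz; have htz := CH_scale ht hz; case/andP: ht => t0 t1.
have e := f_hsq htz hz; have e1 := f_norm htz; have e2 := f_norm hz.
rewrite dotZl dotZr mulrA in e1; rewrite dotZl (dotZl t z) dotxJx mulr0 in e.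
have hz1 := hz; move/CHE in hz1.
have z0 := dot_ge0 z.
have cs : dot (f (t *: z)) (f z) <= t * dot z z.
  rewrite leNgt; apply/negP => lt; have := dot_CS (f (t *: z)) (f z).
  rewrite e1 e2; apply/negP; rewrite -ltNge.
  rewrite [X in X < _](_ : _ = (t * dot z z) ^+ 2); last by ring.
  have p0 : 0 <= t * dot z z by rewrite mulr_ge0.
  by rewrite ltrXn2r // ?nnegrE ?p0 // ltW // (le_lt_trans p0 lt).
have tz1 : t * dot z z < 1 by apply: le_lt_trans hz1; rewrite ler_piMl.
have sq0 := sqr_ge0 (dot (f (t *: z)) (Jmul (f z))).
have pq : dot (f (t *: z)) (f z) = t * dot z z.
  apply/eqP; rewrite eq_le cs /= leNgt; apply/negP => lt.
  move: e sq0; move: (dot _ (Jmul (f z)) ^+ 2) (dot (f (t *: z)) (f z)) lt => s p lt e s0.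
  by move: e s0 lt tz1; nra.
apply/eqP; rewrite -subr_eq0 -dot_eq0 !dotX (dotC (f z)) pq e1 e2.
by apply/eqP; ring.
Qed.

(** The identity [f_hsq] for [z] and for z / 2 separates its linear part from its quadratic part. *)
Let f_dot z w : CH z -> CH w -> dot (f z) (f w) = dot z w /\
  dot (f z) (Jmul (f w)) ^+ 2 = dot z (Jmul w) ^+ 2.
Proof.
move=> hz hw; have h2 : 0 <= (2^-1 : R) <= 1 by apply/andP; split; lra.
have e1 := f_hsq hz hw; have e2 := f_hsq (CH_scale h2 hz) hw.
rewrite f_scale // !dotZl in e2.
move: e1 e2; rewrite !sqrrB !exprMn.
move: (dot (f z) (Jmul (f w)) ^+ 2) (dot z (Jmul w) ^+ 2) (dot (f z) (f w)) (dot z w) => s s' p p'.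
by move=> e1 e2; have ep : p = p' by [lra]; rewrite ep in e1 *; split; lra.
Qed.

(** The rows of [A] come from the images of the basis vectors, halved to lie in the ball. Of the
    imaginary part of the Hermitian product only the square is known to be preserved, so J
    conjugated by [A] sends each w to J w or to - J w; additivity makes the sign independent of
    w. *)
Lemma fix0_linear : exists (A : 'M[R]_(n + n)) (s : R), [/\ A *m A^T = 1%:M,
  s ^+ 2 = 1, forall x, Jmul (x *m A) = s *: (Jmul x *m A) & forall z, CH z -> f z = z *m A].
Proof.
pose ei (i : 'I_(n + n)) : V := 2^-1 *: delta_mx 0 i.
have dd (i j : 'I_(n + n)) : dot (delta_mx 0 i : V) (delta_mx 0 j) = (i == j)%:R.
  by rewrite /dot trmx_delta mul_delta_mx_cond; case: eqP => _; rewrite ?mulr1n ?mulr0n ?mxE ?eqxx.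
have dz (z : V) i : dot z (delta_mx 0 i) = z 0 i.
  by rewrite /dot trmx_delta -colE mxE.
have hei i : CH (ei i) by apply/CHE; rewrite dotZl dotZr dd eqxx /=; lra.
pose A : 'M[R]_(n + n) := \matrix_(i, j) (2 * f (ei i) 0 j).
have rA i : row i A = 2 *: f (ei i) by apply/rowP => j; rewrite !mxE.
have AE (z : V) : z *m A^T = \row_i dot z (row i A).
  apply/rowP => i; rewrite !mxE dotE; apply: eq_bigr => j _.
  by rewrite !mxE.
have AA : A *m A^T = 1%:M.
  apply/row_matrixP => i; rewrite row_mul AE; apply/rowP => j; rewrite !mxE !rA.
  rewrite dotZl dotZr (f_dot (hei i) (hei j)).1 dotZl dotZr dd.
  by move: ((i == j)%:R : R) => d; field.
have fA z : CH z -> f z = z *m A.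
  move=> hz; rewrite -[LHS]mulmx1 -(mulmx1C AA) mulmxA AE; congr (_ *m _).
  by apply/rowP => i; rewrite mxE rA dotZr (f_dot hz (hei i)).1 dotZr dz; field.
have fJ z w : dot (z *m A) (Jmul (w *m A)) ^+ 2 = dot z (Jmul w) ^+ 2.
  have sc (x : V) : exists2 t : R, t != 0 & CH (t *: x).
    exists (dot x x + 1)^-1; first by rewrite invr_eq0 gt_eqF // ltr_wpDl // dot_ge0.
    apply/CHE; rewrite dotZl dotZr; have := dot_ge0 x; move: (dot x x) => d d0.
    have d1 : 0 < d + 1 by lra.
    by rewrite mulrA -invfM mulrC ltr_pdivrMr ?mulr_gt0 // mul1r; nra.
  have [t t0 hz] := sc z; have [u u0 hw] := sc w.
  have := (f_dot hz hw).2; rewrite !fA // -!scalemxAl !JmulZ !dotZl !dotZr !exprMn.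
  by move/(mulfI (expf_neq0 2 t0))/(mulfI (expf_neq0 2 u0)).
pose K w : V := Jmul (w *m A) *m A^T.
have Kdot z w : dot z (K w) = dot (z *m A) (Jmul (w *m A)).
  by rewrite /K /dot trmx_mul trmxK mulmxA.
have Kpm w : K w = Jmul w \/ K w = - Jmul w.
  have h z : dot z (K w) ^+ 2 = dot z (Jmul w) ^+ 2 by rewrite Kdot fJ.
  have h1 := h (K w); have h2 := h (Jmul w); rewrite (dotC (Jmul w) (K w)) in h2.
  have k0 := dot_ge0 (K w); have j0 := dot_ge0 (Jmul w).
  have e : dot (K w) (K w) = dot (Jmul w) (Jmul w).
    by apply: (pexpIrn (n := 2)) => //; rewrite h1 h2.
  have : (dot (K w) (Jmul w) - dot (K w) (K w)) * (dot (K w) (Jmul w) + dot (K w) (K w)) = 0.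
    by rewrite -subr_sqr h1 subrr.
  move/eqP; rewrite mulf_eq0 => /orP[] /eqP e'; [left|right].
    by apply: dot_CS_eq => //; lra.
  by apply: dot_CS_eq; rewrite ?dotNr ?dotNl ?opprK //; lra.
have KD w w' : K (w + w') = K w + K w' by rewrite /K mulmxDl JmulD mulmxDl.
have [s s1 hs] : exists2 s : R, s ^+ 2 = 1 & forall w, K w = s *: Jmul w.
  have [h|h] := pselect (forall w, K w = Jmul w).
    by exists 1 => [|w]; rewrite ?expr1n ?scale1r.
  have [h'|h'] := pselect (forall w, K w = - Jmul w).
    by exists (-1) => [|w]; rewrite ?sqrrN ?expr1n ?scaleN1r.
  exfalso; move/existsNP: h => [w1 h1]; move/existsNP: h' => [w2 h2].
  case: (Kpm w1) => // e1; case: (Kpm w2) => // e2.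
  case: (Kpm (w1 + w2)); rewrite KD e1 e2 JmulD => e3.
    apply: h1; rewrite e1; move: e3 => /addIr //.
  by apply: h2; rewrite e2; move: e3; rewrite opprD => /addrI.
exists A, s; split=> // x.
by have := hs x; rewrite /K => /(congr1 (mulmx^~ A)); rewrite -mulmxA (mulmx1C AA) mulmx1 scalemxAl.
Qed.
End FixZero.

(** The extension of [A] to C^(1+n) that is the identity or, for antilinear [A], the conjugation on
    the first coordinate. *)
Definition extmx (A : 'M[R]_(n + n)) (s : R) : 'M[R]_(n.+1 + n.+1) :=
  (e0 R n)^T *m e0 R n + s *: ((f0 R n)^T *m f0 R n) + (iotamx R n)^T *m A *m iotamx R n.

Lemma extmxE (A : 'M[R]_(n + n)) (s : R) (x : W) :
  x *m extmx A s = c0 x *: e0 R n + (s * c1 x) *: f0 R n + iota_ (pi_ x *m A).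
Proof.
have h (u w : W) : x *m (u^T *m w) = dot x u *: w.
  by rewrite mulmxA -mul_scalar_mx {1}[x *m u^T]mx11_scalar.
by rewrite /extmx !mulmxDr -scalemxAr !h scalerA /iota_ /pi_ !mulmxA.
Qed.

Lemma extmx_uni (A : 'M[R]_(n + n)) (s : R) : A *m A^T = 1%:M -> s ^+ 2 = 1 ->
  (forall x, Jmul (x *m A) = s *: (Jmul x *m A)) -> uni s (extmx A s).
Proof.
move=> AA s1 hJ; have dA (x y : V) : dot (x *m A) (y *m A) = dot x y.
  by rewrite /dot trmx_mul mulmxA -(mulmxA x) AA mulmx1.
split=> [x y|x]; rewrite !extmxE.
  rewrite /B !piX !cX !scaler0 !add0r dA !mulr0 !mulr1 !addr0 !add0r.
  by rewrite mulrACA -expr2 s1 mul1r.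
apply: Wext.
- by rewrite !cX; ring.
- by rewrite !cX; ring: s1.
- by rewrite !piX !scaler0 !add0r hJ.
Qed.

Lemma isometry_mx f : CH_isometry f -> exists2 g, Ghat g & f = act g.
Proof.
move=> fi; have [fout _ _ _ _] := fi; have [f1 _ _ _] := wiso_CH fi.
have [h /uni_Ghat hh hf0] := transitive_CH (f1 0 (CH0 R n)).
have hh' := GhatV hh.
pose F z := act (invmx h) (f z).
have F0 : F 0 = 0 by rewrite /F -hf0 actK.
have FD x y : CH x -> CH y -> Dch (F x) (F y) = Dch x y.
  by move=> hx hy; rewrite Dch_act //; [exact: isometry_Dch|exact: f1|exact: f1].
have [A [s [AA s1 AJ AF]]] := fix0_linear F0 FD.
have hE : Ghat (extmx A s) by exists s => //; exact: extmx_uni.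
exists (extmx A s *m h); first exact: GhatM.
apply/funext => z; have [hz|hz] := pselect (CH z); last by rewrite act_out ?fout.
rewrite actM // -[LHS](actKV _ hh) -/(F z); congr (act h _).
rewrite act_in // extmxE c0_lift c1_lift pi_lift mulr0 scale0r scale1r addr0.
by rewrite AF // -[LHS]pr_lift.
Qed.
End IsometryMatrix.

(** * Properness of the action and limits of isometries *)

Section GhatSeq.
Variables (R : realType) (n : nat).
Local Notation V := (realCn R n).
Local Notation W := (realCn R n.+1).
Local Notation M := 'M[R]_(n.+1 + n.+1).
Implicit Types (z w v : V) (X Y : W) (g h : M).

Lemma cvg_iota (z : nat -> V) (z' : V) : z @ \oo --> z' -> (fun i => iota_ (z i)) @ \oo --> iota_ z'.
Proof. by move=> h; apply: cvg_mulmx => //; exact: cvg_cst. Qed.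
Lemma cvg_pi (X : nat -> W) (X' : W) : X @ \oo --> X' -> (fun i => pi_ (X i)) @ \oo --> pi_ X'.
Proof. by move=> h; apply: cvg_mulmx => //; exact: cvg_cst. Qed.
Lemma cvg_c0 (X : nat -> W) (X' : W) : X @ \oo --> X' -> (fun i => c0 (X i)) @ \oo --> c0 X'.
Proof. by move=> h; apply: cvg_dot => //; exact: cvg_cst. Qed.
Lemma cvg_c1 (X : nat -> W) (X' : W) : X @ \oo --> X' -> (fun i => c1 (X i)) @ \oo --> c1 X'.
Proof. by move=> h; apply: cvg_dot => //; exact: cvg_cst. Qed.
Lemma cvg_J (m : nat) (x : nat -> realCn R m) (x' : realCn R m) :
  x @ \oo --> x' -> (fun i => Jmul (x i)) @ \oo --> Jmul x'.
Proof.
move=> h; rewrite JmulE (_ : (fun i => _) = (fun i => x i *m @Jmx R m)); last first.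
  by apply/funext => i; rewrite JmulE.
by apply: cvg_mulmx => //; exact: cvg_cst.
Qed.
Lemma cvg_B (X Y : nat -> W) (X' Y' : W) : X @ \oo --> X' -> Y @ \oo --> Y' ->
  (fun i => B (X i) (Y i)) @ \oo --> B X' Y'.
Proof.
move=> hX hY; apply: cvgB; [apply: cvgB|].
- by apply: cvg_dot; exact: cvg_pi.
- by apply: cvgM; exact: cvg_c0.
- by apply: cvgM; exact: cvg_c1.
Qed.
Lemma cvg_scale (m k : nat) (a : nat -> R) (x : nat -> 'M[R]_(m, k)) (a' : R) (x' : 'M[R]_(m, k)) :
  a @ \oo --> a' -> x @ \oo --> x' -> (fun i => a i *: x i) @ \oo --> a' *: x'.
Proof. by move=> ha hx; apply: cvgZ. Qed.

Lemma cvg_pr (X : nat -> W) X' : X @ \oo --> X' -> q2 X' != 0 ->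
  (fun i => pr (X i)) @ \oo --> pr X'.
Proof.
move=> hX q0; have h0 := cvg_c0 hX; have h1 := cvg_c1 hX; have hp := cvg_pi hX.
have hq : (fun i => q2 (X i)) @ \oo --> q2 X'.
  by apply: cvgD; rewrite /= ?expr2; under eq_fun do rewrite expr2; apply: cvgM.
apply: cvg_scale; first exact: cvgV.
apply: cvgB; first exact: cvg_scale.
by apply: cvg_scale => //; exact: cvg_J.
Qed.

Lemma act_cvg (g : nat -> M) (g' : M) (z : nat -> V) (z' : V) : Ghat g' -> CH z' ->
  (forall i, CH (z i)) -> g @ \oo --> g' -> z @ \oo --> z' ->
  (fun i => act (g i) (z i)) @ \oo --> act g' z'.
Proof.
move=> hg hz' hz cg cz; rewrite act_in //; under eq_fun do rewrite act_in //.
apply: cvg_pr; last by rewrite lt0r_neq0 // q2_lift.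
apply: cvg_mulmx => //; apply: cvgD; first exact: cvg_cst.
exact: cvg_iota.
Qed.

Lemma hsq_CS X Y : hsq X Y <= dot X X * dot Y Y.
Proof.
pose Y' := iota_ (pi_ Y) - c0 Y *: e0 R n - c1 Y *: f0 R n.
have e1 : c0 Y' = - c0 Y by rewrite /Y' !cX; ring.
have e2 : c1 Y' = - c1 Y by rewrite /Y' !cX; ring.
have e3 : pi_ Y' = pi_ Y by rewrite /Y' !piX !scaler0 !subr0.
clearbody Y'.
have h : hsq X Y = dot X Y' ^+ 2 + dot X (Jmul Y') ^+ 2.
  by rewrite /hsq /B !dotW !piJ !cX e1 e2 e3; ring.
have -> : dot Y Y = dot Y' Y'.
  by rewrite !dotW e1 e2 e3; ring.
by rewrite h dot_CCS.
Qed.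

Lemma hsq_sym X Y : hsq X Y = hsq Y X.
Proof. by rewrite /hsq BC (BJs Y X) sqrrN. Qed.

Lemma q2_hsq X : q2 X = hsq X (e0 R n).
Proof. by rewrite /hsq /B piJ pi_e0 Jmul0 !dot0r !cX /q2; ring. Qed.

Lemma dot_q2 X : dot X X = B X X + 2 * q2 X.
Proof. by rewrite dotW /B /q2; ring. Qed.

Lemma e0_inv g : Ghat g -> dot (e0 R n *m invmx g) (e0 R n *m invmx g) = dot (e0 R n *m g) (e0 R n *m g).
Proof.
move=> hg; rewrite !dot_q2 !q2_hsq !B_mulg //; last exact: GhatV.
by rewrite -(hsq_mulg _ _ hg) mulmxKV ?Ghat_unit // hsq_sym.
Qed.

(** The Euclidean norm differs from h by twice |(X g)_0|^2, and (X g)_0 is the h-product of X with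
    e0 g^-1, a vector with the norm of e0 g. *)
Lemma Ghat_bound g X : Ghat g ->
  dot (X *m g) (X *m g) <= dot X X * (1 + 2 * dot (e0 R n *m g) (e0 R n *m g)).
Proof.
move=> hg; rewrite dot_q2 q2_hsq B_mulg // -(hsq_mulg _ _ (GhatV hg)) mulmxK ?Ghat_unit //.
have h := hsq_CS X (e0 R n *m invmx g); rewrite e0_inv // in h.
have : B X X <= dot X X by rewrite dot_q2 lerDl mulr_ge0 // q2_ge0.
move: h; move: (hsq _ _) (dot X X) (B X X) (dot _ _) => a b c d; lra.
Qed.

Lemma dot_e0g g : Ghat g -> dot (e0 R n *m g) (e0 R n *m g) = 2 / (1 - dot (act g 0) (act g 0)) - 1.
Proof.
move=> hg; have q0 := lt0r_neq0 (q2_lift hg (CH0 R n)); rewrite lift0 in q0.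
have h := B_pr q0; rewrite B_mulg // Bee in h.
have /CHE h0 := act_CH hg (CH0 R n).
rewrite dot_q2 B_mulg // Bee; move: h h0; rewrite act_in ?lift0; last exact: CH0.
move: (q2 _) (dot (pr _) _) => q d h h0.
have d0 : 1 - d != 0 by rewrite gt_eqF // subr_gt0.
by have -> : q = (1 - d)^-1; [apply: (mulIf d0); rewrite mulVf //; lra|field].
Qed.

(** Properness in matrix form: bounding the image of 0 away from the boundary bounds the matrix. *)
Lemma Ghat_norm g (r : R) : Ghat g -> r < 1 -> dot (act g 0) (act g 0) <= r ->
  `|g| <= Num.sqrt (4 / (1 - r)).
Proof.
move=> hg r1 hr; apply: mx_norm_le => [|i j]; first exact: sqrtr_ge0.
have r0 : 0 < 1 - r by lra.
have := Ghat_bound (delta_mx 0 i) hg; rewrite -rowE dot_e0g // => h.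
have e : dot (delta_mx 0 i : W) (delta_mx 0 i) = 1.
  by rewrite /dot trmx_delta mul_delta_mx !mxE !eqxx.
rewrite e mul1r in h.
have h2 : `|g i j| ^+ 2 <= 4 / (1 - r).
  have := coord_norm_le (row i g) 0 j; rewrite mxE => h3.
  have h4 : `|g i j| ^+ 2 <= `|row i g| ^+ 2 by rewrite lerXn2r // nnegrE.
  apply: le_trans h4 _; apply: le_trans (sqr_norm_le _) _; apply: le_trans h _.
  have : (1 - dot (act g 0) (act g 0))^-1 <= (1 - r)^-1.
    by rewrite lef_pV2 ?posrE //; lra.
  by move=> h5; lra.
rewrite -[leLHS]ger0_norm // -sqrtr_sqr ler_sqrt //.
by rewrite divr_ge0 // ltW.
Qed.

(** The signs of the [g i] may vary; a subsequence of constant sign gives that of the limit. *)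
Lemma Ghat_closed (g : nat -> M) (g' : M) : (forall i, Ghat (g i)) -> g @ \oo --> g' -> Ghat g'.
Proof.
move=> hg cg.
have hB X Y : B (X *m g') (Y *m g') = B X Y.
  have c1 : (fun i => B (X *m g i) (Y *m g i)) @ \oo --> B (X *m g') (Y *m g').
    by apply: cvg_B; apply: cvg_mulmx => //; exact: cvg_cst.
  have c2 : (fun i => B (X *m g i) (Y *m g i)) @ \oo --> B X Y.
    by under eq_fun do rewrite B_mulg //; exact: cvg_cst.
  by rewrite -(cvg_lim _ c1) // (cvg_lim _ c2).
have sub s (phi : nat -> nat) : s ^+ 2 = 1 -> (forall i, phi i < phi i.+1)%N ->
    (forall i, uni s (g (phi i))) -> Ghat g'.
  move=> s1 inc hs; exists s => //; split=> // X.
  have cs := cvg_subseq inc cg.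
  have c1 : (fun i => Jmul (X *m g (phi i))) @ \oo --> Jmul (X *m g').
    by apply: cvg_J; apply: cvg_mulmx => //; exact: cvg_cst.
  have c2 : (fun i => Jmul (X *m g (phi i))) @ \oo --> s *: (Jmul X *m g').
    under eq_fun do rewrite (hs _).2; apply: cvg_scale; first exact: cvg_cst.
    by apply: cvg_mulmx => //; exact: cvg_cst.
  by rewrite -(cvg_lim _ c1) // (cvg_lim _ c2).
have [h|h] := pselect (forall N, exists i, (N <= i)%N /\ uni 1 (g i)).
  have [phi [inc hphi]] := subseq_cauchy_choice (P := fun k i => uni 1 (g i)) (fun k N => h N).
  by apply: (sub 1 phi) => //; rewrite expr1n.
move/existsNP: h => [N hN].
apply: (sub (-1) (fun i => N + i)%N); rewrite ?sqrrN ?expr1n //.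
  by move=> i; rewrite addnS.
move=> i; have [s s1 us] := hg (N + i)%N.
have : (s - 1) * (s + 1) = 0 by rewrite -subr_sqr s1 expr1n subrr.
move/eqP; rewrite mulf_eq0 subr_eq0 addr_eq0 => /orP[/eqP e|/eqP <- //].
by exfalso; apply: hN; exists (N + i)%N; rewrite leq_addr -e.
Qed.

Lemma not_near_subseq (P : nat -> Prop) : ~ (\forall i \near \oo, P i) ->
  forall N, exists i, (N <= i)%N /\ ~ P i.
Proof.
move=> h N; apply: contrapT => hN; apply: h; exists N => // i /= Ni.
by apply: contrapT => Pi; apply: hN; exists i.
Qed.

Lemma compact_subseq (K : set V) (y : nat -> V) : compact K -> (forall i, K (y i)) ->
  exists (phi : nat -> nat) (l : V), [/\ (forall i, phi i < phi i.+1)%N, K l & (y \o phi) @ \oo --> l].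
Proof.
move=> cK hy; have [M0 [_ hM]] := compact_bounded cK.
have [i|phi [l [inc hl]]] := @Bolzano_rV _ _ y (M0 + 1).
  by apply: (hM (M0 + 1)) => //; rewrite ltrDl.
exists phi, l; split=> //.
have clK : closed K by apply: compact_closed => //; exact: norm_hausdorff.
apply: clK => B /hl; rewrite nbhs_filterE => -[N _ hN].
by exists (y (phi N)); split; [exact: hy|exact: (hN N (leqnn N))].
Qed.

(** This links the topology used in [isometric_action] to that of matrices: the matrices of a closed
    group form a closed set. *)
Lemma act_uniform (g : nat -> M) (g' : M) (K : set V) : (forall i, Ghat (g i)) ->
  g @ \oo --> g' -> compact K -> K `<=` CH -> {uniform K, (fun i => act (g i)) @ \oo --> act g'}.
Proof.
move=> hg cg cK KCH; have hg' := Ghat_closed hg cg.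
move=> Q /= /uniform_nbhs [E [entE EsubQ]]; move: entE; rewrite -entourage_ballE => -[e /= e0 eE].
suff h : \forall i \near \oo, forall y, K y -> ball (act g' y) e (act (g i) y).
  by apply: filterS h => i hi; apply: EsubQ => y Ky; apply: eE; exact: hi.
apply: contrapT => hn.
have [phi [inc hphi]] := subseq_cauchy_choice
  (P := fun k i => ~ forall y, K y -> ball (act g' y) e (act (g i) y)) (fun k N => not_near_subseq hn N).
have hy k : exists y, K y /\ ~ ball (act g' y) e (act (g (phi k)) y).
  by have /existsNP[y /not_implyP[Ky hy]] := hphi k; exists y.
pose y k := sval (cid (hy k)).
have yP k : K (y k) /\ ~ ball (act g' (y k)) e (act (g (phi k)) (y k)) by exact: (svalP (cid (hy k))).
have [psi [l [inc2 Kl hl]]] := compact_subseq cK (fun k => (yP k).1).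
have c1 : (fun i => act (g (phi (psi i))) (y (psi i))) @ \oo --> act g' l.
  apply: act_cvg => //; [exact: KCH|by move=> i; apply: KCH; exact: (yP _).1|].
  by apply: (cvg_subseq inc2 (cvg_subseq inc cg)).
have c2 : (fun i => act g' (y (psi i))) @ \oo --> act g' l.
  by apply: act_cvg => //; [exact: KCH|by move=> i; apply: KCH; exact: (yP _).1|exact: cvg_cst].
have c3 : (fun i => act g' (y (psi i)) - act (g (phi (psi i))) (y (psi i))) @ \oo --> (0 : V).
  by rewrite -(subrr (act g' l)); apply: cvgB.
have /cvgrPdist_lt/(_ _ e0) [N _ hN] := c3.
have := hN N (leqnn N); rewrite /= sub0r normrN => h.
by apply: (yP (psi N)).2; rewrite -ball_normE.
Qed.

Lemma cvg_uniform_pt (f : nat -> V -> V) (f' : V -> V) (z : V) :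
  {uniform [set z], f @ \oo --> f'} -> (fun i => f i z) @ \oo --> f' z.
Proof.
move=> h; apply/cvgrPdist_lt => e e0.
pose E := [set xy : V * V | ball xy.1 e xy.2].
have entE : entourage E by rewrite -entourage_ballE; exists e.
have /= := h [set k | forall y, [set z] y -> E (f' y, k y)].
have h2 : nbhs (f' : {uniform` [set z] -> V}) [set k | forall y, [set z] y -> E (f' y, k y)].
  by apply/uniform_nbhs; exists E; split.
move=> /(_ h2); apply: filterS => i /= hi.
by have := hi z erefl; rewrite /E /= -ball_normE.
Qed.
End GhatSeq.

(** * The Lie algebra of a closed group of isometries *)

Section MinAttained.
Variables (R : realType) (k l : nat).
Lemma min_attained (P : 'M[R]_(k, l) -> Prop) (phi : 'M[R]_(k, l) -> R) x0 (C : R) :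
  P x0 -> (forall x, P x -> 0 <= phi x) ->
  (forall x, P x -> phi x <= phi x0 -> `|x| <= C) ->
  (forall (u : nat -> 'M[R]_(k, l)) x, (forall i, P (u i)) -> u @ \oo --> x ->
     P x /\ (fun i => phi (u i)) @ \oo --> phi x) ->
  exists2 x, P x & forall y, P y -> phi x <= phi y.
Proof.
move=> P0 phi0 bdd cl.
pose S := [set phi x | x in [set x | P x /\ phi x <= phi x0]].
have lbS : lbound S 0 by move=> _ [x [Px _] <-]; exact: phi0.
have infS : has_inf S by split; [exists (phi x0), x0|exists 0].
have hx i : exists x, [/\ P x, phi x <= phi x0 & phi x < inf S + i.+1%:R^-1].
  have [|_ [x [Px xx0] <-] lt] := @inf_adherent _ S i.+1%:R^-1 _ infS; first by rewrite invr_gt0.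
  by exists x.
pose u i := sval (cid (hx i)).
have uP i : [/\ P (u i), phi (u i) <= phi x0 & phi (u i) < inf S + i.+1%:R^-1] by exact: (svalP (cid (hx i))).
have [i|f [x [inc cx]]] := @Bolzano_mx _ _ _ u C; first by have [h1 h2 _] := uP i; exact: bdd.
have [Px cphi] := cl (u \o f) x (fun i => let: And3 h _ _ := uP (f i) in h) cx.
have xS : phi x <= inf S.
  have ch : (fun i => inf S + i.+1%:R^-1) @ \oo --> inf S.
    by rewrite -[X in _ --> X]addr0; apply: cvgD; [exact: cvg_cst|exact: cvg_harmonic].
  apply: (ler_cvg_to cphi (cvg_subseq inc ch)).
  by apply: nearW => i; have [_ _ h] := uP (f i); exact: ltW.
exists x => // y Py; have [h|h] := leP (phi y) (phi x0).
  by apply: le_trans xS _; apply: ge_inf; [exists 0|exists y].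
apply: le_trans xS _; apply: le_trans (ltW h).
by apply: ge_inf; [exists 0|exists x0; split].
Qed.
End MinAttained.

Section LieAlgebra.
Variables (R : realType) (n : nat).
Local Notation V := (realCn R n).
Local Notation W := (realCn R n.+1).
Local Notation MM := 'M[R]_(n.+1 + n.+1).

(** The second clause puts all matrices that act trivially, such as the unit scalars, into [H],
    which is thus a full preimage of a group of isometries. *)
Definition closed_subgroup (H : set MM) :=
  [/\ forall g, H g -> Ghat g,
      forall g, Ghat g -> (forall z, act g z = z) -> H g,
      forall g h, H g -> H h -> H (g *m h),
      forall g, H g -> H (invmx g) &
      forall (u : nat -> MM) g, (forall i, H (u i)) -> u @ \oo --> g -> H g].

Variable H : set MM.
Hypothesis HH : closed_subgroup H.

Lemma HG g : H g -> Ghat g. Proof. by have [h _ _ _ _] := HH; exact: h. Qed.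
Lemma HM g h : H g -> H h -> H (g *m h). Proof. by have [_ _ k _ _] := HH; exact: k. Qed.
Lemma HV g : H g -> H (invmx g). Proof. by have [_ _ _ k _] := HH; exact: k. Qed.
Lemma Hcl (u : nat -> MM) g : (forall i, H (u i)) -> u @ \oo --> g -> H g.
Proof. by have [_ _ _ _ k] := HH; exact: k. Qed.
Lemma Htriv g : Ghat g -> (forall z, act g z = z) -> H g.
Proof. by have [_ k _ _ _] := HH; exact: k. Qed.
Lemma H1 : H 1%:M.
Proof. by apply: Htriv; [exact: Ghat1|move=> z; exact: act1]. Qed.
Lemma Hmpow g k : H g -> H (mpow g k).
Proof. by move=> hg; elim: k => [|k IH]; [exact: H1|exact: HM]. Qed.

Definition lie : set MM := [set X | forall t, H (expm X t)].

(** Von Neumann's argument: powers of [a i] lie in [H] and converge to [expm Z t] by [mpow_cvg]. *)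
Lemma lie_lim (a : nat -> MM) (r : nat -> R) Z :
  (forall i, H (a i)) -> (forall i, 0 < r i) -> r @ \oo --> (0 : R) ->
  (fun i => (r i)^-1 *: (a i - 1%:M)) @ \oo --> Z -> lie Z.
Proof.
move=> ha r0 rc ac.
have pos t : 0 <= t -> H (expm Z t).
  move=> t0; apply: Hcl (mpow_cvg t0 r0 rc ac) => i; exact: Hmpow.
move=> t; have [t0|t0] := leP 0 t; first exact: pos.
by rewrite -[t]opprK -expm_inv; apply: HV; apply: pos; rewrite oppr_ge0 ltW.
Qed.

Lemma harmonic_gt0 (i : nat) : 0 < (i.+1%:R : R)^-1. Proof. by rewrite invr_gt0. Qed.
Lemma harmonic_cvg : (fun i => (i.+1%:R : R)^-1) @ \oo --> (0 : R).
Proof. exact: cvg_harmonic. Qed.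

Lemma norm_harmonic_cvg0 (U : normedModType R) (u : nat -> U) :
  (forall i, `|u i| <= i.+1%:R^-1) -> u @ \oo --> (0 : U).
Proof.
move=> h; apply: norm_cvg0; apply: (@squeeze_cvgr _ _ _ _ (cst 0) (fun i => i.+1%:R^-1)) => //;
 [|exact: cvg_cst|exact: harmonic_cvg].
by apply: nearW => i; rewrite normr_ge0 h.
Qed.

Lemma lie_curve (c : R -> MM) Z : (forall t, H (c t)) -> c 0 = 1%:M -> is_derive (0 : R) (1 : R) c Z -> lie Z.
Proof.
move=> hc c00 dc.
apply: (@lie_lim (fun i => c i.+1%:R^-1) (fun i => i.+1%:R^-1)) => //; first exact: harmonic_cvg.
have := is_derive_seq dc (fun i => lt0r_neq0 (harmonic_gt0 i)) harmonic_cvg.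
by rewrite c00; under eq_fun do rewrite addr0.
Qed.

Lemma lieD X Y : lie X -> lie Y -> lie (X + Y).
Proof.
move=> hX hY; apply: (@lie_curve (fun t => expm X t *m expm Y t)).
- by move=> t; apply: HM.
- by rewrite !expm0 mulmx1.
apply: is_derive_eq (is_derive_mulmx (is_derive_expm X 0) (is_derive_expm Y 0)) _.
by rewrite !expm0 !mulmx1 mul1mx.
Qed.
Lemma lieZ a X : lie X -> lie (a *: X).
Proof. by move=> h t; rewrite expm_scale. Qed.
Lemma lie0 : lie 0.
Proof. by have := H1 => h t; rewrite -(scale0r (0 : MM)) expm_scale mul0r expm0. Qed.
Lemma lieN X : lie X -> lie (- X).
Proof. by move=> h; rewrite -scaleN1r; exact: lieZ. Qed.
Lemma lie_conj g X : H g -> lie X -> lie (g *m X *m invmx g).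
Proof.
move=> hg hX t; rewrite -expm_conj ?Ghat_unit //; last exact: HG.
by apply: HM; [exact: HM|exact: HV].
Qed.
Lemma lie_conjV g X : H g -> lie X -> lie (invmx g *m X *m g).
Proof.
by move=> hg hX; have := lie_conj (HV hg) hX; rewrite invmxK.
Qed.

Lemma lie_closed (X : nat -> MM) Y : (forall i, lie (X i)) -> X @ \oo --> Y -> lie Y.
Proof.
move=> hX cX.
have hr i : exists r : R, [/\ 0 < r, r <= i.+1%:R^-1 &
   `|X i - r^-1 *: (expm (X i) r - 1%:M)| < i.+1%:R^-1].
  have := is_derive_seq (is_derive_expm (X i) 0) (fun i => lt0r_neq0 (harmonic_gt0 i)) harmonic_cvg.
  rewrite expm0 mulmx1 => /cvgrPdist_lt/(_ _ (harmonic_gt0 i))[N _ hN].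
  have := hN (maxn N i) (leq_maxl _ _); rewrite /= addr0 => h.
  exists (maxn N i).+1%:R^-1; split=> //.
  by rewrite lef_pV2 ?posrE // ler_nat ltnS leq_maxr.
pose r i := sval (cid (hr i)).
have rP i := svalP (cid (hr i)).
apply: (@lie_lim (fun i => expm (X i) (r i)) r) => [i|i||]; first exact: hX.
- by have [] := rP i.
- apply: (@squeeze_cvgr _ _ _ _ (cst 0) (fun i => i.+1%:R^-1)) => //; [|exact: cvg_cst|exact: harmonic_cvg].
  by apply: nearW => i; have [/ltW h1 h2 _] := rP i; rewrite h1.
have d0 : (fun i => X i - (r i)^-1 *: (expm (X i) (r i) - 1%:M)) @ \oo --> (0 : MM).
  by apply: norm_harmonic_cvg0 => i; have [_ _ /ltW] := rP i.
rewrite (_ : (fun i => _) = (fun i => X i - (X i - (r i)^-1 *: (expm (X i) (r i) - 1%:M)))); last first.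
  by apply/funext => i; rewrite subKr.
by rewrite -[X in _ --> X]subr0; apply: cvgB.
Qed.

(** [expm X t] is the square of a matrix in [H], so it cannot be antilinear. *)
Lemma lie_uni X t : lie X -> uni 1 (expm X t).
Proof.
move=> hX; have [s s1 hs] := HG (hX (t / 2)).
have -> : expm X t = expm X (t / 2) *m expm X (t / 2) by rewrite -expmD -splitr.
by have := uniM hs hs; rewrite -expr2 s1.
Qed.

Definition uLie (X : MM) := (forall x, Jmul (x *m X) = Jmul x *m X) /\
  forall x y : W, B (x *m X) y = - B x (y *m X).

Lemma is_derive_B (x y : R -> W) t dx dy : is_derive t (1 : R) x dx -> is_derive t (1 : R) y dy ->
  is_derive t (1 : R) (fun s => B (x s) (y s)) (B dx (y t) + B (x t) dy).
Proof.
move=> hx hy.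
have hQ : is_derive t (1 : R) (fun s => x s *m @Qmx R n) (dx *m @Qmx R n).
  by have := is_derive_mulmx hx (is_derive_cstmx (@Qmx R n) t (1 : R)); rewrite mulmx0 addr0.
have h := is_derive_dot hQ hy.
rewrite (_ : (fun s => _) = (fun s => dot (x s *m @Qmx R n) (y s))); last first.
  by apply/funext => s; rewrite BE.
by rewrite !BE.
Qed.

Lemma lie_uLie X : lie X -> uLie X.
Proof.
move=> hX; have e0' := expm0 X.
have dE (x : W) : is_derive (0 : R) (1 : R) (fun t => x *m expm X t) (x *m X).
  by apply: is_derive_eq (is_derive_expm_mul x X 0) _; rewrite e0' mulmx1.
split=> [x|x y].
  have h1 := is_derive_J (dE x); have h2 := dE (Jmul x).
  rewrite (_ : (fun y => _) = (fun t => Jmul x *m expm X t)) in h1; last first.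
    by apply/funext => t; rewrite (lie_uni t hX).2 scale1r.
  exact: is_derive_uniq h1 h2.
have h := is_derive_B (dE x) (dE y).
rewrite (_ : (fun s => _) = (fun=> B x y)) in h; last first.
  by apply/funext => t; rewrite (lie_uni t hX).1.
have := is_derive_uniq h (is_derive_cstmx (B x y) (0 : R) (1 : R)).
by rewrite e0' !mulmx1 => /eqP; rewrite addr_eq0 => /eqP.
Qed.

Lemma uLie_uni X t : uLie X -> uni 1 (expm X t).
Proof.
move=> [hJ hB]; split=> [x y|x].
  pose f s := B (x *m expm X s) (y *m expm X s).
  have df s : is_derive s (1 : R) f 0.
    apply: is_derive_eq (is_derive_B (is_derive_expm_mul x X s) (is_derive_expm_mul y X s)) _.
    by rewrite hB addNr.
  by have := @is_derive_0_is_cst R f t 0 df; rewrite /f expm0 !mulmx1.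
have c : @Jmx R n.+1 *m X = X *m @Jmx R n.+1.
  by apply/row_matrixP => i; rewrite !rowE !mulmxA -!JmulE hJ.
by rewrite scale1r !JmulE -!mulmxA (expm_mulC t c).
Qed.

Definition orb0 : set V := [set act g 0 | g in H].
Lemma orb0_CH z : orb0 z -> CH z.
Proof. by move=> [g hg <-]; apply: act_CH; [exact: HG|exact: CH0]. Qed.
Lemma orb0_act g z : H g -> orb0 z -> orb0 (act g z).
Proof.
move=> hg [h hh <-]; exists (h *m g); first exact: HM.
by rewrite actM //; exact: HG.
Qed.
Lemma orb00 : orb0 0. Proof. by exists 1%:M; [exact: H1|exact: act1]. Qed.

Lemma q2e0 : q2 (e0 R n) = 1.
Proof. by rewrite /q2 c0e c1e expr1n expr0n addr0. Qed.
Lemma act0E g : act g 0 = pr (e0 R n *m g).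
Proof. by rewrite act_in ?lift0 //; exact: CH0. Qed.

Lemma pr_diff (a : nat -> MM) (r : nat -> R) Z :
  (forall i, 0 < r i) -> a @ \oo --> (1%:M : MM) ->
  (fun i => (r i)^-1 *: (a i - 1%:M)) @ \oo --> Z ->
  (fun i => (r i)^-1 *: act (a i) 0) @ \oo --> pi_ (e0 R n *m Z).
Proof.
move=> r0 ca cz.
have cx : (fun i => e0 R n *m a i) @ \oo --> e0 R n.
  by rewrite -[X in _ --> X]mulmx1; apply: cvg_mulmx => //; exact: cvg_cst.
have cy : (fun i => pi_ (e0 R n *m ((r i)^-1 *: (a i - 1%:M)))) @ \oo --> pi_ (e0 R n *m Z).
  by apply: cvg_pi; apply: cvg_mulmx => //; exact: cvg_cst.
have e i : (r i)^-1 *: act (a i) 0 = (q2 (e0 R n *m a i))^-1 *: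
   (c0 (e0 R n *m a i) *: pi_ (e0 R n *m ((r i)^-1 *: (a i - 1%:M)))
    - c1 (e0 R n *m a i) *: Jmul (pi_ (e0 R n *m ((r i)^-1 *: (a i - 1%:M))))).
  rewrite -!scalemxAr mulmxBr mulmx1 piZ piB pi_e0 subr0 act0E /pr JmulZ.
  by move: (q2 _)^-1 (r i)^-1 => q s; rewrite !scalerBr !scalerA; congr (_ *: _ - _ *: _); ring.
under eq_fun do rewrite e.
have -> : pi_ (e0 R n *m Z) = (q2 (e0 R n))^-1 *: (c0 (e0 R n) *: pi_ (e0 R n *m Z) - c1 (e0 R n) *: Jmul (pi_ (e0 R n *m Z))).
  by rewrite q2e0 c0e c1e invr1 !scale1r scale0r subr0.
have h0 := cvg_c0 cx; have h1 := cvg_c1 cx.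
have hq : (fun i => q2 (e0 R n *m a i)) @ \oo --> q2 (e0 R n).
  by apply: cvgD; rewrite /= ?expr2; under eq_fun do rewrite expr2; apply: cvgM.
apply: cvg_scale; first by apply: cvgV => //; rewrite q2e0 oner_eq0.
by apply: cvgB; apply: cvg_scale => //; exact: cvg_J.
Qed.

Lemma H_orbit_bound q : orb0 q -> exists C : R, forall a, H a -> act a 0 = q -> `|a| <= C.
Proof.
move=> /orb0_CH /CHE hq; exists (Num.sqrt (4 / (1 - dot q q))) => a ha e.
by apply: Ghat_norm => //; [exact: HG|rewrite e].
Qed.

Lemma min_transport q : orb0 q -> exists a, [/\ H a, act a 0 = q &
  forall b, H b -> act b 0 = q -> `|a - 1%:M| <= `|b - 1%:M|].
Proof.
move=> hq; have [g hg gq] := hq; have [C hC] := H_orbit_bound hq.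
have [||||a [ha aq] hmin] := @min_attained _ _ _ (fun a => H a /\ act a 0 = q) (fun a => `|a - 1%:M|) g C.
- by split.
- by [].
- by move=> x [hx xq] _; exact: hC.
- move=> u x hu cx; have hx : H x by apply: Hcl cx => i; have [] := hu i.
  split; first split=> //.
    have c1 : (fun i => act (u i) 0) @ \oo --> act x 0.
      by apply: act_cvg => //; [exact: HG|exact: CH0|move=> _; exact: CH0|exact: cvg_cst].
    have c2 : (fun i => act (u i) 0) @ \oo --> q.
      by rewrite (_ : (fun i => _) = (fun=> q)); [exact: cvg_cst|apply/funext => i; have [] := hu i].
    by rewrite -(cvg_lim _ c1) // (cvg_lim _ c2).
  by apply: cvg_norm; apply: cvgB => //; exact: cvg_cst.
by exists a; split=> // b hb bq; apply: hmin.
Qed.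

(** Otherwise take the elements a_i closest to 1 that carry 0 to points q_i, with r_i = |a_i - 1|
    much larger than |q_i|. A limit Z of (a_i - 1) / r_i lies in the Lie algebra and has velocity 0
    at the point 0, so exp(tZ) fixes 0. Then exp(- r_i Z) a_i also carries 0 to q_i but is closer to
    1 than a_i. *)
Lemma transport_rate : exists (C d : R), [/\ 0 < C, 0 < d & forall q, orb0 q -> `|q| < d ->
  exists a, [/\ H a, act a 0 = q & `|a - 1%:M| <= C * `|q|]].
Proof.
apply: contrapT => hn.
have hq i : exists q, [/\ orb0 q, `|q| < i.+1%:R^-1 &
    forall a, H a -> act a 0 = q -> i.+1%:R * `|q| < `|a - 1%:M|].
  apply: contrapT => hq; apply: hn; exists i.+1%:R, i.+1%:R^-1; split=> // q oq q1.
  apply: contrapT => ha; apply: hq; exists q; split=> // a Ha aq.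
  by rewrite ltNge; apply/negP => le; apply: ha; exists a.
pose q i := sval (cid (hq i)).
have qP i := svalP (cid (hq i)); rewrite -/(q _) in qP.
have hmin i : exists a, [/\ H a, act a 0 = q i &
  forall b, H b -> act b 0 = q i -> `|a - 1%:M| <= `|b - 1%:M|].
  by apply: min_transport; have [] := qP i.
pose a i := sval (cid (hmin i)).
have aP i := svalP (cid (hmin i)); rewrite -/(a _) in aP.
have q0 : q @ \oo --> (0 : V).
  by apply: norm_harmonic_cvg0 => i; have [_ /ltW] := qP i.
have dq0 : (fun i => dot (q i) (q i)) @ \oo --> (0 : R).
  by rewrite -(dot0l (0 : V)); exact: cvg_dot.
have [N0 _ hN0] : \forall i \near \oo, dot (q i) (q i) <= 2^-1.
  have /cvgrPdist_le/(_ 2^-1) := dq0; rewrite invr_gt0 => /(_ (ltr0n _ _)).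
  by apply: filterS => i; rewrite sub0r normrN ger0_norm ?dot_ge0.
have abd i : `|a (N0 + i)%N| <= Num.sqrt (4 / (1 - 2^-1)).
  have [h1 h2 _] := aP (N0 + i)%N; apply: Ghat_norm; [exact: HG|lra|rewrite h2].
  by apply: hN0; rewrite /= leq_addr.
have [phi [b [inc cb]]] := Bolzano_mx abd.
have hb : H b by apply: Hcl cb => i; have [] := aP (N0 + phi i)%N.
have inc' i : ((N0 + phi i) < (N0 + phi i.+1))%N by rewrite ltn_add2l.
have b0 : act b 0 = 0.
  have c1 : (fun i => act (a (N0 + phi i)%N) 0) @ \oo --> act b 0.
    by apply: act_cvg => //; [exact: HG|exact: CH0|move=> _; exact: CH0|exact: cvg_cst].
  have c2 : (fun i => act (a (N0 + phi i)%N) 0) @ \oo --> (0 : V).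
    rewrite (_ : (fun i => _) = (fun i => q (N0 + phi i)%N)); first exact: (cvg_subseq inc' q0).
    by apply/funext => i; have [] := aP (N0 + phi i)%N.
  by rewrite -(cvg_lim _ c1) // (cvg_lim _ c2).
pose a' i := a (N0 + phi i)%N; pose q' i := q (N0 + phi i)%N.
(* The limit [b] of the a_i is an isotropy element that may differ from 1; multiplying by its
   inverse shows that the minimal distances tend to 0. *)
have r0 : (fun i => `|a' i - 1%:M|) @ \oo --> (0 : R).
  have c1 : (fun i => `|invmx b *m a' i - 1%:M|) @ \oo --> (0 : R).
    rewrite -[X in _ --> X](@normr0 _ MM) -(subrr (1%:M : MM)) -(mulVmx (Ghat_unit (HG hb))).
    by apply: cvg_norm; apply: cvgB; [apply: cvg_mulmx => //; exact: cvg_cst|exact: cvg_cst].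
  apply: (@squeeze_cvgr _ _ _ _ (cst 0) _ _ _ _ _ c1); last exact: cvg_cst.
  apply: nearW => i; rewrite normr_ge0 /=; have [h1 h2 h3] := aP (N0 + phi i)%N.
  apply: h3; first by apply: HM => //; exact: HV.
  rewrite actM; [|exact: GhatV (HG hb)|exact: HG].
  by rewrite -[in act (invmx b) 0]b0 actK //; exact: HG.
have rp i : 0 < `|a' i - 1%:M|.
  have [h1 h2 _] := aP (N0 + phi i)%N; have [_ _ h3] := qP (N0 + phi i)%N.
  by apply: le_lt_trans (h3 _ h1 h2); rewrite mulr_ge0.
pose r i := `|a' i - 1%:M|.
have zb i : `|(r i)^-1 *: (a' i - 1%:M)| <= 1.
  by rewrite normrZ gtr0_norm ?invr_gt0 ?rp // -/(r i) mulVf // gt_eqF // rp.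
have [psi [Z [inc2 cZ]]] := Bolzano_mx zb.
have cr : (r \o psi) @ \oo --> (0 : R) := cvg_subseq inc2 r0.
have lZ : lie Z.
  apply: (lie_lim (a := a' \o psi) (r := r \o psi)) => //= i; last exact: rp.
  by have [] := aP (N0 + phi (psi i))%N.
have ca : (a' \o psi) @ \oo --> (1%:M : MM).
  have h : (fun i => (a' \o psi) i - 1%:M) @ \oo --> (0 : MM) by apply: norm_cvg0.
  rewrite -[X in _ --> X]add0r (_ : a' \o psi = (fun i => (a' (psi i) - 1%:M) + 1%:M)); last first.
    by apply/funext => i; rewrite subrK.
  by apply: cvgD => //; exact: cvg_cst.
have piZ0 : pi_ (e0 R n *m Z) = 0.
  have c1 := pr_diff (fun i => rp (psi i)) ca cZ.
  have c2 : (fun i => (r (psi i))^-1 *: act (a' (psi i)) 0) @ \oo --> (0 : V).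
    apply: norm_harmonic_cvg0 => i; rewrite normrZ gtr0_norm ?invr_gt0 ?rp //.
    have [h1 h2 _] := aP (N0 + phi (psi i))%N; have [_ _ h3] := qP (N0 + phi (psi i))%N.
    have h := h3 _ h1 h2; rewrite /a' h2 ler_pdivrMl ?rp // mulrC.
    rewrite ler_pdivlMl //; apply: le_trans (ltW h); rewrite ler_wpM2r //.
    by rewrite ler_nat ltnS (leq_trans (subseq_ge inc2 i)) // (leq_trans (subseq_ge inc _)) // leq_addl.
  by rewrite -(cvg_lim _ c1) // (cvg_lim _ c2).
have [_ ZJ] : True /\ forall x, Jmul (x *m Z) = Jmul x *m Z by split=> //; have [] := lie_uLie lZ.
have fixE t : act (expm Z t) 0 = 0.
  pose al := c0 (e0 R n *m Z); pose be := c1 (e0 R n *m Z).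
  have eZ : e0 R n *m Z = cs al be (e0 R n).
    by rewrite (decompE (e0 R n *m Z)) piZ0 iota0 addr0.
  have hu := lie_uni t lZ.
  (* [e0] and [f0] span a plane stable under Z, so the projections of their images solve a linear
     differential equation with initial value 0. *)
  have pE s : pi_ (e0 R n *m expm Z s) = 0.
    pose E := col_mx (e0 R n) (f0 R n); pose y s := E *m expm Z s *m (iotamx R n)^T.
    pose K : 'M[R]_(1 + 1) := block_mx al%:M be%:M (- be%:M) al%:M.
    have fZ : f0 R n *m Z = cs al be (f0 R n) by rewrite /f0 -ZJ eZ /cs !JmulX.
    have EZ : E *m Z = K *m E.
      rewrite mul_col_mx eZ fZ mul_block_col !mulNmx !mul_scalar_mx /cs [al *: f0 R n + _]addrC.
      by rewrite [Jmul (f0 R n)]JmulJ scalerN.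
    have dy u : is_derive u (1 : R) (fun s => (y s)^T) ((y u)^T *m K^T).
      apply: is_derive_eq (is_derive_trmx (_ : is_derive u (1 : R) y (K *m y u))) _; last by rewrite trmx_mul.
      have := is_derive_mulmx (is_derive_mulmx (is_derive_cstmx E u (1 : R)) (is_derive_expm Z u)) (is_derive_cstmx (iotamx R n)^T u (1 : R)).
      by rewrite /y mul0mx add0r mulmx0 addr0 !mulmxA EZ.
    have := expm_ode dy s.
    rewrite {2}/y expm0 mulmx1 mul_col_mx -[e0 R n *m _]/(pi_ _) -[f0 R n *m _]/(pi_ _) pi_e0 pi_f0 col_mx0 trmx0 mul0mx.
    by move=> /(congr1 trmx); rewrite trmxK trmx0 /y !mul_col_mx -col_mx0 => /eq_col_mx[].
  rewrite act0E /pr pE Jmul0 !scaler0 subr0 scaler0 //.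
have c3 : (fun i => (r (psi i))^-1 *: (expm Z (- r (psi i)) *m a' (psi i) - 1%:M)) @ \oo --> (0 : MM).
  have c4 : (fun i => (r (psi i))^-1 *: (expm Z (- r (psi i)) - 1%:M)) @ \oo --> - Z.
    have := is_derive_seq (is_derive_expm_opp Z 0) (fun i => lt0r_neq0 (rp (psi i))) cr.
    rewrite oppr0 expm0 mulmx1; under eq_fun do rewrite addr0.
    by [].
  rewrite -[X in _ --> X](addNr Z).
  rewrite (_ : (fun i => _) = (fun i => ((r (psi i))^-1 *: (expm Z (- r (psi i)) - 1%:M)) *m a' (psi i)
     + (r (psi i))^-1 *: (a' (psi i) - 1%:M))); last first.
    apply/funext => i; rewrite -scalemxAl -scalerDr; congr (_ *: _).
    by rewrite mulmxBl mul1mx addrA subrK.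
  apply: cvgD => //; rewrite -[X in _ --> X]mulmx1.
  exact: cvg_mulmx.
have /cvgrPdist_lt/(_ 1 ltr01)[N _ hN] := c3.
have := hN N (leqnn N); rewrite /= sub0r normrN normrZ gtr0_norm ?invr_gt0 ?rp //.
rewrite ltr_pdivrMl ?rp // mulr1 ltNge => /negP; apply.
have [h1 h2 h3] := aP (N0 + phi (psi N))%N; apply: h3; first by apply: HM.
by rewrite actM; [rewrite fixE|exact/HG/lZ|exact: HG].
Qed.
End LieAlgebra.

(** * Tangent spaces of orbits and closest points *)

Section Tangent.
Variables (R : realType) (n : nat).
Local Notation V := (realCn R n).
Local Notation W := (realCn R n.+1).
Local Notation MM := 'M[R]_(n.+1 + n.+1).
Implicit Types (x y z q v : V).

Lemma Dch_lower x y : CH x -> CH y -> (1 - dot x x) / (4 * (1 - dot y y)) <= Dch x y.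
Proof.
move=> /CHE hx /CHE hy; rewrite /Dch hsq_lift.
have x0 : 0 < 1 - dot x x by lra.
have y0 : 0 < 1 - dot y y by lra.
have h : (1 - dot x x) / 2 <= 1 - dot x y.
  have := dot_ge0 (x - y); rewrite !dotX (dotC y x) => h.
  by lra.
rewrite ler_pdivlMr ?mulr_gt0 // mulrAC mulrA -expr2.
rewrite ler_pdivrMr ?mulr_gt0 //.
have h2 : (1 - dot x x) ^+ 2 / 4 <= (1 - dot x y) ^+ 2.
  rewrite (_ : _ / 4 = ((1 - dot x x) / 2) ^+ 2); last by field.
  by rewrite lerXn2r // ?nnegrE; lra.
have h3 := sqr_ge0 (dot x (Jmul y)).
move: h2 h3 y0; move: ((1 - dot x x) ^+ 2) ((1 - dot x y) ^+ 2) (dot x (Jmul y) ^+ 2) (1 - dot y y) => a b c d; nra.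
Qed.

Lemma Dch_sym x y : Dch x y = Dch y x.
Proof. by rewrite /Dch hsq_sym [_ * (1 - dot y y)]mulrC. Qed.

(** By [Dch_lower] and the invariance of [Dch], 1 - |g 0|^2 is at least (1 - r)^2 / 4; this is the
    origin of [r']. *)
Lemma Ghat_norm_at (r : R) : r < 1 -> exists C : R, forall (g : MM) x, Ghat g -> CH x ->
  dot x x <= r -> dot (act g x) (act g x) <= r -> `|g| <= C.
Proof.
move=> r1; pose r' : R := 1 - (1 - r) ^+ 2 / 4.
have r0 : 0 < 1 - r by lra.
have r'1 : r' < 1 by rewrite /r' ltrBlDr ltrDl divr_gt0 // exprn_gt0.
exists (Num.sqrt (4 / (1 - r'))) => g x hg hx xr gr.
apply: Ghat_norm => //.
have hg0 := act_CH hg (CH0 R n); have hgx := act_CH hg hx.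
have := Dch_lower hgx hg0; rewrite (Dch_act hg hx (CH0 R n)) (Dch_sym x) Dch0.
have /CHE := hg0; have /CHE := hx.
move: (dot (act g 0) _) (dot (act g x) _) (dot x x) gr xr => a b c gr xr c1 a1.
have a0 : 0 < 1 - a by lra.
have c0 : 0 < 1 - c by lra.
rewrite ler_pdivrMr ?mulr_gt0 // => h.
have : (1 - b) * (1 - c) <= 4 * (1 - a).
  by rewrite -ler_pdivlMr // mulrC.
rewrite /r' => h'; have : (1 - r) ^+ 2 <= (1 - b) * (1 - c).
  by rewrite expr2 ler_pM; lra.
by move: h'; move: ((1 - b) * (1 - c)) ((1 - r) ^+ 2) => p q; lra.
Qed.

Variable H : set MM.
Hypothesis HH : closed_subgroup H.

(** The elements a_i given by [transport_rate] are O(t_i) away from 1, so (a_i - 1) / t_i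
    subconverges to an element of the Lie algebra. *)
Lemma tangent_cone (q : nat -> V) (t : nat -> R) v : (forall i, orb0 H (q i)) -> (forall i, 0 < t i) ->
  t @ \oo --> (0 : R) -> (fun i => (t i)^-1 *: q i) @ \oo --> v ->
  exists2 X, lie H X & pi_ (e0 R n *m X) = v.
Proof.
move=> oq t0 tc qc.
have [C [d [C0 d0 hCd]]] := transport_rate HH.
have cq : q @ \oo --> (0 : V).
  rewrite -(scale0r v) (_ : q = (fun i => t i *: ((t i)^-1 *: q i))); first exact: cvg_scale.
  by apply/funext => i; rewrite scalerA mulfV ?scale1r // gt_eqF.
have [N _ hN] : \forall i \near \oo, `|q i| < d.
  by move/cvgrPdist_lt: cq => /(_ d d0); apply: filterS => i; rewrite sub0r normrN.
have ha i : exists a, [/\ H a, act a 0 = q (N + i)%N & `|a - 1%:M| <= C * `|q (N + i)%N|].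
  by apply: hCd => //; apply: hN; rewrite /= leq_addr.
pose a i := sval (cid (ha i)); have aP i := svalP (cid (ha i)); rewrite -/(a _) in aP.
have incN i : (N + i < N + i.+1)%N by rewrite addnS.
have [K [_ hK]] := cvg_seq_bounded (cvgP _ qc).
have K1 : K < `|K| + 1 by rewrite (le_lt_trans (ler_norm _)) // ltrDl.
have bd i : `|(t (N + i)%N)^-1 *: (a i - 1%:M)| <= C * (`|K| + 1).
  have [_ _ h] := aP i; have /= h2 := hK _ K1 (N + i)%N I.
  rewrite normrZ gtr0_norm ?invr_gt0 // ler_pdivrMl //; apply: le_trans h _.
  rewrite mulrCA; apply: ler_wpM2l; first exact: ltW.
  by move: h2; rewrite normrZ gtr0_norm ?invr_gt0 // ler_pdivrMl.
have [phi [X [inc cX]]] := Bolzano_mx bd.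
have ct : (fun i => t (N + phi i)%N) @ \oo --> (0 : R) := cvg_subseq inc (cvg_subseq incN tc).
have lX : lie H X.
  apply: (lie_lim HH (a := a \o phi) (r := fun i => t (N + phi i)%N)) => // i.
  by have [] := aP (phi i).
have ca : (a \o phi) @ \oo --> (1%:M : MM).
  rewrite -[X in _ --> X]addr0 (_ : a \o phi = (fun i => 1%:M + t (N + phi i)%N *: ((t (N + phi i)%N)^-1 *: (a (phi i) - 1%:M)))).
    apply: cvgD; first exact: cvg_cst.
    by rewrite -(scale0r X); exact: cvg_scale.
  by apply/funext => i; rewrite scalerA mulfV ?scale1r ?gt_eqF // addrC subrK.
have c1 := pr_diff (fun i => t0 (N + phi i)%N) ca cX.
have c2 : (fun i => (t (N + phi i)%N)^-1 *: act (a (phi i)) 0) @ \oo --> v.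
  rewrite (_ : (fun i => _) = (fun i => (t (N + phi i)%N)^-1 *: q (N + phi i)%N)).
    exact: (cvg_subseq inc (cvg_subseq incN qc)).
  by apply/funext => i; have [_ -> _] := aP (phi i).
exists X => //; by rewrite -(cvg_lim _ c1) // (cvg_lim _ c2).
Qed.

Lemma lie_curve_smooth X : lie H X -> [/\ smooth_curve (fun t => act (expm X t) (0 : V)),
  forall t, orb0 H (act (expm X t) 0), act (expm X 0) (0 : V) = 0 &
  is_derive (0 : R) (1 : R) (fun t => act (expm X t) 0) (pi_ (e0 R n *m X))].
Proof.
move=> hX; have q0 t : q2 (e0 R n *m expm X t) != 0.
  by have := q2_lift (HG HH (hX t)) (CH0 R n); rewrite lift0 => /lt0r_neq0.
have fE : (fun t => act (expm X t) 0) = (fun t => pr (e0 R n *m expm X t)).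
  by apply/funext => t; exact: act0E.
split.
- move=> k; rewrite fE; apply: Ck_pr => //; first exact: openT.
  by apply: Ck_mulmx; [exact: openT|exact: Ck_cst|exact: smooth_expm].
- by move=> t; exists (expm X t).
- by rewrite expm0 act1.
rewrite fE; have nq : \forall y \near (0 : R), q2 (e0 R n *m expm X y) != 0 by near=> y; exact: q0.
have := @is_derive_pr R n _ (fun t => e0 R n *m expm X t) 0 1 _ _ (is_derive_expm_mul _ X 0).
rewrite expm0 mulmx1 => h; apply: is_derive_eq (h nq) _.
rewrite /prd c0e c1e q2e0 (_ : pr (e0 R n) = 0); last by rewrite /pr pi_e0 Jmul0 !scaler0 subr0 scaler0.
by rewrite Jmul0 !scaler0 !subr0 /cs divr1 scale1r oppr0 mul0r scale0r addr0.
Unshelve. all: by end_near.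
Qed.

Lemma tangent_orb0 v : tangent_space (orb0 H) 0 v <-> exists2 X, lie H X & pi_ (e0 R n *m X) = v.
Proof.
split=> [[c [sc oc c00 dc]]|[X hX <-]]; last first.
  have [h1 h2 h3 [_ h4]] := lie_curve_smooth hX.
  by exists (fun t => act (expm X t) 0); split; [exact: h1|exact: h2|exact: h3|rewrite derive1E].
have [dcc _] := sc 1%N; have dc0 : is_derive (0 : R) (1 : R) c v.
  by apply: DeriveDef; [exact/derivable1_diffP/dcc|rewrite -derive1E].
apply: (tangent_cone (q := fun i => c i.+1%:R^-1) (t := fun i => i.+1%:R^-1)) => //.
  exact: harmonic_cvg.
have := is_derive_seq dc0 (fun i => lt0r_neq0 (harmonic_gt0 R i)) (@harmonic_cvg R).
by rewrite c00; under eq_fun do rewrite addr0 subr0.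
Qed.

(** That 0 is a closest point of its orbit to [x], freed from the denominators of [Dch]
    ([foot0_Dch]); in this form it behaves well when [x] is scaled. *)
Definition foot0 x := forall q, orb0 H q -> 0 <= dot q q - 2 * dot x q + (dot x q ^+ 2 + dot x (Jmul q) ^+ 2).

Lemma foot0_Dch x q : CH x -> CH q ->
  (Dch x 0 <= Dch x q) = (0 <= dot q q - 2 * dot x q + (dot x q ^+ 2 + dot x (Jmul q) ^+ 2)).
Proof.
move=> /CHE hx /CHE hq; rewrite Dch_sym Dch0 /Dch hsq_lift.
have x0 : 0 < 1 - dot x x by lra.
have q0 : 0 < 1 - dot q q by lra.
rewrite ler_pdivlMr ?mulr_gt0 // mulKf ?gt_eqF //.
by rewrite -subr_ge0; congr (0 <= _); ring.
Qed.

(** Strictly inside the segment from 0 to [x], the point 0 becomes the only closest point. *)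
Lemma foot0_strict x q (s : R) : CH x -> foot0 x -> 0 < s < 1 -> orb0 H q -> q != 0 ->
  0 < dot q q - 2 * dot (s *: x) q + (dot (s *: x) q ^+ 2 + dot (s *: x) (Jmul q) ^+ 2).
Proof.
move=> /CHE hx hf /andP[s0 s1] oq q0; have := hf q oq; have h := dot_CCS x q.
have qp : 0 < dot q q by rewrite dot_gt0.
rewrite !dotZl !exprMn -mulrDr; move: h.
set S := _ + _; set Q := dot q q in qp *; set p := dot x q => h1 h2.
have SQ : S < Q by apply: le_lt_trans h1 _; rewrite gtr_pMl.
rewrite (_ : _ + _ = s * (Q - 2 * p + S) + (1 - s) * (Q - s * S)); last by ring.
have S0 : 0 <= S by rewrite addr_ge0 ?sqr_ge0.
apply: ltr_wpDl; first by rewrite mulr_ge0 // ltW.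
apply: mulr_gt0; first by lra.
by rewrite subr_gt0; apply: le_lt_trans SQ; rewrite ler_piMl // ltW.
Qed.

Lemma foot0_scale x (s : R) : CH x -> foot0 x -> 0 <= s <= 1 -> foot0 (s *: x).
Proof.
move=> hx hf /andP[s0 s1] q oq.
have [->|q0] := eqVneq q 0; first by rewrite Jmul0 !dot0r expr0n /=; lra.
have [e|sn0] := eqVneq s 0; first by rewrite e scale0r !dot0l expr0n /=; have := dot_ge0 q; lra.
have [e|sn1] := eqVneq s 1; first by rewrite e scale1r; exact: hf.
by apply: ltW; apply: foot0_strict => //; rewrite !lt_def s0 sn0 s1 eq_sym sn1.
Qed.

(** First variation of the distance along one-parameter groups; X and - X give the two
    inequalities. *)
Lemma foot0_normal x v : foot0 x -> tangent_space (orb0 H) 0 v -> dot v x = 0.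
Proof.
move=> hf; have half w X : lie H X -> pi_ (e0 R n *m X) = w -> dot x w <= 0.
  move=> hX <-; have [_ oc c00 dc] := lie_curve_smooth hX.
  set c := (fun t => _) in oc c00 dc.
  have := is_derive_seq dc (fun i => lt0r_neq0 (harmonic_gt0 R i)) (@harmonic_cvg R).
  rewrite [c 0]c00; under eq_fun do rewrite addr0 subr0.
  set u := (fun k => _) => cu.
  have hc : (fun i : nat => i.+1%:R^-1 * (dot (u i) (u i) + (dot x (u i) ^+ 2 + dot x (Jmul (u i)) ^+ 2))) @ \oo --> (0 : R).
    rewrite -(mul0r (dot (pi_ (e0 R n *m X)) (pi_ (e0 R n *m X)) + (dot x (pi_ (e0 R n *m X)) ^+ 2 + dot x (Jmul (pi_ (e0 R n *m X))) ^+ 2))).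
    apply: cvgM; first exact: harmonic_cvg.
    apply: cvgD; first exact: cvg_dot.
    have c1 : (fun i => dot x (u i)) @ \oo --> dot x (pi_ (e0 R n *m X)) by apply: cvg_dot => //; exact: cvg_cst.
    have c2 : (fun i => dot x (Jmul (u i))) @ \oo --> dot x (Jmul (pi_ (e0 R n *m X))).
      by apply: cvg_dot; [exact: cvg_cst|exact: cvg_J].
    by apply: cvgD; [exact: (cvgM c1 c1)|exact: (cvgM c2 c2)].
  have hl : (fun i => 2 * dot x (u i)) @ \oo --> 2 * dot x (pi_ (e0 R n *m X)).
    by apply: cvgMr; apply: cvg_dot => //; exact: cvg_cst.
  have : 2 * dot x (pi_ (e0 R n *m X)) <= 0.
    apply: (ler_cvg_to hl hc); apply: nearW => i.
    have h0 := harmonic_gt0 R i; set t : R := i.+1%:R^-1 in h0 *.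
    have ect : t *: u i = act (expm X t) 0.
      by rewrite /u scalerA mulfV ?scale1r // gt_eqF.
    have := hf (t *: u i); rewrite {1}ect => /(_ (oc t)).
    move: (u i) => ui; rewrite JmulZ !dotZr dotZl.
    move: (dot ui ui) (dot x ui) (dot x (Jmul ui)) => a b c' h.
    have : 0 <= t * (t * a - 2 * b + t * (b ^+ 2 + c' ^+ 2)).
      by apply: le_trans h _; rewrite le_eqVlt; apply/orP; left; apply/eqP; ring.
    by rewrite pmulr_rge0 // => h'; lra.
  by lra.
move=> /tangent_orb0 [X hX <-]; rewrite dotC; apply/eqP; rewrite eq_le (half _ X) //=.
have := half (- pi_ (e0 R n *m X)) (- X) (lieN hX); rewrite mulmxN piN dotNr => h.
by have := h erefl; lra.
Qed.

Lemma foot_exists x : CH x -> exists2 a, H a & foot0 (act a x).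
Proof.
move=> hx; have x0 : 0 < 1 - dot x x by rewrite subr_gt0; exact/CHE.
pose D0 := Dch x 0.
have hD0 : D0 = (1 - dot x x)^-1 by rewrite /D0 Dch_sym Dch0.
have D0p : 0 < D0 by rewrite hD0 invr_gt0.
(* By [Dch_lower], |a 0|^2 > r would make [Dch x (act a 0)] larger than its value at a = 1. *)
pose r : R := 1 - (1 - dot x x) / (4 * D0).
have r1 : r < 1 by rewrite /r ltrBlDr ltrDl divr_gt0 // mulr_gt0.
have [||||a ha hmin] := @min_attained _ _ _ H (fun a => Dch x (act a 0)) 1%:M (Num.sqrt (4 / (1 - r))).
- exact: H1.
- move=> g hg; have hg0 := act_CH (HG HH hg) (CH0 R n).
  by apply: le_trans (Dch_lower hx hg0); rewrite divr_ge0 ?mulr_ge0 ?subr_ge0 ?ltW //; exact/CHE.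
- move=> g hg; rewrite act1 -/D0 => h; have hg0 := act_CH (HG HH hg) (CH0 R n).
  apply: Ghat_norm => //; first exact: (HG HH).
  have := le_trans (Dch_lower hx hg0) h; have /CHE := hg0.
  rewrite /r; move: (D0) D0p => D Dp; move: (dot (act g 0) _) (dot x x) x0 => d e e0' d1.
  have d0 : 0 < 1 - d by lra.
  rewrite ler_pdivrMr ?mulr_gt0 // => h2.
  rewrite lerBrDr -lerBrDl ler_pdivrMr ?mulr_gt0 //; apply: le_trans h2 _.
  by rewrite le_eqVlt; apply/orP; left; apply/eqP; ring.
- move=> u g hu cu; have hg : H g by apply: (Hcl HH) cu.
  split=> //.
  have c1 : (fun i => act (u i) 0) @ \oo --> act g 0.
    by apply: act_cvg => //; [exact: (HG HH)|exact: CH0|move=> _; exact: CH0|exact: cvg_cst].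
  have dlift z : (fun i => dot z (act (u i) 0)) @ \oo --> dot z (act g 0).
    by apply: cvg_dot => //; exact: cvg_cst.
  have dJ : (fun i => dot x (Jmul (act (u i) 0))) @ \oo --> dot x (Jmul (act g 0)).
    by apply: cvg_dot; [exact: cvg_cst|exact: cvg_J].
  have hg0 := act_CH (HG HH hg) (CH0 R n).
  rewrite /Dch; under eq_fun do rewrite hsq_lift; rewrite hsq_lift.
  apply: cvgM.
    have d1 : (fun i => 1 - dot x (act (u i) 0)) @ \oo --> 1 - dot x (act g 0).
      by apply: cvgB (dlift x); exact: cvg_cst.
    by apply: cvgD; [exact: (cvgM d1 d1)|exact: (cvgM dJ dJ)].
  apply: cvgV; first by rewrite mulf_neq0 // gt_eqF // subr_gt0; exact/CHE.
  apply: cvgMr; apply: cvgB; first exact: cvg_cst.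
  exact: cvg_dot.
exists (invmx a); first exact: HV.
move=> q oq; have hq := orb0_CH HH oq.
have Ga := HG HH ha; have GV := GhatV Ga.
rewrite -foot0_Dch //; last exact: act_CH.
have [g hg eq] := orb0_act HH ha oq.
rewrite -(Dch_act Ga) ?actKV //; [|exact: act_CH|exact: CH0].
rewrite -(Dch_act Ga _ hq) ?actKV //; last exact: act_CH.
by rewrite -eq; exact: hmin.
Qed.
End Tangent.

(** * Orbit spaces of dimension one *)

Definition pole_edge (a b : nat) := (a == 0%N) && (b == 1%N) || (a == 1%N) && (b == 0%N).

Lemma pole_edge_triangle a b c : (a < 3)%N -> (b < 3)%N -> (c < 3)%N -> ~~ uniq [:: a; b; c] ->
  pole_edge a b (+) pole_edge a c = pole_edge b c.
Proof. by case: a => [|[|[|a]]] //; case: b => [|[|[|b]]] //; case: c => [|[|[|c]]]. Qed.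

(* Sperner's lemma, by counting mod 2 the edges with end labels 0 and 1. *)
Lemma sperner (N : nat) (l : nat -> nat -> nat) : (0 < N)%N ->
  (forall i j, (l i j < 3)%N) ->
  (forall j, (j <= N)%N -> l 0%N j = 0%N) -> (forall i, (i <= N)%N -> l i 0%N != 2%N) ->
  (forall j, (j <= N)%N -> l N j != 0%N) -> (forall i, (i <= N)%N -> l i N != 1%N) ->
  exists i j, [/\ (i < N)%N, (j < N)%N &
    uniq [:: l i j; l i.+1 j; l i j.+1] || uniq [:: l i.+1 j.+1; l i.+1 j; l i j.+1]].
Proof.
move=> N0 l3 lL lB lR lT; apply: contrapT => no.
have tri i j : (i < N)%N -> (j < N)%N ->
  pole_edge (l i j) (l i.+1 j) (+) pole_edge (l i j.+1) (l i.+1 j.+1) =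
  pole_edge (l i j) (l i j.+1) (+) pole_edge (l i.+1 j) (l i.+1 j.+1).
  move=> hi hj; have /norP[h1 h2] : ~~ (uniq [:: l i j; l i.+1 j; l i j.+1] || uniq [:: l i.+1 j.+1; l i.+1 j; l i j.+1]).
    by apply/negP => h; apply: no; exists i, j.
  have sym a b : pole_edge a b = pole_edge b a by rewrite /pole_edge orbC [X in X || _]andbC [X in _ || X]andbC.
  have e1 := pole_edge_triangle (l3 _ _) (l3 _ _) (l3 _ _) h1.
  have e2 := pole_edge_triangle (l3 _ _) (l3 _ _) (l3 _ _) h2.
  rewrite -e1 [pole_edge (l i.+1 j.+1) _]sym [pole_edge (l i.+1 j.+1) (l i j.+1)]sym in e2.
  move: e2; do 5 case: (pole_edge _ _) => //.
(* The parity of the number of edges with labels 0 and 1 in row j. It does not depend on j, is even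
   at the top and odd at the bottom. *)
pose X j := \big[addb/false]_(i < N) pole_edge (l i j) (l i.+1 j).
have Xstep j : (j < N)%N -> X j = X j.+1.
  move=> hj; have part k : (k <= N)%N -> \big[addb/false]_(i < k) pole_edge (l i j) (l i.+1 j) (+)
      \big[addb/false]_(i < k) pole_edge (l i j.+1) (l i.+1 j.+1) =
      pole_edge (l 0%N j) (l 0%N j.+1) (+) pole_edge (l k j) (l k j.+1).
    elim: k => [_|k IH hk]; first by rewrite !big_ord0 !addbb.
    rewrite !big_ord_recr /= addbACA (IH (ltnW hk)) tri //.
    by rewrite -!addbA; congr (_ (+) _); rewrite addbA addbb.
  have := part N (leqnn N); rewrite -/(X j) -/(X j.+1) !lL ?(ltnW hj) //.
  move: (lR j (ltnW hj)) (lR j.+1 hj); case: (l N j) => // a _; case: (l N j.+1) => // b _.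
  by rewrite /pole_edge /= andbF /=; case: (X j) (X j.+1) => [] [].
have XN j : (j <= N)%N -> X j = X 0%N by elim: j => // j IH hj; rewrite -Xstep // IH // ltnW.
have : X N = false.
  rewrite /X big1 // => i _; have := lT i (ltnW (ltn_ord i)); have := lT i.+1 (ltn_ord i).
  by rewrite /pole_edge => /negbTE -> /negbTE ->; rewrite andbF.
rewrite XN // => X0; have part k : (k <= N)%N ->
   \big[addb/false]_(i < k) pole_edge (l i 0%N) (l i.+1 0%N) = (l k 0%N == 1%N).
  elim: k => [_|k IH hk]; first by rewrite big_ord0 lL.
  rewrite big_ord_recr /= (IH (ltnW hk)).
  have := lB k.+1 hk; have := lB k (ltnW hk); have := l3 k 0%N; have := l3 k.+1 0%N.
  by case: (l k 0%N) => [|[|[|a]]] //; case: (l k.+1 0%N) => [|[|[|b]]].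
have := part N (leqnn N); rewrite -/(X 0%N) X0 => /esym/eqP.
have := lR 0%N (leq0n N); have := lB N (leqnn N); have := l3 N 0%N.
by case: (l N 0%N) => [|[|[|a]]].
Qed.

(** * From covering dimension to squares in the ball *)

Section Thin.
Variables (R : realType) (n : nat).
Local Notation V := (realCn R n).
Local Notation MM := 'M[R]_(n.+1 + n.+1).

Lemma open_seq (m k : nat) (S : set 'M[R]_(m, k)) :
  (forall (u : nat -> 'M[R]_(m, k)) z, S z -> u @ \oo --> z -> exists i, S (u i)) -> open S.
Proof.
move=> h; rewrite openE => z Sz; apply: contrapT => nS.
have hu i : exists y, `|z - y| < (i.+1%:R)^-1 /\ ~ S y.
  apply: contrapT => no; apply: nS; apply/nbhs_ballP; exists (i.+1%:R)^-1; first by rewrite /= invr_gt0.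
  move=> y; rewrite -ball_normE /= => hy; apply: contrapT => nSy; apply: no; by exists y.
pose u i := sval (cid (hu i)); have uP i := svalP (cid (hu i)); rewrite -/(u _) in uP.
have cu : u @ \oo --> z.
  by apply: cvg_harmonic_bound => i; have [] := uP i.
by have [i] := h u z Sz cu; have [_] := uP i.
Qed.

Definition unit01 : set R := [set s | 0 <= s <= 1].

Definition square_cont (p : R -> R -> V) := forall (s t : nat -> R) (s0 t0 : R),
  (forall i, unit01 (s i)) -> (forall i, unit01 (t i)) -> s @ \oo --> s0 -> t @ \oo --> t0 ->
  (fun i => p (s i) (t i)) @ \oo --> p s0 t0.

Definition same_orbit (H : set MM) x y := exists2 g, H g & act g x = y.

(* The substitute for "the orbit space has dimension at most one". *)
Definition thin (H : set MM) := forall p : R -> R -> V, square_cont p ->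
  (forall s t, unit01 s -> unit01 t -> CH (p s t)) ->
  (exists t t', [/\ unit01 t, unit01 t' & same_orbit H (p 0 t) (p 1 t')]) \/
  (exists s s', [/\ unit01 s, unit01 s' & same_orbit H (p s 0) (p s' 1)]).

Lemma unit01_closed (s : nat -> R) s0 : (forall i, unit01 (s i)) -> s @ \oo --> s0 -> unit01 s0.
Proof.
move=> hs cs; apply/andP; split.
  by apply: (ler_cvg_to (cvg_cst 0) cs); apply: nearW => i; have /andP[] := hs i.
by apply: (ler_cvg_to cs (cvg_cst (1 : R))); apply: nearW => i; have /andP[] := hs i.
Qed.

Lemma unit01_subseq (s : nat -> R) : (forall i, unit01 (s i)) ->
  exists (phi : nat -> nat) l, [/\ (forall i, (phi i < phi i.+1)%N), unit01 l & (s \o phi) @ \oo --> l].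
Proof.
move=> hs; pose x i : 'rV[R]_1 := const_mx (s i).
have bx i : `|x i| <= 1.
  have /andP[h0 h1] := hs i; apply: mx_norm_le => // a b; by rewrite mxE ger0_norm.
have [phi [l [inc cl]]] := Bolzano_mx bx.
have cs : (s \o phi) @ \oo --> l 0 0.
  by have := (cvg_mxP _ _).1 cl 0 0; apply: cvg_trans; apply: near_eq_cvg; apply: nearW => i; rewrite /= mxE.
by exists phi, (l 0 0); split => //; apply: unit01_closed cs => i; exact: hs.
Qed.

Variable H : set MM.
Hypothesis HH : closed_subgroup H.

Definition seq_compact (K : set V) := forall u : nat -> V, (forall i, K (u i)) ->
  exists (phi : nat -> nat) l, [/\ (forall i, (phi i < phi i.+1)%N), K l & (u \o phi) @ \oo --> l].

(** Properness: group elements that carry a convergent sequence into [K] are bounded, and a limit of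
    them carries the limit point into [K]. *)
Lemma open_avoid (K : set V) : seq_compact K -> K `<=` CH ->
  open [set z | CH z /\ forall y, K y -> ~ same_orbit H z y].
Proof.
move=> cK KCH; apply: open_seq => u z [hz nz] cu; apply: contrapT => no.
have [N _ hN] : \forall i \near \oo, CH (u i) by apply: cu; apply: near_CH.
have hK i : exists y, K y /\ same_orbit H (u (N + i)%N) y.
  apply: contrapT => nK; apply: no; exists (N + i)%N; split; first by apply: hN; rewrite /= leq_addr.
  by move=> y Ky hy; apply: nK; exists y.
pose y i := sval (cid (hK i)); have yP i := svalP (cid (hK i)); rewrite -/(y _) in yP.
have [phi [l [inc Kl cl]]] := cK y (fun i => (yP i).1).
have hl := KCH _ Kl.
have hg i : exists2 g, H g & act g (u (N + phi i)%N) = y (phi i) by have [_ [g]] := yP (phi i); exists g.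
pose g i := s2val (cid2 (hg i)); have gH i : H (g i) := s2valP (cid2 (hg i)).
have gE i : act (g i) (u (N + phi i)%N) = y (phi i) := s2valP' (cid2 (hg i)).
have cz : (fun i => u (N + phi i)%N) @ \oo --> z.
  exact: (cvg_subseq inc (cvg_subseq (u := u) (phi := addn N) (fun i => eq_ind_r (fun k => N + i < k)%N (ltnSn _) (addnS N i)) cu)).
pose r : R := (1 + Num.max (dot z z) (dot l l)) / 2.
have [zr lr] : dot z z < r /\ dot l l < r.
  by move: hz hl => /CHE hz /CHE hl; rewrite /r; case: (leP (dot z z) (dot l l)) => h; split; lra.
have r1 : r < 1 by move: hz hl => /CHE hz /CHE hl; rewrite /r; case: (leP (dot z z) (dot l l)) => h; lra.
have [C hC] := Ghat_norm_at n r1.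
have near_lt (w : nat -> V) w0 : w @ \oo --> w0 -> dot w0 w0 < r -> \forall i \near \oo, dot (w i) (w i) <= r.
  move=> cw w0r; have := cvg_dot cw cw => /cvgrPdist_lt /(_ (r - dot w0 w0)); rewrite subr_gt0 => /(_ w0r).
  by apply: filterS => i; rewrite ltr_distl => /andP[h _]; lra.
have [N1 _ h1] := near_lt _ _ cz zr; have [N2 _ h2] := near_lt _ _ cl lr.
pose N3 := maxn N1 N2.
have bg i : `|g (N3 + i)%N| <= C.
  apply: (hC _ (u (N + phi (N3 + i))%N)); first exact: (HG HH).
  - by apply: hN; rewrite /= leq_addr.
  - by apply: h1; rewrite /= (leq_trans (leq_maxl N1 N2)) // leq_addr.
  - by rewrite gE; apply: h2; rewrite /= (leq_trans (leq_maxr N1 N2)) // leq_addr.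
have [psi [g' [inc' cg]]] := Bolzano_mx bg.
have Hg' : H g' by apply: (Hcl HH) cg => i; exact: gH.
have incN i : (N3 + i < N3 + i.+1)%N by rewrite addnS.
have c1 : (fun i => act (g (N3 + psi i)%N) (u (N + phi (N3 + psi i))%N)) @ \oo --> act g' z.
  apply: act_cvg => //; [exact: (HG HH)|by move=> i; apply: hN; rewrite /= leq_addr|].
  exact: (cvg_subseq inc' (cvg_subseq incN cz)).
have c2 : (fun i => act (g (N3 + psi i)%N) (u (N + phi (N3 + psi i))%N)) @ \oo --> l.
  under eq_fun do rewrite gE; exact: (cvg_subseq inc' (cvg_subseq incN cl)).
apply: (nz l Kl); exists g' => //.
by rewrite -(cvg_lim _ c1) // (cvg_lim _ c2).
Qed.
End Thin.
Arguments unit01 {R}.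
Local Notation orbit := Defs.orbit.

Section ThinOfDim.
Variables (R : realType) (n : nat).
Local Notation V := (realCn R n).
Local Notation MM := 'M[R]_(n.+1 + n.+1).
Implicit Type A : set (V -> V).

Definition Hof (A : set (V -> V)) : set MM := [set g | Ghat g /\ A (act g)].

Lemma Hof_closed A : isometric_action A -> closed_subgroup (Hof A).
Proof.
move=> [Aiso A1 AM AV Acl]; split.
- by move=> g [].
- move=> g hg h; split=> //; rewrite (_ : act g = id) //; exact/funext.
- move=> g h [hg Ag] [hh Ah]; split; first exact: GhatM.
  rewrite (_ : act (g *m h) = act h \o act g); first exact: AM.
  by apply/funext => z; rewrite actM.
- move=> g [hg Ag]; split; first exact: GhatV.
  have [h Ah hgE] := AV _ Ag; rewrite (_ : act (invmx g) = h) //.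
  apply/funext => z; have := congr1 (fun f => f (act (invmx g) z)) hgE.
  by rewrite /= actKV.
move=> u g hu cu; have hg : Ghat g by apply: Ghat_closed cu => i; have [] := hu i.
split=> //; apply: (Acl (fun i => act (u i))); [by move=> i; have [] := hu i|exact: act_isometry|].
by move=> K cK KCH; apply: act_uniform => // i; have [] := hu i.
Qed.

Lemma orbitE A (z : V) : isometric_action A -> orbit A z = [set y | same_orbit (Hof A) z y].
Proof.
move=> [Aiso _ _ _ _]; apply/seteqP; split=> y [g].
  move=> Ag <-; have [h Gh e] := isometry_mx (Aiso _ Ag).
  by rewrite e in Ag *; exists h.
by move=> [hg Ag] <-; exists (act g).
Qed.

Lemma lebesgue_square (q : nat) (P : 'I_q -> R -> R -> Prop) :
  (forall s t, unit01 s -> unit01 t -> exists j, P j s t) ->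
  (forall j (s t : nat -> R) (s0 t0 : R), (forall i, unit01 (s i)) -> (forall i, unit01 (t i)) ->
     s @ \oo --> s0 -> t @ \oo --> t0 -> P j s0 t0 -> exists i, P j (s i) (t i)) ->
  exists2 N, (0 < N)%N & forall s t, unit01 s -> unit01 t -> exists j, forall s' t',
    unit01 s' -> unit01 t' -> `|s - s'| <= N%:R^-1 -> `|t - t'| <= N%:R^-1 -> P j s' t'.
Proof.
move=> cov op; apply: contrapT => no.
have bad i : exists st : R * R, [/\ unit01 st.1, unit01 st.2 & forall j, exists st' : R * R,
    [/\ unit01 st'.1, unit01 st'.2, `|st.1 - st'.1| <= i.+1%:R^-1, `|st.2 - st'.2| <= i.+1%:R^-1 & ~ P j st'.1 st'.2]].
  apply: contrapT => nb; apply: no; exists i.+1 => // s t hs ht.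
  apply: contrapT => nj; apply: nb; exists (s, t); split=> // j.
  apply: contrapT => nst; apply: nj; exists j => s' t' hs' ht' h1 h2.
  by apply: contrapT => nP; apply: nst; exists (s', t').
pose st i := sval (cid (bad i)); have stP i := svalP (cid (bad i)); rewrite -/(st _) in stP.
have [phi [s [inc hs cs]]] := unit01_subseq (s := fun i => (st i).1) (fun i => let: And3 h _ _ := stP i in h).
have [psi [t [inc' ht ct]]] := unit01_subseq (s := fun i => (st (phi i)).2) (fun i => let: And3 _ h _ := stP (phi i) in h).
have [j Pj] := cov s t hs ht.
have hst i : exists st' : R * R, [/\ unit01 st'.1, unit01 st'.2, `|(st (phi (psi i))).1 - st'.1| <= (phi (psi i)).+1%:R^-1,
   `|(st (phi (psi i))).2 - st'.2| <= (phi (psi i)).+1%:R^-1 & ~ P j st'.1 st'.2].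
  by have [_ _ /(_ j)] := stP (phi (psi i)).
pose st' i := sval (cid (hst i)); have st'P i := svalP (cid (hst i)); rewrite -/(st' _) in st'P.
have close (a b : nat -> R) (l : R) : (forall i, `|a i - b i| <= (phi (psi i)).+1%:R^-1) -> a @ \oo --> l -> b @ \oo --> l.
  move=> hab ca; have cd : (fun i => a i - b i) @ \oo --> (0 : R).
    apply/norm_cvg0P; apply: (squeeze_cvgr (f := fun=> 0) (h := fun i => (phi (psi i)).+1%:R^-1)).
    - by apply: nearW => i; rewrite normr_ge0 hab.
    - exact: cvg_cst.
    exact: (cvg_subseq inc' (cvg_subseq inc (@harmonic_cvg R))).
  rewrite -(subr0 l) (_ : b = (fun i => a i - (a i - b i))); first exact: cvgB.
  by apply/funext => i; rewrite subKr.
have [||||i] := op j (fun i => (st' i).1) (fun i => (st' i).2) s t _ _ _ _ Pj.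
- by move=> i; have [] := st'P i.
- by move=> i; have [] := st'P i.
- apply: close (cvg_subseq inc' cs) => i; by have [] := st'P i.
- apply: close ct => i; by have [] := st'P i.
by have [] := st'P i.
Qed.

(** If no orbit joins opposite sides, the orbits that avoid one of left and right and one of bottom
    and top form four open sets that cover. Each grid point chooses a member of the refinement that
    contains the orbits of all nearby points of the square, and a member is labelled 0 if it meets
    the left side, otherwise 1 if it meets the bottom, otherwise 2. A triangle with three labels
    gives three different members with a common orbit, one too many. *)
Lemma thin_of_dim A : isometric_action A ->
  covering_dim_le (orbits A) (orbits_open A) 1 -> thin (Hof A).
Proof.
move=> hA hdim p pc pCH; apply: contrapT => /not_orP[noLR noBT].
have HH := Hof_closed hA.
have I0 : unit01 (0 : R) by rewrite /unit01 /= lexx ler01.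
have I1 : unit01 (1 : R) by rewrite /unit01 /= lexx ler01.
have edge (c : R -> V) : (forall (t : nat -> R) (t0 : R), (forall i, unit01 (t i)) -> t @ \oo --> t0 -> (fun i => c (t i)) @ \oo --> c t0) ->
    seq_compact [set c t | t in unit01].
  move=> cc u hu; have hu' i : exists2 t, unit01 t & c t = u i by have [t] := hu i; exists t.
  pose t i := s2val (cid2 (hu' i)); have tI i : unit01 (t i) := s2valP (cid2 (hu' i)).
  have tE i : c (t i) = u i := s2valP' (cid2 (hu' i)).
  have [phi [l [inc hl cl]]] := unit01_subseq tI; exists phi, (c l); split=> //; first by exists l.
  rewrite (_ : u \o phi = fun i => c ((t \o phi) i)); last by apply/funext => i; rewrite /= tE.
  by apply: cc cl => i; exact: tI.
pose Kx (a : R) := [set p a t | t in unit01]; pose Ky (a : R) := [set p s a | s in unit01].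
have cKx a : unit01 a -> seq_compact (Kx a).
  by move=> ha; apply: edge => t t0 ht ct; apply: (pc (fun=> a) t) => //; exact: cvg_cst.
have cKy a : unit01 a -> seq_compact (Ky a).
  by move=> ha; apply: edge => t t0 ht ct; apply: (pc t (fun=> a)) => //; exact: cvg_cst.
pose av (K : set V) (o : set V) := forall y, K y -> ~ o y.
pose U (i : 'I_4) : set (set V) := [set o | [/\ orbits A o, av (Kx (i < 2)%N%:R) o & av (Ky (odd i)%:R) o]].
have Ib (b : bool) : unit01 (b%:R : R) by case: b.
have avE K : [set z | CH z /\ av K (orbit A z)] = [set z | CH z /\ forall y, K y -> ~ same_orbit (Hof A) z y].
  by apply/seteqP; split=> z [hz h]; split=> // y Ky' hy; apply: (h y Ky'); move: hy; rewrite orbitE.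
have [|o [z hz <-]|q [W [Wop Wcov Wref Word]]] := hdim 4%N U.
- move=> i; split; first by move=> ? [].
  rewrite (_ : [set z | _] = [set z | CH z /\ av (Kx (i < 2)%N%:R) (orbit A z)] `&` [set z | CH z /\ av (Ky (odd i)%:R) (orbit A z)]).
    apply: openI; rewrite avE; apply: open_avoid => //; try exact: cKx; try exact: cKy.
      by move=> _ [t ht <-]; exact: pCH.
    by move=> _ [t ht <-]; exact: pCH.
  apply/seteqP; split=> z; first by move=> [hz [_ h1 h2]].
  by move=> [[hz h1] [_ h2]]; split=> //; split=> //; exists z.
- pose a := `[< exists2 y, Kx 0 y & orbit A z y >]; pose b := `[< exists2 y, Ky 0 y & orbit A z y >].
  have hi : ((~~ a).*2 + b < 4)%N by case: a b => [] [].
  have trans x y : orbit A z x -> orbit A z y -> same_orbit (Hof A) x y.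
    rewrite orbitE // => -[g hg <-] [h hh <-]; exists (invmx g *m h); first by apply: (HM HH) => //; exact: (HV HH).
    by rewrite actM ?actK //; [exact: (HG HH)|apply: GhatV|]; exact: (HG HH).
  exists (Ordinal hi) => //=; split; first by exists z.
    rewrite /=; have [/asboolP [y [t ht <-] hy]|/asboolPn na] := boolP a.
      rewrite (_ : (_ < 2)%N = true) => [_ [t' ht' <-] hy'|]; last by case: (b).
      by apply: noLR; exists t, t'; split=> //; exact: trans.
    rewrite (_ : (_ < 2)%N = false) => [y hy hy'|]; last by case: (b).
    by apply: na; exists y.
  rewrite /= oddD odd_double /= oddb.
  have [/asboolP [y [t ht <-] hy] _ [t' ht' <-] hy'|/asboolPn na y hy hy'] := boolP b.
    by apply: noBT; exists t, t'; split=> //; exact: trans.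
  by apply: na; exists y.
pose P j s t := W j (orbit A (p s t)).
have orefl z : orbit A z z by have [_ A1 _ _ _] := hA; exists id.
have [||N N0 hN] := @lebesgue_square q P.
- move=> s t hs ht; have [|j _ hj] := Wcov (orbit A (p s t)); last by exists j.
  by exists (p s t) => //; exact: pCH.
- move=> j s t s0 t0 hs ht cs ct Pj; have [_ oW] := Wop j.
  have hs0 := unit01_closed hs cs.
  have ht0 := unit01_closed ht ct.
  have nb : nbhs (p s0 t0) [set z | CH z /\ W j (orbit A z)].
    by apply: open_nbhs_nbhs; split=> //; split=> //; exact: pCH.
  have [M _ hM] := pc s t s0 t0 hs ht cs ct _ nb.
  by exists M; have [] := hM M (leqnn M).
pose pt i : R := (minn i N)%:R / N%:R.
have Np : 0 < N%:R :> R by rewrite ltr0n.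
have ptI i : unit01 (pt i).
  by rewrite /unit01 /pt /= divr_ge0 //= ler_pdivrMr // mul1r ler_nat geq_minr.
have pt0 : pt 0%N = 0 by rewrite /pt min0n mul0r.
have ptN : pt N = 1 by rewrite /pt minnn divff // gt_eqF.
have ptS i : `|pt i - pt i.+1| <= N%:R^-1.
  rewrite /pt -mulrBl normrM [`|_^-1|]gtr0_norm ?invr_gt0 // -[leRHS]mul1r ler_wpM2r ?invr_ge0 //.
  rewrite distrC; have [h|h] := ltnP i N.
    by rewrite ?(minn_idPl (ltnW h)) (minn_idPl h) -natrB // subSnn normr1.
  by rewrite (minn_idPr (leqW h)) subrr normr0.
have hc i j := hN (pt i) (pt j) (ptI i) (ptI j).
pose c i j := sval (cid (hc i j)); have cP i j := svalP (cid (hc i j)).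
have c_self i j : P (c i j) (pt i) (pt j) by apply: cP; rewrite ?subrr ?normr0 ?invr_ge0.
pose meets j K := exists2 o, W j o & exists2 y, K y & o y.
pose cl j := if `[< meets j (Kx 0) >] then 0%N else if `[< meets j (Ky 0) >] then 1%N else 2%N.
have [|||||i [j [hi hj]]] := @sperner N (fun i j => cl (c i j)) N0.
- by move=> i j; rewrite /cl; case: ifP => // _; case: ifP.
- move=> j _; rewrite /cl (_ : `[< _ >] = true) //; apply/asboolP.
  exists (orbit A (p (pt 0%N) (pt j))); first exact: c_self.
  by rewrite pt0; exists (p 0 (pt j)); [exists (pt j)|exact: orefl].
- move=> i _; rewrite /cl; case: ifP => // _; rewrite (_ : `[< _ >] = true) //; apply/asboolP.
  exists (orbit A (p (pt i) (pt 0%N))); first exact: c_self.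
  by rewrite pt0; exists (p (pt i) 0); [exists (pt i)|exact: orefl].
- move=> j _; rewrite /cl; case: asboolP => [h|_]; last by case: ifP.
  have [ob Wo [y Ky' oy]] := h.
  have [i0 hU] := Wref (c N j).
  have [_ a1 _] := hU _ Wo; have [_ a2 _] := hU _ (c_self N j).
  case: (i0 < 2)%N a1 a2 => a1 a2; last by case: (a1 y).
  by case: (a2 (p 1 (pt j))); [exists (pt j)|rewrite ptN; exact: orefl].
- move=> i _; rewrite /cl; case: ifP => // _; case: asboolP => // h.
  have [ob Wo [y Ky' oy]] := h.
  have [i0 hU] := Wref (c i N).
  have [_ _ a1] := hU _ Wo; have [_ _ a2] := hU _ (c_self i N).
  case: (odd i0) a1 a2 => a1 a2; last by case: (a1 y).
  by case: (a2 (p (pt i) 1)); [exists (pt i)|rewrite ptN; exact: orefl].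
have tri j1 j2 j3 z : uniq [:: cl j1; cl j2; cl j3] -> CH z -> W j1 (orbit A z) -> W j2 (orbit A z) -> W j3 (orbit A z) -> False.
  move=> u hz w1 w2 w3; have uj : uniq [:: j1; j2; j3] by apply: (map_uniq (f := cl)).
  have := Word (orbit A z); rewrite leqNgt => /(_ _) /negP; apply; first by exists z.
  rewrite (_ : 2.+1 = size [:: j1; j2; j3]) // -(card_uniqP uj) ; apply: subset_leq_card.
  apply/fintype.subsetP => j' jin; rewrite finset.in_set; apply/asboolP; move: jin.
  by rewrite !in_cons in_nil orbF => /or3P[] /eqP ->.
have ptS' k : `|pt k.+1 - pt k| <= N%:R^-1 by rewrite distrC.
have c0' k : `|pt k - pt k| <= N%:R^-1 by rewrite subrr normr0 invr_ge0.
by case/orP => u; [apply: (tri _ _ _ (p (pt i) (pt j)) u)|apply: (tri _ _ _ (p (pt i.+1) (pt j.+1)) u)];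
  (try exact: pCH); apply: cP.
Qed.
End ThinOfDim.

(** * Transitivity of the isotropy group *)

Section Slice.
Variables (R : realType) (n : nat).
Local Notation V := (realCn R n).
Local Notation W := (realCn R n.+1).
Local Notation MM := 'M[R]_(n.+1 + n.+1).
Variable H : set MM.
Hypothesis HH : closed_subgroup H.

Definition tan0 : set V := [set v | exists2 X, lie H X & pi_ (e0 R n *m X) = v].
Definition nu0 : set V := [set w | forall v, tan0 v -> dot v w = 0].
Definition unu0 : set V := [set w | nu0 w /\ dot w w = 1].

Lemma nu0D v w : nu0 v -> nu0 w -> nu0 (v + w).
Proof. by move=> hv hw x hx; rewrite dotDr hv // hw // addr0. Qed.
Lemma nu0Z a v : nu0 v -> nu0 (a *: v).
Proof. by move=> hv x hx; rewrite dotZr hv // mulr0. Qed.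
Lemma nu0_cvg (u : nat -> V) v : (forall i, nu0 (u i)) -> u @ \oo --> v -> nu0 v.
Proof.
move=> hu cu x hx; have c : (fun i => dot x (u i)) @ \oo --> dot x v by apply: cvg_dot cu; exact: cvg_cst.
rewrite -(cvg_lim _ c) //; under eq_fun do rewrite hu //.
by rewrite lim_cst.
Qed.

(** The arithmetic of [cone_dist], where t and Q are the norms of t xi and of the point of the
    orbit. *)
Lemma near_orb_bound (t Q x2 p S c : R) : 0 < t -> t <= 2^-1 -> 0 <= Q -> x2 = t ^+ 2 -> p <= t * Q -> 0 <= S -> c <= 1 -> 0 <= c ->
  (1 - c * t ^+ 2) * ((1 - p) ^+ 2 + S) <= (1 - x2) * (1 - Q ^+ 2) -> Q < 1 -> Q <= 3 * t.
Proof.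
move=> t0 t2 Q0 -> pq S0 c1 c0' h Q1.
have t4 : t ^+ 2 <= 4^-1 by rewrite (_ : 4^-1 = 2^-1 ^+ 2 :> R); [rewrite lerXn2r ?nnegrE //; lra|field].
have tp : 0 < t ^+ 2 by rewrite exprn_gt0.
have tQ : t * Q <= 2^-1 by rewrite -[leRHS]mulr1 ler_pM //; lra.
have h1 : (1 - t * Q) ^+ 2 <= (1 - p) ^+ 2 by rewrite lerXn2r ?nnegrE //; lra.
have h2 : (1 - t ^+ 2) * (1 - t * Q) ^+ 2 <= (1 - c * t ^+ 2) * ((1 - p) ^+ 2 + S).
  apply: ler_pM; rewrite ?sqr_ge0 //; [lra| |lra].
  by rewrite lerD2l lerN2 ler_piMl // ltW.
have h3 : (1 - t ^+ 2) * (1 - Q ^+ 2) <= 1 - Q ^+ 2.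
  by rewrite ler_piMl //; [rewrite subr_ge0 expr_le1 // ltW|lra].
have h4 : (1 - t ^+ 2) * (1 - 2 * (t * Q)) <= (1 - t ^+ 2) * (1 - t * Q) ^+ 2.
  apply: ler_wpM2l; first lra.
  have := sqr_ge0 (t * Q); rewrite sqrrB expr1n mul1r -mulr_natl; lra.
have h5 : (1 - t ^+ 2) * (1 - 2 * (t * Q)) <= 1 - Q ^+ 2 by lra.
have h6 : 0 <= t ^+ 2 * (t * Q) by rewrite !mulr_ge0 // ltW.
have h7 : Q ^+ 2 <= t ^+ 2 + 2 * (t * Q).
  move: h5; rewrite mulrBl mul1r mulrBr mulr1 mulrCA; lra.
rewrite leNgt; apply/negP => h8.
have h9 : 0 < (Q - 3 * t) * Q by apply: mulr_gt0; lra.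
have h10 : 0 < t * (Q - 3 * t) by apply: mulr_gt0; lra.
move: h7 h9 h10; rewrite !expr2 in tp *; rewrite mulrBl mulrBr; nra.
Qed.

(* Points of the orbit that are not farther from [t i *: xi i] than the point 0 *)
(* is, up to the factor [c], are asymptotically tangent.                        *)
Lemma cone_dist (t : nat -> R) (xi q : nat -> V) (c : R) :
  (forall i, 0 < t i <= 2^-1) -> t @ \oo --> (0 : R) -> (forall i, unu0 (xi i)) ->
  (forall i, orb0 H (q i)) -> 0 <= c <= 1 ->
  (forall i, Dch (t i *: xi i) (q i) <= (1 - c * t i ^+ 2)^-1) ->
  exists phi w xl, [/\ forall i, (phi i < phi i.+1)%N,
    (fun i => (t (phi i))^-1 *: q (phi i)) @ \oo --> w,
    (xi \o phi) @ \oo --> xl, unu0 xl & 1 + dot w w <= c].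
Proof.
move=> ht ct hxi hq /andP[c0' c1] hD.
pose u i := (t i)^-1 *: q i.
have qE i : q i = t i *: u i by rewrite scalerA mulfV ?scale1r // gt_eqF //; have /andP[] := ht i.
have key i : (1 - c * t i ^+ 2) * ((1 - dot (t i *: xi i) (q i)) ^+ 2 + dot (t i *: xi i) (Jmul (q i)) ^+ 2)
   <= (1 - t i ^+ 2) * (1 - dot (q i) (q i)).
  have /andP[t0 t2] := ht i; have [_ x1] := hxi i.
  have hx : dot (t i *: xi i) (t i *: xi i) = t i ^+ 2 by rewrite dotZl dotZr x1 mulr1 expr2.
  have t4 : t i ^+ 2 <= 4^-1 by rewrite (_ : 4^-1 = 2^-1 ^+ 2 :> R); [rewrite lerXn2r ?nnegrE //; lra|field].
  have tp : 0 < t i ^+ 2 by rewrite exprn_gt0.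
  have /CHE hq1 := orb0_CH HH (hq i).
  have := hD i; rewrite /Dch hsq_lift hx.
  have cp : 0 < 1 - c * t i ^+ 2.
    by rewrite subr_gt0; apply: le_lt_trans (_ : 1 * t i ^+ 2 < 1); [rewrite ler_wpM2r // ltW|lra].
  by rewrite ler_pdivrMr ?mulr_gt0 ?subr_gt0 //; [rewrite mulrC ler_pdivlMr // mulrC|lra].
have ub i : dot (u i) (u i) <= 9.
  have /andP[t0 t2] := ht i; have [_ x1] := hxi i.
  have /CHE hq1 := orb0_CH HH (hq i).
  pose Q := Num.sqrt (dot (q i) (q i)); have Q2 : Q ^+ 2 = dot (q i) (q i) by rewrite sqr_sqrtr ?dot_ge0.
  have hQ : Q <= 3 * t i.
    apply: (@near_orb_bound (t i) Q (t i ^+ 2) (dot (t i *: xi i) (q i)) (dot (t i *: xi i) (Jmul (q i)) ^+ 2) c) => //.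
    - exact: sqrtr_ge0.
    - rewrite dotZl ler_pM2l //; apply: le_trans (ler_norm _) _; rewrite -sqrtr_sqr ler_wsqrtr //.
      have := dot_CS (xi i) (q i); by rewrite x1 mul1r.
    - exact: sqr_ge0.
    - by rewrite Q2.
    by rewrite -(ltr_pXn2r (n := 2)) ?nnegrE ?sqrtr_ge0 // Q2 expr1n.
  have : Q ^+ 2 <= (3 * t i) ^+ 2 by rewrite lerXn2r ?nnegrE ?sqrtr_ge0 // mulr_ge0 // ltW.
  rewrite Q2 {1}qE {1}qE dotZl dotZr => h; rewrite -(ler_pM2l (x := t i ^+ 2)) ?exprn_gt0 //.
  by rewrite expr2 -mulrA; apply: le_trans h _; rewrite exprMn; lra.
have bu i : `|u i| <= 3.
  apply: le_trans (norm_le_dot _) _; rewrite (_ : 3 = Num.sqrt (3 ^+ 2)); first by rewrite ler_wsqrtr // (le_trans (ub i)) //; lra.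
  by rewrite sqrtr_sqr ger0_norm.
have bx i : `|xi i| <= 1.
  by apply: le_trans (norm_le_dot _) _; have [_ ->] := hxi i; rewrite sqrtr1.
have [phi [w [inc cw]]] := Bolzano_mx bu.
have [psi [xl [inc' cx]]] := Bolzano_mx (u := xi \o phi) (fun i => bx (phi i)).
have inc2 i : (phi (psi i) < phi (psi i.+1))%N.
  exact: (homo_ltn (f := phi) (r := fun a b => (a < b)%N) ltn_trans inc (inc' i)).
have cw' := cvg_subseq inc' cw.
have hxl : unu0 xl.
  split; first by apply: nu0_cvg cx => i; have [] := hxi (phi (psi i)).
  have := cvg_dot cx cx; rewrite (_ : (fun i => _) = fun=> 1); last first.
    by apply/funext => i; have [_] := hxi (phi (psi i)).
  by move=> h; rewrite -(cvg_lim _ h) // lim_cst.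
have [X hX hw] : exists2 X, lie H X & pi_ (e0 R n *m X) = w.
  apply: (tangent_cone HH (q := q \o (phi \o psi)) (t := t \o (phi \o psi))).
  - by move=> i; exact: hq.
  - by move=> i; have /andP[] := ht (phi (psi i)).
  - exact: (cvg_subseq inc2 ct).
  - exact: cw'.
exists (phi \o psi), w, xl; split=> //.
have ort : dot w xl = 0 by have [h _] := hxl; apply: h; exists X.
pose a i := phi (psi i).
have ctt : (t \o a) @ \oo --> (0 : R) := cvg_subseq inc2 ct.
have ct2 : (fun i => t (a i) ^+ 2) @ \oo --> (0 : R).
  have h : (fun i => t (a i) * t (a i)) @ \oo --> (0 : R) by rewrite -[X in _ --> X](mul0r 0); apply: cvgM.
  by under eq_fun do rewrite expr2.
have cuu := cvg_dot cw' cw'.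
have cux := cvg_dot cx cw'.
have cuJ := cvg_dot cx (cvg_J cw').
pose S i := dot (xi (a i)) (u (a i)) ^+ 2 + dot (xi (a i)) (Jmul (u (a i))) ^+ 2.
pose r i := dot (u (a i)) (u (a i)) - S i - 2 * (c * dot (xi (a i)) (u (a i))) + c * (t (a i) ^+ 2 * S i).
have key2 i : 1 + dot (u (a i)) (u (a i)) - c - 2 * dot (xi (a i)) (u (a i)) <= t (a i) ^+ 2 * r i.
  have := key (a i); have /andP[t0 _] := ht (a i).
  rewrite /r /S qE; move: (u (a i)) => ui; rewrite JmulZ !dotZl !dotZr => h.
  rewrite -(ler_pM2l (x := t (a i) ^+ 2)) ?exprn_gt0 // -subr_ge0.
  move: h; rewrite -subr_ge0; congr (0 <= _); ring.
have cS : S @ \oo --> dot xl w ^+ 2 + dot xl (Jmul w) ^+ 2.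
  by apply: cvgD; [exact: (cvgM cux cux)|exact: (cvgM cuJ cuJ)].
have cr : r @ \oo --> dot w w - (dot xl w ^+ 2 + dot xl (Jmul w) ^+ 2) - 2 * (c * dot xl w)
    + c * (0 * (dot xl w ^+ 2 + dot xl (Jmul w) ^+ 2)).
  apply: cvgD; last by apply: cvgMr; exact: (cvgM ct2 cS).
  apply: cvgB; first by apply: cvgB.
  by apply: cvgMr; apply: cvgMr.
have cl : (fun i => 1 + dot (u (a i)) (u (a i)) - c - 2 * dot (xi (a i)) (u (a i))) @ \oo -->
   1 + dot w w - c - 2 * dot xl w.
  apply: cvgB; last by apply: cvgMr.
  by apply: cvgB; [apply: cvgD => //; exact: cvg_cst|exact: cvg_cst].
have := ler_cvg_to cl (cvgM ct2 cr); rewrite mul0r dotC ort mulr0 subr0 => h.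
by rewrite -subr_le0; apply: h; apply: nearW => i; exact: key2.
Qed.

(** Otherwise [cone_dist] would give a vector w with 1 + |w|^2 <= 1/16. The constant is (1/4)^2, the
    square of the ratio of the extreme radii in [prox_equiv]. *)
Lemma far_orb : exists2 e : R, 0 < e <= 2^-1 & forall t xi q, 0 < t <= e -> unu0 xi -> orb0 H q ->
  (1 - 16^-1 * t ^+ 2)^-1 < Dch (t *: xi) q.
Proof.
apply: contrapT => no.
(* The radii 1 / (i + 2) are at most 1/2 from the start, as [cone_dist] requires. *)
have bad i : exists txq : R * (V * V), [/\ 0 < txq.1 <= i.+2%:R^-1, unu0 txq.2.1, orb0 H txq.2.2 &
    Dch (txq.1 *: txq.2.1) txq.2.2 <= (1 - 16^-1 * txq.1 ^+ 2)^-1].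
  apply: contrapT => nb; apply: no; exists i.+2%:R^-1.
    by rewrite invr_gt0 ltr0n /= lef_pV2 ?posrE ?ltr0n // ler_nat.
  move=> t xi q ht hx hq; rewrite ltNge; apply/negP => h; apply: nb.
  by exists (t, (xi, q)).
pose f i := sval (cid (bad i)); have fP i := svalP (cid (bad i)); rewrite -/(f _) in fP.
have [||||||phi [w [xl [_ _ _ _]]]] := @cone_dist (fun i => (f i).1) (fun i => (f i).2.1) (fun i => (f i).2.2) 16^-1.
- move=> i; have [/andP[-> h] _ _ _] := fP i; apply: le_trans h _.
  by rewrite lef_pV2 ?posrE ?ltr0n // ler_nat.
- apply: (squeeze_cvgr (f := fun=> 0) (h := fun i => i.+1%:R^-1)); last exact: (@harmonic_cvg R).
    apply: nearW => i; have [/andP[h0 h1] _ _ _] := fP i; rewrite ltW //=; apply: le_trans h1 _.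
    by rewrite lef_pV2 ?posrE ?ltr0n // ler_nat.
  exact: cvg_cst.
- by move=> i; have [] := fP i.
- by move=> i; have [] := fP i.
- lra.
- by move=> i; have [] := fP i.
by have := dot_ge0 w; lra.
Qed.

Definition csmx (a b : R) : MM := a%:M + b *: @Jmx R n.+1.
Lemma csmxE a b (x : W) : x *m csmx a b = cs a b x.
Proof. by rewrite /csmx mulmxDr mul_mx_scalar -scalemxAr -JmulE. Qed.
Lemma csmx_uni a b : a ^+ 2 + b ^+ 2 = 1 -> uni 1 (csmx a b).
Proof.
move=> h; split=> [x y|x]; first by rewrite !csmxE B_cs h mul1r.
by rewrite scale1r !csmxE /cs !JmulX; vec.
Qed.
Lemma act_csmx a b z : a ^+ 2 + b ^+ 2 = 1 -> act (csmx a b) z = z.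
Proof.
move=> h; rewrite /act; case: asboolP => // _.
by rewrite csmxE pr_cs ?pr_lift // h oner_neq0.
Qed.
Lemma H_csmx a b : a ^+ 2 + b ^+ 2 = 1 -> H (csmx a b).
Proof. by move=> h; apply: (Htriv HH) => [|z]; [apply/uni_Ghat/csmx_uni|exact: act_csmx]. Qed.

(** The isotropy group at 0, normalized to fix the vector [e0] and not only its complex line; the
    unit scalars in [H] allow this. *)
Definition Kiso : set MM := [set g | H g /\ e0 R n *m g = e0 R n].

Lemma Be0 (x : W) : B x (e0 R n) = - c0 x.
Proof. by rewrite /B !cX pi_e0 dot0r mulr0 mulr1 sub0r subr0. Qed.
Lemma Bf0 (x : W) : B x (f0 R n) = - c1 x.
Proof. by rewrite /B !cX pi_f0 dot0r mulr0 mulr1 !sub0r oppr0 add0r. Qed.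

Lemma Kiso_f0 g : Ghat g -> e0 R n *m g = e0 R n -> exists2 s : R, s ^+ 2 = 1 & f0 R n *m g = s *: f0 R n.
Proof.
move=> [s s1 [_ gJ]] eg; exists s => //.
by rewrite /f0 -[in RHS]eg gJ scalerA -expr2 s1 scale1r.
Qed.

Lemma Kiso_iota g z : Ghat g -> e0 R n *m g = e0 R n -> iota_ z *m g = iota_ (pi_ (iota_ z *m g)).
Proof.
move=> hg eg; have [s s1 fg] := Kiso_f0 hg eg.
apply: Wext; rewrite ?iotaK // ?c0i ?c1i; apply/eqP; rewrite -oppr_eq0 -?Be0 -?Bf0.
  by rewrite -eg B_mulg // BC Bei.
have := B_mulg (iota_ z) (f0 R n) hg; rewrite fg BZr => h.
have s0 : s != 0 by apply/eqP => s0; move: s1; rewrite s0 expr0n /= => /esym/eqP; rewrite oner_eq0.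
by move/eqP: h; rewrite [X in _ == X]Bf0 c1i oppr0 mulf_eq0 (negbTE s0).
Qed.

Lemma Kiso_act g z : Ghat g -> e0 R n *m g = e0 R n -> CH z -> act g z = pi_ (iota_ z *m g).
Proof.
move=> hg eg hz; rewrite act_in // /lift mulmxDl eg Kiso_iota // iotaK.
by rewrite -/(lift _) pr_lift.
Qed.

Lemma Kiso_dot g z w : Ghat g -> e0 R n *m g = e0 R n ->
  dot (pi_ (iota_ z *m g)) (pi_ (iota_ w *m g)) = dot z w.
Proof. by move=> hg eg; rewrite -Bii -!Kiso_iota // B_mulg // Bii. Qed.

Lemma fix0_e0 g : Ghat g -> act g (0 : V) = 0 -> exists a b : R, a ^+ 2 + b ^+ 2 = 1 /\ e0 R n *m g = cs a b (e0 R n).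
Proof.
move=> hg g0; have q0 := q2_lift hg (CH0 R n); rewrite lift0 in q0.
have := prK (lt0r_neq0 q0); rewrite -act0E g0 lift0 => e.
exists (c0 (e0 R n *m g)), (c1 (e0 R n *m g)); split=> //.
have : B (e0 R n *m g) (e0 R n *m g) = -1 by rewrite B_mulg // Bee.
by rewrite -{1 2}e B_cs Bee; lra.
Qed.

Lemma Kiso_normalize g : H g -> act g (0 : V) = 0 -> exists2 g', Kiso g' & forall z, act g' z = act g z.
Proof.
move=> hg g0; have [a [b [ab eg]]] := fix0_e0 (HG HH hg) g0.
have ab' : a ^+ 2 + (- b) ^+ 2 = 1 by rewrite sqrrN.
exists (g *m csmx a (- b)).
  split; first by apply: (HM HH) => //; exact: H_csmx.
  rewrite mulmxA eg csmxE cs_cs !mulNr opprK -!expr2 ab [b * a]mulrC subrr.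
  by rewrite /cs scale1r scale0r addr0.
by move=> z; rewrite actM; [exact: act_csmx|exact: (HG HH)|apply/uni_Ghat/csmx_uni].
Qed.

Lemma foot0_Dch_lt (x q : V) : CH x -> CH q ->
  (Dch x 0 < Dch x q) = (0 < dot q q - 2 * dot x q + (dot x q ^+ 2 + dot x (Jmul q) ^+ 2)).
Proof.
move=> /CHE hx /CHE hq; rewrite Dch_sym Dch0 /Dch hsq_lift.
have x0 : 0 < 1 - dot x x by lra.
have q0 : 0 < 1 - dot q q by lra.
rewrite ltr_pdivlMr ?mulr_gt0 // mulKf ?gt_eqF //.
by rewrite -subr_gt0; congr (0 < _); ring.
Qed.

(** Since [Dch x (act (invmx g) 0)] is [Dch y 0], which is at most [Dch x 0], the point g^-1 0 is
    also closest to [x]; but 0 is the only such point for [x] strictly inside a segment. *)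
Lemma foot0_fix x y g : CH x -> CH y -> (exists2 s, 0 < s < 1 & foot0 H (s^-1 *: x) /\ CH (s^-1 *: x)) ->
  foot0 H y -> H g -> act g x = y -> act g 0 = 0 /\ dot x x = dot y y.
Proof.
move=> hx hy [s s01 [fx hsx]] fy hg gxy.
have Gg := HG HH hg; have GV := GhatV Gg; have /andP[s0 s1] := s01.
have og : orb0 H (act (invmx g) 0) by exists (invmx g); [exact: (HV HH)|].
have hq := orb0_CH HH og.
have d1 : Dch x (act (invmx g) 0) = Dch y 0.
  by rewrite -(Dch_act Gg) // actKV // gxy.
have d2 : Dch y (act g 0) = Dch x 0 by rewrite -gxy Dch_act //; exact: CH0.
have l2 : Dch y 0 <= Dch x 0.
  rewrite -d2 (foot0_Dch hy (act_CH Gg (CH0 R n))).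
  by apply: fy; exists g.
have q0 : act (invmx g) 0 = 0.
  apply/eqP/negPn/negP => q0; have := foot0_strict hsx fx s01 og q0.
  rewrite scalerA mulfV ?gt_eqF // scale1r => h.
  by move: h; rewrite -foot0_Dch_lt // d1 ltNge l2.
have g0 : act g 0 = 0 by rewrite -{1}q0 actKV.
split=> //; move: d2; rewrite g0 ![Dch _ 0]Dch_sym !Dch0 => /invr_inj; lra.
Qed.

Definition prox xi r := [/\ unu0 xi, 0 < r < 1 & foot0 H (r *: xi)].

Lemma unu0_CH (xi : V) (a : R) : dot xi xi = 1 -> 0 <= a < 1 -> CH (a *: xi).
Proof.
by move=> h /andP[a0 a1]; apply/CHE; rewrite dotZl dotZr h mulr1 -expr2 expr_lt1.
Qed.

Lemma prox_scale xi (r a : R) : prox xi r -> 0 < a <= r -> prox xi a.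
Proof.
move=> [hx /andP[r0 r1] hf] /andP[a0 ar]; split=> //; first by rewrite a0 (le_lt_trans ar).
rewrite (_ : a *: xi = (a / r) *: (r *: xi)); last by rewrite scalerA mulfVK // gt_eqF.
apply: foot0_scale => //; first by apply: unu0_CH; [case: hx|rewrite ltW].
apply/andP; split; first by rewrite divr_ge0 // ltW.
by rewrite ler_pdivrMr // mul1r.
Qed.

Hypothesis Hthin : thin H.
Hypothesis Hcodim : forall xi, unu0 xi -> exists2 eta, unu0 eta & dot xi eta = 0.

(** The square consists of the multiples, by factors between e / 4 and e, of a path of unit normals
    from [xi0] to [xi1]. Some orbit joins two opposite sides. Bottom and top are excluded by
    [far_orb]; an element that joins left and right fixes 0 by [foot0_fix] and carries [xi0] to
    [xi1]. *)
Lemma prox_equiv xi0 r0 xi1 r1 : prox xi0 r0 -> prox xi1 r1 ->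
  exists2 g, Kiso g & iota_ xi0 *m g = iota_ xi1.
Proof.
move=> p0 p1; have [h0 /andP[r0p r01] f0'] := p0; have [h1 /andP[r1p r11] f1'] := p1.
have [e' /andP[e'0 e'1] far] := far_orb.
pose e := Num.min e' (Num.min (r0 / 2) (r1 / 2)).
have [e0p ee er0 er1] : [/\ 0 < e, e <= e', e <= r0 / 2 & e <= r1 / 2].
  by split; rewrite /e ?lt_min ?ge_min ?lexx ?orbT //= ?e'0 ?divr_gt0.
have [u00 x00] := h0; have [u11 x11] := h1.
have CS := dot_CS xi0 xi1; rewrite x00 x11 mulr1 in CS.
(* The term with [eta] keeps the path away from 0 if [xi1 = - xi0], and this is where a second
   normal direction is needed; otherwise eta = 0 works. *)
pose zz eta (s : R) : V := (1 - s) *: xi0 + s *: xi1 + (s * (1 - s)) *: eta.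
have [eta heta hz] : exists2 eta, nu0 eta & forall s, unit01 s -> 0 < dot (zz eta s) (zz eta s).
  have I4 (s : R) : unit01 s -> 0 <= s * (1 - s) <= 4^-1.
    move=> /andP[s0 s1]; rewrite mulr_ge0 //=; last by lra.
    have := sqr_ge0 (s - 2^-1); rewrite expr2; lra.
  have [e1|e1] := eqVneq xi1 (- xi0).
    have [eta [heta xeta] ort] := Hcodim h0; exists eta => // s /I4.
    rewrite /zz e1 !dotX dotC (dotC eta) ort x00 xeta.
    set x := s * (1 - s) => hx.
    have := sqr_ge0 x => hx2.
    rewrite [ltRHS](_ : _ = 1 - 4 * x + x ^+ 2); last by rewrite /x; ring.
    have [x0|x0] := eqVneq x 0; first by rewrite x0; lra.
    have : 0 < x ^+ 2 by rewrite lt_def sqrf_eq0 x0.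
    lra.
  exists 0 => [v hv|s /I4]; first by rewrite dot0r.
  have hd : 0 < 1 + dot xi0 xi1.
    have : 0 < dot (xi0 + xi1) (xi0 + xi1) by rewrite dot_gt0 addrC addr_eq0.
    by rewrite !dotX x00 x11 (dotC xi1); lra.
  rewrite /zz scaler0 addr0 !dotX x00 x11 (dotC xi1).
  have hd1 : dot xi0 xi1 <= 1.
    by have := sqr_ge0 (dot xi0 xi1 - 1); rewrite sqrrB expr1n mulr1 -mulr_natl; lra.
  move: hd hd1; set d := dot xi0 xi1 => hd hd1.
  set x := s * (1 - s) => hx.
  rewrite [ltRHS](_ : _ = 1 - 2 * (x * (1 - d))); last by rewrite /x; ring.
  have : x * (1 - d) <= 4^-1 * (1 - d) by apply: ler_wpM2r; lra.
  lra.
pose z := zz eta; pose N s := Num.sqrt (dot (z s) (z s)).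
have N0 s : unit01 s -> 0 < N s by move=> hs; rewrite sqrtr_gt0 hz.
pose u s := (N s)^-1 *: z s.
have hu s : unit01 s -> unu0 (u s).
  move=> hs; split; first by apply: nu0Z; apply: nu0D; [apply: nu0D|]; exact: nu0Z.
  rewrite dotZl dotZr mulrA -invfM -expr2 sqr_sqrtr ?dot_ge0 // mulVf //.
  by rewrite gt_eqF ?hz.
have u0 : u 0 = xi0.
  have -> : u 0 = (N 0)^-1 *: xi0 by rewrite /u /z /zz subr0 scale1r mul0r !scale0r !addr0.
  by rewrite /N /z /zz subr0 scale1r mul0r !scale0r !addr0 x00 sqrtr1 invr1 scale1r.
have u1 : u 1 = xi1.
  have -> : u 1 = (N 1)^-1 *: xi1 by rewrite /u /z /zz subrr scale0r mulr0 scale0r scale1r add0r addr0.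
  by rewrite /N /z /zz subrr scale0r mulr0 scale0r scale1r add0r addr0 x11 sqrtr1 invr1 scale1r.
pose h t : R := e * (4^-1 + t * (1 - 4^-1)).
have hh t : unit01 t -> 0 < h t <= e.
  move=> /andP[t0 t1]; rewrite mulr_gt0 //=; last by lra.
  by rewrite -[leRHS]mulr1 ler_pM2l //; lra.
have [|s t hs ht|[t [t' [ht ht' [g hg]]]]|[s [s' [hs hs' [g hg]]]]] := Hthin (p := fun s t => h t *: u s).
- move=> s t s0 t0 hs ht cs ct.
  have hs0 := unit01_closed hs cs.
  have cz : (fun i => z (s i)) @ \oo --> z s0.
    have c1s : (fun i => 1 - s i) @ \oo --> 1 - s0 by apply: cvgB => //; exact: cvg_cst.
    apply: cvgD; first by apply: cvgD; apply: cvg_scale => //; exact: cvg_cst.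
    by apply: cvg_scale; [exact: (cvgM cs c1s)|exact: cvg_cst].
  apply: cvg_scale; first by apply: cvgMr; apply: cvgD; [exact: cvg_cst|exact: cvgMl].
  apply: cvg_scale => //; apply: cvgV; first by rewrite gt_eqF // N0.
  by apply: (cvg_comp _ _ (cvg_dot cz cz)); exact: sqrt_continuous.
- have [_ x1] := hu s hs; have /andP[h0' h1'] := hh t ht; apply: unu0_CH => //.
  by rewrite ltW //=; lra.
- rewrite u0 u1 => eg; have /andP[a0 a1] := hh t ht; have /andP[b0 b1] := hh t' ht'.
  have [||||g0 eab] := @foot0_fix (h t *: xi0) (h t' *: xi1) g _ _ _ _ hg eg.
  + by apply: unu0_CH => //; rewrite ltW //=; lra.
  + by apply: unu0_CH => //; rewrite ltW //=; lra.
  + exists (h t / r0); first by rewrite divr_gt0 //= ltr_pdivrMr // mul1r; lra.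
    rewrite scalerA invf_div mulfVK ?gt_eqF //; split=> //.
    by apply: unu0_CH => //; rewrite ltW.
  + by have [] := @prox_scale xi1 r1 (h t') p1 _; rewrite // b0 /=; lra.
  have [g' [Hg' eg'] actg'] := Kiso_normalize hg g0.
  exists g' => //; have Gg' := HG HH Hg'.
  rewrite Kiso_iota //; congr iota_.
  have ht1 : CH (h t *: xi0) by apply: unu0_CH => //; rewrite ltW //=; lra.
  move: eg; rewrite -actg' Kiso_act // iotaZ -scalemxAl piZ.
  have -> : h t' = h t.
    move: eab; rewrite !dotZl !dotZr x00 x11 !mulr1 -!expr2 => /eqP.
    by rewrite eqrXn2 ?ltW // => /eqP.
  by move=> /(congr1 (fun k => (h t)^-1 *: k)); rewrite !scalerA mulVf ?gt_eqF // !scale1r.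
have [hus xs] := hu s hs; have [hus' xs'] := hu s' hs'.
have -> : h 0 = e / 4 by rewrite /h mul0r addr0.
have -> : h 1 = e by rewrite /h mul1r addrC subrK mulr1.
move=> eg; have Gg := HG HH hg.
have h4 : CH ((e / 4) *: u s) by apply: unu0_CH => //; lra.
have := far e (u s') (act g 0); rewrite e0p ee => /(_ isT (hu _ hs')) /(_ _)-/(_ (ex_intro2 _ _ g hg erefl)).
rewrite -eg Dch_act //; last exact: CH0.
rewrite Dch_sym Dch0 dotZl dotZr xs mulr1 (_ : e / 4 * (e / 4) = 16^-1 * e ^+ 2) ?ltxx //.
by field.
Qed.

Lemma foot_normal x : CH x -> exists2 a, H a & foot0 H (act a x) /\ nu0 (act a x).
Proof.
move=> hx; have [a ha hf] := foot_exists HH hx; exists a => //; split=> // v hv.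
by apply: (foot0_normal HH hf); apply/tangent_orb0.
Qed.

(** [far_orb] keeps t xi off the orbit, so that the direction [eta] from the closest point is
    defined. The last estimate prepares an application of [cone_dist]. *)
Lemma prox_foot (xi : V) (t e : R) : unu0 xi -> 0 < t <= e -> e <= 2^-1 ->
  (forall t xi q, 0 < t <= e -> unu0 xi -> orb0 H q -> (1 - 16^-1 * t ^+ 2)^-1 < Dch (t *: xi) q) ->
  exists a eta r, [/\ H a, prox eta r, act a (t *: xi) = r *: eta, r <= t &
    Dch (t *: xi) (act (invmx a) 0) <= (1 - 1 * t ^+ 2)^-1].
Proof.
move=> hxi /andP[t0 te] e2 far; have [_ x1] := hxi.
have hx : CH (t *: xi) by apply: unu0_CH => //; rewrite ltW //=; lra.
have [a ha [hf hn]] := foot_normal hx; set y := act a _ in hf hn.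
have Ga := HG HH ha; have hy : CH y by exact: act_CH.
have hq : orb0 H (act (invmx a) 0) by exists (invmx a) => //; exact: (HV HH).
have hqC := orb0_CH HH hq.
have yy1 : dot y y < 1 by [].
have dE : Dch (t *: xi) (act (invmx a) 0) = (1 - dot y y)^-1.
  by rewrite -(Dch_act Ga) // actKV // Dch_sym Dch0.
have t2 : dot (t *: xi) (t *: xi) = t ^+ 2 by rewrite dotZl dotZr x1 mulr1 expr2.
have t21 : t ^+ 2 < 1 by rewrite expr_lt1 ?ltW //; lra.
have yt : dot y y <= t ^+ 2.
  have : Dch y 0 <= Dch y (act a 0).
    by rewrite (foot0_Dch hy (act_CH Ga (CH0 R n))); apply: hf; exists a.
  rewrite [X in _ <= X](Dch_act Ga hx (CH0 R n)) ![Dch _ 0]Dch_sym !Dch0 t2.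
  by rewrite lef_pV2 ?posrE; lra.
have y0 : 0 < dot y y.
  rewrite lt_def dot_ge0 andbT; apply/negP => /eqP y0.
  have := far t xi _ _ hxi hq; rewrite dE y0 subr0 invr1 t0 te => /(_ isT).
  by rewrite invf_lt1; lra.
pose r : R := Num.sqrt (dot y y); have r0 : 0 < r by rewrite sqrtr_gt0.
have r2 : r ^+ 2 = dot y y by rewrite sqr_sqrtr // ltW.
have rt : r <= t by rewrite -(ger0_norm (ltW t0)) -sqrtr_sqr ler_wsqrtr.
have yE : y = r *: (r^-1 *: y) by rewrite scalerA mulfV ?gt_eqF // scale1r.
exists a, (r^-1 *: y), r; split=> //.
- split; last by rewrite -yE.
    split; first exact: nu0Z.
    by rewrite dotZl dotZr mulrA -expr2 exprVn r2 mulVf // gt_eqF.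
  by rewrite r0 /=; lra.
by rewrite dE mul1r lef_pV2 ?posrE; lra.
Qed.

Lemma prox_exists xi : unu0 xi -> exists eta r, prox eta r.
Proof.
move=> hx; have [e /andP[e0 e2] far] := far_orb.
have [|||a [eta [r [_ p _ _ _]]]] := @prox_foot xi e e hx; rewrite ?e0 ?lexx //.
by exists eta, r.
Qed.

Lemma cvg_cs (k : nat) (a b : nat -> R) (x : nat -> realCn R k) (a' b' : R) (x' : realCn R k) :
  a @ \oo --> a' -> b @ \oo --> b' -> x @ \oo --> x' -> (fun i => cs (a i) (b i) (x i)) @ \oo --> cs a' b' x'.
Proof. by move=> ha hb hx; apply: cvgD; apply: cvg_scale => //; exact: cvg_J. Qed.

(** For t_i -> 0 there are g_i in [H] that carry r_i xi0 to t_i xi with r_i <= t_i, and g_i 0 =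
    o(t_i) by [cone_dist] with constant 1. Dividing differences of lifts by t_i shows that a limit
    of the g_i fixes 0 and carries l xi0 to xi with 0 <= l <= 1; comparison of lengths gives l =
    1. *)
Lemma prox_dense xi0 r0 xi : prox xi0 r0 -> unu0 xi ->
  exists2 g, Kiso g & iota_ xi0 *m g = iota_ xi.
Proof.
move=> p0 hxi; have [[_ x00] _ _] := p0; have [_ x1] := hxi.
have [e /andP[ep e2] far] := far_orb.
pose t i : R := e * i.+1%:R^-1.
have ht i : 0 < t i <= e.
  by rewrite mulr_gt0 ?invr_gt0 //= -[leRHS]mulr1 ler_pM2l // invf_le1 // ler1n.
have tp i : 0 < t i by have /andP[] := ht i.
have ct : t @ \oo --> (0 : R) by rewrite -(mulr0 e); apply: cvgMr; exact: (@harmonic_cvg R).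
have hf i := prox_foot hxi (ht i) e2 far.
have hf2 i : exists gr : MM * R, [/\ H gr.1, 0 < gr.2 <= t i, act gr.1 (gr.2 *: xi0) = t i *: xi &
    Dch (t i *: xi) (act gr.1 0) <= (1 - 1 * t i ^+ 2)^-1].
  have [a [eta [r [ha p ae rt hD]]]] := hf i.
  have [_ /andP[r0' r1] _] := p; have GV := GhatV (HG HH ha).
  have [b [hb eb] bx] := prox_equiv p0 p; have Gb := HG HH hb.
  have hr : CH (r *: xi0) by apply: unu0_CH => //; rewrite ltW.
  exists (b *m invmx a, r); split=> /=.
  - by apply: (HM HH) => //; exact: (HV HH).
  - by rewrite r0'.
  - rewrite actM // (Kiso_act Gb eb hr).
    by rewrite iotaZ -scalemxAl bx -iotaZ iotaK -ae actK //; exact: (HG HH).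
  by rewrite actM // (Kiso_act Gb eb (CH0 R n)) iota0 mul0mx /pi_ mul0mx.
pose g i := (sval (cid (hf2 i))).1; pose r i := (sval (cid (hf2 i))).2.
have gP i : [/\ H (g i), 0 < r i <= t i, act (g i) (r i *: xi0) = t i *: xi &
    Dch (t i *: xi) (act (g i) 0) <= (1 - 1 * t i ^+ 2)^-1] := svalP (cid (hf2 i)).
clearbody g r.
have [C hC] := @Ghat_norm_at R n (2^-1) ltac:(lra).
have h2 a : 0 < a <= e -> dot (a *: xi0) (a *: xi0) <= 2^-1.
  move=> /andP[a0 ae]; rewrite dotZl dotZr x00 mulr1; apply: le_trans (_ : a * 1 <= _); last by lra.
  by apply: ler_wpM2l; lra.
have bg i : `|g i| <= C.
  have [hg /andP[r0' rt] eg _] := gP i; have /andP[_ te] := ht i.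
  apply: (hC _ (r i *: xi0)); first exact: (HG HH).
  - by apply: unu0_CH => //; rewrite ltW //=; lra.
  - by apply: h2; rewrite r0' /=; lra.
  by have := h2 (t i) (ht i); rewrite eg !dotZl !dotZr x00 x1.
have [||||phi [w [xl [inc cw _ _ hw]]]] := @cone_dist t (fun=> xi) (fun i => act (g i) 0) 1 _ ct (fun=> hxi).
- by move=> i; rewrite tp /=; have /andP[_ h] := ht i; lra.
- by move=> i; exists (g i) => //; have [] := gP i.
- by rewrite lexx ler01.
- by move=> i; have [] := gP i.
have w0 : w = 0 by apply/eqP; rewrite -dot_eq0 eq_le dot_ge0 andbT; lra.
rewrite {}w0 in cw hw.
have [phi2 [g0 [inc2 cg]]] := Bolzano_mx (u := g \o phi) (fun i => bg (phi i)).
pose y i : V := (r i / t i) *: xi0.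
have u1 i : unit01 (r (phi (phi2 i)) / t (phi (phi2 i))).
  have [_ /andP[r0' rt] _ _] := gP (phi (phi2 i)).
  by rewrite /unit01 /= ler_pdivrMr // mul1r rt andbT divr_ge0 // ltW.
have [phi3 [l [inc3 /andP[l0 l1] cl]]] := unit01_subseq u1.
pose s i := phi (phi2 (phi3 i)).
have cq : (fun i => (t (s i))^-1 *: act (g (s i)) 0) @ \oo --> (0 : V) := cvg_subseq inc3 (cvg_subseq inc2 cw).
have cgs : (fun i => g (s i)) @ \oo --> g0 := cvg_subseq inc3 cg.
have cts : (fun i => t (s i)) @ \oo --> (0 : R) := cvg_subseq inc3 (cvg_subseq inc2 (cvg_subseq inc ct)).
have Hg0 : H g0 by apply: (Hcl HH) cgs => i; have [] := gP (s i).
have Gg0 := HG HH Hg0.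
have g00 : act g0 (0 : V) = 0.
  have c1 : (fun i => act (g (s i)) 0) @ \oo --> act g0 0.
    by apply: act_cvg => //; [exact: CH0|move=> _; exact: CH0|exact: cvg_cst].
  have c2 : (fun i => act (g (s i)) 0) @ \oo --> (0 : V).
    rewrite -[X in _ --> X](scale0r (0 : V)) (_ : (fun i => _) = fun i => t (s i) *: ((t (s i))^-1 *: act (g (s i)) 0)).
      exact: cvg_scale.
    by apply/funext => i; rewrite scalerA mulfV ?scale1r ?gt_eqF.
  by rewrite -(cvg_lim _ c1) // (cvg_lim _ c2).
(* difference of the lifts of [act g (r xi0) = t xi] and of [act g 0], divided by [t] *)
pose X i := lift (r (s i) *: xi0) *m g (s i); pose Y i := e0 R n *m g (s i).
have key i : pi_ (iota_ (y (s i)) *m g (s i)) =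
    cs (c0 (X i)) (c1 (X i)) xi - cs (c0 (Y i)) (c1 (Y i)) ((t (s i))^-1 *: act (g (s i)) 0).
  have [hg /andP[r0' rt] eg _] := gP (s i); have Gg := HG HH hg.
  have hr : CH (r (s i) *: xi0).
    by apply: unu0_CH => //; rewrite ltW //=; have /andP[_ h] := ht (s i); lra.
  have qX := lt0r_neq0 (q2_lift Gg hr); have qY := lt0r_neq0 (q2_lift Gg (CH0 R n)); rewrite lift0 in qY.
  have pX := pi_prE qX; have pY := pi_prE qY; rewrite -act_in // eg -/(X i) in pX; rewrite -act0E -/(Y i) in pY.
  have -> : iota_ (y (s i)) *m g (s i) = (t (s i))^-1 *: (X i - Y i).
    by rewrite /X /Y /lift mulmxDl addrAC subrr add0r /y !iotaZ -!scalemxAl scalerA [_^-1 * _]mulrC.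
  by rewrite piZ piB pX pY scalerBr -!csZ scalerA mulVf ?gt_eqF // scale1r.
have cXl : X @ \oo --> e0 R n *m g0.
  apply: cvg_mulmx => //; rewrite -lift0 -(scale0r xi0).
  apply: cvgD; first exact: cvg_cst.
  apply: cvg_iota; apply: cvg_scale; last exact: cvg_cst.
  apply: (squeeze_cvgr (f := fun=> 0) (h := fun i => t (s i))) => //; last exact: cvg_cst.
  by apply: nearW => i; have [_ /andP[h ->] _ _] := gP (s i); rewrite ltW.
have cYl : Y @ \oo --> e0 R n *m g0 by apply: cvg_mulmx => //; exact: cvg_cst.
set m := e0 R n *m g0 in cXl cYl.
have cL : (fun i => pi_ (iota_ (y (s i)) *m g (s i))) @ \oo --> pi_ (iota_ (l *: xi0) *m g0).
  by apply: cvg_pi; apply: cvg_mulmx => //; apply: cvg_iota; apply: cvg_scale; [exact: cl|exact: cvg_cst].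
have cR : (fun i => cs (c0 (X i)) (c1 (X i)) xi - cs (c0 (Y i)) (c1 (Y i)) ((t (s i))^-1 *: act (g (s i)) 0)) @ \oo -->
    cs (c0 m) (c1 m) xi - cs (c0 m) (c1 m) 0.
  by apply: cvgB; apply: cvg_cs => //; [exact: cvg_c0|exact: cvg_c1|exact: cvg_cst|exact: cvg_c0|exact: cvg_c1].
have lim : pi_ (iota_ (l *: xi0) *m g0) = cs (c0 m) (c1 m) xi.
  rewrite -(cvg_lim _ cL) //; under eq_fun do rewrite key.
  by rewrite (cvg_lim _ cR) // /cs Jmul0 !scaler0 addr0 subr0.
have [a [b [ab em]]] := fix0_e0 Gg0 g00.
have [am bm] : c0 m = a /\ c1 m = b.
  by rewrite /m em /cs !cX; split; ring.
rewrite {}am {}bm in lim.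
have ab' : a ^+ 2 + (- b) ^+ 2 = 1 by rewrite sqrrN.
have csK (k : nat) (z : realCn R k) : cs a (- b) (cs a b z) = z.
  by rewrite cs_cs !mulNr opprK -!expr2 ab [b * a]mulrC subrr /cs scale1r scale0r addr0.
have Hg1 : H (g0 *m csmx a (- b)) by apply: (HM HH) => //; exact: H_csmx.
have eg1 : e0 R n *m (g0 *m csmx a (- b)) = e0 R n by rewrite mulmxA em csmxE csK.
have yg1 : iota_ (l *: xi0) *m (g0 *m csmx a (- b)) = iota_ xi.
  rewrite (Kiso_iota _ (HG HH Hg1) eg1); congr iota_.
  rewrite mulmxA csmxE -[RHS](csK _ xi) -lim; move: (iota_ _ *m g0) => v.
  by rewrite /cs piD !piZ piJ.
have l2 : l * l = 1.
  by have := Kiso_dot (l *: xi0) (l *: xi0) (HG HH Hg1) eg1; rewrite yg1 iotaK x1 dotZl dotZr x00 mulr1.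
have lE : l = 1 by nra.
by exists (g0 *m csmx a (- b)); rewrite // -yg1 lE scale1r.
Qed.

Lemma Kiso_trans xi eta : unu0 xi -> unu0 eta -> exists2 g, Kiso g & iota_ xi *m g = iota_ eta.
Proof.
move=> hx he; have [z [r p]] := prox_exists hx.
have [g [hg eg] gx] := prox_dense p hx; have [h [hh eh] hz] := prox_dense p he.
have ug := Ghat_unit (HG HH hg).
exists (invmx g *m h); last by rewrite mulmxA -gx mulmxK.
split; first by apply: (HM HH) => //; exact: (HV HH).
by rewrite mulmxA -{1}eg mulmxK.
Qed.
End Slice.

(** * Projectors, traces and the adjoint representation *)

Section Frobenius.
Variable R : realType.

Lemma frob_dot (m k : nat) (X Y : 'M[R]_(m, k)) : dot (mxvec X) (mxvec Y) = \tr (X *m Y^T).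
Proof.
rewrite dotE (reindex (uncurry (@mxvec_index m k))) /=; last first.
  exact: curry_mxvec_bij.
transitivity (\sum_(p : 'I_m * 'I_k) mxvec X 0 (mxvec_index p.1 p.2) * mxvec Y 0 (mxvec_index p.1 p.2)).
  by apply: eq_bigr => -[].
rewrite -(pair_bigA _ (fun i j => mxvec X 0 (mxvec_index i j) * mxvec Y 0 (mxvec_index i j))) /=.
rewrite /mxtrace; apply: eq_bigr => i _; rewrite mxE; apply: eq_bigr => j _.
by rewrite !mxvecE mxE.
Qed.

Lemma frob_ge0 (m k : nat) (X : 'M[R]_(m, k)) : 0 <= \tr (X *m X^T).
Proof. by rewrite -frob_dot dot_ge0. Qed.

Lemma frob_eq0 (m k : nat) (X : 'M[R]_(m, k)) : \tr (X *m X^T) = 0 -> X = 0.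
Proof.
rewrite -frob_dot => /eqP; rewrite dot_eq0 => /eqP h.
by rewrite -(mxvecK X) h linear0.
Qed.

End Frobenius.

Lemma row_ext (R : realType) (k l : nat) (A B : 'M[R]_(k, l)) :
  (forall x : 'rV_k, x *m A = x *m B) -> A = B.
Proof. by move=> h; apply/row_matrixP => i; rewrite !rowE h. Qed.

Lemma orthonormal_rows (R : realType) (k m : nat) (xi : nat -> 'rV[R]_m) :
  (forall i j, (i < k)%N -> (j < k)%N -> dot (xi i) (xi j) = (i == j)%:R) ->
  let A := \matrix_(i < k) xi i in A *m A^T = 1%:M /\ \rank A = k.
Proof.
move=> ho A; have AA : A *m A^T = 1%:M.
  apply/matrixP => i j; rewrite !mxE; under eq_bigr do rewrite !mxE.
  by rewrite -dotE ho.
by split=> //; apply/eqP; rewrite eqn_leq rank_leq_row /= -{1}(mxrank1 R k) -AA mxrankM_maxl.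
Qed.

Lemma stable_row (R : realType) (k : nat) (P L : 'M[R]_k) : P *m P = P ->
  (forall y : 'rV_k, y *m P = y -> y *m L *m P = y *m L) -> P *m L *m P = P *m L.
Proof.
by move=> PP h; apply: row_ext => x; rewrite !mulmxA h // -mulmxA PP.
Qed.

Section SubspaceProj.
Variables (R : realType) (D : nat).
Implicit Types (S : set 'rV[R]_D) (x y : 'rV[R]_D).

Lemma subspace_basis S : S 0 -> (forall a x y, S x -> S y -> S (a *: x + y)) ->
  exists m (A : 'M[R]_(m, D)), row_free A /\ forall x, S x <-> (x <= A)%MS.
Proof.
move=> S0 SL.
pose good m := `[< exists A : 'M[R]_(m, D), row_free A /\ forall i, S (row i A) >].
have g0 : exists m, good m by exists 0%N; apply/asboolP; exists 0; split; [rewrite /row_free mxrank0|case].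
have gb m : good m -> (m <= D)%N.
  by move=> /asboolP[A [/eqP fA _]]; rewrite -fA rank_leq_col.
pose m := ex_maxn g0 gb.
have [/asboolP [A [fA rA]] mmax] : good m /\ forall k, good k -> (k <= m)%N by rewrite /m; case: ex_maxnP.
exists m, A; split=> // x; split=> [Sx|/submxP[c ->]].
  apply/negPn/negP => xA.
  suff : (m.+1 <= m)%N by rewrite ltnn.
  rewrite -{1}addn1; apply: mmax; apply/asboolP; exists (col_mx A x); split.
    apply/eqP/eqP; rewrite eqn_leq rank_leq_row /= -addsmxE addn1.
    rewrite -{1}(eqP fA); apply: rank_ltmx; rewrite ltmxE addsmxSl /=.
    by apply: contra xA; apply: submx_trans; exact: addsmxSr.
  move=> i; case: (split_ordP i) => j ->; first by rewrite rowKu; exact: rA.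
  by rewrite rowKd (_ : row j x = x) //; apply/rowP => k; rewrite mxE ord1.
rewrite mulmx_sum_row; elim/big_ind: _ => //.
  by move=> a b Sa Sb; rewrite -[a]scale1r; exact: SL.
by move=> i _; rewrite -[_ *: _]addr0; apply: SL.
Qed.

Lemma gram_unit m (A : 'M[R]_(m, D)) : row_free A -> A *m A^T \in unitmx.
Proof.
move=> fA; rewrite -row_free_unit -kermx_eq0; apply/eqP.
set K := kermx _; have KG : K *m (A *m A^T) = 0 by exact: mulmx_ker.
have /eqP : K *m A = 0.
  by apply: frob_eq0; rewrite trmx_mul mulmxA -[K *m A *m _]mulmxA KG mul0mx mxtrace0.
by rewrite mulmx_free_eq0 // => /eqP.
Qed.

Lemma subspace_proj S : S 0 -> (forall a x y, S x -> S y -> S (a *: x + y)) ->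
  exists P : 'M[R]_D, [/\ P^T = P, P *m P = P, forall x, S (x *m P) & forall x, S x -> x *m P = x].
Proof.
move=> S0 SL; have [m [A [fA SA]]] := subspace_basis S0 SL.
have uA := gram_unit fA; set G := A *m A^T in uA.
have GT : G^T = G by rewrite /G trmx_mul trmxK.
have GiT : (invmx G)^T = invmx G by rewrite trmx_inv GT.
have fix_ x : S x -> x *m (A^T *m invmx G *m A) = x.
  by move=> /SA /submxP[c ->]; rewrite -!mulmxA [A *m (A^T *m _)]mulmxA -/G mulKVmx.
have in_ x : S (x *m (A^T *m invmx G *m A)) by apply/SA; rewrite mulmxA submxMl.
exists (A^T *m invmx G *m A); split=> //; first by rewrite !trmx_mul trmxK GiT mulmxA.
by apply: row_ext => x; rewrite [LHS]mulmxA fix_.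
Qed.
End SubspaceProj.

Section Trace.
Variables (R : realType) (D : nat).

Lemma tr_adjoint (A A' : 'M[R]_D) : (forall x y, dot (x *m A) y = dot x (y *m A')) -> A^T = A'.
Proof.
move=> h; apply/matrixP => i j; rewrite mxE.
have := h (delta_mx 0 j) (delta_mx 0 i).
rewrite -!rowE !dotE (bigD1 i) //= [X in _ + X]big1 => [|k ki]; last by rewrite !mxE (negbTE ki) andbF mulr0.
rewrite (bigD1 j) //= [X in _ = _ + X]big1 => [|k ki]; last by rewrite !mxE (negbTE ki) andbF mul0r.
by rewrite !mxE !eqxx !addr0 mulr1 mul1r.
Qed.

(* For an orthogonal projector [P] onto an [L]-stable subspace, the defect of  *)
(* stability under the adjoint of [L] is measured by a commutator.             *)
Lemma proj_adjoint (P L : 'M[R]_D) : P^T = P -> P *m P = P -> P *m L *m P = P *m L ->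
  let Q := P *m L^T *m (1%:M - P) in
  \tr (Q *m Q^T) = \tr (P *m (L^T *m L - L *m L^T)).
Proof.
move=> PT PP PL Q.
have QT : (1%:M - P)^T = 1%:M - P by rewrite raddfB /= trmx1 PT.
rewrite /Q !trmx_mul trmxK QT PT.
have LP : P *m L^T *m P = L^T *m P.
  by have := congr1 trmx PL; rewrite !trmx_mul PT mulmxA.
have e1 : (1%:M - P) *m (1%:M - P) = 1%:M - P.
  by rewrite mulmxBl mul1mx mulmxBr mulmx1 PP subrr subr0.
rewrite !mulmxA -[P *m L^T *m (1%:M - P) *m (1%:M - P)]mulmxA e1.
rewrite mulmxBr mulmx1 !mulmxBl mulmxBr [LHS]raddfB [RHS]raddfB /=; congr (_ - _).
  by rewrite mxtrace_mulC !mulmxA PP.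
by rewrite LP -!mulmxA [P *m (L *m P)]mulmxA PL mxtrace_mulC -mulmxA.
Qed.
End Trace.

Section Ad.
Variables (R : realType) (N : nat).
Local Notation MM := 'M[R]_N.
Implicit Types (X Y Z g : MM).

Definition br X Y := X *m Y - Y *m X.
Definition adm X : 'M[R]_(N * N) := lin_mulmx X - lin_mulmxr X.

Lemma admE X Z : mxvec Z *m adm X = mxvec (br X Z).
Proof. by rewrite /adm mulmxBr !mul_vec_lin linearB. Qed.

Lemma mxvec_ext (k : nat) (A B : 'M[R]_(N * N, k)) : (forall Z : MM, mxvec Z *m A = mxvec Z *m B) -> A = B.
Proof. by move=> h; apply/row_matrixP => i; rewrite !rowE -[delta_mx 0 i]vec_mxK h. Qed.

Lemma mxvec_ind (P : 'rV[R]_(N * N) -> Prop) : (forall Z : MM, P (mxvec Z)) -> forall x, P x.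
Proof. by move=> h x; rewrite -[x]vec_mxK. Qed.

Lemma admD X Y : adm (X + Y) = adm X + adm Y.
Proof.
apply: mxvec_ext => Z; rewrite [RHS]mulmxDr !admE -linearD /=; congr mxvec.
by rewrite /br mulmxDl mulmxDr opprD addrACA.
Qed.

Lemma admZ a X : adm (a *: X) = a *: adm X.
Proof.
apply: mxvec_ext => Z; rewrite -scalemxAr !admE -linearZ /=; congr mxvec.
by rewrite /br -scalemxAl -scalemxAr scalerBr.
Qed.

Lemma adm_tr X : (adm X)^T = adm X^T.
Proof.
apply: tr_adjoint; elim/mxvec_ind => Z; elim/mxvec_ind => T.
rewrite !admE !frob_dot /br mulmxBl [(_ - _)^T]raddfB /= mulmxBr !trmx_mul !trmxK.
rewrite [LHS]raddfB [RHS]raddfB /=; congr (_ - _); last by rewrite mulmxA.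
by rewrite -mulmxA mxtrace_mulC mulmxA.
Qed.

(** The order in the bracket is reversed because a row vector meets the left factor first. *)
Lemma adm_br X Y : adm X *m adm Y - adm Y *m adm X = adm (br Y X).
Proof.
apply: mxvec_ext => Z; rewrite [LHS]mulmxBr !mulmxA !admE -linearB /=; congr mxvec.
rewrite /br !mulmxBl !mulmxBr !mulmxA.
move: (Y *m X *m Z) (Y *m Z *m X) (X *m Z *m Y) (Z *m X *m Y) (X *m Y *m Z) (Z *m Y *m X) => a b c d e f.
by apply/matrixP => i j; rewrite !mxE; ring.
Qed.

Variable P : 'M[R]_(N * N).
Hypotheses (PT : P^T = P) (PP : P *m P = P).
Definition admtr X := \tr (P *m adm X).

Lemma admtrD X Y : admtr (X + Y) = admtr X + admtr Y.
Proof. by rewrite /admtr admD mulmxDr linearD. Qed.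
Lemma admtrZ a X : admtr (a *: X) = a * admtr X.
Proof. by rewrite /admtr admZ -scalemxAr linearZ. Qed.

Definition stable X := forall Z, (mxvec Z *m P = mxvec Z) -> mxvec (br X Z) *m P = mxvec (br X Z).

Lemma stableE X : stable X -> P *m adm X *m P = P *m adm X.
Proof.
by move=> h; apply: stable_row => //; elim/mxvec_ind => Z ZP; rewrite admE h.
Qed.

(** In [proj_adjoint] for ad X, the trace is the squared norm of the part of ad (X^T) that leaves
    the subspace. *)
Lemma stable_adjoint X : stable X -> 0 <= admtr (br X X^T) /\ (admtr (br X X^T) = 0 -> stable X^T).
Proof.
move=> hX; have := proj_adjoint PT PP (stableE hX); rewrite adm_tr adm_br -/(admtr _) /=.
set Q := P *m _ *m _ => e; rewrite -e; split; first exact: frob_ge0.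
move=> /frob_eq0 Q0 Z ZP; have h : P *m adm X^T = P *m adm X^T *m P.
  by move: Q0; rewrite /Q mulmxBr mulmx1 => /subr0_eq.
have e2 : mxvec Z *m adm X^T = mxvec Z *m (P *m adm X^T) by rewrite mulmxA ZP.
by rewrite -admE e2 -mulmxA -h.
Qed.

Lemma admtr_conj g X : g *m g^T = 1%:M ->
  (forall Z, mxvec Z *m P = mxvec Z -> mxvec (g *m Z *m g^T) *m P = mxvec (g *m Z *m g^T)) ->
  (forall Z, mxvec Z *m P = mxvec Z -> mxvec (g^T *m Z *m g) *m P = mxvec (g^T *m Z *m g)) ->
  admtr (g *m X *m g^T) = admtr X.
Proof.
move=> gg h1 h2; have gg' : g^T *m g = 1%:M by apply: mulmx1C.
pose C (g : MM) : 'M[R]_(N * N) := lin_mulmx g *m lin_mulmxr g^T.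
have CE k Z : mxvec Z *m C k = mxvec (k *m Z *m k^T) by rewrite mulmxA !mul_vec_lin.
clearbody C.
have PC k : (forall Z, mxvec Z *m P = mxvec Z -> mxvec (k *m Z *m k^T) *m P = mxvec (k *m Z *m k^T)) ->
    P *m C k *m P = P *m C k.
  by move=> h; apply: stable_row => //; elim/mxvec_ind => Z ZP; rewrite CE h.
have CT : (C g)^T = C g^T.
  apply: tr_adjoint; elim/mxvec_ind => Z; elim/mxvec_ind => T.
  by rewrite !CE !frob_dot !trmx_mul !trmxK !mulmxA [RHS]mxtrace_mulC !mulmxA.
have PCC : P *m C g = C g *m P.
  have e1 := PC g h1; have e2 : P *m C g^T *m P = P *m C g^T by apply: PC => Z; rewrite trmxK; exact: h2.
  have CT' : (C g^T)^T = C g by rewrite -CT trmxK.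
  by have := congr1 trmx e2; rewrite !trmx_mul PT CT' mulmxA e1.
have CC : C g^T *m C g = 1%:M.
  apply: mxvec_ext => Z; rewrite mulmxA !CE mulmx1 trmxK; congr mxvec.
  by rewrite !mulmxA gg mul1mx -mulmxA gg mulmx1.
have -> : admtr (g *m X *m g^T) = \tr (P *m (C g^T *m adm X *m C g)).
  rewrite /admtr; congr (\tr (_ *m _)); apply: mxvec_ext => Z.
  rewrite !mulmxA CE !admE CE trmxK /br !mulmxBr !mulmxBl !mulmxA; congr (mxvec (_ - _)).
    by rewrite -!mulmxA gg mulmx1.
  by rewrite gg mul1mx.
rewrite mulmxA mxtrace_mulC !mulmxA -PCC -[P *m C g *m _]mulmxA.
by rewrite (mulmx1C CC) mulmx1.
Qed.
End Ad.

(** * Boosts and accelerations *)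

Lemma riesz (R : realType) (k : nat) (f : 'rV[R]_k -> R) :
  (forall x y, f (x + y) = f x + f y) -> (forall a x, f (a *: x) = a * f x) ->
  exists mu, forall v, f v = dot mu v.
Proof.
move=> fD fZ; exists (\row_i f (delta_mx 0 i)) => v.
have f0 : f 0 = 0 by rewrite -(scale0r 0) fZ mul0r.
rewrite {1}(row_sum_delta v) dotE (big_morph f fD f0); apply: eq_bigr => i _.
by rewrite fZ mxE mulrC.
Qed.

Section Boost.
Variables (R : realType) (n : nat).
Local Notation V := (realCn R n).
Local Notation W := (realCn R n.+1).
Local Notation MM := 'M[R]_(n.+1 + n.+1).
Implicit Types (X Y N g : MM) (x y : W) (u v w z : V).
Local Notation e0 := (e0 R n).
Local Notation f0 := (f0 R n).

Lemma mul_outer (k l : nat) (x a : 'rV[R]_k) (b : 'rV[R]_l) : x *m (a^T *m b) = dot x a *: b.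
Proof. by rewrite mulmxA [x *m _]mx11_scalar mul_scalar_mx. Qed.

Lemma dot_mul_tr (k l : nat) (A : 'M[R]_(k, l)) (x : 'rV[R]_l) (y : 'rV[R]_k) : dot (x *m A^T) y = dot x (y *m A).
Proof. by rewrite /dot trmx_mul mulmxA. Qed.

Lemma dot_ext (k : nat) (x x' : 'rV[R]_k) : (forall y : 'rV_k, dot x y = dot x' y) -> x = x'.
Proof.
move=> h; apply/eqP; rewrite -subr_eq0 -dot_eq0 dotBl; apply/eqP.
by rewrite [X in X - _]h subrr.
Qed.

(** The infinitesimal boost along [v]: the complex linear map with e0 |-> v and v |-> |v|^2 e0 that
    kills the complement of e0 and v. *)
Definition Ymx v : MM := e0^T *m iota_ v + (iota_ v)^T *m e0 + f0^T *m iota_ (Jmul v) + (iota_ (Jmul v))^T *m f0.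

Lemma YmxE x v : x *m Ymx v = c0 x *: iota_ v + dot (pi_ x) v *: e0 + c1 x *: iota_ (Jmul v) + dot (pi_ x) (Jmul v) *: f0.
Proof. by rewrite /Ymx !mulmxDr !mul_outer ![dot x (iota_ _)]dotC !dot_iota_l ![dot _ (pi_ x)]dotC. Qed.

Lemma Ymx_tr v : (Ymx v)^T = Ymx v.
Proof. by rewrite /Ymx !raddfD /= !trmx_mul !trmxK [X in X + _ + _ = _]addrC -addrA [X in _ + X = _]addrC addrA. Qed.

Lemma YmxD v w : Ymx (v + w) = Ymx v + Ymx w.
Proof.
apply: row_ext => x; rewrite [RHS]mulmxDr !YmxE JmulD !iotaD !dotDr !scalerDr !scalerDl.
by apply/rowP => i; rewrite !mxE; ring.
Qed.
Lemma YmxZ a v : Ymx (a *: v) = a *: Ymx v.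
Proof.
apply: row_ext => x; rewrite -scalemxAr !YmxE JmulZ !iotaZ !dotZr.
by apply/rowP => i; rewrite !mxE; ring.
Qed.

Lemma c0_Y x v : c0 (x *m Ymx v) = dot (pi_ x) v.
Proof. by rewrite YmxE !cX; ring. Qed.
Lemma c1_Y x v : c1 (x *m Ymx v) = dot (pi_ x) (Jmul v).
Proof. by rewrite YmxE !cX; ring. Qed.
Lemma pi_Y x v : pi_ (x *m Ymx v) = c0 x *: v + c1 x *: Jmul v.
Proof. by rewrite YmxE !piD !piZ !iotaK pi_e0 pi_f0 !scaler0 !addr0. Qed.

Lemma uLie_Y v : uLie (Ymx v).
Proof.
split=> [x|x y]; last by rewrite /B !c0_Y !c1_Y !pi_Y !dotDl !dotDr !dotZl !dotZr ![dot (pi_ _) _]dotC; ring.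
apply: Wext; rewrite ?c0_Y ?c1_Y ?pi_Y ?cX ?piJ ?c0_Y ?c1_Y ?pi_Y ?JmulX ?dotJJ ?dotJl //.
by rewrite addrC scalerN scaleNr.
Qed.

Lemma uLieD X Y : uLie X -> uLie Y -> uLie (X + Y).
Proof.
move=> [h1 h2] [k1 k2]; split=> [x|x y]; first by rewrite !mulmxDr JmulD h1 k1.
by rewrite [x *m _]mulmxDr [y *m _]mulmxDr BDl BDr h2 k2; ring.
Qed.
Lemma uLieZ a X : uLie X -> uLie (a *: X).
Proof.
move=> [h1 h2]; split=> [x|x y]; first by rewrite -!scalemxAr JmulZ h1.
by rewrite -!scalemxAr BZl BZr h2 mulrN.
Qed.
Lemma uLie_br X Y : uLie X -> uLie Y -> uLie (br X Y).
Proof.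
rewrite /br; move=> [h1 h2] [k1 k2]; split=> [x|x y]; first by rewrite !mulmxBr !mulmxA JmulB k1 h1 h1 k1.
rewrite !mulmxBr !mulmxA !(BDl, BDr, BNl, BNr) k2 h2 h2 k2 !opprK; ring.
Qed.

Lemma uLie_c0 X : uLie X -> c0 (e0 *m X) = 0.
Proof. by move=> [_ h]; have := h e0 e0; rewrite !(BC e0) Be0; lra. Qed.

Lemma uLie_e0 X : uLie X -> e0 *m X = c1 (e0 *m X) *: f0 + iota_ (pi_ (e0 *m X)).
Proof. by move=> hX; rewrite {1}[e0 *m X]decompE uLie_c0 // scale0r add0r. Qed.

Lemma dot_B x y : dot x y = B x y + 2 * (c0 x * c0 y + c1 x * c1 y).
Proof. by rewrite dotW /B; ring. Qed.

(** The Cartan decomposition: the symmetric part of an element of the unitary Lie algebra is the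
    boost along its velocity at 0. *)
Lemma uLie_sym X : uLie X -> X + X^T = 2 *: Ymx (pi_ (e0 *m X)).
Proof.
move=> hX; apply: row_ext => x; apply: dot_ext => y; have [hJ hB] := hX.
have eX := uLie_e0 hX; move: (c1 (e0 *m X)) (pi_ (e0 *m X)) eX => th v eX.
have k0 (z : W) : c0 (z *m X) = - (th * c1 z) + dot (pi_ z) v.
  by rewrite -[LHS]opprK -Be0 hB opprK eX BDr BZr Bf0 [B z _]BC B_iota_l [dot v _]dotC; ring.
have k1 (z : W) : c1 (z *m X) = th * c0 z + dot (pi_ z) (Jmul v).
  rewrite -[LHS]opprK -Bf0 hB opprK /f0 -hJ eX JmulD JmulZ JmulJ BDr BZr BNr Be0.
  by rewrite -iotaJ [B z _]BC B_iota_l [dot (Jmul v) _]dotC; ring.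
rewrite mulmxDr dotDl dot_mul_tr -scalemxAr dotZl !dot_B hB !k0 !k1 c0_Y c1_Y.
rewrite /B c0_Y c1_Y pi_Y !dotDl !dotZl [dot v _]dotC [dot (Jmul _) (pi_ y)]dotC; ring.
Qed.

Lemma uLie_symm_Y X : uLie X -> X^T = X -> X = Ymx (pi_ (e0 *m X)).
Proof.
move=> hX hT; have := uLie_sym hX; rewrite hT => /(congr1 (fun Z => 2^-1 *: Z)).
by rewrite -mulr2n -[X *+ 2]scaler_nat !scalerA mulVf ?pnatr_eq0 // !scale1r.
Qed.

Lemma uLie_tr X : uLie X -> uLie X^T.
Proof.
move=> hX; rewrite (_ : X^T = 2 *: Ymx (pi_ (e0 *m X)) + (-1) *: X).
  by apply: uLieD; apply: uLieZ => //; exact: uLie_Y.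
by rewrite scaleN1r -uLie_sym // addrC addKr.
Qed.

Lemma mxtrace_outer (a b : W) X : \tr (a^T *m b *m X) = dot (b *m X) a.
Proof. by rewrite -mulmxA mxtrace_mulC /dot /mxtrace big_ord1. Qed.

Lemma mxtrace_Y u v : \tr (Ymx u *m Ymx v) = 4 * dot u v.
Proof.
have hc0 x := c0_Y x v; have hc1 x := c1_Y x v; have hpi x := pi_Y x v.
move: (Ymx v) hc0 hc1 hpi => S hc0 hc1 hpi.
rewrite /Ymx !mulmxDl !raddfD /= !mxtrace_outer.
rewrite ![dot _ (iota_ _)]dotC !dot_iota_l !hpi -/(c0 _) -/(c1 _) hc0 hc1 !iotaK !cX.
by rewrite !scale0r !scale1r ?scaler0 ?add0r ?addr0 ?oppr0 ?scale0r ?add0r dotJJ; ring.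
Qed.

(* the normal part of the acceleration at [0] of the orbit of [0] under [expm X] *)
Definition accel X : V := pi_ (iota_ (pi_ (e0 *m X)) *m X) - c1 (e0 *m X) *: Jmul (pi_ (e0 *m X)).

Lemma pi_br_Y v X : uLie X -> pi_ (e0 *m br (Ymx v) X) = pi_ (iota_ v *m X) - c1 (e0 *m X) *: Jmul v.
Proof.
move=> hX; rewrite /br mulmxBr !mulmxA piB pi_Y uLie_c0 // scale0r add0r; congr (pi_ (_ *m X) - _).
by rewrite YmxE !cX pi_e0 !dot0l !scale0r scale1r !addr0.
Qed.

Lemma br_tr X : uLie X -> br X X^T = Ymx (-2 *: accel X).
Proof.
move=> hX; rewrite (uLie_symm_Y (uLie_br hX (uLie_tr hX))); last by rewrite /br raddfB /= !trmx_mul trmxK.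
congr Ymx; have -> : br X X^T = -2 *: br (Ymx (pi_ (e0 *m X))) X.
  have -> : X^T = 2 *: Ymx (pi_ (e0 *m X)) - X by rewrite -uLie_sym // addrAC subrr add0r.
  rewrite /br mulmxBr mulmxBl -scalemxAr -scalemxAl scalerBr !scaleNr opprK.
  by rewrite opprB addrA subrK addrC.
by rewrite -scalemxAr piZ pi_br_Y.
Qed.

Lemma dot_accel X : uLie X -> dot (pi_ (e0 *m X)) (accel X) = 0.
Proof.
move=> [_ hB]; rewrite /accel dotBr dotZr dotxJx mulr0 subr0 -B_iota_l; set x := iota_ _.
by have := hB x x; rewrite [B x (_ *m _)]BC; lra.
Qed.
Variable H : set MM.
Hypothesis HH : closed_subgroup H.

(** The bracket is the derivative at 0 of conjugation by exp(tX), and the Lie algebra is a closed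
    subspace. *)
Lemma lie_br X Z : lie H X -> lie H Z -> lie H (br X Z).
Proof.
move=> hX hZ; pose c t := expm X t *m Z *m expm X (- t).
have hc t : lie H (c t) by rewrite /c -expm_inv; apply: lie_conj => //; exact: hX.
have dc : is_derive (0 : R) (1 : R) c (br X Z).
  have h1 := is_derive_mulmx (is_derive_expm X 0) (is_derive_cstmx Z (0 : R) (1 : R)).
  have h2 := is_derive_mulmx h1 (is_derive_expm_opp X 0).
  apply: is_derive_eq h2 _; rewrite oppr0 expm0 !mulmx1 mulmx0 addr0 mul1mx /br.
  by rewrite mulmxN.
have := is_derive_seq dc (fun i => lt0r_neq0 (harmonic_gt0 R i)) (@harmonic_cvg R).
apply: (lie_closed HH) => i; apply: lieZ; apply: (lieD HH) => //.
exact: lieN.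
Qed.

Lemma lie_J : lie H (@Jmx R n.+1).
Proof.
have uJ : uLie (@Jmx R n.+1) by split=> [x|x y]; rewrite -!JmulE // BJl.
move=> t; apply: (Htriv HH); first by apply/uni_Ghat/uLie_uni.
move=> z; rewrite /act; case: asboolP => // hz.
pose Y (s : R) := csmx n (cos s) (sin s).
suff <- : Y t = expm (@Jmx R n.+1) t.
  by rewrite /Y csmxE pr_cs ?pr_lift // cos2Dsin2 oner_neq0.
apply: expm_ode1; first by rewrite /Y cos0 sin0 /csmx scale0r addr0.
move=> s; rewrite /Y /csmx.
have -> : (fun s => (cos s)%:M + sin s *: @Jmx R n.+1) = (fun s => cos s *: 1%:M + sin s *: @Jmx R n.+1).
  by apply/funext => r; rewrite scalemx1.
have h1 := is_derive_scale (is_derive_cos s) (is_derive_cstmx (1%:M : MM) s (1 : R)).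
have h2 := is_derive_scale (is_derive_sin s) (is_derive_cstmx (@Jmx R n.+1) s (1 : R)).
apply: is_derive_eq (is_derive_addmx h1 h2) _.
rewrite !scaler0 !addr0 mulmxDl -scalemxAl mul_scalar_mx addrC; congr (_ + _).
have -> : @Jmx R n.+1 *m @Jmx R n.+1 = - 1%:M.
  by apply: row_ext => x; rewrite mulmxA -!JmulE JmulJ mulmxN mulmx1.
by rewrite scalerN scaleNr.
Qed.

Lemma tan0D v w : tan0 H v -> tan0 H w -> tan0 H (v + w).
Proof.
by move=> [X hX <-] [Y hY <-]; exists (X + Y); [exact: (lieD HH)|rewrite mulmxDr piD].
Qed.
Lemma tan0Z a v : tan0 H v -> tan0 H (a *: v).
Proof. by move=> [X hX <-]; exists (a *: X); [exact: lieZ|rewrite -scalemxAr piZ]. Qed.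

Lemma tan_nu v : exists a b, [/\ tan0 H a, nu0 H b & v = a + b].
Proof.
have t0 : tan0 H 0 by exists 0; [exact: (lie0 HH)|rewrite mulmx0 /pi_ mul0mx].
have [|P [PT PP Pin Pfix]] := subspace_proj t0; first by move=> a x y hx hy; apply: tan0D => //; exact: tan0Z.
exists (v *m P), (v - v *m P); split=> //; last by rewrite addrC subrK.
move=> w hw; rewrite dotBr -{1}(Pfix _ hw).
by rewrite -[P in X in X - _]PT dot_mul_tr subrr.
Qed.

Lemma nu0_unit b : nu0 H b -> b != 0 -> unu0 H ((Num.sqrt (dot b b))^-1 *: b).
Proof.
move=> hb b0; split; first exact: nu0Z.
by rewrite dotZl dotZr mulrA -expr2 exprVn sqr_sqrtr ?dot_ge0 // mulVf // gt_eqF // dot_gt0.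
Qed.

Lemma unu0_perp v : (forall xi, unu0 H xi -> dot v xi = 0) -> tan0 H v.
Proof.
move=> h; have [a [b [ha hb e]]] := tan_nu v.
have [b0|b0] := eqVneq b 0; first by rewrite e b0 addr0.
have := h _ (nu0_unit hb b0); rewrite dotZr => /eqP; rewrite mulf_eq0 invr_eq0 sqrtr_eq0.
rewrite leNgt dot_gt0 b0 /= e dotDl hb // add0r dot_eq0 => /eqP b0'.
by rewrite b0' eqxx in b0.
Qed.

(** The Euclidean product differs from [B] only by the first coordinates, which such a matrix fixes
    or conjugates. *)
Lemma Kiso_orth g : Ghat g -> e0 *m g = e0 -> g *m g^T = 1%:M.
Proof.
move=> hg eg; have [s s1 fg] := Kiso_f0 hg eg.
apply: row_ext => x; apply: dot_ext => y; rewrite mulmx1 mulmxA dot_mul_tr.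
have k0 (z : W) : c0 (z *m g) = c0 z by rewrite -[LHS]opprK -Be0 -{1}eg B_mulg // Be0 opprK.
have k1 (z : W) : c1 (z *m g) = s * c1 z.
  have := B_mulg z f0 hg; rewrite fg BZr !Bf0 => h.
  by rewrite -[LHS]mul1r -s1 expr2 -mulrA; congr (_ * _); lra.
rewrite !dot_B B_mulg // !k0 !k1; congr (_ + _ * (_ + _)).
by rewrite mulrACA -expr2 s1 mul1r.
Qed.

Lemma Y_conj g v v' : Ghat g -> e0 *m g = e0 -> iota_ v *m g = iota_ v' ->
  g^T *m Ymx v *m g = Ymx v'.
Proof.
move=> hg eg vg; have [s s1 [gB gJ]] := hg.
have fg : f0 *m g = s *: f0 by rewrite /f0 -[in RHS]eg gJ scalerA -expr2 s1 scale1r.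
have Jg : iota_ (Jmul v) *m g = s *: iota_ (Jmul v').
  by rewrite !iotaJ -vg gJ scalerA -expr2 s1 scale1r.
have outer (a b : W) : g^T *m (a^T *m b) *m g = (a *m g)^T *m (b *m g) by rewrite trmx_mul !mulmxA.
rewrite /Ymx !mulmxDr !mulmxDl !outer eg fg vg Jg.
by rewrite !linearZ /= -!scalemxAl !scalerA -expr2 s1 !scale1r.
Qed.

Hypothesis Hthin : thin H.
Hypothesis Hcodim : forall xi, unu0 H xi -> exists2 eta, unu0 H eta & dot xi eta = 0.

Lemma mean_curvature_dir : exists mu : V, [/\ tan0 H mu,
  forall g, Kiso H g -> iota_ mu *m g = iota_ mu,
  forall X, lie H X -> dot mu (accel X) <= 0 &
  forall X, lie H X -> dot mu (accel X) = 0 ->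
    forall Z, lie H Z -> lie H (br (Ymx (pi_ (e0 *m X))) Z)].
Proof.
have s0 : [set x | lie H (vec_mx x)] 0 by rewrite /= linear0; exact: (lie0 HH).
have [|P [PT PP Pin Pfix]] := subspace_proj s0.
  by move=> a x y hx hy; rewrite /= linearP; apply: (lieD HH) => //; exact: lieZ.
have hP Z : mxvec Z *m P = mxvec Z <-> lie H Z.
  split=> [ZP|hZ]; last by apply: Pfix; rewrite /= mxvecK.
  by have := Pin (mxvec Z); rewrite /= ZP mxvecK.
have [v w|a v|mu hmu] := @riesz R _ (fun v => admtr P (Ymx v)).
- by rewrite YmxD admtrD.
- by rewrite YmxZ admtrZ.
have stab X : lie H X -> stable P X by move=> hX Z /hP hZ; apply/hP; exact: lie_br.
have conj g v v' : Kiso H g -> iota_ v *m g = iota_ v' -> dot mu v' = dot mu v.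
  move=> [hg eg] vg; have Gg := HG HH hg; have og := Kiso_orth Gg eg.
  have gT : invmx g = g^T by rewrite -[RHS]mul1mx -[X in X *m _](mulVmx (Ghat_unit Gg)) -mulmxA og mulmx1.
  have h1 Z : mxvec Z *m P = mxvec Z -> mxvec (g *m Z *m g^T) *m P = mxvec (g *m Z *m g^T).
    by move=> /hP hZ; apply/hP; rewrite -gT; exact: (lie_conj HH).
  have h2 Z : mxvec Z *m P = mxvec Z -> mxvec (g^T *m Z *m g) *m P = mxvec (g^T *m Z *m g).
    by move=> /hP hZ; apply/hP; rewrite -gT; exact: (lie_conjV HH).
  rewrite -!hmu -(admtr_conj PT PP _ og h1 h2) -(Y_conj Gg eg vg).
  by rewrite !mulmxA og mul1mx -mulmxA og mulmx1.
have key X : lie H X -> 0 <= -2 * dot mu (accel X) /\ (-2 * dot mu (accel X) = 0 -> stable P X^T).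
  by move=> hX; have := stable_adjoint PT PP (stab X hX); rewrite (br_tr (lie_uLie HH hX)) hmu dotZr.
exists mu; split.
(* An isotropy element reverses [xi], hence mu . xi = 0. *)
- apply: unu0_perp => xi hxi; have hN : unu0 H (- xi).
    by have [h1 h2] := hxi; split; [rewrite -scaleN1r; exact: nu0Z|rewrite dotNl dotNr opprK].
  have [g hg xg] := Kiso_trans HH Hthin Hcodim hxi hN.
  by have := conj g _ _ hg xg; rewrite dotNr; lra.
- move=> g hg; have [Hg eg] := hg; have Gg := HG HH Hg.
  rewrite (Kiso_iota _ Gg eg); congr iota_; apply/esym.
  have e1 := conj g mu _ hg (Kiso_iota _ Gg eg).
  apply: dot_CS_eq; first by rewrite e1.
  by rewrite Kiso_dot.
- by move=> X hX; have [] := key X hX; lra.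
(* In the case of equality ad (X^T) preserves the Lie algebra as ad X does; their sum is twice the
   adjoint action of the boost. *)
move=> X hX h0 Z hZ; have [_ /(_ _)/(_ Z) hT] := key X hX.
have {hT} : lie H (br X^T Z) by apply/hP/hT; [rewrite h0 mulr0|apply/hP].
move=> /(lieD HH (lie_br hX hZ)) /(lieZ 2^-1).
congr (lie H _); rewrite (_ : br X Z + br X^T Z = br (X + X^T) Z); last first.
  by rewrite /br mulmxDl mulmxDr opprD addrACA.
rewrite (uLie_sym (lie_uLie HH hX)); move: (Ymx _) => Y0.
by rewrite /br -scalemxAl -scalemxAr -scalerBr scalerA mulVf ?scale1r // pnatr_eq0.
Qed.
End Boost.

(** * The fixed boundary point *)

Section Derivation.
Variables (R : realType) (m : nat) (E : 'M[R]_m).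
Hypotheses (E3 : E *m E *m E = E) (ET : E^T = E).
Implicit Types (N K : 'M[R]_m).

(* This derivation has eigenvalues among -2, -1, 0, 1, 2. *)
Definition DD := locked (fun N => br N E).
Lemma DDE N : DD N = N *m E - E *m N. Proof. by rewrite /DD -lock. Qed.

Lemma DDD N N' : DD (N + N') = DD N + DD N'.
Proof. by rewrite !DDE mulmxDl mulmxDr opprD addrACA. Qed.
Lemma DDZ a N : DD (a *: N) = a *: DD N.
Proof. by rewrite !DDE -scalemxAl -scalemxAr scalerBr. Qed.
Lemma DDN N : DD (- N) = - DD N.
Proof. by rewrite -scaleN1r DDZ scaleN1r. Qed.

Lemma DD_tr N K : \tr (DD N *m K^T) = \tr (N *m (DD K)^T).
Proof.
rewrite !DDE mulmxBl [(_ - _)^T]raddfB /= mulmxBr !trmx_mul ET [LHS]raddfB [RHS]raddfB /=.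
by congr (_ - _); [rewrite mulmxA|rewrite -mulmxA mxtrace_mulC mulmxA].
Qed.

Lemma DD_frob N : \tr (DD N *m N^T) = - \tr (E *m br N N^T).
Proof.
rewrite DDE /br mulmxBl mulmxBr [LHS]raddfB [X in _ = - X]raddfB /= opprB; congr (_ - _).
  by rewrite -mulmxA mxtrace_mulC -mulmxA.
by rewrite mulmxA.
Qed.

Let DD2 N : DD (DD N) = N *m E *m E - 2 *: (E *m N *m E) + E *m E *m N.
Proof.
rewrite !DDE !mulmxBl !mulmxBr !mulmxA.
move: (N *m E *m E) (E *m N *m E) (E *m E *m N) => a b c.
by apply/matrixP => i j; rewrite !mxE; ring.
Qed.

Let E3r N : N *m E *m E *m E = N *m E.
Proof. by rewrite -!mulmxA [E *m (E *m E)]mulmxA E3. Qed.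

Let DD2l N : DD (DD (E *m N)) = E *m N *m E *m E - 2 *: (E *m E *m N *m E) + E *m N.
Proof. by rewrite DD2 !mulmxA E3. Qed.
Let DD2r N : DD (DD (N *m E)) = N *m E - 2 *: (E *m N *m E *m E) + E *m E *m N *m E.
Proof. by rewrite DD2 !mulmxA E3r. Qed.

Let DD3 N : DD (DD (DD N)) = N *m E - E *m N - 3 *: (E *m N *m E *m E) + 3 *: (E *m E *m N *m E).
Proof.
rewrite [X in DD (DD X)]DDE !(DDD, DDN) DD2l DD2r.
move: (N *m E) (E *m N) (E *m N *m E *m E) (E *m E *m N *m E) => a b c d.
by apply/matrixP => i j; rewrite !mxE; ring.
Qed.

(** [E] has eigenvalues -1, 0, 1; those of the derivation are their differences, the roots of x (x^2
    - 1) (x^2 - 4). *)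
Lemma DD5 N : DD (DD (DD (DD (DD N)))) - 5 *: DD (DD (DD N)) + 4 *: DD N = 0.
Proof.
have p2 : DD (DD (E *m N *m E *m E)) = 2 *: (E *m N *m E *m E) - 2 *: (E *m E *m N *m E).
  rewrite DD2r !mulmxA E3 E3r; move: (E *m N *m E *m E) (E *m E *m N *m E) => a b.
  by apply/matrixP => i j; rewrite !mxE; ring.
have r2 : DD (DD (E *m E *m N *m E)) = 2 *: (E *m E *m N *m E) - 2 *: (E *m N *m E *m E).
  rewrite DD2r !mulmxA E3; move: (E *m N *m E *m E) (E *m E *m N *m E) => a b.
  by apply/matrixP => i j; rewrite !mxE; ring.
rewrite (DD3 N) !(DDD, DDN, DDZ) p2 r2 DD2l DD2r DDE.
move: (N *m E) (E *m N) (E *m N *m E *m E) (E *m E *m N *m E) => a b c d.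
by apply/matrixP => i j; rewrite !mxE; ring.
Qed.

(* A derivation-stable space on which [<DD N, N>] is nonnegative only meets *)
(* the eigenspaces for 0, 1, 2.                                            *)
Lemma DD_cubic (S : set 'M[R]_m) : (forall N N', S N -> S N' -> S (N + N')) -> (forall a N, S N -> S (a *: N)) ->
  (forall N, S N -> S (DD N)) -> (forall N, S N -> 0 <= \tr (DD N *m N^T)) ->
  forall N, S N -> DD (DD (DD N)) = 3 *: DD (DD N) - 2 *: DD N.
Proof.
move=> SD SZ SDD Spos N SN.
(* The factor (x + 1) (x + 2) is injective on [S]: the derivation is symmetric for the trace form,
   and nonnegative on [S]. *)
have zero K : S K -> DD (DD K) + 3 *: DD K + 2 *: K = 0 -> K = 0.
  move=> SK K2; apply: frob_eq0; have h1 := Spos K SK; have h2 := frob_ge0 K; have h3 := frob_ge0 (DD K).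
  have : \tr ((DD (DD K) + 3 *: DD K + 2 *: K) *m K^T) = 0 by rewrite K2 mul0mx mxtrace0.
  rewrite !mulmxDl -!scalemxAl !mxtraceD !mxtraceZ DD_tr; lra.
(* The complementary factor x (x - 1) (x - 2) of the polynomial in [DD5]. *)
pose K := DD (DD (DD N)) - 3 *: DD (DD N) + 2 *: DD N.
have SK : S K.
  apply: (SD); last by apply: (SZ); apply: (SDD).
  apply: (SD); first by apply: (SDD); apply: (SDD); apply: (SDD).
  by rewrite -scaleNr; apply: (SZ); apply: (SDD); apply: (SDD).
have K2 : DD (DD K) + 3 *: DD K + 2 *: K = 0.
  have h := DD5 N; rewrite -[RHS]h /K !(DDD, DDN, DDZ).
  move: (DD (DD (DD (DD (DD N))))) (DD (DD (DD (DD N)))) (DD (DD (DD N))) (DD (DD N)) (DD N) => a b c d f.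
  by apply/matrixP => i j; rewrite !mxE; ring.
have K0 : K = 0 by apply: zero SK K2.
move: K0; rewrite /K => /eqP; rewrite -addrA addr_eq0 => /eqP ->.
by rewrite opprD opprK.
Qed.
End Derivation.

(** * The graded Lie algebra and the null vector q *)

Section Grading.
Variables (R : realType) (n : nat).
Local Notation V := (realCn R n).
Local Notation W := (realCn R n.+1).
Local Notation MM := 'M[R]_(n.+1 + n.+1).
Implicit Types (X Y N Z : MM) (x y : W) (u v w z : V).
Local Notation e0 := (e0 R n).
Local Notation f0 := (f0 R n).
Variable e : V.
Hypothesis e1 : dot e e = 1.
Let E := Ymx e.
Let q : W := lift e.
Let q' : W := lift (- e).

Let ee : dot e (Jmul e) = 0. Proof. exact: dotxJx. Qed.
Let Jee : dot (Jmul e) e = 0. Proof. exact: dotJxx. Qed.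
Let JeJe : dot (Jmul e) (Jmul e) = 1. Proof. by rewrite dotJJ. Qed.

Lemma pi_EE x : pi_ (x *m E *m E) = dot (pi_ x) e *: e + dot (pi_ x) (Jmul e) *: Jmul e.
Proof. by rewrite pi_Y c0_Y c1_Y. Qed.

Lemma E_cube : E *m E *m E = E.
Proof.
apply: row_ext => x; rewrite !mulmxA; apply: Wext; rewrite ?c0_Y ?c1_Y.
- by rewrite pi_EE dotDl !dotZl e1 Jee; ring.
- by rewrite pi_EE dotDl !dotZl ee JeJe; ring.
by rewrite 2!pi_Y !c0_Y !c1_Y !pi_Y !dotDl !dotZl e1 ee Jee JeJe; congr (_ *: _ + _ *: _); ring.
Qed.

Lemma E_mul3 x : x *m E *m E *m E = x *m E.
Proof. by rewrite -!mulmxA [E *m (E *m E)]mulmxA E_cube. Qed.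

Lemma E_eig1 x : x *m E = x -> exists a b, x = cs a b q.
Proof.
move=> h; exists (c0 x), (c1 x); rewrite /cs /q; apply: Wext.
- by rewrite !cX; ring.
- by rewrite !cX; ring.
by rewrite -{1}h pi_Y piD !piZ piJ pi_lift.
Qed.

Lemma E_eigN1 x : x *m E = - x -> exists a b, x = cs a b q'.
Proof.
move=> h; exists (c0 x), (c1 x); rewrite /cs /q'; apply: Wext.
- by rewrite !cX; ring.
- by rewrite !cX; ring.
by rewrite -[x in LHS]opprK -h piN pi_Y piD !piZ piJ pi_lift JmulN !scalerN opprD.
Qed.

Lemma E_ker x : x *m E = 0 -> [/\ x = iota_ (pi_ x), dot (pi_ x) e = 0 & dot (pi_ x) (Jmul e) = 0].
Proof.
move=> h; have h0 := c0_Y x e; have h1 := c1_Y x e; rewrite -/E h in h0 h1.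
have hp := pi_Y x e; rewrite -/E h /pi_ mul0mx in hp.
have z0 : c0 (0 : W) = 0 by rewrite /c0 dot0l.
have z1 : c1 (0 : W) = 0 by rewrite /c1 dot0l.
have k0 : c0 x = 0.
  have := congr1 (fun v => dot v e) hp; rewrite dot0l dotDl !dotZl e1 Jee; lra.
have k1 : c1 x = 0.
  have := congr1 (fun v => dot v (Jmul e)) hp; rewrite dot0l dotDl !dotZl ee JeJe; lra.
by split; [rewrite {1}[x]decompE k0 k1 !scale0r !add0r|rewrite -h0|rewrite -h1].
Qed.

Lemma iota_E z : dot z e = 0 -> dot z (Jmul e) = 0 -> iota_ z *m E = 0.
Proof. by move=> h1 h2; rewrite YmxE !iotaK h1 h2 !cX !scale0r !addr0. Qed.

Lemma qE : q *m E = q.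
Proof.
apply: Wext; rewrite ?c0_Y ?c1_Y ?pi_Y pi_lift ?c0_lift ?c1_lift //.
by rewrite scale1r scale0r addr0.
Qed.
Lemma q'E : q' *m E = - q'.
Proof.
apply: Wext; rewrite ?c0_Y ?c1_Y ?pi_Y ?c0N ?c1N ?piN ?pi_lift ?c0_lift ?c1_lift //.
- by rewrite dotNl e1.
- by rewrite dotNl ee.
by rewrite scale1r scale0r addr0 opprK.
Qed.

Lemma E_eig_big x (a : R) : x *m E = a *: x -> a ^+ 3 != a -> x = 0.
Proof.
move=> h ha; have := E_mul3 x; rewrite h -!scalemxAl h -!scalemxAl h !scalerA => /eqP.
rewrite -subr_eq0 -scalerBl scaler_eq0 subr_eq0 => /orP[|/eqP //].
by move=> /eqP k; move: ha; rewrite -[X in _ != X]k !exprS expr0 mulr1 mulrA eqxx.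
Qed.

Variable H : set MM.
Hypothesis HH : closed_subgroup H.
Hypothesis HE : forall Z, lie H Z -> lie H (br E Z).
Hypothesis Hpos : forall X, lie H X -> 0 <= dot e (accel X).
Local Notation D := (DD E).

Lemma lie_DD N : lie H N -> lie H (D N).
Proof.
by move=> hN; rewrite DDE -opprB; apply: lieN; exact: HE.
Qed.

Lemma lie_cubic N : lie H N -> D (D (D N)) = 3 *: D (D N) - 2 *: D N.
Proof.
apply: (DD_cubic E_cube (Ymx_tr e)) => {N}; [exact: (lieD HH)|exact: lieZ|exact: lie_DD|].
move=> N hN; have uN := lie_uLie HH hN.
have := DD_frob E N; rewrite (br_tr uN) mxtrace_Y dotZr => ->; have := Hpos hN; lra.
Qed.

(** [q] is an eigenvector of [E] for 1. On the component of q N for an eigenvalue a of [E] the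
    derivation acts as a - 1, one of -2, -1, 0, which has to be a root of x (x - 1) (x - 2); so only
    a = 1 occurs. *)
Lemma lie_q N : lie H N -> exists a b, q *m N = cs a b q.
Proof.
move=> hN; apply: E_eig1; set x := q *m N.
have xD K : q *m D K = q *m K *m E - q *m K by rewrite DDE mulmxBr !mulmxA qE.
have := congr1 (mulmx q) (lie_cubic hN); rewrite mulmxBr -!scalemxAr !xD -/x.
rewrite !mulmxBl E_mul3 => h.
have h1 : x *m E *m E - 2 *: (x *m E) + x = 0.
  move: h; move: (x *m E *m E) (x *m E) => a b h.
  apply/rowP => i; have := congr1 (fun v : 'rV_(n.+1 + n.+1) => v 0 i) h; rewrite !mxE; lra.
have h2 : x *m E - x *m E *m E = 0.
  have := congr1 (mulmxr E) h1; rewrite /= mul0mx mulmxDl mulmxBl -scalemxAl E_mul3.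
  move: (x *m E *m E) (x *m E) => a b k.
  apply/rowP => i; have := congr1 (fun v : 'rV_(n.+1 + n.+1) => v 0 i) k; rewrite !mxE; lra.
move: h1 h2; move: (x *m E *m E) (x *m E) => a b h1 h2.
apply/rowP => i; have := congr1 (fun v : 'rV_(n.+1 + n.+1) => v 0 i) h1.
by have := congr1 (fun v : 'rV_(n.+1 + n.+1) => v 0 i) h2; rewrite !mxE; lra.
Qed.

Lemma q_decomp N : lie H N -> q *m N = cs (dot e (pi_ (e0 *m N))) (c1 (e0 *m N) - dot (Jmul e) (pi_ (e0 *m N))) q.
Proof.
move=> hN; have uN := lie_uLie HH hN; have [hJ hB] := uN; have [a [b hq]] := lie_q hN.
have qN : q *m N = e0 *m N + iota_ e *m N by rewrite /q /lift mulmxDl.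
have ca : c0 (q *m N) = a by rewrite hq /cs !cX; ring.
have cb : c1 (q *m N) = b by rewrite hq /cs !cX; ring.
have k0 : c0 (iota_ e *m N) = dot e (pi_ (e0 *m N)).
  by rewrite -[LHS]opprK -Be0 hB opprK B_iota_l.
have k1 : c1 (iota_ e *m N) = - dot (Jmul e) (pi_ (e0 *m N)).
  by rewrite -[LHS]opprK -Bf0 hB opprK /f0 -hJ B_iota_l piJ dotJl opprK.
rewrite hq -ca -cb qN !cX k0 k1 uLie_c0 // add0r.
by congr (cs _ _ _); rewrite ?add0r.
Qed.

Lemma pi_DD N : lie H N -> pi_ (e0 *m D N) = pi_ (e0 *m N) - dot e (pi_ (e0 *m N)) *: e +
  dot (Jmul e) (pi_ (e0 *m N)) *: Jmul e.
Proof.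
move=> hN; have uN := lie_uLie HH hN; have := q_decomp hN.
have -> : q *m N = e0 *m N + iota_ e *m N by rewrite /q /lift mulmxDl.
move=> /(congr1 (@pi_ R n)); rewrite /cs !piD !piZ piJ pi_lift => h.
rewrite DDE mulmxBr !mulmxA piB pi_Y uLie_c0 // scale0r add0r.
have -> : e0 *m E = iota_ e by rewrite YmxE !cX pi_e0 !dot0l !scale0r scale1r !addr0.
move: h; move: (pi_ (iota_ e *m N)) (pi_ (e0 *m N)) (c1 _) (dot e _) (dot (Jmul e) _) => x y a b c h.
move: h; move: (Jmul e) => Je h.
apply/rowP => i; have := congr1 (fun v : 'rV_(n + n) => v 0 i) h; rewrite !mxE; lra.
Qed.

Lemma cs_mulmx N a b x : uLie N -> cs a b x *m N = cs a b (x *m N).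
Proof. by move=> [hJ _]; rewrite /cs mulmxDl -!scalemxAl hJ. Qed.

Lemma c0_iota N z : uLie N -> c0 (iota_ z *m N) = B (iota_ z) (e0 *m N).
Proof. by move=> [_ hB]; rewrite -[LHS]opprK -Be0 hB opprK. Qed.
Lemma c1_iota N z : uLie N -> c1 (iota_ z *m N) = B (iota_ z) (Jmul (e0 *m N)).
Proof. by move=> [hJ hB]; rewrite -[LHS]opprK -Bf0 hB opprK hJ. Qed.

Lemma perp_decomp z : exists z0, [/\ dot z0 e = 0, dot z0 (Jmul e) = 0 &
  z = z0 + cs (dot z e) (dot z (Jmul e)) e].
Proof.
exists (z - cs (dot z e) (dot z (Jmul e)) e); split; last by rewrite subrK.
  by rewrite dotBl /cs dotDl !dotZl e1 Jee; ring.
by rewrite dotBl /cs dotDl !dotZl ee JeJe; ring.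
Qed.

Lemma B_csr (x y : W) a b : B x (cs a b y) = a * B x y + b * B x (Jmul y).
Proof. by rewrite /cs BDr !BZr. Qed.
Lemma Jcs a b x : Jmul (cs a b x) = cs a b (Jmul x).
Proof. by rewrite /cs JmulD !JmulZ. Qed.

Lemma e0_qq : e0 = 2^-1 *: (q + q').
Proof.
rewrite /q /q' /lift iotaN addrACA subrr addr0; move: e0 => y.
by apply/rowP => i; rewrite !mxE; field.
Qed.

Lemma Bq x : B x q = - c0 x + dot (pi_ x) e.
Proof. by rewrite /q /lift BDr Be0 BC B_iota_l dotC. Qed.
Lemma BJq x : B x (Jmul q) = - c1 x + dot (pi_ x) (Jmul e).
Proof. by rewrite /q /lift JmulD BDr Bf0 -iotaJ BC B_iota_l dotC. Qed.

(** Skewness for h recovers [N] from the vector m = e0 N: the coefficients in C q of the images of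
    vectors orthogonal to C e are products with m. *)
Lemma formula_gen N (m : W) x : uLie N -> e0 *m N = m -> q *m N = 0 ->
  (forall z, dot z e = 0 -> dot z (Jmul e) = 0 -> exists a b, iota_ z *m N = cs a b q) ->
  B (iota_ e) m = 0 -> B (iota_ e) (Jmul m) = 0 ->
  x *m N = cs (B (iota_ (pi_ x)) m) (B (iota_ (pi_ x)) (Jmul m)) q - cs (B x q) (B x (Jmul q)) m.
Proof.
move=> uN em qN hz em0 em1; have ieN : iota_ e *m N = - m.
  by apply/eqP; rewrite -addr_eq0 addrC -em -mulmxDl -/q qN.
have [z0 [z0e z0J zE]] := perp_decomp (pi_ x).
have [a [b z0N]] := hz z0 z0e z0J.
have Bz y : B (iota_ e) y = 0 -> B (iota_ e) (Jmul y) = 0 -> B (iota_ (pi_ x)) y = B (iota_ z0) y.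
  move=> h1 h2; rewrite zE iotaD BDl /cs iotaD !iotaZ iotaJ BDl !BZl BJl h1 h2; ring.
have az : a = B (iota_ (pi_ x)) m.
  by rewrite Bz // -em -c0_iota // z0N /cs !cX; ring.
have bz : b = B (iota_ (pi_ x)) (Jmul m).
  by rewrite Bz ?JmulJ ?BNr ?em0 ?em1 ?oppr0 // -em -c1_iota // z0N /cs !cX; ring.
rewrite -az -bz {1}[x]decompE -[c0 x *: _ + _]/(cs (c0 x) (c1 x) e0) mulmxDl cs_mulmx // em.
rewrite {1}zE iotaD mulmxDl z0N.
rewrite iota_cs cs_mulmx // ieN Bq BJq /cs JmulN; vec.
Qed.

(** The polynomial 2 x - x^2 is 1 at 1 and 0 at 0 and 2, so [N] is the component of [X] for the
    eigenvalue 1. These elements belong to the Heisenberg algebra of [q]. *)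
Lemma heis1 w : tan0 H w -> dot w e = 0 -> dot w (Jmul e) = 0 -> exists2 N, lie H N &
  [/\ q *m N = 0, e0 *m N = iota_ w & forall x, x *m N = cs (dot (pi_ x) w) (dot (pi_ x) (Jmul w)) q - cs (B x q) (B x (Jmul q)) (iota_ w)].
Proof.
move=> [X hX Xw] we wJ; have hD := lie_DD hX; have hDD := lie_DD hD.
pose N := 2 *: D X - D (D X).
have hN : lie H N by apply: (lieD HH); [exact: lieZ|exact: lieN].
have uN := lie_uLie HH hN.
have DN : D N = N.
  rewrite /N DDD DDN DDZ (lie_cubic hX); move: (D (D X)) (D X) => a b.
  by apply/matrixP => i j; rewrite !mxE; ring.
have pD : pi_ (e0 *m D X) = w.
  by rewrite pi_DD // Xw dotC we dotC wJ !scale0r subr0 addr0.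
have pN : pi_ (e0 *m N) = w.
  rewrite /N mulmxBr -scalemxAr piB piZ pD (pi_DD hD) pD dotC we dotC wJ !scale0r subr0 addr0.
  by apply/rowP => i; rewrite !mxE; ring.
clearbody N; have NE (y : W) : y *m N *m E - y *m E *m N = y *m N by rewrite -[in RHS]DN DDE mulmxBr !mulmxA.
have qN : q *m N = 0.
  apply: (@E_eig_big _ 2); first by have := NE q; rewrite qE => /eqP; rewrite subr_eq => /eqP ->; rewrite -mulr2n -scaler_nat.
  by rewrite -natrX eqr_nat.
have q'N : q' *m N *m E = 0.
  by have := NE q'; rewrite q'E mulNmx opprK -[in RHS](add0r (q' *m N)) => /addIr.
have eN : e0 *m N = iota_ w.
  have h : e0 *m N *m E = 0 by rewrite e0_qq -!scalemxAl mulmxDl qN add0r q'N scaler0.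
  by have [-> _ _] := E_ker h; rewrite pN.
have hz z : dot z e = 0 -> dot z (Jmul e) = 0 -> exists a b, iota_ z *m N = cs a b q.
  move=> h1 h2; apply: E_eig1; have := NE (iota_ z); rewrite iota_E // mul0mx subr0 //.
exists N => //; split=> // x.
have h1 : B (iota_ e) (iota_ w) = 0 by rewrite Bii dotC.
have h2 : B (iota_ e) (Jmul (iota_ w)) = 0 by rewrite -iotaJ Bii dotJs wJ oppr0.
by rewrite (formula_gen x uN eN qN hz h1 h2) -iotaJ !Bii.
Qed.

Hypotheses (Te : tan0 H e) (TJe : tan0 H (Jmul e)).

(** The polynomial (x^2 - x) / 2 selects the eigenvalue 2, which gives the center of the Heisenberg
    algebra. *)
Lemma heis2 : exists2 N, lie H N & forall x, x *m N = - cs (B x q) (B x (Jmul q)) (Jmul q).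
Proof.
have [X hX Xw] := TJe; have hD := lie_DD hX; have hDD := lie_DD hD.
pose N := 2^-1 *: (D (D X) - D X).
have hN : lie H N by apply: lieZ; apply: (lieD HH) => //; exact: lieN.
have uN := lie_uLie HH hN.
have DN : D N = 2 *: N.
  rewrite /N DDZ DDD DDN (lie_cubic hX); move: (D (D X)) (D X) => a b.
  by apply/matrixP => i j; rewrite !mxE; field.
have pD : pi_ (e0 *m D X) = 2 *: Jmul e.
  rewrite pi_DD // Xw ee JeJe scale0r subr0 scale1r -mulr2n scaler_nat //.
have pN : pi_ (e0 *m N) = Jmul e.
  rewrite /N -scalemxAr mulmxBr piZ piB (pi_DD hD) pD !dotZr ee JeJe.
  by move: (Jmul e) => Je; apply/rowP => i; rewrite !mxE; field.
clearbody N; have NE (y : W) : y *m N *m E - y *m E *m N = 2 *: (y *m N).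
  by rewrite scalemxAr -DN DDE mulmxBr !mulmxA.
have qN : q *m N = 0.
  apply: (@E_eig_big _ 3); first by have := NE q; rewrite qE => /eqP; rewrite subr_eq => /eqP ->; apply/rowP => i; rewrite !mxE; ring.
  by rewrite -natrX eqr_nat.
have q'N : q' *m N *m E = q' *m N.
  have := NE q'; rewrite q'E mulNmx opprK => /eqP; rewrite -subr_eq0 => /eqP h.
  apply/eqP; rewrite -subr_eq0 -[X in X == _]/(_ - _) -h; apply/eqP/rowP => i; rewrite !mxE; ring.
have eN : e0 *m N = Jmul q.
  have h : e0 *m N *m E = e0 *m N by rewrite e0_qq -!scalemxAl mulmxDl qN add0r q'N.
  have [a [b ab]] := E_eig1 h.
  have := pN; rewrite ab /cs piD !piZ piJ pi_lift => k.
  have a0 : a = 0 by have := congr1 (fun v => dot v e) k; rewrite dotDl !dotZl e1 Jee; lra.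
  have b1 : b = 1 by have := congr1 (fun v => dot v (Jmul e)) k; rewrite dotDl !dotZl ee JeJe; lra.
  by rewrite a0 b1 scale0r scale1r add0r.
have hz z : dot z e = 0 -> dot z (Jmul e) = 0 -> iota_ z *m N = 0.
  move=> h1 h2; apply: (@E_eig_big _ 2); last by rewrite -natrX eqr_nat.
  by have := NE (iota_ z); rewrite iota_E // mul0mx subr0.
exists N => // x; have [z0 [z0e z0J zE]] := perp_decomp (pi_ x).
have ieN : iota_ e *m N = - Jmul q.
  by apply/eqP; rewrite -addr_eq0 addrC -eN -mulmxDl -/q qN.
rewrite {1}[x]decompE -[c0 x *: _ + _]/(cs (c0 x) (c1 x) e0) mulmxDl cs_mulmx // eN.
rewrite {1}zE iotaD mulmxDl hz // add0r.
by rewrite iota_cs cs_mulmx // ieN Bq BJq /cs !JmulN JmulJ; move: q => qq; vec.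
Qed.

(** The polynomial 1 - 3 x / 2 + x^2 / 2 selects the eigenvalue 0, and subtracting a multiple of J
    gives q X = q. Normal vectors stay normal since brackets with the elements of [heis1] are in the
    Lie algebra. *)
Lemma dilation : exists2 X, lie H X & q *m X = q /\
  forall xi, nu0 H xi -> exists xi', [/\ nu0 H xi', iota_ xi *m X = iota_ xi' & dot xi xi' = 0].
Proof.
have [X hX Xw] := Te; have hD := lie_DD hX; have hDD := lie_DD hD.
pose N := X - (3 / 2) *: D X + 2^-1 *: D (D X).
have hN : lie H N.
  by apply: (lieD HH); [apply: (lieD HH) => //; apply: lieN; exact: lieZ|exact: lieZ].
have DN : D N = 0.
  rewrite /N !DDD DDN !DDZ (lie_cubic hX); move: (D (D X)) (D X) => a b.
  by apply/matrixP => i j; rewrite !mxE; field.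
have pD : pi_ (e0 *m D X) = 0 by rewrite pi_DD // Xw e1 Jee scale0r scale1r subrr addr0.
have pN : pi_ (e0 *m N) = e.
  rewrite /N mulmxDr mulmxBr -!scalemxAr piD piB !piZ Xw (pi_DD hD) pD !dot0r !scale0r subrr addr0 !scaler0.
  by rewrite subr0 addr0.
clearbody N; pose th := c1 (e0 *m N); pose Y := N - th *: @Jmx R n.+1.
have hY : lie H Y by apply: (lieD HH) => //; apply: lieN; apply: lieZ; exact: (lie_J HH).
have uY := lie_uLie HH hY; have [_ YB] := uY.
have YxE x : x *m Y = x *m N - th *: Jmul x by rewrite mulmxBr -scalemxAr -JmulE.
have qY : q *m Y = q.
  rewrite YxE (q_decomp hN) pN e1 Jee subr0 -/th /cs scale1r addrK //.
have YE x : x *m Y *m E = x *m E *m Y.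
  have NE : N *m E = E *m N by apply/eqP; rewrite -subr_eq0 -DDE DN.
  rewrite !YxE mulmxBl -!mulmxA NE -scalemxAl; congr (_ - _ *: _).
  by have [h _] := uLie_Y e; rewrite h.
have Yperp z : dot z e = 0 -> dot z (Jmul e) = 0 ->
    [/\ iota_ z *m Y = iota_ (pi_ (iota_ z *m Y)), dot (pi_ (iota_ z *m Y)) e = 0 & dot (pi_ (iota_ z *m Y)) (Jmul e) = 0].
  by move=> h1 h2; apply: E_ker; rewrite YE iota_E // mul0mx.
have Bqq' : B q q' = -2 by rewrite B_lift dotNr e1; ring.
have BqJq' : B q (Jmul q') = 0.
  by rewrite BC Bq /q' /lift JmulD iotaN JmulN -iotaJ piB iotaK pi_f0 !cX sub0r dotNl Jee; ring.
have q'Y : q' *m Y = - q'.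
  have [a [b ab]] : exists a b, q' *m Y = cs a b q' by apply: E_eigN1; rewrite YE q'E mulNmx.
  have h1 := YB q q'; rewrite qY ab B_csr Bqq' BqJq' in h1.
  have h2 := YB q (Jmul q'); have [YJ _] := uY.
  rewrite -YJ qY ab BqJq' Jcs B_csr JmulJ BNr Bqq' BqJq' in h2.
  have a1 : a = -1 by lra.
  have b0 : b = 0 by lra.
  by rewrite ab a1 b0 /cs scaleN1r scale0r addr0.
have eY : e0 *m Y = iota_ e.
  rewrite [e0 in LHS]e0_qq -scalemxAl mulmxDl qY q'Y /q /q' /lift iotaN.
  by move: e0 (iota_ e) => y y'; apply/rowP => i; rewrite !mxE; field.
exists Y => //; split=> // xi hxi.
have xe : dot xi e = 0 by rewrite dotC; exact: hxi.
have xJ : dot xi (Jmul e) = 0 by rewrite dotC; exact: hxi.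
have [xY h1 h2] := Yperp xi xe xJ; exists (pi_ (iota_ xi *m Y)); split=> //; last first.
  rewrite -B_iota_l; set x := iota_ _; by have := YB x x; rewrite [B x (_ *m _)]BC; lra.
move=> v hv; have [w [we wJ vE]] := perp_decomp v.
have hw : tan0 H w.
  rewrite (_ : w = v + (-1) *: cs (dot v e) (dot v (Jmul e)) e); last by rewrite {1}vE scaleN1r addrK.
  by apply: (tan0D HH) => //; apply: tan0Z; apply: (tan0D HH); exact: tan0Z.
have -> : dot v (pi_ (iota_ xi *m Y)) = dot w (pi_ (iota_ xi *m Y)).
  by rewrite {1}vE dotDl /cs dotDl !dotZl ![dot _ (pi_ _)]dotC h1 h2 !mulr0 !addr0.
rewrite -B_iota_l -[LHS]opprK -YB.
have [N1 hN1 [qN eN _]] := heis1 hw we wJ.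
have ieN : iota_ e *m N1 = - iota_ w.
  by apply/eqP; rewrite -addr_eq0 addrC -eN -mulmxDl -/q qN.
have h3 : tan0 H (pi_ (iota_ w *m Y) + w).
  exists (br N1 Y); first exact: (lie_br HH).
  by rewrite /br mulmxBr !mulmxA eN eY ieN opprK piD iotaK.
have := hxi _ h3; rewrite dotDl (hxi _ hw) addr0 => h4.
by have [wY _ _] := Yperp w we wJ; rewrite wY Bii h4 oppr0.
Qed.
End Grading.

(** * The function rho *)

Section Level.
Variables (R : realType) (n : nat).
Local Notation V := (realCn R n).
Local Notation W := (realCn R n.+1).
Local Notation MM := 'M[R]_(n.+1 + n.+1).
Implicit Types (X Y N g : MM) (x y : W) (u v w z xi : V) (P : 'M[R]_(n + n)).
Local Notation e0 := (e0 R n).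
Local Notation f0 := (f0 R n).

Lemma B_csl (a b : R) x y : B (cs a b x) y = a * B x y - b * B x (Jmul y).
Proof. by rewrite /cs BDl !BZl BJl mulrN. Qed.

(* [fform x p y] is the real part of [conj h(x, p) h(x, y)] *)
Definition fform x (p y : W) : R := B x p * B x y + B x (Jmul p) * B x (Jmul y).

Lemma fform_cs x p y a b a' b' : fform x (cs a b p) (cs a' b' y) =
  (a * a' + b * b') * fform x p y + (a * b' - b * a') * (B x p * B x (Jmul y) - B x (Jmul p) * B x y).
Proof. by rewrite /fform !Jcs !B_csr !JmulJ !BNr; ring. Qed.

Lemma fform_csl x p y a b : fform (cs a b x) p y = (a ^+ 2 + b ^+ 2) * fform x p y.
Proof. by rewrite /fform !B_csl !JmulJ !BNr; ring. Qed.

Lemma fform_self x p : fform x p p = hsq x p.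
Proof. by rewrite /fform /hsq !expr2. Qed.

Lemma fformDr x p y y' : fform x p (y + y') = fform x p y + fform x p y'.
Proof. by rewrite /fform JmulD !BDr; ring. Qed.

Variable e : V.
Let q := lift e.

(** The vector that represents the linear form xi |-> Re (conj h(x, q) h(x, xi)); see [Fvec_dot]. *)
Definition Fvec x : V := B x q *: pi_ x - B x (Jmul q) *: Jmul (pi_ x).

Lemma Fvec_dot x xi : dot (Fvec x) xi = fform x q (iota_ xi).
Proof.
rewrite /Fvec /fform dotBl !dotZl -iotaJ !(BC x (iota_ _)) !B_iota_l dotJl [dot xi _]dotC [dot (Jmul xi) _]dotC.
by rewrite mulrN opprK.
Qed.

(** The function rho before passing to the ball: a homogeneous function of degree 0 on C^(1+n). *)
Definition lev P x : R := dot (Fvec x *m P) (Fvec x *m P) / (hsq x q * - B x x).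

Definition rho P z : R := lev P (lift z).

Lemma dotP P v w : P^T = P -> P *m P = P -> dot (v *m P) (w *m P) = dot v (w *m P).
Proof. by move=> PT PP; rewrite -{1}PT dot_mul_tr -mulmxA PP. Qed.

Lemma hsq_csl x a b y : hsq (cs a b x) y = (a ^+ 2 + b ^+ 2) * hsq x y.
Proof. by rewrite -!fform_self fform_csl. Qed.

Lemma lev_cs P x a b : P^T = P -> P *m P = P -> a ^+ 2 + b ^+ 2 != 0 -> lev P (cs a b x) = lev P x.
Proof.
move=> PT PP ab; rewrite /lev B_cs hsq_csl.
have -> : Fvec (cs a b x) = (a ^+ 2 + b ^+ 2) *: Fvec x.
  by apply: dot_ext => v; rewrite dotZl !Fvec_dot fform_csl.
rewrite -scalemxAl dotZl dotZr; set c := a ^+ 2 + b ^+ 2 in ab *.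
rewrite mulrN mulrACA -mulrN -mulrA mulrA -mulrN; move: (dot _ _) (hsq x q * - B x x) => s t.
by rewrite mulrA -mulf_div divff ?mul1r // mulf_neq0.
Qed.

Lemma hsq_gt0 x : dot e e = 1 -> B x x < 0 -> 0 < hsq x q.
Proof.
move=> e1 hx; rewrite lt_def; apply/andP; split; last by rewrite addr_ge0 ?sqr_ge0.
apply/negP; rewrite /hsq paddr_eq0 ?sqr_ge0 // !sqrf_eq0 => /andP[/eqP h1 /eqP h2].
have [_ h] := B_timelike hx h1 h2.
have := congr1 (@c0 R n) (h _); rewrite /q B_lift e1 subrr => /(_ erefl).
by rewrite c0_lift /c0 dot0l => /eqP; rewrite oner_eq0.
Qed.

(** On a normal ray rho is sinh^2 of half the distance to 0. *)
Lemma rho0_nu P xi r : P^T = P -> P *m P = P -> dot e e = 1 -> dot xi e = 0 -> dot xi (Jmul e) = 0 -> xi *m P = xi ->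
  dot xi xi = 1 -> rho P (r *: xi) = r ^+ 2 / (1 - r ^+ 2).
Proof.
move=> PT PP e1 xe xJ xP x1.
have h0 : B (lift (r *: xi)) q = -1.
  by rewrite B_lift dotZl xe mulr0 sub0r.
have h1 : B (lift (r *: xi)) (Jmul q) = 0.
  by rewrite BJq c1_lift pi_lift dotZl xJ oppr0 mulr0 addr0.
rewrite /rho /lev /Fvec /hsq h0 h1 scale0r subr0 pi_lift B_lift.
rewrite -!scalemxAl xP !dotZl !dotZr x1; congr (_ / _); ring.
Qed.
End Level.

(** * Invariance of rho under the group *)

Section Classify.
Variables (R : realType) (n : nat).
Local Notation V := (realCn R n).
Local Notation W := (realCn R n.+1).
Local Notation MM := 'M[R]_(n.+1 + n.+1).
Implicit Types (X Y N g : MM) (x y : W) (u v w z xi eta : V) (P : 'M[R]_(n + n)).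
Local Notation e0 := (e0 R n).
Local Notation f0 := (f0 R n).
Variable H : set MM.
Hypothesis HH : closed_subgroup H.
Hypothesis Hthin : thin H.
Hypothesis Hcodim : forall xi, unu0 H xi -> exists2 eta, unu0 H eta & dot xi eta = 0.

(** The isotropy group preserves J v up to sign. It carries the direction of the normal part of J v
    to an orthogonal normal vector, whose product with J v is 0; so that normal part vanishes. *)
Lemma tan0_J_fixed v : tan0 H v -> (forall g, Kiso H g -> iota_ v *m g = iota_ v) -> tan0 H (Jmul v).
Proof.
move=> hv hK; apply: (unu0_perp HH) => xi hxi.
have [a [b [ha hb ab]]] := tan_nu HH (Jmul v).
have [b0|b0] := eqVneq b 0.
  by rewrite ab b0 addr0; have [h _] := hxi; exact: h.
have hbu := nu0_unit hb b0; set bu := _ *: b in hbu.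
have [eta he be] := Hcodim hbu; have [g hg bg] := Kiso_trans HH Hthin Hcodim hbu he.
have [Hg eg] := hg; have Gg := HG HH Hg; have [s s1 [gB gJ]] := Gg.
have Jg : iota_ (Jmul v) *m g = s *: iota_ (Jmul v).
  by rewrite !iotaJ -[in RHS](hK g hg) gJ scalerA -expr2 s1 scale1r.
have h : dot (Jmul v) bu = s * dot (Jmul v) eta.
  by rewrite -Bii -(gB (iota_ (Jmul v))) Jg bg BZl Bii.
have e0' : dot (Jmul v) eta = 0.
  have [he1 _] := he; rewrite ab dotDl (he1 _ ha) add0r.
  by move: be; rewrite /bu dotZl => /eqP; rewrite mulf_eq0 invr_eq0 sqrtr_eq0 leNgt dot_gt0 b0 => /eqP.
have := h; rewrite e0' mulr0 /bu dotZr => /eqP; rewrite mulf_eq0 invr_eq0 sqrtr_eq0 leNgt dot_gt0 b0 /=.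
by rewrite ab dotDl (hb _ ha) add0r dot_eq0 (negbTE b0).
Qed.

(** Acceleration is orthogonal to velocity, so an element with velocity [mu] is a case of equality.
    If [mu = 0], every X is one, and the bracket of X with the boost along its velocity lies in the
    Lie algebra and has velocity [accel X]. *)
Lemma flat_or_parabolic : (forall X, lie H X -> tan0 H (accel X)) \/
  exists e, [/\ dot e e = 1, tan0 H e, tan0 H (Jmul e), forall Z, lie H Z -> lie H (br (Ymx e) Z) &
    forall X, lie H X -> 0 <= dot e (accel X)].
Proof.
have [mu [Tmu Kmu neg eq0]] := mean_curvature_dir HH Hthin Hcodim.
have [mu0|mu0] := eqVneq mu 0.
  left=> X hX; exists (br (Ymx (pi_ (e0 *m X))) X); last by rewrite pi_br_Y //; exact: lie_uLie hX.
  by apply: eq0 => //; rewrite mu0 dot0l.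
right; pose r := Num.sqrt (dot mu mu); have r0 : 0 < r by rewrite sqrtr_gt0 dot_gt0.
have r2 : r ^+ 2 = dot mu mu by rewrite sqr_sqrtr ?dot_ge0.
exists ((- r^-1) *: mu); split.
- by rewrite dotZl dotZr mulrA mulrNN -expr2 exprVn r2 mulVf // -r2 gt_eqF ?exprn_gt0.
- exact: tan0Z.
- by rewrite JmulZ; apply: tan0Z; exact: tan0_J_fixed.
- move=> Z hZ; have [X hX Xmu] := Tmu.
  have h : lie H (br (Ymx mu) Z).
    by rewrite -Xmu; apply: eq0 => //; rewrite -Xmu dot_accel //; exact: lie_uLie hX.
  rewrite YmxZ (_ : br _ Z = (- r^-1) *: br (Ymx mu) Z); first exact: lieZ.
  by rewrite /br -scalemxAl -scalemxAr -scalerBr.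
move=> X hX; rewrite dotZl mulNr oppr_ge0; apply: mulr_ge0_le0; last exact: neg.
by rewrite invr_ge0 ltW.
Qed.

Variable e : V.
Hypotheses (e1 : dot e e = 1) (Te : tan0 H e) (TJe : tan0 H (Jmul e)).
Hypothesis HE : forall Z, lie H Z -> lie H (br (Ymx e) Z).
Hypothesis Hpos : forall X, lie H X -> 0 <= dot e (accel X).
Let q := lift e.

Lemma cs_mulg (s : R) g a b x : s ^+ 2 = 1 -> (forall y, Jmul (y *m g) = s *: (Jmul y *m g)) ->
  cs a b x *m g = cs a (s * b) (x *m g).
Proof.
move=> s1 gJ; rewrite /cs mulmxDl -!scalemxAl; congr (_ + _).
by rewrite gJ scalerA mulrAC -expr2 s1 mul1r.
Qed.

Lemma dot_cs a b v : dot (cs a b v) (cs a b v) = (a ^+ 2 + b ^+ 2) * dot v v.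
Proof. by rewrite /cs !dotDl !dotDr !dotZl !dotZr dotJJ dotxJx dotJxx; ring. Qed.

Lemma null_perp x : B x q = 0 -> B x (Jmul q) = 0 -> exists z, [/\ dot z e = 0, dot z (Jmul e) = 0,
  x = cs (c0 x) (c1 x) q + iota_ z & B x x = dot z z].
Proof.
rewrite Bq BJq => /eqP; rewrite addrC subr_eq0 => /eqP h0 /eqP; rewrite addrC subr_eq0 => /eqP h1.
have [z [ze zJ zE]] := perp_decomp e1 (pi_ x); rewrite h0 h1 in zE.
have xE : x = cs (c0 x) (c1 x) q + iota_ z.
  apply: Wext.
  - by rewrite /cs !cX; ring.
  - by rewrite /cs !cX; ring.
  by rewrite [RHS]piD iotaK /cs [pi_ (_ + _)]piD !piZ piJ [pi_ q]pi_lift addrC.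
exists z; split=> //; rewrite /B zE /cs !dotDl !dotDr !dotZl !dotZr e1 ze zJ [dot e z]dotC ze [dot (Jmul e) z]dotC zJ dotJJ e1 dotxJx dotJxx; ring.
Qed.

(** For any g, the conjugate by g of the element of [heis2] is in the Lie algebra and preserves C q
    by [lie_q], but it sends [q] to a multiple of i q g^-1, with a factor that vanishes only
    together with h(q g, q). In the case h(q g, q) = 0, the null vector q g is orthogonal to [q],
    and [null_perp] applies. *)
Lemma H_null g : H g -> exists a b, a ^+ 2 + b ^+ 2 != 0 /\ q *m g = cs a b q.
Proof.
move=> hg; have Gg := HG HH hg; have ug := Ghat_unit Gg; have [s s1 [gB gJ]] := Gg.
have qn0 : q != 0.
  by apply/eqP => q0; have := c0_lift e; rewrite -/q q0 /c0 dot0l => /esym/eqP; rewrite oner_eq0.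
suff [a [b ab]] : exists a b, q *m g = cs a b q.
  exists a, b; split=> //; apply: contra qn0; rewrite paddr_eq0 ?sqr_ge0 // !sqrf_eq0 => /andP[/eqP a0 /eqP b0].
  by rewrite -(mulmxK ug q) ab a0 b0 /cs !scale0r addr0 mul0mx.
have [N hN NE] := heis2 e1 HH HE Hpos TJe.
pose al := B (q *m g) q; pose be := B (q *m g) (Jmul q).
have [ab0|ab0] := eqVneq (al ^+ 2 + be ^+ 2) 0.
  move: ab0 => /eqP; rewrite paddr_eq0 ?sqr_ge0 // !sqrf_eq0 => /andP[/eqP a0 /eqP b0].
  have [z [ze zJ qE' BE]] := null_perp a0 b0.
  have : B (q *m g) (q *m g) = 0 by rewrite gB B_lift e1 subrr.
  by rewrite BE => /eqP; rewrite dot_eq0 => /eqP z0; rewrite z0 iota0 addr0 in qE'; rewrite qE'; do 2 eexists.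
have h1 := lie_conj HH hg hN.
have [a [b ab]] := lie_q e1 HH HE Hpos h1.
rewrite !mulmxA NE mulNmx in ab.
have ab1 : cs a (s * b) (q *m g) = - cs al be (Jmul q).
  rewrite -[X in - X](mulmxKV ug) -mulNmx -/q; move: ab; rewrite -/al -/be => ->.
  by rewrite (cs_mulg _ _ _ s1 gJ).
have [c0'|c0'] := eqVneq (a ^+ 2 + (s * b) ^+ 2) 0.
  move: c0' => /eqP; rewrite paddr_eq0 ?sqr_ge0 // !sqrf_eq0 => /andP[/eqP a0 /eqP b0].
  move: ab1; rewrite a0 b0 /cs !scale0r addr0 -/(cs al be (Jmul q)) => /esym/eqP; rewrite oppr_eq0 => /eqP h.
  have := cs_inv (Jmul q) ab0; rewrite h /cs Jmul0 !scaler0 addr0 => /(congr1 (@Jmul R n.+1)).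
  by rewrite Jmul0 JmulJ => /esym/eqP; rewrite oppr_eq0 (negbTE qn0).
have := cs_inv (q *m g) c0'; rewrite ab1 => <-.
have -> : - cs al be (Jmul q) = cs (- al) (- be) (cs 0 1 q).
  by rewrite /cs scale0r add0r scale1r !scaleNr opprD.
by rewrite !cs_cs; do 2 eexists.
Qed.

Lemma nu0_perp xi : nu0 H xi -> dot xi e = 0 /\ dot xi (Jmul e) = 0.
Proof. by move=> h; rewrite ![dot xi _]dotC; split; apply: h. Qed.

Lemma nu0_of_perp xi : dot xi e = 0 -> dot xi (Jmul e) = 0 ->
  (forall w, tan0 H w -> dot w e = 0 -> dot w (Jmul e) = 0 -> dot w xi = 0) -> nu0 H xi.
Proof.
move=> xe xJ h v hv; have [w [we wJ vE]] := perp_decomp e1 v.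
rewrite vE /cs !dotDl !dotZl ![dot _ xi]dotC xe xJ !mulr0 !addr0 dotC; apply: h => //.
rewrite (_ : w = v + (-1) *: cs (dot v e) (dot v (Jmul e)) e); last by rewrite {1}vE scaleN1r addrK.
by apply: (tan0D HH) => //; apply: tan0Z; apply: (tan0D HH); exact: tan0Z.
Qed.

Lemma conj_pair g s : Ghat g -> s ^+ 2 = 1 -> (forall y, Jmul (y *m g) = s *: (Jmul y *m g)) ->
  forall x y, B x (y *m invmx g) = B (x *m g) y /\ B x (Jmul (y *m invmx g)) = s * B (x *m g) (Jmul y).
Proof.
move=> Gg s1 gJ x y; have ug := Ghat_unit Gg.
by rewrite -(B_mulg x _ Gg) -(B_mulg x (Jmul _) Gg) mulmxKV // -[Jmul _ *m g]scale1r -s1 expr2 -scalerA -gJ mulmxKV // BZr.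
Qed.

(** The elements of [heis1] conjugated by g^-1 are in the Lie algebra again. So the image of a
    normal vector, taken modulo C q and divided by a + i b, is orthogonal to the tangent space. *)
Lemma H_normal g a b xi : H g -> q *m invmx g = cs a b q -> a ^+ 2 + b ^+ 2 != 0 -> nu0 H xi ->
  exists t t' eta, [/\ nu0 H eta, iota_ xi *m invmx g = cs t t' q + iota_ (cs a b eta) &
    dot xi xi = (a ^+ 2 + b ^+ 2) * dot eta eta].
Proof.
move=> hg qg ab hxi; have Gg := HG HH hg; have ug := Ghat_unit Gg; have [s s1 [gB gJ]] := Gg.
have cp := conj_pair Gg s1 gJ; have [xe xJ] := nu0_perp hxi.
have GV := GhatV Gg; set z0 := iota_ xi *m invmx g.
have h0 : B (iota_ xi) q = 0 by rewrite Bq iotaK xe c0i; ring.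
have h1 : B (iota_ xi) (Jmul q) = 0 by rewrite BJq iotaK xJ c1i; ring.
have [k0 k1] : B z0 (cs a b q) = 0 /\ B z0 (Jmul (cs a b q)) = 0.
  by rewrite -qg; have [-> ->] := cp z0 q; rewrite /z0 mulmxKV // h0 h1 mulr0.
have [m0 m1] : B z0 q = 0 /\ B z0 (Jmul q) = 0.
  rewrite Jcs !B_csr JmulJ BNr in k0 k1.
  have [j0 j1] : (a ^+ 2 + b ^+ 2) * B z0 q = 0 /\ (a ^+ 2 + b ^+ 2) * B z0 (Jmul q) = 0.
    split.
      rewrite (_ : _ * _ = a * (a * B z0 q + b * B z0 (Jmul q)) - b * (a * B z0 (Jmul q) + b * - B z0 q)); last by ring.
      by rewrite k0 k1 !mulr0 subrr.
    rewrite (_ : _ * _ = b * (a * B z0 q + b * B z0 (Jmul q)) + a * (a * B z0 (Jmul q) + b * - B z0 q)); last by ring.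
    by rewrite k0 k1 !mulr0 addr0.
  by split; apply/eqP; [move/eqP: j0|move/eqP: j1]; rewrite mulf_eq0 (negbTE ab).
have [z [ze zJ zE zB]] := null_perp m0 m1.
pose c := a ^+ 2 + b ^+ 2; pose eta := cs (a / c) (- b / c) z.
have etaE : cs a b eta = z by rewrite /eta /c cs_inv2.
exists (c0 z0), (c1 z0), eta; rewrite etaE; split=> //.
- apply: nu0_of_perp.
  + by rewrite /eta /cs dotDl !dotZl dotJl ze zJ; ring.
  + by rewrite /eta /cs dotDl !dotZl dotJJ ze zJ; ring.
  move=> w Tw we wJ; have [N hN [_ _ NE]] := heis1 e1 HH HE Hpos Tw we wJ.
  pose y := e0 *m invmx g.
  have h2 : B (y *m N) z0 = 0.
    have := lie_conjV HH hg hN => hN'.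
    have [cp1 _] := cp (y *m N) (iota_ xi); rewrite -/z0 in cp1; rewrite cp1 BC B_iota_l dotC.
    by apply: hxi; exists (invmx g *m N *m g) => //; rewrite !mulmxA.
  have [y0 y1] : B y (cs a b q) = -1 /\ B y (Jmul (cs a b q)) = 0.
    rewrite -qg; have [-> ->] := cp y q; rewrite /y mulmxKV // Bq BJq pi_e0 !dot0l !cX; split; ring.
  rewrite Jcs !B_csr JmulJ BNr in y0 y1.
  have [al be] : c * B y q = - a /\ c * B y (Jmul q) = - b.
    split; rewrite /c.
      rewrite (_ : _ * _ = a * (a * B y q + b * B y (Jmul q)) - b * (a * B y (Jmul q) + b * - B y q)); last by ring.
      by rewrite y0 y1; ring.
    rewrite (_ : _ * _ = b * (a * B y q + b * B y (Jmul q)) + a * (a * B y (Jmul q) + b * - B y q)); last by ring.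
    by rewrite y0 y1; ring.
  have pz : pi_ z0 = cs (c0 z0) (c1 z0) e + z.
    by rewrite {1}zE piD iotaK; congr (_ + _); rewrite /cs [LHS]piD !piZ piJ [pi_ q]pi_lift.
  have w0 : B (iota_ w) z0 = dot w z by rewrite B_iota_l pz dotDr /cs dotDr !dotZr we wJ; ring.
  have w1 : B (iota_ w) (Jmul z0) = dot w (Jmul z).
    by rewrite B_iota_l piJ pz JmulD /cs JmulD !JmulZ JmulJ !dotDr !dotZr dotNr we wJ; ring.
  have q0 : B q z0 = 0 by rewrite BC.
  have q1 : B q (Jmul z0) = 0 by rewrite BJs m1 oppr0.
  move: h2; rewrite NE BDl BNl !B_csl q0 q1 w0 w1 !mulr0 subrr sub0r => /eqP; rewrite oppr_eq0 => /eqP h2.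
  have : c * (B y q * dot w z - B y (Jmul q) * dot w (Jmul z)) = 0 by rewrite h2 mulr0.
  rewrite mulrBr !mulrA al be => h3.
  rewrite /eta /cs dotDr !dotZr (_ : _ + _ = - c^-1 * (- a * dot w z - - b * dot w (Jmul z))); last by ring.
  by rewrite h3 mulr0.
- by rewrite -Bii -(B_mulg _ _ GV) -/z0 zB -etaE dot_cs.
Qed.

Lemma csD (k : nat) a b (x y : realCn R k) : cs a b (x + y) = cs a b x + cs a b y.
Proof. by rewrite /cs JmulD !scalerDr addrACA. Qed.

Lemma csq_coords a b : [/\ c0 (cs a b q) = a, c1 (cs a b q) = b & pi_ (cs a b q) = cs a b e].
Proof.
split; [by rewrite /cs !cX; ring|by rewrite /cs !cX; ring|].
by rewrite /cs [LHS]piD !piZ piJ [pi_ q]pi_lift.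
Qed.

Lemma csDl (k : nat) a b a' b' (x : realCn R k) : cs a b x + cs a' b' x = cs (a + a') (b + b') x.
Proof. by rewrite /cs !scalerDl addrACA. Qed.

Lemma q_iota_uniq a b a' b' v w : cs a b q + iota_ v = cs a' b' q + iota_ w -> v = w.
Proof.
move=> h; have [k0 k1 kp] := csq_coords a b; have [k0' k1' kp'] := csq_coords a' b'.
have := congr1 (@c0 R n) h; rewrite [LHS]c0D [RHS]c0D k0 k0' !c0i !addr0 => h0.
have := congr1 (@c1 R n) h; rewrite [LHS]c1D [RHS]c1D k1 k1' !c1i !addr0 => h1.
by have := congr1 (@pi_ R n) h; rewrite [LHS]piD [RHS]piD kp kp' !iotaK h0 h1 => /addrI.
Qed.

(* multiplication by [g] and [g^-1] being mutually inverse, [H_normal] is onto *)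
Lemma H_normal_onto g a b eta : H g -> q *m invmx g = cs a b q -> a ^+ 2 + b ^+ 2 != 0 -> nu0 H eta ->
  exists xi t t', [/\ nu0 H xi & iota_ xi *m invmx g = cs t t' q + iota_ (cs a b eta)].
Proof.
move=> hg qg ab heta; have Gg := HG HH hg; have ug := Ghat_unit Gg; have [s s1 [gB gJ]] := Gg.
have hV := HV HH hg; have GV := GhatV Gg.
have gVJ y : Jmul (y *m invmx g) = s *: (Jmul y *m invmx g).
  have := gJ (y *m invmx g); rewrite mulmxKV // => ->.
  by rewrite -scalemxAl mulmxK // scalerA -expr2 s1 scale1r.
have [a' [b' [ab' qg']]] := H_null hg.
have [u [u' [xi [hxi e2 _]]]] := H_normal (g := invmx g) hV ltac:(by rewrite invmxK; exact: qg') ab' heta.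
rewrite invmxK in e2.
have [t [t' [eta2 [heta2 e3 _]]]] := H_normal hg qg ab hxi.
have e4 : cs a' (s * b') (cs a b q) = q.
  by rewrite -qg -(cs_mulg _ _ _ s1 gVJ) -qg' mulmxK.
have [k0 k1] : a' * a - s * b' * b = 1 /\ a' * b + s * b' * a = 0.
  rewrite cs_cs in e4; have [m0 m1 _] := csq_coords (a' * a - s * b' * b) (a' * b + s * b' * a).
  by split; [rewrite -m0 e4; exact: c0_lift|rewrite -m1 e4; exact: c1_lift].
have e5 v : cs a' (s * b') (cs a b v) = v by rewrite cs_cs k0 k1 /cs scale1r scale0r addr0.
exists xi, t, t'; split=> //; rewrite e3; congr (_ + iota_ (cs a b _)).
have e6 : iota_ eta = (cs u u' q + iota_ (cs a' b' xi)) *m invmx g by rewrite -e2 mulmxK.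
apply/esym/(@q_iota_uniq 0 0 (u * a - s * u' * b + (a' * t - s * b' * t')) (u * b + s * u' * a + (a' * t' + s * b' * t))).
rewrite {1}/cs !scale0r !add0r e6 mulmxDl iota_cs !(cs_mulg _ _ _ s1 gVJ) e3 csD -!iota_cs e5 qg !cs_cs.
by rewrite addrA csDl.
Qed.

Variable P : 'M[R]_(n + n).
Hypotheses (PT : P^T = P) (PP : P *m P = P) (Pnu : forall v, nu0 H (v *m P)) (Pfix : forall v, nu0 H v -> v *m P = v).

(** The functional [psi] takes equal values at a normal vector v and at its image v' under
    [dilation], which is orthogonal to v. The normal vector m that represents it satisfies |m|^2 = m
    . m' = 0, so [psi] vanishes on normal vectors and only the component along [q] remains. *)
Lemma H_tau g a b t t' xi eta : H g -> q *m invmx g = cs a b q -> a ^+ 2 + b ^+ 2 != 0 -> nu0 H xi -> nu0 H eta ->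
  iota_ xi *m invmx g = cs t t' q + iota_ (cs a b eta) -> a * t + b * t' = 0.
Proof.
move=> hg qg ab hxi heta e2; have Gg := HG HH hg; have ug := Ghat_unit Gg; have [s s1 [gB gJ]] := Gg.
have cp := conj_pair Gg s1 gJ; pose y := e0 *m invmx g; pose c := a ^+ 2 + b ^+ 2.
have [y0 y1] : B y (cs a b q) = -1 /\ B y (Jmul (cs a b q)) = 0.
  rewrite -qg; have [-> ->] := cp y q; rewrite /y mulmxKV // Bq BJq pi_e0 !dot0l !cX; split; ring.
rewrite Jcs !B_csr JmulJ BNr in y0 y1.
have y_xi u : nu0 H u -> B y (iota_ u *m invmx g) = 0.
  by move=> hu; have [-> _] := cp y (iota_ u); rewrite /y mulmxKV // Bei.
have [X hX [qX hnu]] := dilation e1 HH HE Hpos Te TJe.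
have uX := lie_uLie HH hX; have [XJ XB] := uX.
have y_X u : nu0 H u -> B y (iota_ u *m invmx g *m X) = 0.
  move=> hu; rewrite -[LHS]opprK -XB; apply/eqP; rewrite oppr_eq0; apply/eqP.
  have [-> _] := cp (y *m X) (iota_ u); rewrite BC B_iota_l dotC.
  apply: hu; exists (invmx g *m X *m g); first exact: lie_conjV hg hX.
  by rewrite !mulmxA.
pose psi v := B y (iota_ (cs a b v)).
have key v v' : nu0 H v -> nu0 H v' -> iota_ v *m X = iota_ v' -> psi v = psi v'.
  move=> hv hv' vX; have [xi' [r [r' [hxi' e3]]]] := H_normal_onto hg qg ab hv.
  have h1 := y_xi _ hxi'; have h2 := y_X _ hxi'.
  rewrite e3 mulmxDl iota_cs !cs_mulmx // qX vX -/q BDr in h2; rewrite e3 BDr iota_cs in h1.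
  by rewrite /psi !iota_cs; lra.
have [mu hmu] := @riesz R _ psi (fun v w => ltac:(by rewrite /psi csD iotaD BDr)) (fun r v => ltac:(by rewrite /psi /cs JmulZ !scalerA ![_ * r]mulrC -!scalerA -scalerDr iotaZ BZr)).
have psi0 v : nu0 H v -> psi v = 0.
  move=> hv; have hm := Pnu mu; have [m' [hm' mX mm]] := hnu _ hm.
  have e5 := key _ _ hm hm' mX; rewrite !hmu -(Pfix hm) -(Pfix hm') -![dot mu _](dotP _ _ PT PP) -!mulmxA !PP in e5.
  have : dot (mu *m P) (mu *m P) = 0.
    by rewrite e5 -[m' *m P](Pfix (Pnu _)) -mulmxA PP -/(dot _ _) (Pfix hm') mm.
  by move=> /eqP; rewrite dot_eq0 hmu -(Pfix hv) -(dotP _ _ PT PP) => /eqP ->; rewrite dot0l.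
have h := y_xi _ hxi; rewrite e2 BDr -/(psi eta) psi0 // addr0 B_csr in h.
have : c * (t * B y q + t' * B y (Jmul q)) = 0 by rewrite h mulr0.
rewrite (_ : _ * _ = t * (a * (a * B y q + b * B y (Jmul q)) - b * (a * B y (Jmul q) + b * - B y q))
  + t' * (b * (a * B y q + b * B y (Jmul q)) + a * (a * B y (Jmul q) + b * - B y q))); last by rewrite /c; ring.
by rewrite y0 y1; lra.
Qed.

(** Let u be the projection that defines rho at x. By [H_normal] and [H_tau] the projection at x g
    corresponds to a normal vector eta with |eta|^2 = u . eta, hence |eta| <= |u|. The inverse of g
    gives the other inequality in [rho_act]. *)
Lemma rho_le g z : H g -> CH z -> rho e P (act g z) <= rho e P z.
Proof.
move=> hg hz; have Gg := HG HH hg; have ug := Ghat_unit Gg; have [s s1 [gB gJ]] := Gg.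
have cp := conj_pair Gg s1 gJ; set x := lift z.
have xn : B x x < 0 by exact: B_lift_lt0.
have xgn : B (x *m g) (x *m g) < 0 by rewrite gB.
have qx := q2_gt0 xgn.
have [a [b [ab qg]]] := H_null (HV HH hg).
have -> : rho e P (act g z) = lev e P (x *m g).
  have qn := lt0r_neq0 qx; rewrite /rho act_in //.
  by rewrite -(@lev_cs R n e P (lift (pr (x *m g))) (c0 (x *m g)) (c1 (x *m g)) PT PP qn) prK.
pose c := a ^+ 2 + b ^+ 2; have c0' : 0 < c by rewrite lt_def ab addr_ge0 ?sqr_ge0.
have ff y : fform (x *m g) q y = fform x (cs a b q) (y *m invmx g).
  rewrite -qg /fform; have [-> ->] := cp x q; have [-> ->] := cp x y.
  by rewrite [in RHS]mulrACA -expr2 s1 mul1r.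
have hs : hsq (x *m g) q = c * hsq x q by rewrite -fform_self ff qg fform_cs fform_self /c; ring.
rewrite /rho /lev gB hs -/x.
set y := Fvec e (x *m g) *m P; set u := Fvec e x *m P.
have hq := hsq_gt0 e1 xn; have hq' : 0 < hsq x q * - B x x by rewrite mulr_gt0 // oppr_gt0.
have hy : nu0 H y := Pnu _.
have [t [t' [eta [heta e2 n2]]]] := H_normal hg qg ab hy.
have tt := H_tau hg qg ab hy heta e2.
have yy : dot y y = c * dot u eta.
  rewrite {1}/y dotP // -/y Fvec_dot ff e2 fformDr !iota_cs !fform_cs tt mul0r add0r.
  rewrite (_ : B x q * B x (Jmul q) - _ = 0) ?mulr0 ?add0r; last by rewrite mulrC subrr.
  rewrite [a * b]mulrC subrr mul0r addr0 -!expr2 -Fvec_dot /u; congr (_ * _).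
  by rewrite -(Pfix heta) dotP.
have ue : dot u eta = dot eta eta.
  by apply: (mulfI ab); rewrite -/c -yy n2.
have ee_uu : dot eta eta <= dot u u.
  have := dot_CS u eta; rewrite ue expr2; have [->|en0] := eqVneq (dot eta eta) 0; first by rewrite dot_ge0.
  by rewrite ler_pM2r // lt_def en0 dot_ge0.
rewrite -mulrA; apply: le_trans (_ : c * dot u u / (c * (hsq x q * - B x x)) <= _).
  by apply: ler_wpM2r; [rewrite invr_ge0 mulr_ge0 ?ltW|rewrite yy ue ler_pM2l].
by rewrite -mulf_div divff ?mul1r.
Qed.

Lemma rho_act g z : H g -> CH z -> rho e P (act g z) = rho e P z.
Proof.
move=> hg hz; have Gg := HG HH hg; apply/eqP; rewrite eq_le rho_le //=.
by rewrite -{1}(actK z Gg) rho_le //; [exact: HV|exact: act_CH].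
Qed.

Lemma rho_normal v : nu0 H v -> rho e P v = dot v v / (1 - dot v v).
Proof.
move=> hv; have [ve vJ] := nu0_perp hv.
have [v0|v0] := eqVneq v 0.
  by rewrite v0 dot0l mul0r /rho /lev /Fvec pi_lift Jmul0 !scaler0 subr0 mul0mx dot0l mul0r.
have vp : 0 < dot v v by rewrite dot_gt0.
have [hu u1] := nu0_unit hv v0; set r := Num.sqrt _ in hu u1.
have r0 : 0 < r by rewrite sqrtr_gt0.
have vE : v = r *: (r^-1 *: v) by rewrite scalerA mulfV ?gt_eqF // scale1r.
have [ue uJ] := nu0_perp hu; move: (r^-1 *: v) hu u1 ue uJ vE => u hu u1 ue uJ ->.
by rewrite (rho0_nu _ PT PP e1 ue uJ (Pfix hu) u1) !dotZl !dotZr u1 mulr1 -expr2.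
Qed.

(** Both points are moved to normal vectors at 0. Their lengths are determined by rho, and the
    isotropy group is transitive on normal vectors of a given length. *)
Lemma orbits_level (x y : V) : CH x -> CH y -> same_orbit H x y <-> rho e P x = rho e P y.
Proof.
move=> hx hy; split=> [[g hg <-]|eq]; first by rewrite rho_act.
have [a ha [_ nx]] := foot_normal HH hx; have [b hb [_ ny]] := foot_normal HH hy.
have Ga := HG HH ha; have Gb := HG HH hb.
have hax := act_CH Ga hx; have hby := act_CH Gb hy.
move: eq; rewrite -(rho_act ha hx) -(rho_act hb hy) (rho_normal nx) (rho_normal ny) => eq.
have [g hg gE] : exists2 g, H g & act g (act a x) = act b y.
  move: nx ny hax hby eq; move: (act a x) (act b y) => v w hv hw hvC hwC eq.
  have v1 : 0 < 1 - dot v v by rewrite subr_gt0; exact/CHE.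
  have w1 : 0 < 1 - dot w w by rewrite subr_gt0; exact/CHE.
  have vw : dot v v = dot w w.
    have : dot v v * (1 - dot w w) = dot w w * (1 - dot v v).
      by move: eq => /eqP; rewrite eqr_div ?(lt0r_neq0 v1) ?(lt0r_neq0 w1) // => /eqP.
    lra.
  have [v0|v0] := eqVneq v 0.
    exists 1%:M; first exact: H1; rewrite act1 v0; apply/esym/eqP.
    by rewrite -dot_eq0 -vw v0 dot0l.
  have w0 : w != 0 by rewrite -dot_eq0 -vw dot_eq0.
  have [g [hg eg] gvw] := Kiso_trans HH Hthin Hcodim (nu0_unit hv v0) (nu0_unit hw w0).
  have Gg := HG HH hg; exists g => //; rewrite Kiso_act //.
  have r0 : Num.sqrt (dot v v) != 0 by rewrite gt_eqF // sqrtr_gt0 dot_gt0.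
  rewrite -[v](scalerKV r0) iotaZ -scalemxAl gvw -iotaZ iotaK vw scalerKV //.
  by rewrite -vw.
exists (a *m g *m invmx b); first by apply: (HM HH); [exact: (HM HH)|exact: HV].
rewrite !actM //; [by rewrite gE actK|exact: (HG HH)|apply: GhatM => //; exact: (HG HH)|exact: GhatV].
Qed.
End Classify.

(** * Covariant acceleration *)

Section Christoffel.
Variables (R : realType) (n : nat).
Local Notation V := (realCn R n).
Implicit Types (z u v w : V).

Definition dmetric z u v w : R :=
  let s := dot z z in
  16 * dot z u / (1 - s) ^+ 3 * ((1 - s) * dot v w + dot v z * dot w z + dot v (Jmul z) * dot w (Jmul z)) +
  4 / (1 - s) ^+ 2 * (- (2 * dot z u) * dot v w + dot v u * dot w z + dot v z * dot w u +
    dot v (Jmul u) * dot w (Jmul z) + dot v (Jmul z) * dot w (Jmul u)).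

Lemma is_derive_metric z u v w : CH z ->
  is_derive z u (fun x => metric bergman x v w) (dmetric z u v w).
Proof.
move=> /CHE hz; have hz0 : 1 - dot z z != 0 by rewrite gt_eqF // subr_gt0.
have di : is_derive z u (fun x : V => x) u by exact: is_derive_id.
have dc (c : V) : is_derive z u (fun _ : V => c) 0 by exact: is_derive_cstmx.
have ds := is_derive_dot di di.
have dJ := is_derive_J di.
have dv c := is_derive_dot (dc c) di.
have dvJ c := is_derive_dot (dc c) dJ.
have fE : (fun x => metric bergman x v w) = (fun x => 4 * ((1 - dot x x) ^-1 * (1 - dot x x)^-1) *
   ((1 - dot x x) * dot v w + dot v x * dot w x + dot v (Jmul x) * dot w (Jmul x))).
  by apply/funext => x; rewrite metricE -[in RHS]invfM -expr2.
have one : is_derive z u (fun _ : V => 1 : R) 0 by exact: is_derive_cst.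
have d1 : is_derive z u (fun x : V => 1 - dot x x) (- (2 * dot z u)).
  by apply: is_derive_eq (is_deriveB one ds) _; rewrite [dot u z]dotC; ring.
have di1 : is_derive z u (fun x : V => (1 - dot x x)^-1) (2 * dot z u / (1 - dot z z) ^+ 2).
  have d1' := @ex_derive _ _ _ _ _ _ _ d1.
  have D := @derivableV _ _ (fun x : V => 1 - dot x x) z u hz0 d1'.
  apply: (DeriveDef D); rewrite deriveV // (@derive_val _ _ _ _ _ _ _ d1) /GRing.scale /=.
  by field; exact: hz0.
have dA := is_deriveM di1 di1.
have dk := is_deriveM d1 (is_derive_cst (dot v w) z u).
have dvv := is_deriveM (dv v) (dv w).
have dJJ := is_deriveM (dvJ v) (dvJ w).
have dB := is_deriveD (is_deriveD dk dvv) dJJ.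
have d4 := is_deriveM (is_derive_cst (4 : R) z u) dA.
rewrite fE; apply: is_derive_eq (is_deriveM d4 dB) _.
rewrite /dmetric !fctE /GRing.scale /= !dot0l; field.
exact: hz0.
Qed.

Lemma metricDl z v v' w : metric bergman z (v + v') w = metric bergman z v w + metric bergman z v' w.
Proof. by rewrite /metric !mulmxDl mxE. Qed.
Lemma metricZl z a v w : metric bergman z (a *: v) w = a * metric bergman z v w.
Proof. by rewrite /metric -!scalemxAl mxE. Qed.

Lemma metric_sym z v w : metric bergman z v w = metric bergman z w v.
Proof. by rewrite !metricE [dot v w]dotC; congr (_ * _); ring. Qed.

Lemma bergman_sym z : (bergman z)^T = bergman z.
Proof.
rewrite /bergman linearZ /= !linearD /= !trmx_mul !trmxK tr_scalar_mx //.
Qed.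

Lemma bergman_unit z : CH z -> bergman z \in unitmx.
Proof.
move=> /CHE hz; have h0 : 0 < 1 - dot z z by rewrite subr_gt0.
rewrite -row_free_unit -kermx_eq0; apply/eqP/row_ext => x.
rewrite mulmx0; set v := x *m _; have kv : v *m bergman z = 0 by rewrite /v -mulmxA mulmx_ker mulmx0.
have : metric bergman z v v = 0 by rewrite /metric kv mul0mx mxE.
rewrite metricE => /eqP; rewrite mulf_eq0 mulf_eq0 pnatr_eq0 /= invr_eq0 expf_eq0 /= gt_eqF //= -addrA => /eqP h.
have h1 : 0 <= dot v z * dot v z + dot v (Jmul z) * dot v (Jmul z) by rewrite addr_ge0 // -expr2 sqr_ge0.
have h2 := dot_ge0 v; apply/eqP; rewrite -dot_eq0; apply/eqP.
have h3 : 0 <= (1 - dot z z) * dot v v by rewrite mulr_ge0 // ltW.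
by have /eqP : (1 - dot z z) * dot v v = 0 by [lra]; rewrite mulf_eq0 gt_eqF //= => /eqP.
Qed.

Lemma partial_bergman i j l z : CH z ->
  partial i (fun x => bergman x j l) z = dmetric z (delta_mx 0 i) (delta_mx 0 j) (delta_mx 0 l).
Proof.
move=> hz; rewrite /partial.
rewrite (_ : (fun x => bergman x j l) = (fun x => metric bergman x (delta_mx 0 j) (delta_mx 0 l))).
  exact: (@derive_val _ _ _ _ _ _ _ (is_derive_metric (delta_mx 0 i) (delta_mx 0 j) (delta_mx 0 l) hz)).
by apply/funext => x; rewrite /metric trmx_delta -rowE -colE !mxE.
Qed.

(* the quadratic part of the geodesic equation, -2 (h(v, z) / h(z, z)) v in lifted terms *)
Definition gam z v : V := cs (2 * dot v z / (1 - dot z z)) (2 * dot v (Jmul z) / (1 - dot z z)) v.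

(** The Koszul formula, which characterizes the Christoffel symbols applied to (v, v). *)
Lemma gam_koszul z v w : CH z -> 2 * metric bergman z (gam z v) w = 2 * dmetric z v v w - dmetric z w v v.
Proof.
move=> /CHE hz; have hz0 : 1 - dot z z != 0 by rewrite gt_eqF // subr_gt0.
rewrite /gam /cs metricDl !metricZl !metricE /dmetric !dotJJ dotxJx !dotJl.
rewrite (dotC z v) (dotC z w) (dotJs w v) ?(dotC w v); field.
exact: hz0.
Qed.

Lemma dmetric_sum z (u v w : V) : dmetric z u v w = \sum_i \sum_j \sum_l u 0 i * v 0 j * w 0 l *
  dmetric z (delta_mx 0 i) (delta_mx 0 j) (delta_mx 0 l).
Proof.
have sumD (f : V -> R) (x : V) : (forall x y, f (x + y) = f x + f y) -> (forall a x, f (a *: x) = a * f x) ->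
    f x = \sum_i x 0 i * f (delta_mx 0 i).
  move=> fD fZ; have f0 : f 0 = 0 by rewrite -(scale0r 0) fZ mul0r.
  by rewrite {1}(row_sum_delta x) (big_morph f fD f0); apply: eq_bigr => i _; rewrite fZ.
have Dl : forall u u' v w, dmetric z (u + u') v w = dmetric z u v w + dmetric z u' v w.
  by move=> *; rewrite /dmetric JmulD !dotDr; ring.
have Zl : forall a u v w, dmetric z (a *: u) v w = a * dmetric z u v w.
  by move=> *; rewrite /dmetric JmulZ !dotZr; ring.
have Dm : forall v v' u w, dmetric z u (v + v') w = dmetric z u v w + dmetric z u v' w.
  by move=> *; rewrite /dmetric !dotDl; ring.
have Zm : forall a u v w, dmetric z u (a *: v) w = a * dmetric z u v w.
  by move=> *; rewrite /dmetric !dotZl; ring.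
have Dr : forall w w' u v, dmetric z u v (w + w') = dmetric z u v w + dmetric z u v w'.
  by move=> *; rewrite /dmetric !dotDl !dotDr; ring.
have Zr : forall a u v w, dmetric z u v (a *: w) = a * dmetric z u v w.
  by move=> *; rewrite /dmetric !dotZl !dotZr; ring.
rewrite (sumD (fun x => dmetric z x v w)) //; apply: eq_bigr => i _.
rewrite (sumD (fun x => dmetric z _ x w)) // mulr_sumr; apply: eq_bigr => j _.
rewrite (sumD (fun x => dmetric z _ _ x)) // !mulr_sumr; apply: eq_bigr => l _.
by rewrite !mulrA.
Qed.

Lemma christoffel_gam z v : CH z ->
  \row_k (\sum_i \sum_j christoffel bergman z k i j * v 0 i * v 0 j) = gam z v.
Proof.
move=> hz; have uG := bergman_unit hz.
have aE : gam z v *m bergman z = \row_m (\sum_i \sum_j 2^-1 *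
    (partial i (fun x => bergman x j m) z + partial j (fun x => bergman x i m) z
     - partial m (fun x => bergman x i j) z) * v 0 i * v 0 j).
  apply/rowP => m; rewrite [RHS]mxE.
  have -> : (gam z v *m bergman z) 0 m = metric bergman z (gam z v) (delta_mx 0 m).
    by rewrite /metric trmx_delta -colE !mxE.
  apply: (mulfI (_ : (2 : R) != 0)); first by rewrite pnatr_eq0.
  have d1 : dmetric z v v (delta_mx 0 m) =
      \sum_i \sum_j v 0 i * v 0 j * partial i (fun x => bergman x j m) z.
    rewrite dmetric_sum; apply: eq_bigr => i _; apply: eq_bigr => j _.
    rewrite (bigD1 m) //= big1 ?addr0 => [|l lm]; last by rewrite !mxE (negPf lm) andbF mulr0 mul0r.
    by rewrite !mxE !eqxx mulr1 partial_bergman.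
  have d2 : dmetric z v v (delta_mx 0 m) =
      \sum_i \sum_j v 0 i * v 0 j * partial j (fun x => bergman x i m) z.
    rewrite d1 exchange_big; apply: eq_bigr => i _; apply: eq_bigr => j _.
    by rewrite [v 0 j * _]mulrC.
  have d3 : dmetric z (delta_mx 0 m) v v =
      \sum_i \sum_j v 0 i * v 0 j * partial m (fun x => bergman x i j) z.
    rewrite dmetric_sum (bigD1 m) //= [X in _ + X]big1 ?addr0 => [|l lm].
      apply: eq_bigr => i _; apply: eq_bigr => j _.
      by rewrite !mxE !eqxx mul1r partial_bergman.
    by apply: big1 => i _; apply: big1 => j _; rewrite !mxE (negPf lm) andbF !mul0r.
  rewrite gam_koszul // mulr2n mulrDl mul1r {1}d1 d2 d3 mulr_sumr -big_split -sumrB /=.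
  apply: eq_bigr => i _; rewrite mulr_sumr -big_split -sumrB /=.
  by apply: eq_bigr => j _; field.
rewrite -[RHS](mulmxK uG) aE; apply/rowP => k; rewrite !mxE.
under [RHS]eq_bigr do rewrite mxE mulr_suml.
rewrite [RHS]exchange_big; apply: eq_bigr => i _.
under [RHS]eq_bigr do rewrite mulr_suml.
rewrite [RHS]exchange_big; apply: eq_bigr => j _.
rewrite /christoffel mulr_sumr !mulr_suml; apply: eq_bigr => m _.
rewrite (_ : invmx (bergman z) m k = invmx (bergman z) k m); first by ring.
by rewrite -[in LHS](bergman_sym z) -trmx_inv mxE.
Qed.

Lemma covariant_accelerationE (c : R -> V) t : CH (c t) ->
  covariant_acceleration bergman c t = derive1 (derive1 c) t + gam (c t) (derive1 c t).
Proof. by move=> hc; rewrite -christoffel_gam //; apply/rowP => k; rewrite !mxE. Qed.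
End Christoffel.

(** * Second-order expansions of curves *)

Section SmoothCurves.
Variables (R : realType) (W : normedModType R).
Implicit Types c : R -> W.

Lemma smooth_is_derive c t : smooth_curve c -> is_derive t (1 : R) c (derive1 c t).
Proof.
move=> sc; have [dc _] := sc 1%N; apply: DeriveDef; last by rewrite derive1E.
exact/derivable1_diffP/dc.
Qed.

Lemma smooth_derive1 c : smooth_curve c -> smooth_curve (derive1 c).
Proof.
move=> sc k; have [dc h] := sc k.+1.
have e z : derive1 c z = 'd c z 1 by rewrite derive1E deriveE //; exact: dc.
by apply: Ck_ext (h 1); [exact: openT|move=> z _; rewrite e].
Qed.

Lemma derive1_val c t d : is_derive t (1 : R) c d -> derive1 c t = d.
Proof. by move=> h; rewrite derive1E (@derive_val _ _ _ _ _ _ _ h). Qed.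
End SmoothCurves.

Section Taylor.
Variable R : realType.

Lemma harmonic_neq0 (k : nat) : (k.+1%:R : R)^-1 != 0. Proof. by rewrite invr_eq0 pnatr_eq0. Qed.

(** The mean value theorem for f - a x^2 / 2 asks for a derivative of [f1] at 0 only. *)
Lemma taylor2_R (f f1 : R -> R) a : f 0 = 0 -> f1 0 = 0 -> (forall t, is_derive t (1 : R) f (f1 t)) ->
  is_derive (0 : R) (1 : R) f1 a ->
  (fun k => f (k.+1%:R^-1) / (k.+1%:R^-1) ^+ 2) @ \oo --> a / 2.
Proof.
move=> f00 f10 df da; pose h k : R := (k.+1%:R : R)^-1.
have h0 k : 0 < h k by exact: harmonic_gt0.
pose phi x := f x - a / 2 * x ^+ 2; pose phi1 x := f1 x - a * x.
have dphi t : is_derive t (1 : R) phi (phi1 t).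
  have dx : is_derive t (1 : R) (fun x : R => x) 1 by exact: is_derive_id.
  have d2 := is_deriveX 2 dx; have d3 := is_deriveM (is_derive_cst (a / 2) t 1) d2.
  apply: is_derive_eq (is_deriveB (df t) d3) _.
  by rewrite /phi1 /cst /GRing.scale /= expr1; field.
have ex k : exists x, (0 < x < h k) /\ phi (h k) = h k * phi1 x.
  have cphi : {within `[0, h k], continuous phi}.
    apply: continuous_subspaceT => x.
    by apply/differentiable_continuous/derivable1_diffP/(@ex_derive _ _ _ _ _ _ _ (dphi x)).
  have [x xI e] := MVT (h0 k) (fun x _ => dphi x) cphi.
  exists x; split; first by move: xI; rewrite in_itv. move: e; rewrite {2}/phi f00 expr0n /= mulr0 subr0 !subr0 => ->.
  by rewrite mulrC.
have [x xP] := choice ex.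
have x0 k : 0 < x k < h k by have [] := xP k.
have xc : x @ \oo --> (0 : R).
  apply: (@squeeze_cvgr _ _ _ _ (fun=> 0) h); [|exact: cvg_cst|exact: harmonic_cvg].
  by near=> k; have /andP[/ltW -> /ltW ->] := x0 k.
have xn k : x k != 0 by have /andP[/lt0r_neq0] := x0 k.
have := is_derive_seq da xn xc; rewrite f10.
under eq_fun do rewrite addr0 subr0.
move=> lim.
have lim0 : (fun k => `|(x k)^-1 * f1 (x k) - a|) @ \oo --> (0 : R).
  by rewrite -(normr0 R^o) -[X in `|X|](subrr a); apply: cvg_norm; apply: cvgB; [exact: lim|exact: cvg_cst].
have bnd k : `|f (h k) / h k ^+ 2 - a / 2| <= `|(x k)^-1 * f1 (x k) - a|.
  have [_ e] := xP k; have /andP[xp xl] := x0 k.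
  have hn := lt0r_neq0 (h0 k).
  have -> : f (h k) / h k ^+ 2 - a / 2 = phi (h k) / h k ^+ 2 by rewrite /phi; field; exact: hn.
  rewrite e (_ : _ / _ = x k / h k * ((x k)^-1 * f1 (x k) - a)); last first.
    by rewrite /phi1; field; rewrite hn xn.
  rewrite normrM ger0_norm; last by rewrite divr_ge0 // ltW.
  by rewrite ler_piMl // ler_pdivrMr // mul1r ltW.
apply/cvgrPdist_lt => eps eps0; move/cvgrPdist_lt : lim0 => /(_ _ eps0).
apply: filter_app; near=> k; rewrite sub0r normrN normr_id [`|a / 2 - _|]distrC => lt.
exact: le_lt_trans (bnd k) lt.
Unshelve. all: by end_near. Qed.

Lemma taylor2_seq (m : nat) (f f1 : R -> 'rV[R]_m) a : f 0 = 0 -> f1 0 = 0 ->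
  (forall t, is_derive t (1 : R) f (f1 t)) -> is_derive (0 : R) (1 : R) f1 a ->
  (fun k => ((k.+1%:R^-1 : R) ^+ 2)^-1 *: f (k.+1%:R^-1)) @ \oo --> 2^-1 *: a.
Proof.
move=> f00 f10 df da; apply/cvg_mxP => i j; rewrite mxE.
have /is_derive_mxP/(_ i j) da' := da.
have df' t : is_derive t (1 : R) (fun x => f x i j) (f1 t i j) by exact: (is_derive_mxP _ _ _ _).1.
have := @taylor2_R (fun x => f x i j) (fun x => f1 x i j) _ _ _ df' da'.
rewrite f00 f10 mxE mulrC => /(_ erefl erefl); apply: cvg_trans.
by rewrite (_ : (fun _ => _) = (fun k => f (k.+1%:R^-1) i j / (k.+1%:R^-1) ^+ 2)) //; apply/funext => k; rewrite mxE mulrC.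
Qed.
End Taylor.

(** * Isometries and the geometry of submanifolds *)

Section Equivariance.
Variables (R : realType) (n : nat).
Local Notation V := (realCn R n).
Local Notation W := (realCn R n.+1).
Local Notation MM := 'M[R]_(n.+1 + n.+1).
Implicit Types (g h : MM) (z v w : V).

Lemma dactE g z v : Ghat g -> CH z -> iota_ v *m g =
  cs (c0 (iota_ v *m g)) (c1 (iota_ v *m g)) (lift (act g z)) +
  cs (c0 (lift z *m g)) (c1 (lift z *m g)) (iota_ (dact g z v)).
Proof. by move=> Gg hz; rewrite act_in //; apply: prdE; rewrite gt_eqF // q2_lift. Qed.

Lemma dact_uniq g z v w a b : Ghat g -> CH z -> iota_ v *m g = cs a b (lift (act g z)) +
  cs (c0 (lift z *m g)) (c1 (lift z *m g)) (iota_ w) -> dact g z v = w.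
Proof.
move=> Gg hz; rewrite act_in // => e; apply/esym/(@prd_uniq _ _ _ _ _ a b) => //.
by rewrite gt_eqF // q2_lift.
Qed.

Lemma act_liftE g z : Ghat g -> CH z ->
  lift z *m g = cs (c0 (lift z *m g)) (c1 (lift z *m g)) (lift (act g z)).
Proof. by move=> Gg hz; rewrite act_in // prK // gt_eqF // q2_lift. Qed.

Lemma is_derive_cs (k : nat) (a b : R -> R) (x : R -> realCn R k) t da db dx :
  is_derive t (1 : R) a da -> is_derive t (1 : R) b db -> is_derive t (1 : R) x dx ->
  is_derive t (1 : R) (fun s => cs (a s) (b s) (x s)) (cs da db (x t) + cs (a t) (b t) dx).
Proof.
move=> ha hb hx; have hJ := is_derive_J hx.
apply: is_derive_eq (is_derive_addmx (is_derive_scale ha hx) (is_derive_scale hb hJ)) _.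
by rewrite /cs addrACA.
Qed.

Lemma is_derive_c (X : R -> W) t dX : is_derive t (1 : R) X dX ->
  is_derive t (1 : R) (fun s => c0 (X s)) (c0 dX) /\ is_derive t (1 : R) (fun s => c1 (X s)) (c1 dX).
Proof.
move=> h; split.
  by apply: is_derive_eq (is_derive_dot h (is_derive_cstmx (e0 R n) t (1 : R))) _; rewrite dot0r addr0.
by apply: is_derive_eq (is_derive_dot h (is_derive_cstmx (f0 R n) t (1 : R))) _; rewrite dot0r addr0.
Qed.

Lemma is_derive_iota (c : R -> V) t dc : is_derive t (1 : R) c dc ->
  is_derive t (1 : R) (fun s => iota_ (c s)) (iota_ dc).
Proof.
move=> h; apply: is_derive_eq (is_derive_mulmx h (is_derive_cstmx (iotamx R n) t (1 : R))) _.
by rewrite mulmx0 addr0.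
Qed.

Lemma smooth_act_curve g (c : R -> V) : Ghat g -> (forall t, CH (c t)) -> smooth_curve c ->
  smooth_curve (fun t => act g (c t)).
Proof. by move=> Gg hc sc k; apply: Ck_act => //; exact: openT. Qed.

Lemma derive1_act g (c : R -> V) t dc : Ghat g -> (forall t, CH (c t)) -> is_derive t (1 : R) c dc ->
  derive1 (fun t => act g (c t)) t = dact g (c t) dc.
Proof.
move=> Gg hc dcE; apply: derive1_val; apply: is_derive_act => //.
by near=> y; exact: hc.
Unshelve. all: by end_near. Qed.

Lemma gam_act g z c1' c2 d1 d2 (a b a1 b1 e f : R) : Ghat g -> CH z -> let z' := act g z in
  a = c0 (lift z *m g) -> b = c1 (lift z *m g) ->
  iota_ c1' *m g = cs a1 b1 (lift z') + cs a b (iota_ d1) ->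
  iota_ c2 *m g = cs e f (lift z') + cs a1 b1 (iota_ d1) + (cs a1 b1 (iota_ d1) + cs a b (iota_ d2)) ->
  d2 + gam z' d1 = dact g z (c2 + gam z c1').
Proof.
move=> Gg hz z' aE bE X1E X2E; have hz' : CH z' by exact: act_CH.
have q0 : a ^+ 2 + b ^+ 2 != 0 by rewrite aE bE gt_eqF //; exact: (q2_lift Gg hz).
have XE : lift z *m g = cs a b (lift z') by rewrite aE bE; exact: act_liftE.
have zE : z' = act g z by []. clearbody z'; rewrite /gam.
have [s s2 [hB hJ]] := Gg.
have zp : 1 - dot z z != 0 by rewrite gt_eqF // subr_gt0; exact/CHE.
have zp' : 1 - dot z' z' != 0 by rewrite gt_eqF // subr_gt0; exact/CHE.
have NE : 1 - dot z z = (a ^+ 2 + b ^+ 2) * (1 - dot z' z').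
  by apply/oppr_inj; rewrite opprB -B_lift -(hB _ (lift z)) XE B_cs B_lift; ring.
have LL : B (lift z') (lift z') = dot z' z' - 1 by rewrite B_lift.
have IL : B (iota_ d1) (lift z') = dot d1 z' by rewrite B_iota_l pi_lift.
have IJL : B (iota_ d1) (Jmul (lift z')) = dot d1 (Jmul z') by rewrite B_iota_l piJ pi_lift.
have [p1 p2] : dot c1' z = - (a1 * a + b1 * b) * (1 - dot z' z') + (a ^+ 2 + b ^+ 2) * dot d1 z' /\
    dot c1' (Jmul z) = s * (- (b1 * a - a1 * b) * (1 - dot z' z') + (a ^+ 2 + b ^+ 2) * dot d1 (Jmul z')).
  move: (lift z') (iota_ d1) LL IL IJL XE X1E => L I LL IL IJL XE' X1E'.
  rewrite -{1 2}(pi_lift z) -piJ -!B_iota_l -(hB _ (lift z)) -(hB _ (Jmul _)).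
  have -> : Jmul (lift z) *m g = s *: Jmul (lift z *m g) by rewrite hJ scalerA -expr2 s2 scale1r.
  rewrite X1E' XE' /cs; split; last first.
    by rewrite BZr !(JmulX, BX) !BJJ !BJl BxJx LL IL IJL; ring.
  by rewrite !BX !BJJ !BJl BxJx LL IL IJL; ring.
apply/esym.
set p := 2 * _ / _; set pq := 2 * dot c1' (Jmul z) / _; set p' := 2 * dot d1 z' / _; set pq' := 2 * dot d1 (Jmul z') / _.
apply: (@dact_uniq _ _ _ _ (e + (p * a1 - s * pq * b1)) (f + (p * b1 + s * pq * a1))) => //.
rewrite -zE -aE -bE (iotaD c2) (iotaD d2) mulmxDl X2E !iota_cs (@cs_mulg _ _ s _ _ _ _ s2 hJ) X1E.
have r1 : p * a - s * pq * b = - 2 * a1 + (p' * a - pq' * b).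
  rewrite /p /pq /p' /pq' p1 p2 NE; rewrite (_ : s * _ = s ^+ 2 * (2 * (- (b1 * a - a1 * b) * (1 - dot z' z') + (a ^+ 2 + b ^+ 2) * dot d1 (Jmul z'))  / ((a ^+ 2 + b ^+ 2) * (1 - dot z' z')))); last by ring.
  by rewrite s2; field; rewrite zp' q0.
have r2 : p * b + s * pq * a = - 2 * b1 + (p' * b + pq' * a).
  rewrite /p /pq /p' /pq' p1 p2 NE; rewrite (_ : s * _ = s ^+ 2 * (2 * (- (b1 * a - a1 * b) * (1 - dot z' z') + (a ^+ 2 + b ^+ 2) * dot d1 (Jmul z'))  / ((a ^+ 2 + b ^+ 2) * (1 - dot z' z')))); last by ring.
  by rewrite s2; field; rewrite zp' q0.
move: (lift z') (iota_ d1) (iota_ d2) => L I1 I2.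
rewrite (csD p) (csD a b I2) !cs_cs -[cs (e + _) _ _]csDl.
have -> : cs (a * p' - b * pq') (a * pq' + b * p') I1 = cs a1 b1 I1 + cs a1 b1 I1 +
    cs (p * a - s * pq * b) (p * b + s * pq * a) I1.
  by rewrite !csDl r1 r2; congr (cs _ _ _); ring.
move: (cs a1 b1 I1) (cs e f L) (cs a b I2) (cs _ _ I1) (cs _ _ L) => A B1 B2 B3 B4.
by apply/rowP => k; rewrite !mxE; ring.
Qed.

(* Write [lift c g = l L] with [L = lift (act g c)] and [l] complex. Differentiating twice, the
   terms [l' L'] are absorbed since [gam] is multiplication by [-2 h(c', lift c) / h(lift c, lift c)]. *)
Lemma covariant_acceleration_act g (c : R -> V) t : Ghat g -> (forall t, CH (c t)) -> smooth_curve c ->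
  covariant_acceleration bergman (fun t => act g (c t)) t =
  dact g (c t) (covariant_acceleration bergman c t).
Proof.
move=> Gg hc sc; have hd s : CH (act g (c s)) by exact: act_CH.
rewrite !covariant_accelerationE //.
have sd := smooth_act_curve Gg hc sc; pose d s := act g (c s).
have dc s := smooth_is_derive s sc; have ddc s := smooth_is_derive s (smooth_derive1 sc).
have dd s : is_derive s (1 : R) d _ := smooth_is_derive s sd.
have ddd s : is_derive s (1 : R) (derive1 d) _ := smooth_is_derive s (smooth_derive1 sd).
rewrite -/d; pose X s := lift (c s) *m g; pose X1 s := iota_ (derive1 c s) *m g.
have dX s : is_derive s (1 : R) X (X1 s) by exact: is_derive_lift.
have dX1 s : is_derive s (1 : R) X1 (iota_ (derive1 (derive1 c) s) *m g).
  apply: is_derive_eq (is_derive_mulmx (is_derive_iota (ddc s)) (is_derive_cstmx g s (1 : R))) _.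
  by rewrite mulmx0 addr0.
pose al s := c0 (X s); pose be s := c1 (X s); pose al1 s := c0 (X1 s); pose be1 s := c1 (X1 s).
have dal s : is_derive s (1 : R) al (al1 s) by have [] := is_derive_c (dX s).
have dbe s : is_derive s (1 : R) be (be1 s) by have [] := is_derive_c (dX s).
have [dal1 dbe1] := is_derive_c (dX1 t); rewrite -/al1 -/be1 in dal1 dbe1.
have XE s : X s = cs (al s) (be s) (lift (d s)) by exact: act_liftE.
have dL s : is_derive s (1 : R) (fun s => lift (d s)) (iota_ (derive1 d s)).
  have := is_derive_addmx (is_derive_cstmx (e0 R n) s (1 : R)) (is_derive_iota (dd s)).
  by move=> h; apply: is_derive_eq h _; rewrite add0r.
have X1E s : X1 s = cs (al1 s) (be1 s) (lift (d s)) + cs (al s) (be s) (iota_ (derive1 d s)).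
  apply: is_derive_uniq (dX s) _.
  by rewrite (_ : X = fun s => cs (al s) (be s) (lift (d s))); [exact: is_derive_cs|apply/funext].
have X2E := is_derive_uniq (dX1 t) (_ : is_derive t (1 : R) X1 _).
have {X2E} X2E : iota_ (derive1 (derive1 c) t) *m g = cs (c0 (iota_ (derive1 (derive1 c) t) *m g))
    (c1 (iota_ (derive1 (derive1 c) t) *m g)) (lift (d t)) + cs (al1 t) (be1 t) (iota_ (derive1 d t)) +
    (cs (al1 t) (be1 t) (iota_ (derive1 d t)) + cs (al t) (be t) (iota_ (derive1 (derive1 d) t))).
  apply: X2E; rewrite (_ : X1 = fun s => cs (al1 s) (be1 s) (lift (d s)) + cs (al s) (be s) (iota_ (derive1 d s))).
    by apply: is_derive_addmx; apply: is_derive_cs => //; exact: is_derive_iota.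
  exact/funext.
move: (X2E) (X1E t); rewrite /X1 => X2 X1t.
by rewrite -[act g (c t)]/(d t); apply: (gam_act Gg (hc t) erefl erefl X1t X2).
Qed.
Implicit Types (M : set V).

Lemma is_derive_act_id g z v : Ghat g -> CH z -> is_derive z v (act g) (dact g z v).
Proof. by move=> Gg hz; apply: is_derive_act => //; exact: near_CH. Qed.

Lemma dactM g h z v : Ghat g -> Ghat h -> CH z ->
  dact (g *m h) z v = dact h (act g z) (dact g z v).
Proof.
move=> Gg Gh hz; have d1 := is_derive_act_id v (GhatM Gg Gh) hz.
have D : is_derive z v (fun y => act h (act g y)) (dact h (act g z) (dact g z v)).
  have nC : \forall y \near z, CH (act g y) by apply: filterS (near_CH hz) => y; exact: act_CH.
  exact (@is_derive_act R n V (act g) z v (dact g z v) h Gh nC (is_derive_act_id v Gg hz)).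
apply: is_derive_uniq d1 (is_derive_ext _ D).
by near=> y; rewrite actM.
Unshelve. all: by end_near. Qed.

Lemma dact1 z v : CH z -> dact 1%:M z v = v.
Proof.
move=> hz; apply: is_derive_uniq (is_derive_act_id v (@Ghat1 _ _) hz) _.
by rewrite (_ : act 1%:M = fun z => z); [exact: is_derive_id|apply/funext => y; rewrite act1].
Qed.

Lemma dactK g z v : Ghat g -> CH z -> dact (invmx g) (act g z) (dact g z v) = v.
Proof. by move=> Gg hz; rewrite -dactM ?mulmxV ?dact1 //; [exact: Ghat_unit|exact: GhatV]. Qed.

Lemma dactKV g z v : Ghat g -> CH z -> dact g z (dact (invmx g) (act g z) v) = v.
Proof.
move=> Gg hz; rewrite -{1}(actK z Gg) -dactM ?mulVmx ?dact1 //; try exact: act_CH; try exact: GhatV.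
exact: Ghat_unit.
Qed.

Lemma cs_lin (k : nat) (a p q p' q' al be : R) (L I1 I2 : realCn R k) :
  a *: (cs p q L + cs al be I1) + (cs p' q' L + cs al be I2) =
  cs (a * p + p') (a * q + q') L + cs al be (a *: I1 + I2).
Proof.
rewrite /cs JmulD JmulZ; move: (Jmul L) (Jmul I1) (Jmul I2) => JL J1 J2.
by apply/rowP => j; rewrite !mxE; ring.
Qed.

Lemma cs_Js (k : nat) (s p q al be : R) (L I : realCn R k) :
  s *: Jmul (cs p q L + cs al be I) = cs (- s * q) (s * p) L + cs al be (s *: Jmul I).
Proof.
rewrite /cs !JmulX; move: (Jmul L) (Jmul I) => JL J1.
by apply/rowP => j; rewrite !mxE; ring.
Qed.

Lemma dact_linear g z a v w : Ghat g -> CH z -> dact g z (a *: v + w) = a *: dact g z v + dact g z w.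
Proof.
move=> Gg hz; have e1 := dactE v Gg hz; have e2 := dactE w Gg hz.
have : iota_ (a *: v + w) *m g = a *: (iota_ v *m g) + iota_ w *m g.
  by rewrite [iota_ _]iotaD [iota_ (a *: v)]iotaZ mulmxDl scalemxAl.
move: e1 e2; move: (c0 (iota_ v *m g)) (c1 (iota_ v *m g)) (c0 (iota_ w *m g)) (c1 (iota_ w *m g)).
move=> p q p' q' -> -> E; apply: (@dact_uniq _ _ _ _ (a * p + p') (a * q + q')) => //.
have e : iota_ (a *: dact g z v + dact g z w) = a *: iota_ (dact g z v) + iota_ (dact g z w).
  by rewrite [LHS]iotaD [iota_ (_ *: _)]iotaZ.
by rewrite E cs_lin e.
Qed.

Lemma dact_J g z v s : Ghat g -> s ^+ 2 = 1 -> uni s g -> CH z -> dact g z (Jmul v) = s *: Jmul (dact g z v).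
Proof.
move=> Gg s2 [_ hJ] hz.
have : iota_ (Jmul v) *m g = s *: Jmul (iota_ v *m g) by rewrite iotaJ hJ scalerA -expr2 s2 scale1r.
rewrite [in X in _ = s *: X](dactE v Gg hz).
move: (c0 (iota_ v *m g)) (c1 (iota_ v *m g)) => p q E.
apply: (@dact_uniq _ _ _ _ (- s * q) (s * p)) => //.
by rewrite E cs_Js [iota_ (_ *: _)]iotaZ iotaJ.
Qed.

Lemma dact0 g z : Ghat g -> CH z -> dact g z 0 = 0.
Proof. by move=> Gg hz; have := dact_linear (-1) 0 0 Gg hz; rewrite scaler0 addr0 scaleN1r addNr. Qed.

Lemma tangent_act g M z v : Ghat g -> M `<=` CH -> tangent_space M z v ->
  tangent_space (act g @` M) (act g z) (dact g z v).
Proof.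
move=> Gg MC [c [sc cM c0 c1]]; have cC t : CH (c t) by exact: MC.
exists (fun t => act g (c t)); split; [exact: smooth_act_curve|by move=> t; exists (c t)|by rewrite c0|].
by rewrite (derive1_act Gg cC (smooth_is_derive 0 sc)) c0 c1.
Qed.

Lemma act_imageK g M : Ghat g -> act (invmx g) @` (act g @` M) = M.
Proof.
move=> Gg; apply/seteqP; split=> [_ [_ [z Mz <-] <-]|z Mz]; first by rewrite actK.
by exists (act g z); [exists z|rewrite actK].
Qed.

Lemma act_image_CH g M : Ghat g -> M `<=` CH -> act g @` M `<=` CH.
Proof. by move=> Gg MC _ [z Mz <-]; apply: act_CH => //; exact: MC. Qed.

Lemma tangent_actE g M z v : Ghat g -> M `<=` CH -> CH z ->
  tangent_space (act g @` M) (act g z) (dact g z v) <-> tangent_space M z v.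
Proof.
move=> Gg MC hz; split; last exact: tangent_act.
move/(tangent_act (GhatV Gg) (act_image_CH Gg MC)).
by rewrite act_imageK // actK // dactK.
Qed.

Lemma totally_geodesic_act g M : Ghat g -> M `<=` CH -> totally_geodesic bergman (act g @` M) ->
  totally_geodesic bergman M.
Proof.
move=> Gg MC tg c sc cM t; have cC s : CH (c s) by exact: MC.
apply/(tangent_actE (covariant_acceleration bergman c t) Gg MC (cC t)).
rewrite -covariant_acceleration_act //; apply: (tg (fun t => act g (c t))); first exact: smooth_act_curve.
by move=> s; exists (c s).
Qed.

Definition codim_at M z k := exists T : {vspace V},
  [set v | v \in T] = tangent_space M z /\ (\dim T + k = n + n)%N.

Lemma codim_at_act g M z k : Ghat g -> M `<=` CH -> M z -> codim_at M z k -> codim_at (act g @` M) (act g z) k.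
Proof.
move=> Gg MC Mz; have hz := MC _ Mz => -[T [TE dT]].
have lin : linear (dact g z) by move=> a v w; exact: dact_linear.
pose L := GRing.isLinear.Build _ _ _ _ (dact g z) lin.
pose f : {linear V -> V} := HB.pack (dact g z) L.
have fE v : linfun f v = dact g z v by rewrite lfunE.
exists (linfun f @: T)%VS; split.
  apply/seteqP; split=> [w /memv_imgP[v vT ->]|w].
    by rewrite fE; apply: tangent_act => //; rewrite -TE.
  rewrite -{1}(dactKV w Gg hz) => /(tangent_actE _ Gg MC hz); rewrite -TE /= => h.
  by apply/memv_imgP; exists (dact (invmx g) (act g z) w) => //; rewrite fE dactKV.
rewrite limg_dim_eq //; apply/eqP; rewrite -subv0; apply/subvP => v /memv_capP[_].
by rewrite memv_ker fE => /eqP e; rewrite memv0 -(dactK v Gg hz) e dact0 //; [exact: GhatV|exact: act_CH].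
Qed.

Lemma has_codim_act g M k : Ghat g -> M `<=` CH -> has_codim M k -> has_codim (act g @` M) k.
Proof. by move=> Gg MC hk _ [z Mz <-]; apply: codim_at_act => //; exact: hk. Qed.

Lemma normal_actE g M z v : Ghat g -> M `<=` CH -> CH z ->
  Defs.normal_space bergman (act g @` M) (act g z) (dact g z v) <-> Defs.normal_space bergman M z v.
Proof.
move=> Gg MC hz; split=> h w hw.
  by rewrite -(metric_dact _ _ Gg hz); apply: h; exact: tangent_act.
rewrite -(dactKV w Gg hz) metric_dact //; apply: h.
by apply/(tangent_actE _ Gg MC hz); rewrite dactKV.
Qed.

(** [param_codim] and [angle_condition] split [has_parameter] into conditions at one point, so that
    homogeneity reduces an orbit to its point 0 ([orb0_parameter]). *)
Definition param_codim (s : nat + R * nat) := match s with inl k => k | inr p => p.2 end.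

Definition angle_condition M z (s : nat + R * nat) := match s with
  | inl _ => real_subspace z (Defs.normal_space bergman M z)
  | inr p => constant_kahler_angle z (Defs.normal_space bergman M z) p.1
  end.

Lemma has_parameterE M s : has_parameter M s <-> has_codim M (param_codim s) /\ forall z, M z -> angle_condition M z s.
Proof. by case: s => [k|[phi l]]. Qed.

Lemma angle_condition_act g M z s : Ghat g -> M `<=` CH -> M z -> angle_condition M z s ->
  angle_condition (act g @` M) (act g z) s.
Proof.
move=> Gg MC Mz; have hz := MC _ Mz; have [sg s2 us] := Gg.
have sg0 : sg != 0 by rewrite -sqrf_eq0 s2 oner_eq0.
have NE w : Defs.normal_space bergman (act g @` M) (act g z) w ->
    exists2 v, Defs.normal_space bergman M z v & w = dact g z v.
  rewrite -{1}(dactKV w Gg hz) => /(normal_actE _ Gg MC hz) h.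
  by exists (dact (invmx g) (act g z) w); rewrite ?dactKV.
case: s => [k|[phi l]] hp.
  move=> v w /NE[v' hv ->] /NE[w' hw ->].
  by rewrite -[Jmul _](scalerK sg0) -(dact_J _ Gg s2 us hz) metricZl metric_dact // hp // mulr0.
move=> v /NE[v' hv ->] v0.
have v'0 : v' != 0 by apply: contra_neq v0 => ->; rewrite dact0.
rewrite -(hp v' hv v'0) /kahler_angle /angle_to_subspace; congr inf.
have JE : Jmul (dact g z v') = dact g z (sg *: Jmul v').
  have := dact_linear sg (Jmul v') 0 Gg hz; rewrite addr0 dact0 // addr0 => ->.
  by rewrite (dact_J _ Gg s2 us hz) scalerA -expr2 s2 scale1r.
have aE u w : angle bergman (act g z) (dact g z u) (dact g z w) = angle bergman z u w.
  by rewrite /angle (metric_dact u w Gg hz) (metric_dact u u Gg hz) (metric_dact w w Gg hz).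
have sE u w : angle bergman z (sg *: u) w = angle bergman z u (sg *: w).
  have sq x : metric bergman z (sg *: x) (sg *: x) = metric bergman z x x.
    by rewrite metricZl metric_sym metricZl mulrA -expr2 s2 mul1r.
  by rewrite /angle !sq metricZl [in RHS]metric_sym metricZl [metric _ _ w u]metric_sym.
(* The two normal spaces are matched by w |-> dact g z (sg w), which absorbs the sign in the
   commutation with J. *)
apply/seteqP; split=> [_ [w [hw w0] <-]|_ [w [hw w0] <-]].
  have [w' hw' wE] := NE _ hw; exists (sg *: w'); last by rewrite wE JE aE sE.
  split; last by rewrite scaler_eq0 negb_or sg0 /=; apply: contra_neq w0 => w'0; rewrite wE w'0 dact0.
  by move=> u hu; rewrite metric_sym metricZl metric_sym hw' // mulr0.
exists (dact g z (sg *: w)); last first.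
  by rewrite JE aE sE scalerA -expr2 s2 scale1r.
split.
  apply/(normal_actE _ Gg MC hz) => u hu.
  by rewrite metric_sym metricZl metric_sym hw // mulr0.
apply: contra_neq w0 => /(congr1 (dact (invmx g) (act g z))); rewrite dactK // dact0 //; last exact: act_CH; last exact: GhatV.
by move/eqP; rewrite scaler_eq0 (negPf sg0) => /eqP.
Qed.

Lemma has_parameter_act g M s : Ghat g -> M `<=` CH -> has_parameter M s -> has_parameter (act g @` M) s.
Proof.
move=> Gg MC /has_parameterE[hc hp]; apply/has_parameterE; split; first exact: has_codim_act.
by move=> _ [z Mz <-]; exact: angle_condition_act (hp z Mz).
Qed.
Lemma orb0_parameter (H : set MM) s : closed_subgroup H -> codim_at (orb0 H) 0 (param_codim s) ->
  angle_condition (orb0 H) 0 s -> has_parameter (orb0 H) s.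
Proof.
move=> HH hc hp; have OC := orb0_CH HH; have O0 := orb00 HH.
have im g : H g -> act g @` orb0 H = orb0 H.
  move=> hg; apply/seteqP; split=> [_ [y hy <-]|y hy]; first exact: (orb0_act HH).
  exists (act (invmx g) y); [apply: (orb0_act HH) hy; exact: (HV HH)|rewrite actKV //; exact: (HG HH)].
apply/has_parameterE; split=> z [g hg <-]; have Gg := HG HH hg; rewrite -{1}(im g hg).
  exact: codim_at_act.
exact: angle_condition_act.
Qed.
Variable H : set MM.
Hypothesis HH : closed_subgroup H.

Lemma gam0 (v : V) : gam 0 v = 0.
Proof. by rewrite /gam /cs Jmul0 dot0r mulr0 mul0r !scale0r addr0. Qed.

Lemma tan0_derive1 (d : R -> V) t : smooth_curve d -> (forall s, orb0 H (d s)) -> d t = 0 -> tan0 H (derive1 d t).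
Proof.
move=> sd dO d0; have dd := smooth_is_derive t sd.
have := is_derive_seq dd (@harmonic_neq0 R) (@harmonic_cvg R); rewrite d0.
under eq_fun do rewrite subr0.
move=> lim; apply: (tangent_cone HH _ _ (@harmonic_cvg R) lim) => i; [exact: dO|exact: harmonic_gt0].
Qed.

Lemma cvg_pr_scaled (X : nat -> W) (r : nat -> R) (v : V) : X @ \oo --> e0 R n ->
  (fun k => r k *: pi_ (X k)) @ \oo --> v -> (fun k => r k *: pr (X k)) @ \oo --> v.
Proof.
move=> cX lim; have a0 := cvg_c0 cX; have a1 := cvg_c1 cX.
have i1 : (fun k => (q2 (X k))^-1) @ \oo --> (q2 (e0 R n))^-1.
  apply: cvgV; first by rewrite q2e0 oner_eq0.
  by apply: cvgD; [exact: (cvgM a0 a0)|exact: (cvgM a1 a1)].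
have vE : v = (q2 (e0 R n))^-1 *: (c0 (e0 R n) *: v - c1 (e0 R n) *: Jmul v).
  by rewrite q2e0 invr1 scale1r c0e c1e scale1r scale0r subr0.
rewrite [X in _ --> X]vE (_ : (fun k => r k *: _) = fun k => (q2 (X k))^-1 *:
    (c0 (X k) *: (r k *: pi_ (X k)) - c1 (X k) *: Jmul (r k *: pi_ (X k)))).
  by apply: cvg_scale i1 _; apply: cvgB; apply: cvg_scale => //; exact: cvg_J.
apply/funext => k; rewrite /pr JmulZ; move: (q2 _)^-1 (c0 _) (c1 _) (pi_ _) => a b c p.
by move: (Jmul p) => Jp; apply/rowP => j; rewrite !mxE; ring.
Qed.

(* Moving [d] back along the one-parameter group with the same velocity leaves a curve in the orbit
   whose velocity vanishes, so that its acceleration is tangent. *)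
Lemma tan0_derive2 (d : R -> V) t : smooth_curve d -> (forall s, orb0 H (d s)) -> d t = 0 ->
  exists2 X, lie H X & tan0 H (derive1 (derive1 d) t - accel X).
Proof.
move=> sd dO d0; have [X hX vE] := tan0_derive1 sd dO d0; exists X => //.
pose v := derive1 d t; rewrite -/v in vE.
have dd s : is_derive s (1 : R) (fun s => d (t + s)) (derive1 d (t + s)).
  exact: is_derive_shift (smooth_is_derive _ sd).
have ddd s : is_derive s (1 : R) (fun s => derive1 d (t + s)) (derive1 (derive1 d) (t + s)).
  exact: is_derive_shift (smooth_is_derive _ (smooth_derive1 sd)).
pose Y := expm (- X); have dY s : is_derive s (1 : R) Y (- X *m Y s) by exact: is_derive_expm.
pose L s := lift (d (t + s)).
have dL s : is_derive s (1 : R) L (iota_ (derive1 d (t + s))).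
  apply: is_derive_eq (is_derive_addmx (is_derive_cstmx (e0 R n) s (1 : R)) (is_derive_iota (dd s))) _.
  by rewrite add0r.
have dpi (E : R -> W) s dE : is_derive s (1 : R) E dE -> is_derive s (1 : R) (fun s => pi_ (E s)) (pi_ dE).
  move=> h; apply: is_derive_eq (is_derive_mulmx h (is_derive_cstmx (iotamx R n)^T s (1 : R))) _.
  by rewrite mulmx0 addr0.
pose E s := L s *m Y s; pose E1 s := iota_ (derive1 d (t + s)) *m Y s + L s *m (- X *m Y s).
have dE s : is_derive s (1 : R) E (E1 s) by exact: is_derive_mulmx.
have Y0 : Y 0 = 1%:M by rewrite /Y expm0.
have L0 : L 0 = e0 R n by rewrite /L addr0 d0 lift0.
have dE1 : is_derive (0 : R) (1 : R) E1 (iota_ (derive1 (derive1 d) t) - iota_ v *m X - (iota_ v *m X - e0 R n *m X *m X)).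
  apply: is_derive_eq (is_derive_addmx (is_derive_mulmx (is_derive_iota (ddd 0)) (dY 0))
    (is_derive_mulmx (dL 0) (is_derive_expm_mul (- X) (- X) 0))) _.
  by rewrite -/Y Y0 L0 addr0 -/v !mulmx1 mulmxN mulmxN mulNmx opprK mulmxA opprB [_ *m X *m X - _]addrC.
have E10 : pi_ (E1 0) = 0.
  by rewrite /E1 L0 Y0 addr0 !mulmx1 mulmxN [pi_ (_ - _)]piB iotaK vE subrr.
have E0 : E 0 = e0 R n by rewrite /E L0 Y0 mulmx1.
have aE : pi_ (iota_ (derive1 (derive1 d) t) - iota_ v *m X - (iota_ v *m X - e0 R n *m X *m X)) =
    derive1 (derive1 d) t - accel X.
  have uX := lie_uLie HH hX; have [hJ _] := uX.
  have e : e0 R n *m X = c1 (e0 R n *m X) *: f0 R n + iota_ v.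
    by rewrite {1}(decompE (e0 R n *m X)) (uLie_c0 uX) scale0r add0r vE.
  have pe : pi_ (e0 R n *m X *m X) = c1 (e0 R n *m X) *: Jmul v + pi_ (iota_ v *m X).
    by rewrite {1}e mulmxDl [pi_ (_ + _)]piD -scalemxAl [pi_ (_ *: _)]piZ -hJ piJ vE.
  rewrite /accel vE !piB iotaK pe; move: (pi_ (iota_ v *m X)) (_ *: Jmul v) => a b.
  by apply/rowP => k; rewrite !mxE; ring.
have p0 : pi_ (E 0) = 0 by rewrite E0 pi_e0.
have lim := taylor2_seq p0 E10 (fun s => dpi _ _ _ (dE s)) (dpi _ _ _ dE1).
rewrite aE in lim.
have cE : (fun k => E (k.+1%:R^-1)) @ \oo --> e0 R n.
  have := is_derive_seq (dE 0) (@harmonic_neq0 R) (@harmonic_cvg R) => l1.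
  have := cvg_scale (@harmonic_cvg R) l1; rewrite scale0r E0 => l2.
  rewrite (_ : (fun k => E _) = fun k : nat => (k.+1%:R^-1 : R) *: ((k.+1%:R^-1)^-1 *: (E (k.+1%:R^-1 + 0) - e0 R n)) + e0 R n).
    by rewrite -[X in _ --> X]add0r; apply: cvgD; [exact: l2|exact: cvg_cst].
  by apply/funext => k; rewrite addr0 scalerA mulfV ?harmonic_neq0 // scale1r subrK.
have lim' : (fun k => ((k.+1%:R^-1 : R) ^+ 2)^-1 *: act (Y k.+1%:R^-1) (d (t + k.+1%:R^-1))) @ \oo -->
    2^-1 *: (derive1 (derive1 d) t - accel X).
  have := cvg_pr_scaled cE lim; rewrite (_ : (fun k => _) = fun k => ((k.+1%:R^-1 : R) ^+ 2)^-1 *: act (Y k.+1%:R^-1) (d (t + k.+1%:R^-1))) //.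
  by apply/funext => k; rewrite act_in //; exact: (orb0_CH HH (dO _)).
have [Z hZ ZE] : tan0 H (2^-1 *: (derive1 (derive1 d) t - accel X)).
  apply: (tangent_cone HH (t := fun k => (k.+1%:R^-1 : R) ^+ 2) _ _ _ lim').
  - by move=> k; apply: (orb0_act HH) (dO _); exact: (lieN hX).
  - by move=> k; rewrite exprn_gt0 ?harmonic_gt0.
  - by rewrite -(mulr0 (0 : R)); apply: cvgM; exact: harmonic_cvg.
exists (2 *: Z); first exact: lieZ.
by rewrite -scalemxAr piZ ZE scalerA mulfV ?pnatr_eq0 // scale1r.
Unshelve. all: by end_near. Qed.

(** The point c t is moved to 0, where [gam] vanishes and the covariant acceleration is the second
    derivative, known modulo the tangent space from [tan0_derive2]. *)
Lemma flat_totally_geodesic : (forall X, lie H X -> tan0 H (accel X)) -> totally_geodesic bergman (orb0 H).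
Proof.
move=> flat c sc cO t; have cC s : CH (c s) by exact: (orb0_CH HH (cO s)).
have [g hg gE] := cO t; have Gg := HG HH hg; have Gi := GhatV Gg.
pose d s := act (invmx g) (c s).
have dO s : orb0 H (d s) by apply: (orb0_act HH) (cO s); exact: (HV HH).
have sd : smooth_curve d by exact: smooth_act_curve.
have d0 : d t = 0 by rewrite /d -gE actK.
have [X hX hT] := tan0_derive2 sd dO d0.
have hD : tan0 H (derive1 (derive1 d) t).
  by rewrite -[derive1 _ t](subrK (accel X)); apply: (tan0D HH) hT _; exact: flat.
have := covariant_acceleration_act t Gi cC sc; rewrite -/d covariant_accelerationE; last exact: (orb0_CH HH (dO t)).
rewrite d0 gam0 addr0 => e; rewrite e in hD.
have imO : act g @` orb0 H = orb0 H.
  apply/seteqP; split=> [_ [y hy <-]|y hy]; first exact: (orb0_act HH).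
  by exists (act (invmx g) y); [apply: (orb0_act HH) hy; exact: (HV HH)|rewrite actKV].
have /(tangent_orb0 HH)/(tangent_act Gg (orb0_CH HH)) := hD.
by have KV := dactKV (covariant_acceleration bergman c t) Gg (@CH0 _ _); rewrite gE in KV; rewrite imO KV gE.
Qed.
End Equivariance.

(** * Curves with a given second-order jet *)

Section QuadraticCurves.
Variables (R : realType) (n : nat).
Local Notation V := (realCn R n).

(* a bounded change of parameter, tangent to the identity to second order at [0] *)
Definition slow (C t : R) : R := t / (1 + C * t ^+ 2).

Lemma slow_den (C t : R) : 0 < C -> 0 < 1 + C * t ^+ 2.
Proof. by move=> C0; rewrite ltr_pwDl // mulr_ge0 ?sqr_ge0 // ltW. Qed.

Lemma slow_bound (C t : R) : 0 < C -> C * slow C t ^+ 2 <= 1.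
Proof.
move=> C0; have d0 := slow_den t C0.
rewrite /slow expr_div_n mulrA ler_pdivrMr ?exprn_gt0 // mul1r.
have := sqr_ge0 t; nra.
Qed.

Lemma smooth_slow (C : R) : 0 < C -> smooth_curve (slow C).
Proof.
move=> C0 k; have oT : open [set: R] by exact: openT.
rewrite (_ : slow C = fun t => t * (1 + C * (t * t))^-1); last by apply/funext => t; rewrite /slow expr2.
apply: CkM => //; first exact: Ck_id.
apply: CkV => // [z _|]; first by rewrite -expr2 gt_eqF ?slow_den.
apply: CkD => //; first exact: Ck_cst.
by apply: CkM => //; [exact: Ck_cst|apply: CkM => //; exact: Ck_id].
Qed.

Lemma is_derive_slow (C t : R) : 0 < C ->
  is_derive t (1 : R) (slow C) ((1 - C * t ^+ 2) / (1 + C * t ^+ 2) ^+ 2).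
Proof.
move=> C0; have d0 := lt0r_neq0 (slow_den t C0).
have di : is_derive t (1 : R) (fun x : R => x) 1 by exact: is_derive_id.
have d2 : is_derive t (1 : R) (fun x : R => 1 + C * x ^+ 2) (2 * C * t).
  apply: is_derive_eq (is_deriveD (is_derive_cst (1 : R) t 1) (is_deriveM (is_derive_cst C t 1) (is_deriveX 2 di))) _.
  by rewrite /cst /GRing.scale /= expr1; ring.
have dV := @is_deriveV R (fun x => 1 + C * x ^+ 2) t _ 1 d0 d2.
rewrite (_ : slow C = id * (fun x => (1 + C * x ^+ 2)^-1)) //; apply: is_derive_eq (is_deriveM di dV) _.
by rewrite /GRing.scale /=; field.
Qed.

Lemma is_derive_slow1 (C : R) : 0 < C ->
  is_derive (0 : R) (1 : R) (fun t => (1 - C * t ^+ 2) / (1 + C * t ^+ 2) ^+ 2) 0.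
Proof.
move=> C0; have di : is_derive (0 : R) (1 : R) (fun x : R => x) 1 by exact: is_derive_id.
have dC a b : is_derive (0 : R) (1 : R) (fun x : R => a + b * x ^+ 2) 0.
  apply: is_derive_eq (is_deriveD (is_derive_cst (a : R) (0 : R) (1 : R)) (is_deriveM (is_derive_cst (b : R) (0 : R) (1 : R)) (is_deriveX 2 di))) _.
  by rewrite /cst /GRing.scale /= expr1; ring.
have d0 : (1 + C * (0 : R) ^+ 2) ^+ 2 != 0 by rewrite expr0n mulr0 addr0 expr1n oner_eq0.
have e : (fun t => (1 - C * t ^+ 2) / (1 + C * t ^+ 2) ^+ 2) =
    (fun t => (1 + - C * t ^+ 2) * ((1 + C * t ^+ 2) ^+ 2)^-1) by apply/funext => t; rewrite mulNr.
rewrite e; have dV := @is_deriveV R (fun x => (1 + C * x ^+ 2) ^+ 2) 0 _ 1 d0 (is_deriveX 2 (dC 1 C)).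
apply: is_derive_eq (is_deriveM (dC 1 (- C)) dV) _; by rewrite /GRing.scale /= !mulr0 addr0.
Qed.

(** Curves in [tangent_space] are defined on all of R. The bounded parameter [slow] keeps a
    quadratic curve inside the ball without changing its second-order jet at 0. *)
Lemma quad_curve (z u u2 : V) : CH z -> exists c : R -> V, [/\ smooth_curve c,
  forall t, CH (c t) /\ exists s : R, c t = z + s *: u + s ^+ 2 *: u2,
  c 0 = z, derive1 c 0 = u & derive1 (derive1 c) 0 = 2 *: u2].
Proof.
move=> hz; pose f (s : R) := z + s *: u + s ^+ 2 *: u2.
have df s : is_derive s (1 : R) f (u + (2 * s) *: u2).
  have di : is_derive s (1 : R) (fun x : R => x) 1 by exact: is_derive_id.
  have d1 := is_derive_scale di (is_derive_cstmx u s (1 : R)).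
  have d2 := is_derive_scale (is_deriveX 2 di) (is_derive_cstmx u2 s (1 : R)).
  apply: is_derive_eq (is_derive_addmx (is_derive_addmx (is_derive_cstmx z s (1 : R)) d1) d2) _.
  by rewrite !scaler0 !addr0 add0r scale1r expr1 /GRing.scale /= mulr1.
have [eps eps0 he] : exists2 eps : R, 0 < eps & forall s : R, `|s| < eps -> CH (f s).
  have cf : {for 0, continuous f}.
    exact/differentiable_continuous/derivable1_diffP/(@ex_derive _ _ _ _ _ _ _ (df 0)).
  have f0 : f 0 = z by rewrite /f scale0r expr0n scale0r !addr0.
  have : \forall s \near 0, CH (f s) by apply: cf; rewrite f0; exact: near_CH.
  move/nbhs_ballP => [eps /= eps0 h]; exists eps => // s hs; apply: h.
  by rewrite -ball_normE /= sub0r normrN.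
pose C := (eps / 2) ^- 2; have e2 : 0 < eps / 2 by rewrite divr_gt0.
have C0 : 0 < C by rewrite invr_gt0 exprn_gt0.
pose c t := f (slow C t).
have ds t := is_derive_slow t C0; pose s1 t := (1 - C * t ^+ 2) / (1 + C * t ^+ 2) ^+ 2.
have dc t : is_derive t (1 : R) c (s1 t *: u + (2 * (slow C t * s1 t)) *: u2).
  have d1 := is_derive_scale (ds t) (is_derive_cstmx u t (1 : R)).
  have d2 := is_derive_scale (is_deriveX 2 (ds t)) (is_derive_cstmx u2 t (1 : R)).
  apply: is_derive_eq (is_derive_addmx (is_derive_addmx (is_derive_cstmx z t (1 : R)) d1) d2) _.
  by rewrite !scaler0 !addr0 add0r expr1 /GRing.scale /= mulrA.
have s0 : slow C 0 = 0 by rewrite /slow mul0r.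
have s10 : s1 0 = 1 by rewrite /s1 expr0n /= !mulr0 subr0 addr0 expr1n divr1.
exists c; split.
- move=> k; have oT : open [set: R] by exact: openT.
  apply: CkD => //; last first.
    apply: CkZl => //; rewrite (_ : (fun t => _) = fun t => slow C t * slow C t) //.
    by apply: CkM => //; exact: (smooth_slow C0).
  by apply: CkD => //; [exact: Ck_cst|apply: CkZl => //; exact: (smooth_slow C0)].
- move=> t; split; last by exists (slow C t).
  apply: he; have := slow_bound t C0.
  rewrite mulrC ler_pdivrMr ?exprn_gt0 // mul1r => h.
  have : `|slow C t| <= eps / 2 by rewrite -(ger0_norm (ltW e2)) -ler_sqr ?nnegrE // !real_normK ?num_real.
  by move/le_lt_trans; apply; rewrite ltr_pdivrMr // ltr_pMr // ltr1n.
- by rewrite /c s0 /f scale0r expr0n scale0r !addr0.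
- by rewrite (derive1_val (dc 0)) s0 s10 mul0r mulr0 scale0r scale1r addr0.
- rewrite (_ : derive1 c = fun t => s1 t *: u + (2 * (slow C t * s1 t)) *: u2); last first.
    by apply/funext => t; exact: (derive1_val (dc t)).
  apply: derive1_val; have d1 := is_derive_slow1 C0.
  have d2 := is_deriveM (is_derive_cst (2 : R) (0 : R) 1) (is_deriveM (ds 0) d1).
  have d2' : is_derive (0 : R) (1 : R) (fun t => 2 * (slow C t * s1 t)) 2.
    by apply: is_derive_eq d2 _; rewrite -/(s1 0) s10 s0 !scaler0 add0r addr0 /cst /GRing.scale /= !mulr1.
  apply: is_derive_eq (is_derive_addmx (is_derive_scale d1 (is_derive_cstmx u (0 : R) (1 : R)))
    (is_derive_scale d2' (is_derive_cstmx u2 (0 : R) (1 : R)))) _.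
  by rewrite !scaler0 !addr0 scale0r add0r.
Qed.

(** [gam] is a complex multiple of the velocity, so it stays orthogonal to a family of vectors
    closed under J. *)
Lemma complex_slice_totally_geodesic (N : set V) : (forall v, N v -> N (Jmul v)) ->
  totally_geodesic bergman [set z | CH z /\ forall v, N v -> dot z v = 0].
Proof.
move=> NJ c sc cM t; have cC s : CH (c s) by have [] := cM s.
have perp (d : R -> V) s : smooth_curve d -> (forall s v, N v -> dot (d s) v = 0) ->
    forall v, N v -> dot (derive1 d s) v = 0.
  move=> sd h v hv; have dd := is_derive_dot (smooth_is_derive s sd) (is_derive_cstmx v s (1 : R)).
  rewrite (_ : (fun y => _) = fun=> 0) in dd; last by apply/funext => y; rewrite h.
  by have := is_derive_uniq (is_derive_cst (0 : R) s (1 : R)) dd; rewrite dot0r addr0.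
have p0 s v : N v -> dot (c s) v = 0 by have [_] := cM s; exact.
have p1 s v := @perp c s sc p0 v.
have p2 v := @perp (derive1 c) t (smooth_derive1 sc) p1 v.
rewrite covariant_accelerationE //; set D := _ + _.
have hD v : N v -> dot D v = 0.
  move=> hv; rewrite dotDl (p2 v hv) add0r /gam /cs dotDl !dotZl dotJl (p1 t v hv) (p1 t _ (NJ v hv)).
  by rewrite oppr0 !mulr0 addr0.
have [c' [sc' h c0 c1 _]] := quad_curve D 0 (cC t).
exists c'; split=> // s; have [hc [x xE]] := h s; split=> // v hv.
by rewrite xE scaler0 addr0 dotDl dotZl (p0 t v hv) (hD v hv) mulr0 addr0.
Qed.
End QuadraticCurves.

(** * Constant Kaehler angle *)

Section ConstantAngle.
Variables (R : realType) (n : nat).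
Local Notation V := (realCn R n).
Local Notation W := (realCn R n.+1).
Implicit Types (P : 'M[R]_(n + n)) (u v w : V).

(* The projection of [Jmul v] onto the range of [P] has length [Num.sqrt c * |v|]. *)
Definition const_angle P (c : R) := [/\ P^T = P, P *m P = P &
  forall v, v *m P = v -> dot (Jmul v *m P) (Jmul v *m P) = c * dot v v].

(** Pairs 2m with 2m + 1. For c > 0 the vectors of a frame come in such pairs, exchanged by P J up
    to sign and the factor sqrt c. *)
Definition partner (i : nat) := if odd i then i.-1 else i.+1.
Definition kform (c : R) (i j : nat) : R := ((-1) ^+ odd j * Num.sqrt c) * (i == partner j)%:R.

Definition frame P c (k : nat) (xi : nat -> V) := [/\
  forall i, (i < k)%N -> xi i *m P = xi i,
  forall i j, (i < k)%N -> (j < k)%N -> dot (xi i) (xi j) = (i == j)%:R &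
  forall i, (i < k)%N -> Jmul (xi i) *m P = ((-1) ^+ odd i * Num.sqrt c) *: xi (partner i)].

Lemma frame_next P (k : nat) (xi : nat -> V) : P *m P = P -> (forall i, (i < k)%N -> xi i *m P = xi i) -> (k < \rank P)%N ->
  exists v, [/\ v *m P = v, dot v v = 1 & forall i, (i < k)%N -> dot v (xi i) = 0].
Proof.
move=> PP hx hk; pose A := \matrix_(i < k) xi i; pose N := kermx (P *m A^T).
have /row_subPn[i hi] : ~~ (N <= kermx P)%MS.
  apply/negP => /mxrankS; rewrite !mxrank_ker => h.
  have := rank_leq_col (P *m A^T); have := rank_leq_row P; lia.
pose x := row i N; have xA : x *m (P *m A^T) = 0 by apply/eqP; rewrite -sub_kermx; exact: row_sub.
have x0 : x *m P != 0 by apply: contra hi => /eqP h; apply/sub_kermxP.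
have d0 : 0 < dot (x *m P) (x *m P) by rewrite dot_gt0.
pose r := (Num.sqrt (dot (x *m P) (x *m P)))^-1; exists (r *: (x *m P)); split.
- by rewrite -scalemxAl -mulmxA PP.
- by rewrite dotZl dotZr mulrA -expr2 exprVn sqr_sqrtr ?mulVf ?lt0r_neq0 // ltW.
- move=> j hj; rewrite dotZl; have := congr1 (fun M : 'rV_k => M 0 (Ordinal hj)) xA.
  rewrite mulmxA !mxE => h; rewrite (_ : dot _ _ = 0) ?mulr0 // dotE -[RHS]h.
  by apply: eq_bigr => l _; rewrite !mxE.
Qed.

Section Angle.
Variables (P : 'M[R]_(n + n)) (c : R).
Hypotheses (hP : const_angle P c) (c0 : 0 <= c).
Let PT : P^T = P. Proof. by have [] := hP. Qed.
Let PP : P *m P = P. Proof. by have [] := hP. Qed.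

Lemma proj_dot v w : w *m P = w -> dot (v *m P) w = dot v w.
Proof. by move=> hw; rewrite -{1}hw dotP // hw. Qed.

Lemma angle_skew v w : v *m P = v -> w *m P = w -> dot (Jmul v *m P) w = - dot v (Jmul w *m P).
Proof.
move=> hv hw; rewrite proj_dot // dotJl.
by congr (- _); rewrite dotC -(proj_dot _ hv) dotC.
Qed.

Lemma angle_polar v w : v *m P = v -> w *m P = w -> dot (Jmul v *m P) (Jmul w *m P) = c * dot v w.
Proof.
move=> hv hw; have [_ _ h] := hP; have := h (v + w); rewrite mulmxDl hv hw => /(_ erefl).
rewrite JmulD mulmxDl !dotDl !dotDr (h v hv) (h w hw) [dot (Jmul w *m P) _]dotC [dot w v]dotC; nra.
Qed.

Lemma angle_square v : v *m P = v -> Jmul (Jmul v *m P) *m P = - c *: v.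
Proof.
move=> hv; set w := _ *m P; have hw : w *m P = w by rewrite /w -mulmxA PP.
have hk : Jmul v *m P *m P = Jmul v *m P by rewrite -mulmxA PP.
have wE y : y *m P = y -> dot w y = dot (- c *: v) y.
  by move=> hy; rewrite /w angle_skew // angle_polar // dotZl mulNr.
apply/eqP; rewrite -subr_eq0 -dot_eq0; apply/eqP.
have hd : (w - - c *: v) *m P = w - - c *: v by rewrite mulmxBl hw -scalemxAl hv.
by rewrite {1}dotBl (wE _ hd) subrr.
Qed.

Lemma frame_size k xi : frame P c k xi -> (k <= \rank P)%N.
Proof.
move=> [hx ho _]; pose A := \matrix_(i < k) xi i.
have [AA rA] : A *m A^T = 1%:M /\ \rank A = k := orthonormal_rows ho.
have AP : A *m P = A by apply/row_matrixP => i; rewrite row_mul rowK hx.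
by rewrite -{1}rA -AP mxrankM_maxr.
Qed.

(** For c = 0 the range of [P] is real and [v] is added alone. For c > 0 it is added together with P
    J v / sqrt c, and the pair is closed under P J by [angle_square]; hence the parity condition. *)
Lemma frame_step k xi v : frame P c k xi -> (0 < c -> ~~ odd k) -> v *m P = v -> dot v v = 1 ->
  (forall i, (i < k)%N -> dot v (xi i) = 0) ->
  exists k' xi', [/\ frame P c k' xi', 0 < c -> ~~ odd k', (k < k')%N, forall i, (i < k)%N -> xi' i = xi i & xi' k = v].
Proof.
move=> [hx ho hK] ev vP v1 vx.
have Kv i : (i < k)%N -> dot (Jmul v *m P) (xi i) = 0.
  move=> hi; rewrite angle_skew ?hx // hK // dotZr.
  have [->|cn] := eqVneq c 0; first by rewrite sqrtr0 mulr0 mul0r oppr0.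
  have cp : 0 < c by rewrite lt_def cn.
  rewrite vx ?mulr0 ?oppr0 //; have := ev cp; rewrite /partner; case: ifP => oi; lia.
have [cz|cn] := eqVneq c 0.
  exists k.+1, (fun i => if (i < k)%N then xi i else v).
  have z x : x *m P = x -> Jmul x *m P = 0.
    by move=> xP; apply/eqP; rewrite -dot_eq0; have [_ _ ->] := hP; rewrite // cz mul0r.
  split=> //; last by rewrite ltnn.
  - split=> [i|i j|i]; rewrite !ltnS.
    + by case: ifP => [/hx//|].
    + move=> ik jk; case: ltnP => hi; case: ltnP => hj; first exact: ho.
      * by rewrite dotC vx //; rewrite (_ : (i == j) = false) //; lia.
      * by rewrite vx // (_ : (i == j) = false) //; lia.
      * by rewrite v1 (_ : i == j) //; lia.
    + by move=> ik; rewrite cz sqrtr0 mulr0 scale0r; case: ifP => [/hx|_]; [exact: z|exact: z].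
  - by rewrite cz ltxx.
  - by move=> i ->.
have cp : 0 < c by rewrite lt_def cn.
have sc : Num.sqrt c != 0 by rewrite gt_eqF // sqrtr_gt0.
have ek := ev cp; pose v' := (Num.sqrt c)^-1 *: (Jmul v *m P).
have v'P : v' *m P = v' by rewrite /v' -scalemxAl -mulmxA PP.
have v'1 : dot v' v' = 1.
  rewrite /v' dotZl dotZr; have [_ _ ->] := hP => //; rewrite v1 mulr1 mulrA -expr2 exprVn sqr_sqrtr ?ltW //.
  by rewrite mulVf.
have vv' : dot v v' = 0 by rewrite /v' dotZr dotC proj_dot // dotJxx mulr0.
have v'x i : (i < k)%N -> dot v' (xi i) = 0 by move=> hi; rewrite dotZl Kv // mulr0.
exists k.+2, (fun i => if (i < k)%N then xi i else if i == k then v else v').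
have ->: (if (k < k)%N then xi k else if k == k then v else v') = v by rewrite ltnn eqxx.
split=> //=; [|by rewrite negbK|by move=> i ->].
split=> [i|i j|i] hi.
- by case: ifP => [/hx//|_]; case: ifP.
- move=> hj; case: ltnP => ik; case: ltnP => jk; first exact: ho.
  + by rewrite (_ : (i == j) = false); [case: ifP => _; rewrite dotC ?vx ?v'x|lia].
  + by rewrite (_ : (i == j) = false); [case: ifP => _; rewrite ?vx ?v'x|lia].
  + case: eqP => ei; case: eqP => ej; rewrite ?v1 ?v'1 ?vv' ?[dot v' v]dotC ?vv'.
    * by rewrite ei ej eqxx.
    * by rewrite (_ : (i == j) = false); [|lia].
    * by rewrite (_ : (i == j) = false); [|lia].
    * by rewrite (_ : i == j); [|lia].
- have pk : (i < k)%N -> (partner i < k)%N by rewrite /partner; case: ifP => oi; lia.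
  case: ltnP => ik; first by rewrite pk // hK.
  have [->|ni] := eqVneq i k.
    by rewrite /partner (negPf ek) ltnNge leqnSn /= -[k.+1 == k]/(_ == _) gtn_eqF // expr0 mul1r scalerA mulfV // scale1r.
  have -> : i = k.+1 by lia.
  rewrite /partner /= ek /= ltnn eqxx expr1 mulN1r /v' JmulZ -scalemxAl angle_square // scalerA.
  by congr (_ *: _); rewrite -{2}(sqr_sqrtr c0); field.
Qed.

Lemma adapted_frame u : u *m P = u -> dot u u = 1 ->
  (0 < c -> ~~ odd (\rank P)) /\ exists2 xi, frame P c (\rank P) xi & xi 0%N = u.
Proof.
move=> uP u1; have start : frame P c 0 (fun _ => u) by split.
have step0 : exists k xi, [/\ frame P c k xi, 0 < c -> ~~ odd k, (0 < k)%N & xi 0%N = u].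
  have [//|//|k [xi [h1 h2 h3 _ h5]]] := frame_step start _ uP u1.
  by exists k, xi.
suff : forall N, exists k xi, [/\ frame P c k xi, 0 < c -> ~~ odd k, (0 < k)%N, xi 0%N = u &
    (k = \rank P) \/ (N <= k)%N].
  move=> /(_ (\rank P)) [k [xi [h1 h2 h3 h4 h5]]].
  have e : k = \rank P by have := frame_size h1; lia.
  by rewrite -e; split=> //; exists xi.
elim=> [|N [k [xi [h1 h2 h3 h4 h5]]]].
  by have [k [xi [h1 h2 h3 h4]]] := step0; exists k, xi; split=> //; right.
have [e|ne] := eqVneq k (\rank P); first by exists k, xi; split=> //; left.
have [v [vP v1 vx]] : exists v, [/\ v *m P = v, dot v v = 1 & forall i, (i < k)%N -> dot v (xi i) = 0].
  by apply: frame_next => //; [have [] := h1|rewrite ltn_neqAle ne (frame_size h1)].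
have [k' [xi' [g1 g2 g3 g4 g5]]] := frame_step h1 h2 vP v1 vx.
exists k', xi'; split=> //; [exact: leq_trans g3|by rewrite g4|right].
by move: h5 => [e|h5]; [rewrite e eqxx in ne|exact: leq_ltn_trans h5 g3].
Qed.

Lemma frame_proj k xi : frame P c k xi -> k = \rank P ->
  forall x y, dot (x *m P) y = \sum_(i < k) dot x (xi i) * dot y (xi i).
Proof.
move=> hf ek; have [hx ho _] := hf; pose A := \matrix_(i < k) xi i.
have [AA rA] : A *m A^T = 1%:M /\ \rank A = k := orthonormal_rows ho.
have AP : A *m P = A by apply/row_matrixP => i; rewrite row_mul rowK hx.
have /submxP[D PD] : (P <= A)%MS.
  have sAP : (A <= P)%MS by rewrite -AP submxMl.
  by have [_ <-] := mxrank_leqif_sup sAP; rewrite rA; apply/eqP.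
have PE : P = A^T *m A.
  have PQ : P *m (A^T *m A) = P by rewrite {1}PD mulmxA -(mulmxA D) AA mulmx1 -PD.
  have QP : (A^T *m A) *m P = A^T *m A by rewrite -mulmxA AP.
  by rewrite -[LHS]PT -PQ trmx_mul trmx_mul trmxK PT QP.
move=> x y; have xA z : z *m A^T = \row_i dot z (xi i).
  by apply/rowP => i; rewrite !mxE dotE; apply: eq_bigr => j _; rewrite !mxE.
rewrite PE mulmxA /dot -mulmxA -[A *m y^T]trmxK trmx_mul trmxK !xA.
by rewrite mxE; apply: eq_bigr => i _; rewrite ![in LHS]mxE.
Qed.

Lemma frame_norm k xi : frame P c k xi -> k = \rank P ->
  forall x, dot (x *m P) (x *m P) = \sum_(i < k) dot x (xi i) ^+ 2.
Proof. by move=> hf ek x; rewrite dotP // dotC (frame_proj hf ek). Qed.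

Lemma frame_kform k xi i j : frame P c k xi -> (i < k)%N -> (j < k)%N -> (0 < c -> ~~ odd k) ->
  dot (xi i) (Jmul (xi j)) = kform c i j.
Proof.
move=> [hx ho hK] hi hj ek; rewrite dotC -(proj_dot _ (hx i hi)) hK // dotZl /kform.
have [->|cn] := eqVneq c 0; first by rewrite sqrtr0 mulr0 !mul0r.
have cp : 0 < c by rewrite lt_def cn.
have := ek cp => ek'; rewrite dotC ho //; rewrite /partner; case: ifP => oi; lia.
Qed.
End Angle.

Lemma fform_mulg (g : 'M[R]_(n.+1 + n.+1)) (x p w : W) : uni 1 g ->
  fform (x *m g) (p *m g) (w *m g) = fform x p w.
Proof. by move=> [gB gJ]; rewrite /fform !gJ !scale1r !gB. Qed.

(** conj h(x, p) h(x, i p) is purely imaginary: rho does not see real multiples of i q added to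
    normal vectors. *)
Lemma fform_shift (x p w : W) (a t : R) : fform x (a *: p) (w + t *: Jmul p) = a * fform x p w.
Proof. by rewrite /fform !JmulX !BX; ring. Qed.

(** * Isometries between level functions *)

Section Transfer.
Variables (e e' : V) (P P' : 'M[R]_(n + n)) (c : R).
Hypotheses (hP : const_angle P c) (hP' : const_angle P' c).
Local Notation q := (lift e).
Local Notation q' := (lift e').

(** By [frame_norm] the numerator of rho is a sum over the frame; real multiples of i q in the
    images drop out by [fform_shift], and the factor [a] cancels against the denominator. *)
Lemma rho_transfer (k : nat) (xi xi' : nat -> V) (g : 'M[R]_(n.+1 + n.+1)) (a : R) (t : nat -> R) :
  frame P c k xi -> frame P' c k xi' -> k = \rank P -> k = \rank P' -> uni 1 g -> a != 0 ->
  q *m g = a *: q' -> (forall i, (i < k)%N -> iota_ (xi i) *m g = iota_ (xi' i) + t i *: Jmul q') ->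
  forall z, CH z -> rho e' P' (act g z) = rho e P z.
Proof.
move=> f f' ek ek' ug a0 qg xg z hz; have Gg := uni_Ghat ug; have [gB gJ] := ug.
have [PT PP _] := hP; have [PT' PP' _] := hP'.
have gJ1 x : Jmul (x *m g) = Jmul x *m g by rewrite gJ scale1r.
set x := lift z.
have E : rho e' P' (act g z) = lev e' P' (x *m g).
  rewrite /rho [in RHS](act_liftE Gg hz) lev_cs // gt_eqF //; exact: q2_lift.
rewrite E /rho -/x /lev gB.
have hq : hsq x q = a ^+ 2 * hsq (x *m g) q'.
  rewrite -(hsq_mulg _ _ Gg) qg /hsq JmulZ !BZr; ring.
have hF : dot (Fvec e x *m P) (Fvec e x *m P) = a ^+ 2 * dot (Fvec e' (x *m g) *m P') (Fvec e' (x *m g) *m P').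
  rewrite (frame_norm hP f ek) (frame_norm hP' f' ek') mulr_sumr.
  apply: eq_bigr => i _; rewrite !Fvec_dot.
  have -> : fform x q (iota_ (xi i)) = a * fform (x *m g) q' (iota_ (xi' i)).
    by rewrite -(fform_mulg _ _ _ ug) qg xg // fform_shift.
  ring.
rewrite hq hF; move: (dot _ _) (hsq _ _) (- B x x) => A h b.
by rewrite -[a ^+ 2 * h * b]mulrA -mulf_div mulfV ?mul1r // expf_eq0.
Qed.
End Transfer.
Implicit Types (e : V).

Lemma Witt3 (k : nat) (X Y p p' : W) (w w' : nat -> W) : B X X < 0 -> B X X = B Y Y ->
  B X p = B Y p' -> B X (Jmul p) = B Y (Jmul p') -> B p p = B p' p' ->
  (forall i, (i < k)%N -> [/\ B X (w i) = B Y (w' i), B X (Jmul (w i)) = B Y (Jmul (w' i)),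
     B p (w i) = B p' (w' i) & B p (Jmul (w i)) = B p' (Jmul (w' i))]) ->
  (forall i j, (i < k)%N -> (j < k)%N -> B (w i) (w j) = B (w' i) (w' j) /\
     B (w i) (Jmul (w j)) = B (w' i) (Jmul (w' j))) ->
  exists2 g, uni 1 g & [/\ X *m g = Y, p *m g = p' & forall i, (i < k)%N -> w i *m g = w' i].
Proof.
move=> X0 XX Xp XJp pp Xw ww.
pose xs i := if i is i'.+1 then if i' is j.+1 then w j else p else X.
pose ys i := if i is i'.+1 then if i' is j.+1 then w' j else p' else Y.
have [||g ug h] := @Witt R n k.+2 xs ys erefl X0.
- case=> [|[|i]] [|[|j]] // hi hj; rewrite /xs /ys; try by have [? ? ? ?] := Xw _ hj.
  + by rewrite BC Xp BC.
  + by rewrite BC [RHS]BC; have [] := Xw _ hi.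
  + by rewrite BC [RHS]BC; have [] := Xw _ hi.
  + by have [] := ww _ _ hi hj.
- case=> [|[|i]] [|[|j]] // hi hj; rewrite /xs /ys ?BxJx //; try by have [? ? ? ?] := Xw _ hj.
  + by rewrite BJs XJp -BJs.
  + by rewrite BJs [RHS]BJs; have [_ ->] := Xw _ hi.
  + by rewrite BJs [RHS]BJs; have [_ _ _ ->] := Xw _ hi.
  + by have [] := ww _ _ hi hj.
exists g => //; split; [exact: (h 0%N)|exact: (h 1%N)|move=> i hi; exact: (h i.+2)].
Qed.

(** The pairs (e, V), with V the range of [P] and [c] the squared cosine of its Kaehler angle. *)
Definition level_data e P c := [/\ const_angle P c, 0 <= c, (0 < \rank P)%N, dot e e = 1 &
  forall v, v *m P = v -> dot v e = 0 /\ dot v (Jmul e) = 0].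

Lemma proj_unit P c : const_angle P c -> 0 <= c -> (0 < \rank P)%N -> exists2 u, u *m P = u & dot u u = 1.
Proof. by move=> [_ PP _] _ k0; have [//|v [vP v1 _]] := frame_next (k := 0) (xi := fun=> 0) PP _ k0; exists v. Qed.

Lemma data_frame e P c u : level_data e P c -> u *m P = u -> dot u u = 1 ->
  exists xi, [/\ frame P c (\rank P) xi, xi 0%N = u,
    forall i j, (i < \rank P)%N -> (j < \rank P)%N -> dot (xi i) (xi j) = (i == j)%:R /\
      dot (xi i) (Jmul (xi j)) = kform c i j &
    forall i, (i < \rank P)%N -> B (lift e) (iota_ (xi i)) = 0 /\ B (lift e) (Jmul (iota_ (xi i))) = 0].
Proof.
move=> [hP c0 _ _ he] uP u1; have [ev [xi f xi0]] := adapted_frame hP c0 uP u1.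
exists xi; split=> // [i j hi hj|i hi]; have [hx ho _] := f.
  by split; [exact: ho|exact: (frame_kform hP c0 f hi hj ev)].
have [h1 h2] := he _ (hx i hi); rewrite -iotaJ !(BC (lift e)) !B_iota_l !pi_lift h1.
by rewrite dotJl h2 oppr0.
Qed.

Lemma level_equiv e P e' P' c : level_data e P c -> level_data e' P' c -> \rank P = \rank P' ->
  exists2 g, uni 1 g & forall z, CH z -> rho e' P' (act g z) = rho e P z.
Proof.
move=> d d' ek; have [hP c0 k0 e1 he] := d; have [hP' _ k0' e1' he'] := d'.
have [_ PP _] := hP; have [_ PP' _] := hP'.
have [u uP u1] := proj_unit hP c0 k0; have [u' uP' u1'] := proj_unit hP' c0 k0'.
have [xi [f _ fG fq]] := data_frame d uP u1; have [xi' [f' _ fG' fq']] := data_frame d' uP' u1'.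
rewrite -ek in f' fG' fq'.
have [|||||||g ug [g0 ge gw]] := @Witt3 (\rank P) (e0 R n) (e0 R n) (iota_ e) (iota_ e')
  (fun i => iota_ (xi i)) (fun i => iota_ (xi' i)).
- by rewrite Bee ltrN10.
- by [].
- by rewrite !Bei.
- by rewrite -!iotaJ !Bei.
- by rewrite !Bii e1.
- move=> i hi; have [hx _ _] := f; have [hx' _ _] := f'.
  have [a1 a2] := he _ (hx i hi); have [b1 b2] := he' _ (hx' i hi).
  rewrite -!iotaJ !Bei !Bii ![dot e _]dotC ![dot e' _]dotC !dotJl a1 a2 b1 b2.
  by split.
- by move=> i j hi hj; have [a1 a2] := fG i j hi hj; have [b1 b2] := fG' i j hi hj; rewrite -!iotaJ !Bii a1 a2 b1 b2.
exists g => //; apply: (rho_transfer hP hP' f f' erefl ek ug (oner_neq0 R) (t := fun=> 0)).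
- by rewrite /lift mulmxDl g0 ge scale1r.
- by move=> i hi; rewrite scale0r addr0 gw.
Qed.

Lemma normal_lift e x : dot e e = 1 -> CH x -> exists X (mu : R), [/\ 0 < mu, pr X = x, B X X = -1,
  B X (lift e) = mu & B X (Jmul (lift e)) = 0].
Proof.
move=> e1 hx; have x0 := B_lift_lt0 hx; have h0 := hsq_gt0 e1 x0.
set L := lift x in x0 h0; set a := B L (lift e); set b := B L (Jmul (lift e)).
have hE : hsq L (lift e) = a ^+ 2 + b ^+ 2 by [].
pose N := Num.sqrt (hsq L (lift e) * - B L L).
have N2 : N ^+ 2 = hsq L (lift e) * - B L L by rewrite sqr_sqrtr // mulr_ge0 ?oppr_ge0 // ltW.
have N0 : 0 < N by rewrite sqrtr_gt0 mulr_gt0 // oppr_gt0.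
have Nn := lt0r_neq0 N0.
exists (cs (a / N) (- b / N) L), (hsq L (lift e) / N); split.
- by rewrite divr_gt0.
- rewrite pr_cs ?pr_lift //; rewrite (_ : _ + _ = hsq L (lift e) / N ^+ 2); first by rewrite gt_eqF // divr_gt0 // exprn_gt0.
  by rewrite hE; field.
- rewrite B_cs (_ : _ + _ = hsq L (lift e) / N ^+ 2); last by rewrite hE; field.
  by rewrite N2; field; rewrite (lt0r_neq0 h0) ltr0_neq0.
- by rewrite B_csl -/a -/b hE; field.
- by rewrite B_csl JmulJ BNr -/a -/b; field.
Qed.

Lemma rho_normal_lift e P X (mu : R) : 0 < mu -> B X X = -1 -> B X (lift e) = mu -> B X (Jmul (lift e)) = 0 ->
  lev e P X = dot (pi_ X *m P) (pi_ X *m P).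
Proof.
move=> m0 X1 Xq XJ; rewrite /lev /Fvec /hsq Xq XJ X1 scale0r subr0 -scalemxAl dotZl dotZr.
by field; rewrite lt0r_neq0.
Qed.

(** With h(X, q) real and nonzero, a real multiple of i q added to each frame vector makes its
    product with X real, and q is scaled to have product 1 with X. Of the Gram data involving X,
    only the numbers [B X (w i)] then remain. *)
Lemma shifted_gram (k : nat) (X q : W) (m : R) (w : nat -> W) : B X X = -1 -> m != 0 -> B X q = m -> B X (Jmul q) = 0 ->
  B q q = 0 -> (forall i, (i < k)%N -> B q (w i) = 0 /\ B q (Jmul (w i)) = 0) ->
  let s i := w i + (B X (Jmul (w i)) / m) *: Jmul q in
  [/\ [/\ B X (m^-1 *: q) = 1, B X (Jmul (m^-1 *: q)) = 0 & B (m^-1 *: q) (m^-1 *: q) = 0],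
    forall i, (i < k)%N -> [/\ B X (s i) = B X (w i), B X (Jmul (s i)) = 0, B (m^-1 *: q) (s i) = 0 &
      B (m^-1 *: q) (Jmul (s i)) = 0] &
    forall i j, (i < k)%N -> (j < k)%N -> B (s i) (s j) = B (w i) (w j) /\ B (s i) (Jmul (s j)) = B (w i) (Jmul (w j))].
Proof.
move=> _ m0 Xq XJ qq hw s; split.
- by rewrite JmulZ !BZr BZl Xq XJ qq mulVf // !mulr0.
- move=> i hi; have [h1 h2] := hw i hi; rewrite /s !(JmulD, JmulZ, JmulJ) !(BDr, BZr, BZl, BNr) XJ Xq qq BxJx h1 h2.
  by split; field.
- move=> i j hi hj; have [h1 h2] := hw i hi; have [h3 h4] := hw j hj.
  have h1' : B (w i) q = 0 by rewrite BC.
  have h2' : B (w i) (Jmul q) = 0 by rewrite BJs h2 oppr0.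
  rewrite /s !(JmulD, JmulZ, JmulJ) !(BDr, BDl, BZr, BZl, BNr, BJJ, BJl) qq BxJx h1' h2' h3 h4.
  by split; ring.
Qed.

(** The frames start with the directions of the projections of the two lifts to V. Then all products
    of a lift with its frame vanish except the first, whose square is rho; hence the Gram data of
    the two points agree and Witt's theorem applies. *)
Lemma level_transitive e P c x y : level_data e P c -> CH x -> CH y -> rho e P x = rho e P y ->
  exists g, [/\ uni 1 g, act g x = y & forall z, CH z -> rho e P (act g z) = rho e P z].
Proof.
move=> d hx hy; have [hP c0 k0 e1 he] := d; have [PT PP _] := hP.
have [X [mu [m0 Xx X1 Xq XJ]]] := normal_lift e1 hx.
have [Y [nu [n0 Yy Y1 Yq YJ]]] := normal_lift e1 hy.
have rE z Z (m : R) : CH z -> 0 < m -> pr Z = z -> B Z Z = -1 -> B Z (lift e) = m -> B Z (Jmul (lift e)) = 0 ->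
    rho e P z = dot (pi_ Z *m P) (pi_ Z *m P).
  move=> hz mp Zz Z1 Zq ZJ; rewrite -(rho_normal_lift P mp Z1 Zq ZJ) /rho -Zz.
  have q0 : 0 < q2 Z by apply: q2_gt0; rewrite Z1 ltrN10.
  by rewrite -{2}(prK (lt0r_neq0 q0)) lev_cs // lt0r_neq0.
rewrite (rE _ _ _ hx m0 Xx X1 Xq XJ) (rE _ _ _ hy n0 Yy Y1 Yq YJ).
set vx := pi_ X *m P; set vy := pi_ Y *m P => eq.
have [u0 u0P u01] := proj_unit hP c0 k0.
have ex v : v *m P = v -> exists u, [/\ u *m P = u, dot u u = 1 & v = Num.sqrt (dot v v) *: u].
  move=> vP; have [->|v0] := eqVneq v 0; first by exists u0; split=> //; rewrite dot0l sqrtr0 scale0r.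
  have d0 : 0 < dot v v by rewrite dot_gt0.
  exists ((Num.sqrt (dot v v))^-1 *: v); split; first by rewrite -scalemxAl vP.
  - by rewrite dotZl dotZr mulrA -expr2 exprVn sqr_sqrtr ?ltW // mulVf // lt0r_neq0.
  - by rewrite scalerA mulfV ?scale1r // lt0r_neq0 // sqrtr_gt0.
have [ux [uxP ux1 uxE]] : exists u, [/\ u *m P = u, dot u u = 1 & vx = Num.sqrt (dot vx vx) *: u].
  by apply: ex; rewrite /vx -mulmxA PP.
have [uy [uyP uy1 uyE]] : exists u, [/\ u *m P = u, dot u u = 1 & vy = Num.sqrt (dot vy vy) *: u].
  by apply: ex; rewrite /vy -mulmxA PP.
have [xi [f xi0 fG fq]] := data_frame d uxP ux1; have [xi' [f' xi0' fG' fq']] := data_frame d uyP uy1.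
set k := \rank P in f fG fq f' fG' fq'; set q := lift e.
have qq : B q q = 0 by rewrite B_lift e1 subrr.
have aE (Z : W) (z : nat -> V) v u i : z 0%N = u -> v = pi_ Z *m P -> v = Num.sqrt (dot v v) *: u -> frame P c k z ->
    (i < k)%N -> B Z (iota_ (z i)) = Num.sqrt (dot v v) * (0%N == i)%:R.
  move=> z0 vE vu [hz ho _] hi; rewrite BC B_iota_l dotC -(proj_dot hP) ?hz // -vE vu dotZl.
  by rewrite -z0 ho // !z0 -vu.
have [x1 x2 x3] := shifted_gram X1 (lt0r_neq0 m0) Xq XJ qq fq.
have [y1 y2 y3] := shifted_gram Y1 (lt0r_neq0 n0) Yq YJ qq fq'.
have [|||||||g ug [gX gq gw]] := @Witt3 k X Y (mu^-1 *: q) (nu^-1 *: q)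
    (fun i => iota_ (xi i) + (B X (Jmul (iota_ (xi i))) / mu) *: Jmul q)
    (fun i => iota_ (xi' i) + (B Y (Jmul (iota_ (xi' i))) / nu) *: Jmul q).
- by rewrite X1 ltrN10.
- by rewrite X1 Y1.
- by have [-> _ _] := x1; have [-> _ _] := y1.
- by have [_ -> _] := x1; have [_ -> _] := y1.
- by have [_ _ ->] := x1; have [_ _ ->] := y1.
- move=> i hi; have [-> -> -> ->] := x2 i hi; have [-> -> -> ->] := y2 i hi.
  by rewrite (aE X xi vx ux) // (aE Y xi' vy uy) // eq.
- move=> i j hi hj; have [-> ->] := x3 i j hi hj; have [-> ->] := y3 i j hi hj.
  by have [a1 a2] := fG i j hi hj; have [b1 b2] := fG' i j hi hj; rewrite -!iotaJ !Bii a1 a2 b1 b2.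
exists g; split=> //.
  by rewrite -Xx act_pr ?gX //; [exact: uni_Ghat|rewrite X1 ltrN10].
have [_ gJ] := ug; have gq' : q *m g = (mu / nu) *: q.
  by rewrite -[q in LHS](scalerKV (lt0r_neq0 m0)) -scalemxAl gq scalerA.
apply: (rho_transfer hP hP f f' erefl erefl ug (a := mu / nu)
  (t := fun i => B Y (Jmul (iota_ (xi' i))) / nu - B X (Jmul (iota_ (xi i))) / mu * (mu / nu))) => //.
  by rewrite mulf_neq0 ?invr_eq0 ?lt0r_neq0.
move=> i hi; have := gw i hi; rewrite mulmxDl -scalemxAl -[Jmul q *m g]scale1r -gJ gq' JmulZ.
by move/(canRL (addrK _)) => ->; rewrite scalerA [X in _ = _ + X]scalerBl addrA.
Qed.
End ConstantAngle.

(** * Codimension, Kaehler angle and the parameter *)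

Section VspaceRank.
Variables (R : realType) (m : nat).

Lemma dim_row_space (T : {vspace 'rV[R]_m}) (Q : 'M[R]_m) :
  (forall v, (v \in T) = (v <= Q)%MS) -> \dim T = \rank Q.
Proof.
move=> TQ; pose A := row_base Q; have fA : row_free A by exact: row_base_free.
pose X := [tuple row i A | i < \rank Q].
have Xi i : X`_i = if insub i is Some j then row j A else 0.
  case: insubP => [j ji <-|]; first by rewrite -[val j]/(nat_of_ord j) -tnth_nth tnth_mktuple.
  by move=> h; rewrite nth_default // size_tuple leqNgt.
have XE (i : 'I_(\rank Q)) : X`_i = row i A by rewrite -tnth_nth tnth_mktuple.
have frX : free X.
  apply/freeP => k h i; pose y := \row_j k j.
  have : y *m A = 0.
    rewrite mulmx_sum_row -[RHS]h; apply: eq_bigr => j _; by rewrite mxE XE.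
  move/eqP; rewrite mulmx_free_eq0 // => /eqP/rowP/(_ i); by rewrite !mxE.
have spX : <<X>>%VS = T.
  apply/vspaceP => v; rewrite TQ; have -> : (v <= Q)%MS = (v <= A)%MS by rewrite /A eq_row_base.
  apply/idP/idP.
    move/coord_span => ->; apply: summx_sub => i _; apply: scalemx_sub; rewrite XE; exact: row_sub.
  case/submxP => y ->; rewrite mulmx_sum_row; apply: memv_suml => i _; apply: memvZ.
  by apply: memv_span; rewrite -XE; apply: mem_nth; rewrite size_tuple.
by rewrite -spX; move: frX; rewrite /free size_tuple => /eqP.
Qed.

Lemma proj_compl_rank (P : 'M[R]_m) : P *m P = P -> (\rank (1%:M - P)%R + \rank P = m)%N.
Proof.
move=> PP; have e : (kermx P :=: 1%:M - P)%MS.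
  apply/eqmxP/andP; split; last by apply/sub_kermxP; rewrite mulmxBl mul1mx PP subrr.
  by apply/submxP; exists (kermx P); rewrite mulmxBr mulmx1 mulmx_ker subr0.
have := mxrank_ker P; rewrite e => ->; have := rank_leq_row P; lia.
Qed.
End VspaceRank.

Section NormalAngle.
Variables (R : realType) (n : nat).
Local Notation V := (realCn R n).
Implicit Types (P : 'M[R]_(n + n)) (e u v w : V).

(** Here c = cos^2 phi, and the real case phi = pi / 2 is c = 0. *)
Definition param (c : R) (k : nat) : nat + R * nat := if c == 0 then inl k else inr (acos (Num.sqrt c), k).

Lemma param_codimE c k : param_codim (param c k) = k.
Proof. by rewrite /param; case: ifP. Qed.

Lemma sqrt_unit (c : R) : 0 <= c -> c < 1 -> 0 <= Num.sqrt c < 1.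
Proof. by move=> c0 c1; rewrite sqrtr_ge0 -sqrtr1 ltr_sqrt. Qed.

Lemma param_inj (c c' : R) k k' : 0 <= c < 1 -> 0 <= c' < 1 -> param c k = param c' k' -> c = c' /\ k = k'.
Proof.
move=> /andP[c0 c1] /andP[c0' c1']; rewrite /param; case: (eqVneq c 0) => [->|cn]; case: (eqVneq c' 0) => [->|cn'] //.
  by case.
case=> h ->; split=> //.
have [/andP[s0 s1] /andP[s0' s1']] := (sqrt_unit c0 c1, sqrt_unit c0' c1').
have b (x : R) : 0 <= x -> x < 1 -> x \in `[-1, 1] by move=> x0 x1; rewrite in_itv /=; apply/andP; split; lra.
have : Num.sqrt c = Num.sqrt c' by rewrite -(acosK (b _ s0 s1)) h acosK // b.
by move=> e; rewrite -(sqr_sqrtr c0) e sqr_sqrtr.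
Qed.

Lemma acos_le (x y : R) : -1 <= x -> x <= y -> y <= 1 -> acos y <= acos x.
Proof.
move=> x1 xy y1; rewrite leNgt; apply/negP => lt.
have bx : -1 <= x <= 1 by rewrite x1 (le_trans xy).
have yb : -1 <= y <= 1 by rewrite y1 (le_trans x1).
have := ltr_cos (x := acos x) (y := acos y); rewrite !in_itv /= !acos_ge0 ?acos_lepi //.
move=> /(_ erefl erefl); rewrite lt !acosK ?in_itv //= => /idP.
by rewrite ltNge xy.
Qed.

(** For c < 1 the part of J V orthogonal to V has the dimension of V. It is orthogonal to C e, and
    both lie in the orthogonal complement of V. *)
Lemma data_rank e P c : level_data e P c -> c < 1 -> (\rank P + \rank P + 2 <= n + n)%N.
Proof.
move=> [[PT PP hc] c0 k0 e1 he] c1.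
pose A := P *m @Jmx R n *m (1%:M - P); pose E := col_mx e (Jmul e).
have eP : e *m P = 0.
  apply/eqP; rewrite -dot_eq0 dotP // dotC; apply/eqP.
  have hp : e *m P *m P = e *m P by rewrite -mulmxA PP.
  by have [-> _] := he _ hp.
have JeP : Jmul e *m P = 0.
  apply/eqP; rewrite -dot_eq0 dotP // dotC; apply/eqP.
  have hp : Jmul e *m P *m P = Jmul e *m P by rewrite -mulmxA PP.
  by have [_ ->] := he _ hp.
have AE x : x *m A = Jmul (x *m P) - Jmul (x *m P) *m P by rewrite /A !mulmxA -JmulE mulmxBr mulmx1.
have rA : \rank A = \rank P.
  apply/eqP; rewrite eqn_leq; apply/andP; split; first by rewrite /A -mulmxA mxrankM_maxl.
  have := mxrank_ker A; have := mxrank_ker P; have := rank_leq_row A; have := rank_leq_row P.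
  suff /mxrankS : (kermx A <= kermx P)%MS by lia.
  apply/sub_kermxP/row_ext => x; rewrite mulmx0 mulmxA; set y := x *m _.
  have yA : y *m A = 0 by rewrite /y -mulmxA mulmx_ker mulmx0.
  move/eqP: yA; rewrite AE subr_eq0 => /eqP yJ; set v := y *m P in yJ *.
  have vP : v *m P = v by rewrite /v -mulmxA PP.
  have := hc v vP; rewrite -yJ dotJJ => h; apply/eqP; rewrite -dot_eq0.
  have := dot_ge0 v; rewrite le_eqVlt eq_sym => /orP[//|d0].
  by move: h; nra.
have EE : E *m E^T = 1%:M.
  rewrite /E tr_col_mx mul_col_row (scalar_mx_block 1 1).
  have tE (x y : V) : x *m y^T = (dot x y)%:M by rewrite /dot [LHS]mx11_scalar.
  by rewrite !tE dotxJx dotJxx dotJJ e1 !raddf0.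
have dAE (x : V) (y : 'rV_(1 + 1)) : dot (x *m A) (y *m E) = 0.
  rewrite -[y]hsubmxK mul_row_col dotDr [lsubmx y]mx11_scalar [rsubmx y]mx11_scalar !mul_scalar_mx !dotZr AE.
  have hp : x *m P *m P = x *m P by rewrite -mulmxA PP.
  have hp' : Jmul (x *m P) *m P *m P = Jmul (x *m P) *m P by rewrite -mulmxA PP.
  have [a1 a2] := he _ hp; have [b1 b2] := he _ hp'.
  by rewrite !dotBl !dotJl b1 b2 a2 JmulJ dotNr a1 !oppr0 !addr0 !mulr0 addr0.
have rE : \rank E = 2%N by apply/eqP; rewrite eqn_leq rank_leq_row /= -{1}(mxrank1 R 2) -EE mxrankM_maxl.
have cap : (A :&: E)%MS = 0.
  apply/row_ext => x; rewrite mulmx0; set v := x *m _.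
  have /submxP[a va] : (v <= A)%MS by apply: submx_trans (capmxSl A E); rewrite submxMl.
  have /submxP[b vb] : (v <= E)%MS by apply: submx_trans (capmxSr A E); rewrite submxMl.
  by apply/eqP; rewrite -dot_eq0 {1}va vb dAE.
have sub : (A + E <= 1%:M - P)%MS.
  rewrite addsmx_sub submxMl /=; apply/submxP; exists E.
  by rewrite mulmxBr mulmx1 /E mul_col_mx eP JeP col_mx0 subr0.
have := mxrankS sub; rewrite (mxrank_disjoint_sum cap) rA rE; have := proj_compl_rank PP; lia.
Qed.

Lemma param_model e P c : level_data e P c -> c < 1 -> (2 <= \rank P)%N -> model_space R n (param c (\rank P)).
Proof.
move=> d c1 k2; have rk := data_rank d c1; have [hP c0 k0 _ _] := d.
rewrite /model_space /param; case: eqVneq => [_|cn] /=; first lia.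
have cp : 0 < c by rewrite lt_def cn.
have /andP[s0 s1] := sqrt_unit c0 c1; have sp : 0 < Num.sqrt c by rewrite sqrtr_gt0.
split.
  have b : -1 <= Num.sqrt c <= 1 by apply/andP; split; lra.
  rewrite acos_gt0 /=; last by apply/andP; split; lra.
  rewrite lt_neqAle -acos0 acos_le ?andbT; try lra; try exact: ltW.
  apply/eqP => h; have := acosK (x := Num.sqrt c); rewrite in_itv /= => /(_ b).
  rewrite h acosK; first by move=> h0; rewrite -h0 ltxx in sp.
  by rewrite in_itv /=; apply/andP; split; lra.
have [u uP u1] := proj_unit hP c0 k0; have [ev _] := adapted_frame hP c0 uP u1.
exists (\rank P)./2; have := ev cp; have := odd_double_half (\rank P); lia.
Qed.

Lemma angle0 v w : angle bergman 0 v w = acos (dot v w / (Num.sqrt (dot v v) * Num.sqrt (dot w w))).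
Proof.
have s4 x : Num.sqrt (4 * x) = 2 * Num.sqrt x :> R.
  by rewrite sqrtrM // (_ : 4 = 2 ^+ 2) ?sqrtr_sqr ?ger0_norm // -natrX.
rewrite /angle !metric0 !s4; congr acos.
have [->|a0] := eqVneq (Num.sqrt (dot v v)) 0; first by rewrite mulr0 !mul0r invr0 !mulr0.
have [->|b0] := eqVneq (Num.sqrt (dot w w)) 0; first by rewrite !mulr0 invr0 !mulr0.
by field; rewrite a0 b0.
Qed.

(** The infimum of the angles is attained at the projection of J v, where the cosine is sqrt c; the
    Cauchy-Schwarz inequality bounds it elsewhere. *)
Lemma angle_condition_base M P c k : const_angle P c -> 0 <= c < 1 ->
  (forall w, Defs.normal_space bergman M 0 w <-> w *m P = w) -> angle_condition M 0 (param c k).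
Proof.
move=> hP /andP[c0 c1] NE; have [PT PP hc] := hP.
have JP v w : w *m P = w -> dot (Jmul v) w = dot (Jmul v *m P) w by move=> hw; rewrite (proj_dot hP).
rewrite /angle_condition /param; case: eqVneq => [cz|cn].
  move=> v w /NE hv /NE hw; rewrite metric0 JP //.
  have /eqP : dot (Jmul v *m P) (Jmul v *m P) = 0 by rewrite hc // cz mul0r.
  by rewrite dot_eq0 => /eqP ->; rewrite dot0l mulr0.
have cp : 0 < c by rewrite lt_def cn.
move=> v /NE hv v0 /=; have /andP[s0 s1] := sqrt_unit c0 c1.
have vv : 0 < dot v v by rewrite dot_gt0.
pose w0 := Jmul v *m P; have w0P : w0 *m P = w0 by rewrite /w0 -mulmxA PP.
have w0n : dot w0 w0 = c * dot v v by exact: hc.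
have w00 : 0 < dot w0 w0 by rewrite w0n mulr_gt0.
have sv : 0 < Num.sqrt (dot v v) by rewrite sqrtr_gt0.
have sc : 0 < Num.sqrt c by rewrite sqrtr_gt0.
have att : angle bergman 0 (Jmul v) w0 = acos (Num.sqrt c).
  rewrite angle0 dotJJ JP // w0n sqrtrM // -{1}(sqr_sqrtr c0) -{1}(sqr_sqrtr (ltW vv)); congr acos.
  by field; rewrite (lt0r_neq0 sv) (lt0r_neq0 sc).
have bound w : w *m P = w -> w != 0 -> acos (Num.sqrt c) <= angle bergman 0 (Jmul v) w.
  move=> hw wn; have ww : 0 < dot w w by rewrite dot_gt0.
  have sw : 0 < Num.sqrt (dot w w) by rewrite sqrtr_gt0.
  rewrite angle0 dotJJ JP //.
  have CS : `|dot (Jmul v *m P) w| <= Num.sqrt c * (Num.sqrt (dot v v) * Num.sqrt (dot w w)).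
    rewrite -sqrtr_sqr -[X in _ * X]sqrtrM ?dot_ge0 // -sqrtrM // ler_sqrt ?mulr_ge0 ?dot_ge0 //.
    by rewrite mulrA -w0n; exact: dot_CS.
  have den : 0 < Num.sqrt (dot v v) * Num.sqrt (dot w w) by rewrite mulr_gt0.
  have : `|dot (Jmul v *m P) w / (Num.sqrt (dot v v) * Num.sqrt (dot w w))| <= Num.sqrt c.
    by rewrite normrM normfV (gtr0_norm den) ler_pdivrMr.
  rewrite ler_norml => /andP[l1 l2]; apply: acos_le; lra.
rewrite /kahler_angle /angle_to_subspace; set S := (X in inf X).
have lbS : lbound S (acos (Num.sqrt c)) by move=> _ [w [/NE hw wn] <-]; exact: bound.
have inS : S (acos (Num.sqrt c)) by exists w0 => //; split; [exact/NE|rewrite -dot_gt0].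
by apply/eqP; rewrite eq_le; apply/andP; split; [apply: ge_inf => //; exists (acos (Num.sqrt c))|apply: lb_le_inf => //; exists (acos (Num.sqrt c))].
Qed.
End NormalAngle.

(** * Orbits as level sets *)

Section Conjugation.
Variables (R : realType) (n : nat).
Local Notation V := (realCn R n).
Local Notation MM := 'M[R]_(n.+1 + n.+1).
Implicit Types (H : set MM) (b g : MM).

Definition conj_group b H : set MM := [set g | H (b *m g *m invmx b)].

Lemma conj_closed b H : Ghat b -> closed_subgroup H -> closed_subgroup (conj_group b H).
Proof.
move=> Gb HH; have ub := Ghat_unit Gb; have Gi := GhatV Gb.
have KE g : g = invmx b *m (b *m g *m invmx b) *m b by rewrite !mulmxA mulVmx // mul1mx mulmxKV.
split.
- by move=> g hg; rewrite (KE g); apply: GhatM => //; apply: GhatM => //; exact: (HG HH hg).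
- move=> g Gg tr; apply: (Htriv HH); first by do 2 apply: GhatM => //.
  by move=> z; rewrite !actM ?tr ?actK //; exact: GhatM.
- move=> g h hg hh; rewrite /conj_group /= (_ : _ *m _ = b *m g *m invmx b *m (b *m h *m invmx b)).
    exact: (HM HH).
  by rewrite !mulmxA mulmxKV.
- move=> g hg; have ug : g \in unitmx.
    have := Ghat_unit (HG HH hg); rewrite !unitmx_mul => /andP[/andP[_ //]].
  rewrite /conj_group /=; have := HV HH hg; congr (H _).
  apply: (can_inj (mulKmx (Ghat_unit (HG HH hg)))).
  by rewrite mulmxV ?(Ghat_unit (HG HH hg)) // !mulmxA mulmxKV // mulmxK // mulmxV.
- move=> u g hu cu; apply: (Hcl HH hu).
  by apply: cvg_mulmx; [apply: cvg_mulmx => //|]; exact: cvg_cst.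
Qed.

Lemma conj_orbit b H x y : Ghat b -> closed_subgroup H ->
  same_orbit (conj_group b H) (act b x) (act b y) <-> same_orbit H x y.
Proof.
move=> Gb HH; have ub := Ghat_unit Gb; have Gi := GhatV Gb; split=> -[g hg e].
  have Gg := HG (conj_closed Gb HH) hg.
  by exists (b *m g *m invmx b) => //; rewrite !actM ?e ?actK //; exact: GhatM.
have Gg := HG HH hg; exists (invmx b *m g *m b).
  by rewrite /conj_group /= !mulmxA mulmxV // mul1mx mulmxK.
by rewrite !actM ?actK ?e //; exact: GhatM.
Qed.

Lemma conj_orbitV b H x y : Ghat b -> closed_subgroup H ->
  same_orbit H (act (invmx b) x) (act (invmx b) y) -> same_orbit (conj_group b H) x y.
Proof. by move=> Gb HH /(conj_orbit _ _ Gb HH); rewrite !actKV. Qed.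

Lemma conj_thin b H : Ghat b -> closed_subgroup H -> thin H -> thin (conj_group b H).
Proof.
move=> Gb HH Ht p cp pC; have Gi := GhatV Gb.
have cp' : square_cont (fun s t => act (invmx b) (p s t)).
  move=> s t s0 t0 hs ht cs ct.
  have ps i : unit01 (s i) by exact: hs.
  apply: (act_cvg (g := fun=> invmx b) Gi); [|by move=> i; exact: pC|exact: cvg_cst|exact: cp].
  have cl (u : nat -> R) (u0 : R) : (forall i, unit01 (u i)) -> u @ \oo --> u0 -> unit01 u0.
    move=> hu cu; have [phi [l [hphi hl lim]]] := unit01_subseq hu.
    by rewrite (cvg_unique _ (cvg_subseq hphi cu) lim).
  by apply: pC; [exact: cl cs|exact: cl ct].
have [|[t [t' [h1 h2 h3]]]|[t [t' [h1 h2 h3]]]] := Ht _ cp'.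
- by move=> s t hs ht; apply: act_CH => //; exact: pC.
- by left; exists t, t'; split=> //; exact: conj_orbitV h3.
- by right; exists t, t'; split=> //; exact: conj_orbitV h3.
Qed.

Lemma orb0_conj b H y : Ghat b -> closed_subgroup H -> act b y = 0 ->
  orb0 (conj_group b H) = act b @` [set z | same_orbit H y z].
Proof.
move=> Gb HH y0; apply/seteqP; split=> z.
  move=> [g hg e]; exists (act (invmx b) z); last by rewrite actKV.
  by apply/(conj_orbit _ _ Gb HH); rewrite y0 actKV //; exists g.
move=> [w hw <-]; have /(conj_orbit _ _ Gb HH) := hw; rewrite y0 => -[g hg e].
by exists g.
Qed.
End Conjugation.

Section Slice.
Variables (R : realType) (n : nat).
Local Notation V := (realCn R n).
Local Notation W := (realCn R n.+1).
Local Notation MM := 'M[R]_(n.+1 + n.+1).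
Implicit Types (H : set MM).

Lemma rho_base (e : V) (P : 'M[R]_(n + n)) : rho e P 0 = 0.
Proof. by rewrite /rho /lev /Fvec pi_lift Jmul0 !scaler0 subr0 mul0mx dot0l mul0r. Qed.

Lemma nu0_projector H k : closed_subgroup H -> has_codim (orb0 H) k -> exists P : 'M[R]_(n + n),
  [/\ P^T = P, P *m P = P, forall v, nu0 H v <-> v *m P = v & \rank P = k].
Proof.
move=> HH hc.
have [||P [PT PP Pnu Pfix]] := @subspace_proj R (n + n) (nu0 H).
- by move=> v _; rewrite dot0r.
- by move=> a x y hx hy; apply: nu0D => //; exact: nu0Z.
have nuE v : nu0 H v <-> v *m P = v by split; [exact: Pfix|move=> <-].
exists P; split=> //.
have tE v : tan0 H v <-> v *m P = 0.
  split=> [hv|vP]; first by apply/eqP; rewrite -dot_eq0 dotP // (Pnu v _ hv).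
  have [a [b [ha hb ab]]] := tan_nu HH v.
  have aP : a *m P = 0 by apply/eqP; rewrite -dot_eq0 dotP // (Pnu a _ ha).
  by move: vP; rewrite ab mulmxDl aP add0r (Pfix b hb) => ->; rewrite addr0.
have [T [TE dT]] := hc 0 (orb00 HH).
have : \dim T = \rank (1%:M - P)%R.
  apply: dim_row_space => v; apply/idP/idP => h.
    have /(tangent_orb0 HH)/tE vP : tangent_space (orb0 H) 0 v by rewrite -TE.
    by apply/submxP; exists v; rewrite mulmxBr mulmx1 vP subr0.
  have : [set` T] v; last by [].
  rewrite TE; apply/(tangent_orb0 HH)/tE; have /submxP[y ->] := h.
  by rewrite -mulmxA mulmxBl mul1mx PP subrr mulmx0.
by have := proj_compl_rank PP; lia.
Qed.

Lemma codim_normals H k : closed_subgroup H -> has_codim (orb0 H) k -> (2 <= k)%N ->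
  forall xi, unu0 H xi -> exists2 eta, unu0 H eta & dot xi eta = 0.
Proof.
move=> HH hc hk xi [hx x1]; have [P [PT PP nuE rP]] := nu0_projector HH hc.
have [||v [vP v1 hv]] := @frame_next R n P 1 (fun=> xi) PP; first by move=> _ _; exact/nuE.
  by rewrite rP.
by exists v; [split=> //; exact/nuE|rewrite dotC (hv 0%N)].
Qed.

Variables (H : set MM) (k : nat).
Hypotheses (HH : closed_subgroup H) (Hthin : thin H) (hc : has_codim (orb0 H) k) (hk : (2 <= k)%N).
Let Hcodim := codim_normals HH hc hk.

Lemma Kiso_nu0 g v : Kiso H g -> nu0 H v -> nu0 H (pi_ (iota_ v *m g)).
Proof.
move=> [hg eg] hv w [X hX <-]; have Gg := HG HH hg.
have gi : iota_ v *m g = iota_ (pi_ (iota_ v *m g)) by exact: Kiso_iota.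
have u : tan0 H (pi_ (e0 R n *m (g *m X *m invmx g))) by exists (g *m X *m invmx g) => //; exact: lie_conj.
have := hv _ u; rewrite dotC -B_iota_l -(B_mulg _ _ Gg) !mulmxA mulmxKV ?(Ghat_unit Gg) // eg gi B_iota_l.
by rewrite iotaK dotC.
Qed.

Lemma Kiso_inv g : Kiso H g -> Kiso H (invmx g).
Proof.
move=> [hg eg]; split; first exact: (HV HH).
by rewrite -{1}eg mulmxK // (Ghat_unit (HG HH hg)).
Qed.

Lemma Kiso_proj P g y : P^T = P -> P *m P = P -> (forall v, nu0 H v <-> v *m P = v) -> Kiso H g ->
  pi_ (iota_ y *m g) *m P = pi_ (iota_ (y *m P) *m g).
Proof.
move=> PT PP nuE kg; have [hg eg] := kg; have Gg := HG HH hg; have ug := Ghat_unit Gg.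
have nP x : nu0 H (x *m P) by apply/nuE; rewrite -mulmxA PP.
have h1 : pi_ (iota_ (y *m P) *m g) *m P = pi_ (iota_ (y *m P) *m g) by apply/nuE; exact: Kiso_nu0.
rewrite -[in LHS](subrK (y *m P) y) [iota_ (_ + _)]iotaD mulmxDl [pi_ (_ + _)]piD mulmxDl h1.
set z := y - y *m P; set a := pi_ (iota_ z *m g) *m P.
suff -> : a = 0 by rewrite add0r.
apply/eqP; rewrite -dot_eq0 /a dotP // -/a.
have ha : nu0 H a by exact: nP.
have ap := Kiso_nu0 (Kiso_inv kg) ha; set p := pi_ _ in ap.
have -> : a = pi_ (iota_ p *m g).
  by rewrite /p -Kiso_iota ?mulmxKV ?iotaK //; [exact: GhatV|have [] := Kiso_inv kg].
rewrite Kiso_dot // /z dotBl -{2}((nuE p).1 ap) dotP // ((nuE p).1 ap) subrr; exact: eqxx.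
Qed.

(** The isotropy group commutes with [P], and with J up to sign, and is transitive on unit normals;
    so |P J v| is the same for all of them. *)
Lemma nu0_const_angle P : P^T = P -> P *m P = P -> (forall v, nu0 H v <-> v *m P = v) -> \rank P = k ->
  exists2 c, const_angle P c & 0 <= c.
Proof.
move=> PT PP nuE rP.
have [u uP u1] : exists2 u, u *m P = u & dot u u = 1.
  by have [//||v [vP v1 _]] := @frame_next R n P 0 (fun=> 0) PP; [rewrite rP; lia|exists v].
exists (dot (Jmul u *m P) (Jmul u *m P)); last exact: dot_ge0.
split=> // v vP; have [->|v0] := eqVneq v 0; first by rewrite Jmul0 mul0mx !dot0l mulr0.
have vv : 0 < dot v v by rewrite dot_gt0.
have hu : unu0 H u by split=> //; exact/nuE.
have hv := nu0_unit ((nuE v).2 vP) v0.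
have [g kg gE] := Kiso_trans HH Hthin Hcodim hu hv; have [hg eg] := kg.
have [s s2 [_ gJ]] := HG HH hg; have Gg := HG HH hg.
set r := Num.sqrt (dot v v) in gE *; have r0 : r != 0 by rewrite gt_eqF // sqrtr_gt0.
have vE : v = r *: pi_ (iota_ u *m g) by rewrite gE iotaK scalerA mulfV // scale1r.
have JE : Jmul (pi_ (iota_ u *m g)) = s *: pi_ (iota_ (Jmul u) *m g).
  by rewrite -piJ gJ [pi_ (_ *: _)]piZ iotaJ.
rewrite {1 2}vE JmulZ JE -!scalemxAl (Kiso_proj _ PT PP nuE kg) !dotZl !dotZr Kiso_dot //.
rewrite (_ : r * _ = r ^+ 2 * s ^+ 2 * dot (Jmul u *m P) (Jmul u *m P)); last by ring.
by rewrite s2 mulr1 sqr_sqrtr ?dot_ge0 // mulrC.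
Qed.

Hypothesis ntg : ~ totally_geodesic bergman (orb0 H).

Lemma orbit_classification : exists e P c, [/\ level_data e P c, c < 1, \rank P = k,
  forall v, nu0 H v <-> v *m P = v &
  forall x y, CH x -> CH y -> (same_orbit H x y <-> rho e P x = rho e P y)].
Proof.
have [flat|[e [e1 Te TJe HE Hpos]]] := flat_or_parabolic HH Hthin Hcodim.
  by case: ntg; exact: flat_totally_geodesic.
have [P [PT PP nuE rP]] := nu0_projector HH hc.
have [c hP c0] := nu0_const_angle PT PP nuE rP; have [_ _ hcv] := hP.
have Pnu v : nu0 H (v *m P) by apply/nuE; rewrite -mulmxA PP.
have lvl x y := @orbits_level R n H HH Hthin Hcodim e e1 Te TJe HE Hpos P PT PP Pnu (fun v => (nuE v).1) x y.
have he v : v *m P = v -> dot v e = 0 /\ dot v (Jmul e) = 0.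
  by move=> vP; apply: (nu0_perp Te TJe); exact/nuE.
exists e, P, c; split=> //; first by split=> //; rewrite rP; lia.
(* If c >= 1, the normal space is complex and the orbit is the slice orthogonal to it, which is
   totally geodesic. *)
rewrite ltNge; apply/negP => c1; apply: ntg.
have NJ v : nu0 H v -> nu0 H (Jmul v).
  move/nuE => vP; apply/nuE; apply/eqP; rewrite -subr_eq0 -dot_eq0.
  have := dot_ge0 (Jmul v *m P - Jmul v); rewrite dotBl !dotBr [dot (Jmul v) (_ *m P)]dotC.
  have -> : dot (Jmul v *m P) (Jmul v) = c * dot v v by rewrite -(hcv v vP) [RHS]dotP // dotC.
  rewrite (hcv v vP) dotJJ; have := dot_ge0 v => v0 h; apply/eqP; nra.
have -> : orb0 H = [set z | CH z /\ forall v, nu0 H v -> dot z v = 0]; last exact: complex_slice_totally_geodesic.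
have r0 := rho_base e P.
have FE z : CH z -> rho e P z = 0 <-> Fvec e (lift z) *m P = 0.
  move=> hz; have x0 := B_lift_lt0 hz; have h0 := hsq_gt0 e1 x0; split=> [/eqP|h]; last first.
    by rewrite /rho /lev h dot0l mul0r.
  rewrite /rho /lev mulf_eq0 dot_eq0 invr_eq0 mulf_eq0 oppr_eq0 (gt_eqF h0) (lt_eqF x0) !orbF => /eqP //.
have oE z : orb0 H z <-> CH z /\ rho e P z = 0.
  split=> [hz|[hz rz]].
    have hzC := orb0_CH HH hz; split=> //; rewrite -r0; apply/esym/lvl => //; exact: CH0.
  have [g hg <-] : same_orbit H 0 z by apply/(lvl _ _ (@CH0 _ _) hz); rewrite r0.
  by exists g.
have Fd z v : v *m P = v -> dot (Fvec e (lift z)) v = 0 -> dot (Fvec e (lift z)) (Jmul v) = 0 -> CH z -> dot z v = 0.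
  move=> vP; rewrite !Fvec_dot /fform !iotaJ JmulJ !BNr => h1 h2 hz.
  have x0 := B_lift_lt0 hz; have h0 := hsq_gt0 e1 x0.
  have : hsq (lift z) (lift e) * B (lift z) (iota_ v) = 0.
    move: h1 h2; rewrite /hsq; move: (B _ (lift e)) (B _ (Jmul (lift e))) (B _ (iota_ v)) (B _ (Jmul (iota_ v))).
    move=> a b p q h1 h2; rewrite (_ : _ * p = a * (a * p + b * q) - b * (a * q + b * - p)); last by ring.
    by rewrite h1 h2 !mulr0 subrr.
  move/eqP; rewrite mulf_eq0 (gt_eqF h0) /= BC B_iota_l pi_lift dotC => /eqP //.
apply/seteqP; split=> z.
  move/oE => [hz /(FE z hz) F0]; split=> // v hv; have vP := (nuE v).1 hv; have JP := (nuE _).1 (NJ v hv).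
  by apply: Fd => //; rewrite -(proj_dot hP) // F0 dot0l.
move=> [hz zp]; apply/oE; split=> //; apply/(FE z hz)/eqP; rewrite -dot_eq0 dotP //.
set w := _ *m P; have hw : nu0 H w by exact: Pnu.
by rewrite /Fvec pi_lift dotBl !dotZl dotJl (zp w hw) (zp _ (NJ w hw)) oppr0 !mulr0 subrr.
Qed.
End Slice.

(** * Uniqueness of the singular orbit *)

Section Uniqueness.
Variables (R : realType) (n : nat).
Local Notation V := (realCn R n).
Local Notation W := (realCn R n.+1).
Local Notation MM := 'M[R]_(n.+1 + n.+1).

(** Together with [rho0_nu] this shows that the points of a level set on normal rays are closest to
    0. *)
Lemma rho_upper e (P : 'M[R]_(n + n)) c z : level_data e P c -> CH z -> rho e P z <= dot z z / (1 - dot z z).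
Proof.
move=> [[PT PP _] _ _ e1 _] hz; have x0 := B_lift_lt0 hz; have h0 := hsq_gt0 e1 x0.
have z1 : 0 < 1 - dot z z by rewrite subr_gt0; exact/CHE.
rewrite /rho /lev B_lift opprB invfM mulrA ler_pM2r ?invr_gt0 // ler_pdivrMr //.
have -> : dot z z * hsq (lift z) (lift e) = dot (Fvec e (lift z)) (Fvec e (lift z)).
  rewrite /Fvec pi_lift dotBl !dotBr !dotZl !dotZr dotJJ dotxJx dotJxx /hsq; ring.
move: (Fvec _ _) => F; have := dot_ge0 (F - F *m P).
rewrite dotBl !dotBr [dot (F *m P) F]dotC dotP //; lra.
Qed.

(** The isometry translates the geodesic along [xi] by the distance from 0 to r xi; its inverse
    doubles that distance at r xi, whence the factor 2 r / (1 + r^2). *)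
Lemma boost_to0 (xi : V) (r : R) : dot xi xi = 1 -> 0 <= r < 1 -> exists b, [/\ Ghat b, act b (r *: xi) = 0,
  act b 0 = - r *: xi & act (invmx b) (r *: xi) = (2 * r / (1 + r ^+ 2)) *: xi].
Proof.
move=> x1 /andP[r0 r1]; have s0 : 0 < 1 - r ^+ 2 by nra.
pose s := Num.sqrt (1 - r ^+ 2); have sp : 0 < s by rewrite sqrtr_gt0.
have s2 : s ^+ 2 = 1 - r ^+ 2 by rewrite sqr_sqrtr // ltW.
pose w := r *: e0 R n + iota_ xi.
have Bxx : B (lift (r *: xi)) (lift (r *: xi)) = r ^+ 2 - 1 by rewrite B_lift dotZl dotZr x1 mulr1.
have Bw : B w w = 1 - r ^+ 2.
  by rewrite /w !BDl !BDr !BZl !BZr Bee Bei (BC _ (e0 R n)) Bei Bii x1; ring.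
have LE : lift (r *: xi) = e0 R n + r *: iota_ xi by rewrite /lift iotaZ.
have Bxw : B (lift (r *: xi)) w = 0.
  by rewrite LE /w !BDl !BDr !BZl !BZr Bee Bei (BC _ (e0 R n)) Bei Bii x1; ring.
have BxJw : B (lift (r *: xi)) (Jmul w) = 0.
  rewrite LE /w JmulD JmulZ -iotaJ !BDl !BDr !BZl !BZr BxJx Bei Bii dotxJx BJs -iotaJ Bei; ring.
have [|||||||g ug [gx gw _]] := @Witt3 R n 0 (lift (r *: xi)) (s *: e0 R n) w (s *: iota_ xi) (fun=> 0) (fun=> 0).
- by rewrite Bxx; nra.
- by rewrite Bxx BZl BZr Bee mulrA -expr2 s2; ring.
- by rewrite Bxw BZl BZr Bei !mulr0.
- by rewrite BxJw JmulZ BZl BZr -iotaJ Bei !mulr0.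
- by rewrite Bw BZl BZr Bii x1 mulr1 -expr2 s2.
- by [].
- by [].
have Gg := uni_Ghat ug; have rC : CH (r *: xi) by apply: unu0_CH => //; rewrite r0.
have sn := lt0r_neq0 sp; have s20 : s ^+ 2 != 0 by rewrite expf_eq0.
have cs1 (k : nat) (a : R) (x : realCn R k) : a *: x = cs a 0 x by rewrite /cs scale0r addr0.
have ga : act g (r *: xi) = 0.
  by rewrite act_in // gx cs1 pr_cs ?expr0n ?addr0 // -lift0 pr_lift.
have e0g : e0 R n *m g = cs s^-1 0 (lift (- r *: xi)).
  have -> : e0 R n = (s ^+ 2)^-1 *: (lift (r *: xi) - r *: w).
    have s2n : 1 - r ^+ 2 != 0 by rewrite -s2.
    rewrite LE /w s2; move: (e0 R n) (iota_ xi) => E I.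
    by apply/rowP => j; rewrite !mxE; field.
  rewrite -scalemxAl mulmxBl gx -scalemxAl gw -cs1 /lift [iota_ (_ *: xi)]iotaZ.
  by move: (e0 R n) (iota_ xi) => E I; apply/rowP => j; rewrite !mxE; field.
have giE : lift (r *: xi) *m invmx g = cs ((1 + r ^+ 2) / s) 0 (lift ((2 * r / (1 + r ^+ 2)) *: xi)).
  apply: (can_inj (mulmxK (Ghat_unit Gg))); rewrite mulmxKV ?Ghat_unit // -cs1 -scalemxAl.
  have r2 : 1 + r ^+ 2 != 0 by rewrite gt_eqF // ltr_pwDl // sqr_ge0.
  have -> : lift ((2 * r / (1 + r ^+ 2)) *: xi) = (1 + r ^+ 2)^-1 *: (lift (r *: xi) + r *: w).
    rewrite LE /w /lift [iota_ (_ *: xi)]iotaZ; move: (e0 R n) (iota_ xi) => E I.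
    by apply/rowP => j; rewrite !mxE; field.
  rewrite -scalemxAl mulmxDl gx -scalemxAl gw LE; move: (e0 R n) (iota_ xi) => E I.
  by apply/rowP => j; rewrite !mxE; field; rewrite sn r2.
exists g; split=> //.
  by rewrite act_in ?lift0; [rewrite e0g pr_cs ?pr_lift // expr0n addr0 expf_eq0 invr_eq0|exact: CH0].
rewrite act_in // giE pr_cs ?pr_lift // expr0n addr0 expf_eq0 mulf_eq0 invr_eq0 (negPf sn) orbF /=.
by rewrite gt_eqF // ltr_pwDl // sqr_ge0.
Qed.

(* If a level set [rho > 0] had codimension at least two, the isotropy group at its point [r xi]
   closest to [0] would reverse [xi], moving [0] into a positive level set. *)
Lemma singular_unique (H : set MM) e (P : 'M[R]_(n + n)) c y k : closed_subgroup H -> thin H -> level_data e P c ->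
  (forall x y, CH x -> CH y -> (same_orbit H x y <-> rho e P x = rho e P y)) ->
  CH y -> has_codim [set z | same_orbit H y z] k -> (2 <= k)%N -> rho e P y = 0.
Proof.
move=> HH Ht d lvl hy hc hk; have [hP c0 k0 e1 he] := d; have [PT PP _] := hP.
have yup := rho_upper d hy; have y1 : 0 < 1 - dot y y by rewrite subr_gt0; exact/CHE.
have r0 : 0 <= rho e P y.
  rewrite /rho /lev divr_ge0 ?dot_ge0 // mulr_ge0 ?oppr_ge0 ?ltW ?B_lift_lt0 //.
  exact: hsq_gt0 e1 (B_lift_lt0 hy).
apply/eqP; apply: contraT => rn; have {rn r0} rp : 0 < rho e P y by rewrite lt_def rn.
(* [r] solves r^2 / (1 - r^2) = rho(y), so that r u lies on the orbit of y. *)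
set ry := rho e P y in rp *; pose r := Num.sqrt (ry / (1 + ry)).
have r2 : r ^+ 2 = ry / (1 + ry) by rewrite sqr_sqrtr // divr_ge0 ?addr_ge0 // ltW.
have ry1 : 0 < 1 + ry by rewrite ltr_pwDl // ltW.
have rr : 0 < r by rewrite sqrtr_gt0 divr_gt0.
have r21 : r ^+ 2 < 1 by rewrite r2 ltr_pdivrMr // mul1r ltrDr.
have r1 : r < 1 by nra.
have rb : 0 <= r < 1 by rewrite ltW.
have [u uP u1] := proj_unit hP c0 k0; have [ue uJ] := he u uP.
have rhoU t : rho e P (t *: u) = t ^+ 2 / (1 - t ^+ 2) by apply: rho0_nu.
have uC t : 0 <= t < 1 -> CH (t *: u) by exact: unu0_CH.
have yu : same_orbit H y (r *: u).
  by apply/lvl => //; [exact: uC|rewrite rhoU r2 -/ry; field; rewrite lt0r_neq0 //=; apply/eqP; lra].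
have [b [Gb b0 b1 b2]] := boost_to0 u1 rb.
have Hb := conj_closed Gb HH; have Tb := conj_thin Gb HH Ht.
have same z : same_orbit H y z <-> same_orbit H (r *: u) z.
  have [g hg gE] := yu; split=> -[h hh hE].
    exists (invmx g *m h); first by apply: (HM HH) => //; exact: (HV HH).
    have Gg := HG HH hg; have Gh := HG HH hh.
    by rewrite actM //; [rewrite -gE actK|exact: GhatV].
  exists (g *m h); first exact: (HM HH).
  by have Gg := HG HH hg; have Gh := HG HH hh; rewrite actM // gE.
have oE : orb0 (conj_group b H) = act b @` [set z | same_orbit H y z].
  by rewrite (orb0_conj Gb HH b0); congr (_ @` _); apply/seteqP; split=> z /same.
have NC : [set z | same_orbit H y z] `<=` CH by move=> _ [g hg <-]; apply: act_CH => //; exact: (HG HH).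
have hcb : has_codim (orb0 (conj_group b H)) k by rewrite oE; exact: has_codim_act.
have Cb := codim_normals Hb hcb hk.
have xC : CH (act b 0) by apply: act_CH => //; exact: CH0.
have ft : foot0 (conj_group b H) (act b 0).
  move=> q; rewrite oE => -[w hw <-]; have hwC := NC _ hw.
  rewrite -foot0_Dch //; last exact: act_CH.
  have rC : CH (r *: u) by exact: uC.
  rewrite -[X in Dch _ X <= _]b0 (Dch_act Gb (@CH0 _ _) rC) (Dch_act Gb (@CH0 _ _) hwC) !Dch0.
  have [g hg gw] := hw; have rw : rho e P w = ry by apply/esym/lvl.
  have := rho_upper d hwC; rewrite rw dotZl dotZr u1 mulr1 -expr2 r2.
  have w1 : 0 < 1 - dot w w by rewrite subr_gt0; exact/CHE.
  rewrite ler_pdivlMr // => hle.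
  rewrite lef_pV2 ?posrE //; last by rewrite -r2; lra.
  rewrite lerD2l lerN2 ler_pdivrMr //; nra.
have xn : nu0 (conj_group b H) (act b 0).
  by move=> v hv; apply: (foot0_normal Hb ft); exact/(tangent_orb0 Hb).
have un : unu0 (conj_group b H) u.
  split=> //; rewrite -(scalerKV (_ : - r != 0) u); last by rewrite oppr_eq0 gt_eqF.
  by rewrite scalerA mulrC -scalerA -b1; exact: nu0Z.
have un' : unu0 (conj_group b H) (- u).
  by split; [rewrite -scaleN1r; apply: nu0Z; have [] := un|rewrite dotNl dotNr opprK].
have [g kg gE] := Kiso_trans Hb Tb Cb un un'; have [hg eg] := kg.
have Gg := HG Hb hg.
(* Seen before the conjugation by [b], the isotropy element at r u sends 0 to the point 2 r / (1 +
   r^2) u, where rho is positive. *)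
have gx : act g (act b 0) = r *: u.
  by rewrite b1 Kiso_act //; [rewrite iotaZ -scalemxAl gE iotaN scalerN scaleNr opprK -iotaZ iotaK|rewrite -b1].
have : same_orbit (conj_group b H) (act b 0) (act b (act (invmx b) (r *: u))).
  by exists g => //; rewrite actKV.
move/(conj_orbit _ _ Gb HH); rewrite b2 => h.
have s1 : 0 < 2 * r / (1 + r ^+ 2) < 1.
  have d0 : 0 < 1 + r ^+ 2 by rewrite ltr_pwDl // sqr_ge0.
  by rewrite divr_gt0 ?mulr_gt0 //= ltr_pdivrMr // mul1r; nra.
have : rho e P 0 = rho e P ((2 * r / (1 + r ^+ 2)) *: u).
  by apply/lvl => //; [exact: CH0|apply: uC; move/andP: s1 => [/ltW -> ->]].
rewrite rho_base rhoU; move: s1; move: (_ / _) => t /andP[t0 t1] /esym/eqP.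
by rewrite mulf_eq0 expf_eq0 (gt_eqF t0) /= invr_eq0 subr_eq0 eq_sym lt_eqF // expr_lt1 // ltW.
Qed.
End Uniqueness.

(** * Covering dimension of the half-line *)

Section HalfLine.
Variable R : realType.

Section Cover.
Variables (p : nat) (U : 'I_p -> set R).
Hypotheses (oU : forall i, open (U i)) (cU : forall t, 0 <= t -> exists i, U i t).

(** Lebesgue radii at [t], capped at 1 so that they have a supremum even if one member contains the
    whole line. *)
Let radii t : set R := [set d | 0 <= d <= 1 /\ exists i, forall s, `|s - t| < d -> U i s].
Let leb t := sup (radii t).

Lemma radii_sup t : 0 <= t -> has_sup (radii t).
Proof.
move=> t0; split; last by exists 1 => d [/andP[_ ?]].
have [i hi] := cU t0; exists 0; split; first by rewrite lexx ler01.
by exists i => s; rewrite ltNge normr_ge0.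
Qed.

Lemma leb_gt0 t : 0 <= t -> 0 < leb t.
Proof.
move=> t0; have [i hi] := cU t0; have /nbhs_ballP[d /= d0 hd] := open_nbhs_nbhs (conj (@oU i) hi).
have m0 : 0 < Num.min d 1 by rewrite lt_min d0 ltr01.
have m1 := ltW m0; apply: lt_le_trans m0 _; apply: (ub_le_sup (radii_sup t0).2).
split; first by rewrite m1 ge_min lexx orbT.
by exists i => s hs; apply: hd; rewrite -ball_normE /= distrC (lt_le_trans hs) // ge_min lexx.
Qed.

Lemma leb_ball t d : 0 <= t -> d < leb t -> exists i, forall s, `|s - t| < d -> U i s.
Proof.
move=> t0 /(sup_gt (radii_sup t0).1)[d' [_ [i hi]] dd']; exists i => s hs.
by apply: hi; exact: lt_trans hs dd'.
Qed.

Lemma leb_lip t s : 0 <= t -> 0 <= s -> leb t <= leb s + `|s - t|.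
Proof.
move=> t0 s0; apply: ge_sup; first exact: (radii_sup t0).1.
move=> d [/andP[d0 d1] [i hi]]; rewrite -lerBlDr.
have [h|h] := leP (d - `|s - t|) 0; first by apply: le_trans h _; exact: ltW (leb_gt0 s0).
apply: (ub_le_sup (radii_sup s0).2); split.
  by rewrite (ltW h) /= lerBlDr (le_trans d1) // lerDl.
exists i => x hx; apply: hi; rewrite (le_lt_trans (ler_distD s _ _)) //; lra.
Qed.

Fixpoint nodes (m : nat) : R := if m is m'.+1 then nodes m' + leb (nodes m') / 4 else 0.

Lemma nodes_ge0 m : 0 <= nodes m.
Proof. by elim: m => //= m IH; rewrite addr_ge0 // divr_ge0 // ltW // leb_gt0. Qed.

Lemma nodes_lt m : nodes m < nodes m.+1.
Proof. by rewrite /= ltrDl divr_gt0 // leb_gt0 // nodes_ge0. Qed.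

Lemma nodes_mono m l : (m <= l)%N -> nodes m <= nodes l.
Proof.
by elim: l => [|l IH]; [rewrite leqn0 => /eqP ->|rewrite leq_eqVlt => /orP[/eqP ->//|/IH h]; apply: le_trans h (ltW (nodes_lt l))].
Qed.

Lemma nodes_unbounded t : exists m, t < nodes m.
Proof.
apply: contrapT => h; have ub m : nodes m <= t by rewrite leNgt; apply/negP => lt; apply: h; exists m.
have hs : has_sup (range nodes) by split; [exists (nodes 0); exists 0%N|exists t => _ [m _ <-]].
set a := sup (range nodes).
have na m : nodes m <= a by apply: (ub_le_sup hs.2); exists m.
have a0 : 0 <= a := na 0%N; have la := leb_gt0 a0.
(* A node within leb a / 16 of the supremum [a] has leb at least 15/16 of leb a, so its next step of
   a quarter of that passes [a]. *)
have e0 : 0 < leb a / 16 by rewrite divr_gt0.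
have [_ [m _ <-] lt] := sup_adherent e0 hs; rewrite -/a in lt.
have := na m.+1 => /=; have := leb_lip a0 (nodes_ge0 m); have := na m => h1.
rewrite distrC ger0_norm ?subr_ge0 // => h2 h3; lra.
Qed.

Lemma nodes_fine m : exists i, forall s, nodes m <= s <= nodes m.+2 -> U i s.
Proof.
have m0 := nodes_ge0 m; have lm := leb_gt0 m0.
(* By [leb_lip] two steps have length at most 1/4 + 5/16 < 3/4 of [leb] at the first node. *)
have [|i hi] := @leb_ball (nodes m) (leb (nodes m) * 3 / 4) m0; first lra.
exists i => s /andP[s1 s2]; apply: hi; rewrite ger0_norm ?subr_ge0 //.
have d : `|nodes m - nodes m.+1| = leb (nodes m) / 4.
  by rewrite /= opprD addrA subrr sub0r normrN ger0_norm // divr_ge0 // ltW.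
have := leb_lip (nodes_ge0 m.+1) m0; rewrite d => h.
have s2' : s <= nodes m + leb (nodes m) / 4 + leb (nodes m.+1) / 4 := s2.
by move: (leb (nodes m.+1)) h s2' => x h s2'; lra.
Qed.

(** A piece spans two steps, so that consecutive pieces overlap and no point of the half-line lies
    in three of them. *)
Definition piece (m : nat) : set R := if m is l.+1 then `]nodes l, nodes m.+1[%classic else [set t | t < nodes 1].

Lemma half_line_refine : exists W : 'I_p -> set R, [/\ forall i, open (W i), forall t, 0 <= t -> exists i, W i t,
  forall i t, 0 <= t -> W i t -> U i t & forall t, 0 <= t -> (#|[set i | `[< W i t >]]%SET| <= 2)%N].
Proof.
have ex m : exists i, forall s, 0 <= s -> piece m s -> U i s.
  case: m => [|m].
    have [i hi] := nodes_fine 0; exists i => s s0 /= s1; apply: hi; rewrite s0 /=.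
    by apply: le_trans (ltW s1) _; exact: (ltW (nodes_lt 1)).
  have [i hi] := nodes_fine m; exists i => s s0; rewrite /piece /= in_itv /= => /andP[h1 h2]; apply: hi.
  by rewrite (ltW h1) /=; exact: ltW.
have [im imP] := choice ex.
have loc t : 0 <= t -> exists m, nodes m <= t < nodes m.+1.
  move=> t0; have := nodes_unbounded t; move/(@ex_minnP (fun m => t < nodes m)) => [[|m] h1 h2].
    by move: h1; rewrite ltNge t0.
  exists m; rewrite h1 andbT leNgt; apply/negP => /h2; by rewrite ltnn.
(* Pieces assigned to the same member are united, which keeps the index set finite; the multiplicity
   can only drop. *)
exists (fun i => \bigcup_(m in [set m | im m = i]) piece m); split.
- move=> i; apply: bigcup_open => -[|m] _; first exact: open_lt.
  exact: interval_open.
- move=> t t0; have [m /andP[h1 h2]] := loc t t0; exists (im m), m => //.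
  case: m h1 h2 => [|m] h1 h2 //; rewrite /piece /= in_itv /= h2 andbT.
  by apply: lt_le_trans h1; exact: nodes_lt.
- by move=> i t t0 [m <- hm]; exact: imP hm.
- move=> t t0; have [m /andP[h1 h2]] := loc t t0.
  have sub l : piece l t -> l = m \/ l = m.+1.
    move=> hl; suff : (m <= l <= m.+1)%N by case/andP; lia.
    apply/andP; split; rewrite leqNgt; apply/negP => lt.
      have : nodes l.+1 <= nodes m by exact: nodes_mono.
      case: l hl lt => [|l] /=; [|rewrite in_itv /= => /andP[_]]; move=> hl _ hle; move: (lt_le_trans hl hle); by rewrite ltNge h1.
    case: l hl lt => [//|l]; rewrite /piece /= in_itv /= => /andP[hl _] lt.
    have : nodes m.+1 <= nodes l by apply: nodes_mono; lia.
    by move/(lt_le_trans h2)/(lt_trans hl); rewrite ltxx.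
  apply: leq_trans (_ : #|[set im m; im m.+1]%SET| <= 2)%N; last by rewrite cards2; case: (_ != _).
  apply: subset_leq_card; apply/fintype.subsetP => i; rewrite finset.in_set => /asboolP[l /= <- /sub[->|->]];
  by rewrite finset.in_set2 eqxx ?orbT.
Qed.
End Cover.

Lemma half_line_connected (q : nat) (W : 'I_q -> set R) : (forall i, open (W i)) ->
  (forall t, exists i, W i t) -> (forall t i j, W i t -> W j t -> i = j) -> exists i, W i = setT.
Proof.
move=> oW cW dW; have [i hi] := cW 0; exists i.
have cR : connected [set: R] by apply/connected_intervalP => x y _ _ z _.
apply: cR; first by exists 0.
  by exists (W i) => //; rewrite setTI.
exists (W i); last by rewrite setTI.
rewrite -[W i]setCK; apply: open_closedC.
rewrite (_ : ~` W i = \bigcup_(j in [set j | j != i]) W j); first exact: bigcup_open.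
apply/seteqP; split=> t.
  by move=> ht; have [j hj] := cW t; exists j => //=; apply/eqP => e; apply: ht; rewrite -e.
by move=> [j /eqP ji hj] hi'; apply: ji; exact: dW hj hi'.
Qed.
End HalfLine.

(** * Model actions *)

Section Model.
Variables (R : realType) (n : nat).
Local Notation V := (realCn R n).
Local Notation W := (realCn R n.+1).
Local Notation MM := 'M[R]_(n.+1 + n.+1).
Local Notation orbit := Defs.orbit.
Variables (e : V) (P : 'M[R]_(n + n)) (c : R).
Hypothesis d : level_data e P c.

Let hP : const_angle P c. Proof. by have [] := d. Qed.
Let c0 : 0 <= c. Proof. by have [] := d. Qed.
Let k0 : (0 < \rank P)%N. Proof. by have [] := d. Qed.
Let e1 : dot e e = 1. Proof. by have [] := d. Qed.
Let he v : v *m P = v -> dot v e = 0 /\ dot v (Jmul e) = 0. Proof. by have [_ _ _ _] := d; exact. Qed.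
Let PT : P^T = P. Proof. by have [] := hP. Qed.
Let PP : P *m P = P. Proof. by have [] := hP. Qed.

(** Taking all isometries that preserve rho makes closedness immediate; transitivity on the level
    sets is then [level_transitive]. *)
Definition model_group : set (V -> V) :=
  [set f | CH_isometry f /\ forall z, CH z -> rho e P (f z) = rho e P z].

Lemma model_act g : Ghat g -> (forall z, CH z -> rho e P (act g z) = rho e P z) -> model_group (act g).
Proof. by move=> Gg h; split=> //; exact: act_isometry. Qed.

Lemma rho_cvg (u : nat -> V) (z : V) : CH z -> u @ \oo --> z -> (fun i => rho e P (u i)) @ \oo --> rho e P z.
Proof.
move=> hz cu; have cl : (fun i => lift (u i)) @ \oo --> lift z.
  by apply: cvgD; [exact: cvg_cst|exact: cvg_iota].
have cq (x : W) : (fun i => B (lift (u i)) x) @ \oo --> B (lift z) x by apply: cvg_B => //; exact: cvg_cst.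
have cF : (fun i => Fvec e (lift (u i)) *m P) @ \oo --> Fvec e (lift z) *m P.
  apply: cvg_mulmx; last exact: cvg_cst.
  apply: cvgB; apply: cvg_scale; [exact: cq|exact: cvg_pi|exact: cq|apply: cvg_J; exact: cvg_pi].
have x0 := B_lift_lt0 hz; have h0 := hsq_gt0 e1 x0.
have ch : (fun i => hsq (lift (u i)) (lift e)) @ \oo --> hsq (lift z) (lift e).
  by apply: cvgD; [exact: (cvgM (cq _) (cq _))|exact: (cvgM (cq _) (cq _))].
apply: cvgM; first exact: cvg_dot.
apply: cvgV; first by rewrite mulf_neq0 ?lt0r_neq0 // oppr_gt0.
by apply: cvgM => //; apply: cvgN; exact: cvg_B.
Qed.

Lemma model_action : isometric_action model_group.
Proof.
have idE : id = act 1%:M :> (V -> V) by apply/funext => z; rewrite act1.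
split.
- by move=> f [].
- by split=> //; rewrite idE; apply: act_isometry; exact: Ghat1.
- move=> f g [If hf] [Ig hg]; have [x Gx fE] := isometry_mx If; have [y Gy gE] := isometry_mx Ig.
  have -> : f \o g = act (y *m x) by apply/funext => z; rewrite actM // fE gE.
  apply: model_act; first exact: GhatM.
  by move=> z hz; rewrite actM // -fE hf ?gE; [rewrite -gE hg|exact: act_CH].
- move=> f [If hf]; have [x Gx fE] := isometry_mx If; exists (act (invmx x)); last first.
    by apply/funext => z; rewrite /= fE actK.
  apply: model_act; first exact: GhatV.
  by move=> z hz; rewrite -hf; [rewrite fE actKV|apply: act_CH => //; exact: GhatV].
- move=> u f hu If cu; split=> // z hz.
  have := cvg_uniform_pt (cu [set z] (@compact_set1 _ z) (_ : [set z] `<=` CH)) => lim.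
  have {}lim := lim (fun x (xz : x = z) => eq_ind_r CH hz xz).
  have [x Gx fE] := isometry_mx If; have fz : CH (f z) by rewrite fE; exact: act_CH.
  have := rho_cvg fz lim; rewrite (_ : (fun i => _) = fun=> rho e P z) => [l|].
    exact: (cvg_unique _ l (cvg_cst _)).
  by apply/funext => i; have [_ ->] := hu i.
Qed.

Lemma model_orbit z : CH z -> orbit model_group z = [set y | CH y /\ rho e P y = rho e P z].
Proof.
move=> hz; apply/seteqP; split=> y.
  move=> [f [If hf] <-]; split; last exact: hf.
  by have [x Gx ->] := isometry_mx If; exact: act_CH.
move=> [hy eq]; have [g [ug gE hg]] := level_transitive d hz hy (esym eq).
by exists (act g) => //; apply: model_act => //; exact: uni_Ghat.
Qed.

Lemma model_orbit_eq y z : CH y -> CH z -> orbit model_group y = orbit model_group z <-> rho e P y = rho e P z.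
Proof.
move=> hy hz; rewrite !model_orbit //; split=> [h|-> //].
by have [] : [set x | CH x /\ rho e P x = rho e P z] y by rewrite -h.
Qed.

Lemma rho_ge0 z : CH z -> 0 <= rho e P z.
Proof.
move=> hz; rewrite /rho /lev divr_ge0 ?dot_ge0 // mulr_ge0 ?oppr_ge0 ?ltW ?B_lift_lt0 //.
exact: hsq_gt0 e1 (B_lift_lt0 hz).
Qed.

Definition orbit_level (S : set R) : set (set V) :=
  [set O | exists2 z, CH z & O = orbit model_group z /\ S (rho e P z)].

Lemma orbit_levelE S z : CH z -> orbit_level S (orbit model_group z) <-> S (rho e P z).
Proof.
by move=> hz; split=> [[y hy [/(model_orbit_eq hz hy) -> //]]|h]; exists z.
Qed.

Lemma orbit_level_open S : open S -> orbits_open model_group (orbit_level S).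
Proof.
move=> oS; split=> [_ [z hz [-> _]]|]; first by exists z.
apply: open_seq => u z [hz /(orbit_levelE S hz) Sz] cu.
have n1 : \forall i \near \oo, CH (u i) by apply: cu; exact: near_CH.
have n2 : \forall i \near \oo, S (rho e P (u i)).
  by apply: (rho_cvg hz cu); exact: open_nbhs_nbhs.
have [i [ci si]] := filter_ex (filterI n1 n2).
by exists i; split=> //; exact/(orbit_levelE S ci).
Qed.

Let u := xget 0 [set u | u *m P = u /\ dot u u = 1].
Let uE : u *m P = u /\ dot u u = 1.
Proof.
have [v vP v1] := proj_unit hP c0 k0.
have ex : exists v : V, [set u | u *m P = u /\ dot u u = 1] v by exists v.
exact (xgetPex 0 ex).
Qed.

(** Parametrized so that rho (ray t) = |t|. The absolute value extends the ray to all of R, where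
    openness and connectedness can be taken in the line. *)
Definition ray (t : R) : V := Num.sqrt (`|t| / (1 + `|t|)) *: u.

Lemma ray_scale (t : R) : 0 <= Num.sqrt (`|t| / (1 + `|t|)) < 1 /\
  Num.sqrt (`|t| / (1 + `|t|)) ^+ 2 = `|t| / (1 + `|t|).
Proof.
have t1 : 0 < 1 + `|t| by rewrite ltr_pwDl.
have q0 : 0 <= `|t| / (1 + `|t|) by rewrite divr_ge0 // ltW.
split; last by rewrite sqr_sqrtr.
by apply: sqrt_unit => //; rewrite ltr_pdivrMr // mul1r; lra.
Qed.

Lemma ray_CH t : CH (ray t).
Proof. by have [h _] := ray_scale t; have [_ u1] := uE; exact: unu0_CH. Qed.

Lemma rho_ray t : rho e P (ray t) = `|t|.
Proof.
have [uP u1] := uE; have [ue uJ] := he uP; rewrite (rho0_nu _ PT PP e1 ue uJ uP u1).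
have [_ ->] := ray_scale t; have t1 : 0 < 1 + `|t| by rewrite ltr_pwDl.
by field; rewrite lt0r_neq0 //=; apply/eqP; lra.
Qed.

Lemma open_ray (S : set V) : open S -> open [set t | S (ray t)].
Proof.
move=> oS; apply: (open_comp (f := ray)) oS => t _.
have t1 : 1 + `|t| != 0 by rewrite gt_eqF // ltr_pwDl.
have cn : (fun s : R => `|s|) @ t --> `|t| by apply: cvg_norm; exact: cvg_id.
have cq : (fun s : R => `|s| / (1 + `|s|)) @ t --> `|t| / (1 + `|t|).
  by apply: cvgM => //; apply: cvgV => //; apply: cvgD => //; exact: cvg_cst.
have cs : (fun s : R => Num.sqrt (`|s| / (1 + `|s|))) @ t --> Num.sqrt (`|t| / (1 + `|t|)).
  by apply: continuous_cvg => //; exact: sqrt_continuous.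
by apply: cvgZr_tmp.
Qed.

Lemma model_dim1 : covering_dim_le (orbits model_group) (orbits_open model_group) 1.
Proof.
move=> p U oU cU; pose U' i := [set t | CH (ray t) /\ U i (orbit model_group (ray t))].
have oU' i : open (U' i) by apply: (@open_ray [set z | CH z /\ U i (orbit model_group z)]); have [] := oU i.
have cU' t : 0 <= t -> exists i, U' i t.
  move=> t0; have [|i _ hi] := cU (orbit model_group (ray t)); first by exists (ray t) => //; exact: ray_CH.
  by exists i; split=> //; exact: ray_CH.
have [S [oS cS sS dS]] := half_line_refine oU' cU'.
exists p, (fun i => orbit_level (S i)); split.
- by move=> j; exact: orbit_level_open.
- move=> _ [z hz <-]; have [j hj] := cS _ (rho_ge0 hz); exists j => //; exact/(orbit_levelE _ hz).
- move=> j; exists j => _ [z hz [-> hS]]; have [_] := sS j _ (rho_ge0 hz) hS.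
  have -> // : orbit model_group (ray (rho e P z)) = orbit model_group z.
  by apply/(model_orbit_eq (ray_CH _) hz); rewrite rho_ray ger0_norm // rho_ge0.
- move=> _ [z hz <-]; apply: leq_trans (dS _ (rho_ge0 hz)); apply: subset_leq_card.
  apply/fintype.subsetP => j; rewrite !finset.in_set => /asboolP/(orbit_levelE _ hz) h; exact/asboolP.
Qed.

(** A refinement of the cover by rho < 2 and rho > 1 with disjoint open members would have a member
    containing the whole ray, on which rho takes the values 0 and 3. *)
Lemma model_dim0 : ~ covering_dim_le (orbits model_group) (orbits_open model_group) 0.
Proof.
move=> dim0; pose U (i : 'I_2) := orbit_level (if val i == 0%N then [set t | t < 2] else [set t | 1 < t]).
have [||q [S [oS cS sS dS]]] := dim0 2%N U.
- by move=> i; apply: orbit_level_open; case: ifP => _; [exact: open_lt|exact: open_gt].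
- move=> _ [z hz <-]; have [lt|ge] := ltP (rho e P z) 2.
    by exists ord0 => //; apply/(orbit_levelE _ hz).
  by exists ord_max => //; apply/(orbit_levelE _ hz) => /=; apply: lt_le_trans ge; rewrite ltr1n.
pose T j := [set t | CH (ray t) /\ S j (orbit model_group (ray t))].
have [|t|t i j [_ hi] [_ hj]|i iT] := @half_line_connected R q T.
- by move=> j; apply: (@open_ray [set z | CH z /\ S j (orbit model_group z)]); have [] := oS j.
- have [|j _ hj] := cS (orbit model_group (ray t)); first by exists (ray t) => //; exact: ray_CH.
  by exists j; split=> //; exact: ray_CH.
- have /dS/card_le1_eqP : orbits model_group (orbit model_group (ray t)) by exists (ray t) => //; exact: ray_CH.
  by apply; rewrite finset.in_set; apply/asboolP.
have [l hl] := sS i.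
have h t : U l (orbit model_group (ray t)).
  by apply: hl; have : T i t by [rewrite iT]; case.
have := h 3; have := h 0; rewrite /U => /(orbit_levelE _ (ray_CH _)) h0 /(orbit_levelE _ (ray_CH _)) h3.
move: h0 h3; rewrite !rho_ray normr0 ger0_norm //; case: ifP => _ /=; first by move=> _; rewrite ltr_nat.
by rewrite ltNge ler01.
Qed.

Lemma model_cohomogeneity_one : cohomogeneity_one model_group.
Proof. by split; [exact: model_action|split; [exact: model_dim1|exact: model_dim0]]. Qed.

Let H := Hof model_group.
Let HH : closed_subgroup H := Hof_closed model_action.

Lemma model_orb0 z : orb0 H z <-> CH z /\ forall v, v *m P = v ->
  (dot z e - 1) * dot z v + dot z (Jmul e) * dot z (Jmul v) = 0.
Proof.
have -> : orb0 H z <-> orbit model_group 0 z by rewrite (orbitE _ model_action); split.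
rewrite model_orbit; last exact: CH0.
have FE : CH z -> rho e P z = 0 <-> Fvec e (lift z) *m P = 0.
  move=> hz; have x0 := B_lift_lt0 hz; have h0 := hsq_gt0 e1 x0; split=> [/eqP|h]; last first.
    by rewrite /rho /lev h dot0l mul0r.
  by rewrite /rho /lev mulf_eq0 dot_eq0 invr_eq0 mulf_eq0 oppr_eq0 (gt_eqF h0) (lt_eqF x0) !orbF => /eqP.
have Fd v : dot (Fvec e (lift z)) v = (dot z e - 1) * dot z v + dot z (Jmul e) * dot z (Jmul v).
  have E : B (lift z) (Jmul (lift e)) = dot z (Jmul e).
    by rewrite /B piJ !pi_lift c0J c1J !c0_lift !c1_lift; ring.
  by rewrite /Fvec pi_lift dotBl !dotZl dotJl E B_lift; ring.
rewrite rho_base; split=> -[hz h]; split=> //.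
  by move=> v vP; rewrite -Fd -(proj_dot hP) // (FE hz).1 // dot0l.
apply/(FE hz)/eqP; rewrite -dot_eq0 dotP // Fd h // -mulmxA PP //.
Qed.

(** On z + s v + s^2 u2 with z = 0, the equation in [model_orb0] is a polynomial in s; the vector u2
    is chosen such that all its coefficients vanish. *)
Lemma model_curve v : v *m P = 0 -> exists cu : R -> V, [/\ smooth_curve cu, forall t, orb0 H (cu t),
  cu 0 = 0, derive1 cu 0 = v &
  derive1 (derive1 cu) 0 = 2 *: - cs (dot v e) (dot v (Jmul e)) (v - cs (dot v e) (dot v (Jmul e)) e)].
Proof.
move=> vP; set al := dot v e; set be := dot v (Jmul e); set w := v - cs al be e.
have [cu [scu hcu cu0 cu1 cu2]] := quad_curve v (- cs al be w) (@CH0 R n).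
exists cu; split=> // t; have [hC [s E]] := hcu t; apply/model_orb0; split=> // x xP; rewrite {}E add0r.
have [xe xJ] := he xP; have vx : dot v x = 0 by rewrite -xP -{1}PT /dot trmx_mul trmxK mulmxA vP mul0mx mxE.
have ex : dot e x = 0 by rewrite dotC.
have eJx : dot e (Jmul x) = 0 by rewrite dotJs xJ oppr0.
have w1 : dot w x = 0 by rewrite /w /cs dotBl dotDl !dotZl vx ex dotJl eJx; ring.
have we : dot w e = 0 by rewrite /w /cs dotBl dotDl !dotZl dotJxx e1 -/al; ring.
have wJ : dot w (Jmul e) = 0 by rewrite /w /cs dotBl dotDl !dotZl dotxJx dotJJ e1 -/be; ring.
have wx : dot w (Jmul x) = dot v (Jmul x).
  by rewrite /w /cs dotBl dotDl !dotZl eJx dotJJ ex; ring.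
clearbody w; rewrite /cs !(dotDl, dotNl, dotZl) !dotJl !JmulJ !dotNr we wJ w1 wx vx -/al -/be; ring.
Qed.

Lemma model_tangent v : tangent_space (orb0 H) 0 v <-> v *m P = 0.
Proof.
split=> [[cu [scu hcu cu0 <-]]|vP]; last first.
  by have [cu [h1 h2 h3 h4 _]] := model_curve vP; exists cu.
have hp x : x *m P = x -> dot (derive1 cu 0) x = 0.
  move=> xP; have dc := smooth_is_derive 0 scu; set v1 := derive1 cu 0 in dc *.
  have dd y : is_derive (0 : R) (1 : R) (fun t => dot (cu t) y) (dot v1 y).
    by apply: is_derive_eq (is_derive_dot dc (is_derive_cstmx y (0 : R) (1 : R))) _; rewrite dot0r addr0.
  have d1 := is_deriveB (dd e) (is_derive_cst (1 : R) (0 : R) (1 : R)).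
  have D := is_deriveD (is_deriveM d1 (dd x)) (is_deriveM (dd (Jmul e)) (dd (Jmul x))).
  have z : (fun t => (dot (cu t) e - 1) * dot (cu t) x + dot (cu t) (Jmul e) * dot (cu t) (Jmul x)) = fun=> 0.
    by apply/funext => t; have /model_orb0[_] := hcu t; exact.
  have := is_derive_uniq D (is_derive_ext _ (is_derive_cst (0 : R) (0 : R) (1 : R))).
  rewrite !fctE /GRing.scale /= !cu0 !dot0l; move=> h.
  have : (0 - 1) * dot v1 x = 0.
    rewrite -[RHS](h _); first by ring.
    by near=> t; have := congr1 (@^~ t) z.
  by rewrite sub0r mulN1r => /eqP; rewrite oppr_eq0 => /eqP.
by apply/eqP; rewrite -dot_eq0 dotP // hp // -mulmxA PP.
Unshelve. all: by end_near. Qed.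

Lemma model_codim : codim_at (orb0 H) 0 (\rank P).
Proof.
exists (lker (linfun (mulmxr P : V -> V))).
have kE v : (v \in lker (linfun (mulmxr P : V -> V))) = (v *m P == 0) by rewrite memv_ker lfunE.
split.
  by apply/seteqP; split=> v; [rewrite /= kE => /eqP h|move/model_tangent => h]; [apply/model_tangent|rewrite /= kE h].
rewrite (dim_row_space (Q := (1%:M - P)%R)) ?proj_compl_rank // => v.
rewrite kE; apply/eqP/submxP => [vP|[y ->]].
  by exists v; rewrite mulmxBr mulmx1 vP subr0.
by rewrite -mulmxA mulmxBl mul1mx PP subrr mulmx0.
Qed.

Lemma normal_base M : (forall v, tangent_space M 0 v <-> v *m P = 0) ->
  forall w, Defs.normal_space bergman M 0 w <-> w *m P = w.
Proof.
move=> hT w; split=> [h|wP v /hT vP].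
  have wt : (w - w *m P) *m P = 0 by rewrite mulmxBl -mulmxA PP subrr.
  apply/esym/eqP; rewrite -subr_eq0 -dot_eq0 dotBr; have := h _ ((hT _).2 wt).
  rewrite metric0 => /eqP; rewrite mulf_eq0 pnatr_eq0 /= => /eqP ->.
  have hp : w *m P *m P = w *m P by rewrite -mulmxA PP.
  by rewrite -(proj_dot hP _ hp) wt dot0l subrr.
by rewrite metric0 -(proj_dot hP _ wP) vP dot0l mulr0.
Qed.

Hypothesis c1 : c < 1.

Lemma model_parameter : has_parameter (orb0 H) (param c (\rank P)).
Proof.
apply: (orb0_parameter HH); first by rewrite param_codimE; exact: model_codim.
apply: (angle_condition_base _ hP _ (normal_base model_tangent)); exact/andP.
Qed.

(** The test curve has velocity J e + w, where w is the part of J x orthogonal to V for a unit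
    vector x of V. Its acceleration - 2 J w has the product 2 (1 - c) with the normal vector x. *)
Lemma model_not_totally_geodesic : ~ totally_geodesic bergman (orb0 H).
Proof.
move=> tg; have [xP x1] := uE; set x := u in xP x1; have [xe xJ] := he xP.
pose w := Jmul x - Jmul x *m P; have wP : w *m P = 0 by rewrite mulmxBl -mulmxA PP subrr.
have hp : Jmul x *m P *m P = Jmul x *m P by rewrite -mulmxA PP.
have [a1 a2] := he hp.
have we : dot w e = 0 by rewrite dotBl dotJl xJ a1 oppr0 addr0.
have wJ : dot w (Jmul e) = 0 by rewrite dotBl dotJJ xe a2 subr0.
have JeP : Jmul e *m P = 0.
  apply/eqP; rewrite -dot_eq0 dotP // dotC; apply/eqP.
  have hq : Jmul e *m P *m P = Jmul e *m P by rewrite -mulmxA PP.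
  by have [_ ->] := he hq.
have vP : (Jmul e + w) *m P = 0 by rewrite mulmxDl JeP wP addr0.
have [cu [scu hcu cu0 cu1 cu2]] := model_curve vP.
have := tg cu scu hcu 0; rewrite covariant_accelerationE ?cu0; last exact: CH0.
rewrite gam0 addr0 cu2 => /model_tangent.
have -> : dot (Jmul e + w) e = 0 by rewrite dotDl dotJxx we addr0.
have -> : dot (Jmul e + w) (Jmul e) = 1 by rewrite dotDl dotJJ e1 wJ addr0.
rewrite /cs !scale0r !add0r !scale1r [_ + w]addrC addrK -scalemxAl mulNmx => /eqP.
rewrite scaler_eq0 pnatr_eq0 /= oppr_eq0 => /eqP h.
have : dot (Jmul w *m P) x = 0 by rewrite h dot0l.
rewrite (proj_dot hP) // dotJl /w dotBl dotJJ x1 => /eqP; rewrite oppr_eq0.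
have -> : dot (Jmul x *m P) (Jmul x) = c * dot x x.
  by have [_ _ <-] := hP; rewrite ?xP // [RHS]dotP // dotC.
by rewrite x1 mulr1 subr_eq0 eq_sym => /eqP e'; move: c1; rewrite e' ltxx.
Qed.
End Model.

(** * The moduli space *)

Section StandardSubspace.
Variables (R : realType) (n : nat).
Local Notation V := (realCn R n).
Variables (c : R) (k : nat).
Hypotheses (c0 : 0 <= c) (c1 : c <= 1) (k0 : (0 < k)%N) (kn : (k < n)%N) (ev : c != 0 -> ~~ odd k).

Definition unitv (j : nat) : V := row_mx (\row_(l < n) (l == j :> nat)%:R) 0.

Lemma dot_unitv i j : (i < n)%N -> dot (unitv i) (unitv j) = (i == j)%:R.
Proof.
move=> hi; rewrite dot_row dot0l addr0 dotE (bigD1 (Ordinal hi)) //= big1 => [|l li]; rewrite !mxE ?eqxx ?mul1r ?addr0 //.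
by rewrite -[(l == i :> nat)]/(l == Ordinal hi) (negPf li) mul0r.
Qed.

Lemma dot_unitvJ i j : dot (unitv i) (Jmul (unitv j)) = 0.
Proof. by rewrite /Jmul /unitv row_mxKl row_mxKr oppr0 dot_row dot0r dot0l addr0. Qed.

(** The pairs u_(2m+1) and sqrt c J u_(2m+1) + sqrt (1 - c) u_(2m+2). Indices start at 1 because
    [unitv 0] is reserved for [e]; hence k < n. *)
Definition std_vec (i : nat) : V :=
  if odd i then Num.sqrt c *: Jmul (unitv i) + Num.sqrt (1 - c) *: unitv i.+1 else unitv i.+1.

Let sc2 : Num.sqrt c * Num.sqrt c = c. Proof. by rewrite -expr2 sqr_sqrtr. Qed.
Let sd2 : Num.sqrt (1 - c) * Num.sqrt (1 - c) = 1 - c. Proof. by rewrite -expr2 sqr_sqrtr // subr_ge0. Qed.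

Lemma std_dot i j : (i < k)%N -> (j < k)%N -> dot (std_vec i) (std_vec j) = (i == j)%:R.
Proof.
move=> hi hj; have [a1 a2 a3 a4] : [/\ (i < n)%N, (i.+1 < n)%N, (j < n)%N & (j.+1 < n)%N] by split; lia.
rewrite /std_vec; case: ifP => oi; case: ifP => oj.
- rewrite !(dotDl, dotDr, dotZl, dotZr) dotJJ dotJl !dot_unitvJ !dot_unitv // eqSS.
  have -> : forall x, Num.sqrt c * (Num.sqrt c * x) + Num.sqrt c * (Num.sqrt (1 - c) * - 0) +
     (Num.sqrt (1 - c) * (Num.sqrt c * 0) + Num.sqrt (1 - c) * (Num.sqrt (1 - c) * x)) =
     (Num.sqrt c * Num.sqrt c + Num.sqrt (1 - c) * Num.sqrt (1 - c)) * x by move=> x; ring.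
  by rewrite sc2 sd2; ring.
- have E : (i == j) = false by apply/eqP => h; rewrite h oj in oi.
  by rewrite dotDl !dotZl dotJl dot_unitvJ dot_unitv // eqSS E oppr0 !mulr0 addr0.
- have E : (i == j) = false by apply/eqP => h; rewrite h oj in oi.
  by rewrite dotDr !dotZr dot_unitvJ dot_unitv // eqSS E !mulr0 addr0.
- by rewrite dot_unitv // eqSS.
Qed.

Lemma std_J i j : (i < k)%N -> (j < k)%N ->
  dot (Jmul (std_vec i)) (std_vec j) = (-1) ^+ odd i * Num.sqrt c * (j == partner i)%:R.
Proof.
move=> hi hj; have [a1 a2 a3 a4] : [/\ (i < n)%N, (i.+1 < n)%N, (j < n)%N & (j.+1 < n)%N] by split; lia.
rewrite /std_vec /partner; case: ifP => oi; case: ifP => oj.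
- rewrite JmulD !JmulZ JmulJ !(dotDl, dotDr, dotZl, dotZr) dotJJ dotNl dotJl dotNl !dot_unitvJ !dot_unitv //.
  have [E1 E2 E3] : [/\ (i == j.+1) = false, (i.+1 == j) = false & (j == i.-1) = false] by split; apply/eqP; lia.
  by rewrite E1 E2 E3 !oppr0 !mulr0 !addr0 !mulr0 addr0.
- rewrite JmulD !JmulZ JmulJ !(dotDl, dotZl) dotNl dotJl !dot_unitvJ !dot_unitv //.
  rewrite (_ : i == j.+1 = (j == i.-1)) ?expr1; first ring; apply/eqP/eqP; lia.
- rewrite !(dotDr, dotZr) dotJJ dotJl dot_unitvJ dot_unitv // (_ : i.+1 == j = (j == i.+1)) ?expr0; first ring.
  by rewrite eq_sym.
- by rewrite dotJl dot_unitvJ oppr0 (_ : j == i.+1 = false) ?mulr0 //; apply/eqP; lia.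
Qed.

Let A := \matrix_(i < k) std_vec i.
Definition std_proj : 'M[R]_(n + n) := A^T *m A.

Lemma std_data : level_data (unitv 0) std_proj c /\ \rank std_proj = k.
Proof.
have [AA rA] : A *m A^T = 1%:M /\ \rank A = k := orthonormal_rows std_dot.
have AP : A *m std_proj = A by rewrite /std_proj mulmxA AA mul1mx.
have rP : \rank std_proj = k.
  apply/eqP; rewrite eqn_leq; apply/andP; split; first by rewrite -[X in (_ <= X)%N]rA mxrankM_maxr.
  by rewrite -[X in (X <= _)%N]rA -AP mxrankM_maxr.
have PT : std_proj^T = std_proj by rewrite /std_proj trmx_mul trmxK.
have PP : std_proj *m std_proj = std_proj by rewrite {2}/std_proj mulmxA /std_proj -(mulmxA A^T) AA mulmx1.
have vA v : v *m std_proj = v -> v = (v *m A^T) *m A by rewrite /std_proj mulmxA.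
have dA (x y : 'rV_k) : dot (x *m A) (y *m A) = dot x y.
  by rewrite /dot trmx_mul mulmxA -(mulmxA x) AA mulmx1.
have xA (x : 'rV_k) y : dot (x *m A) y = \sum_(i < k) x 0 i * dot (std_vec i) y.
  rewrite mulmx_sum_row (big_morph (fun z => dot z y) (fun a b => dotDl a b y) (dot0l y)).
  by apply: eq_bigr => i _; rewrite dotZl rowK.
split=> //; split=> //; last first.
- move=> v /vA ->; rewrite !xA; split; apply: big1 => i _; rewrite /std_vec; case: ifP => oi.
  + by rewrite dotDl !dotZl dotJl dot_unitvJ dot_unitv ?oppr0 ?mulr0 ?addr0 ?mulr0 //; have := ltn_ord i; lia.
  + by rewrite dot_unitv ?mulr0 //; have := ltn_ord i; lia.
  + rewrite dotDl !dotZl dotJJ dot_unitvJ dot_unitv; last by have := ltn_ord i; lia.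
    by rewrite (_ : i == 0%N :> nat = false) ?mulr0 ?addr0 ?mulr0 //; apply/eqP => e; rewrite e in oi.
  + by rewrite dot_unitvJ mulr0.
- by rewrite dot_unitv //; lia.
- by rewrite rP.
split=> // v /vA; set a := v *m A^T => vE.
(* The matrix of P J in the frame; for c > 0 it is sqrt c times a signed permutation matrix, and for
   c = 0 it is 0. *)
pose Om := \matrix_(i < k, j < k) dot (Jmul (std_vec i)) (std_vec j).
have JE : Jmul v *m A^T = a *m Om.
  apply/rowP => j; rewrite mxE [RHS]mxE.
  have -> : \sum_l Jmul v 0 l * A^T l j = dot (Jmul v) (std_vec j).
    by rewrite dotE; apply: eq_bigr => l _; rewrite !mxE.
  by rewrite {1}vE dotJl xA -sumrN; apply: eq_bigr => i _; rewrite [Om _ _]mxE dotJl mulrN.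
have OO : Om *m Om^T = c%:M.
  apply/matrixP => i l; rewrite !mxE; under eq_bigr do rewrite !mxE !std_J //.
  have [cz|cn] := eqVneq c 0.
    by rewrite cz sqrtr0 mul0rn; apply: big1 => j _; rewrite !mulr0 !mul0r.
  have pk : (partner i < k)%N by rewrite /partner; have := ev cn; have := ltn_ord i; case: ifP; lia.
  rewrite (bigD1 (Ordinal pk)) //= big1 ?addr0 => [|j ji]; last first.
    by rewrite (_ : j == partner i :> nat = false) ?mulr0 ?mul0r //; apply: negbTE.
  rewrite eqxx mulr1 (_ : partner i == partner l = (i == l)); last first.
    apply/eqP/eqP => [|-> //]; rewrite /partner => h; apply/val_inj => /=; move: h; do 2 case: ifP; lia.
  have [->|_] := eqVneq i l; last by rewrite !mulr0.
  by rewrite /= !mulr1n mulr1 mulrACA sc2 -expr2 sqrr_sign mul1r.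
rewrite {1 2}/std_proj mulmxA JE dA {1}vE [in RHS]vE dA /dot trmx_mul mulmxA -(mulmxA a) OO.
by rewrite mul_mx_scalar -scalemxAl mxE.
Qed.
End StandardSubspace.

(** * Parameters of orbit equivalence classes *)

Section Moduli.
Variables (R : realType) (n : nat).
Local Notation V := (realCn R n).
Local Notation MM := 'M[R]_(n.+1 + n.+1).
Local Notation orbit := Defs.orbit.
Implicit Types (A : set (V -> V)) (M : set V).

Lemma orbit_CH A z : isometric_action A -> CH z -> orbit A z `<=` CH.
Proof. by move=> hA hz; rewrite orbitE // => _ [g [Gg _] <-]; exact: act_CH. Qed.

Lemma orbit_eq A x y : isometric_action A -> orbit A x y -> orbit A y = orbit A x.
Proof.
move=> [_ _ hc hi _] [f hf <-]; have [g hg gf] := hi f hf.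
apply/seteqP; split=> _ [h hh <-]; first by exists (h \o f) => //; exact: hc.
by exists (h \o g); [exact: hc|rewrite /= -[g (f x)]/((g \o f) x) gf].
Qed.

Lemma equiv_refl A : orbit_equivalent A A.
Proof.
exists id; last by rewrite (_ : image _ _ = orbits A) //; apply/seteqP; split=> [_ [M hM <-]|M hM]; [rewrite image_id|exists M => //; rewrite image_id].
by rewrite (_ : id = act 1%:M :> (V -> V)); [apply: act_isometry; exact: Ghat1|apply/funext => z; rewrite act1].
Qed.

Lemma equiv_sym A A' : orbit_equivalent A A' -> orbit_equivalent A' A.
Proof.
move=> [f If fE]; have [g Gg gE] := isometry_mx If; rewrite /orbit_equivalent -fE gE; exists (act (invmx g)); first by apply: act_isometry; exact: GhatV.
apply/seteqP; split=> [_ [_ [M hM <-] <-]|M hM]; first by rewrite act_imageK.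
by exists (act g @` M); [exists M|rewrite act_imageK].
Qed.

Lemma equiv_trans A A' A'' : orbit_equivalent A A' -> orbit_equivalent A' A'' -> orbit_equivalent A A''.
Proof.
move=> [f If e] [f' If' e']; rewrite /orbit_equivalent -e' -e; have [g Gg fE] := isometry_mx If; have [g' Gg' fE'] := isometry_mx If'.
exists (f' \o f).
  by rewrite (_ : f' \o f = act (g *m g')); [apply: act_isometry; exact: GhatM|apply/funext => z; rewrite fE fE' /= actM].
apply/seteqP; split=> [_ [M hM <-]|_ [_ [M hM <-] <-]].
  by exists (f @` M); [exists M|rewrite image_comp].
by exists M => //; rewrite image_comp.
Qed.

Lemma orbit_class_eq A A' : orbit_equivalent A A' -> orbit_class A = orbit_class A'.
Proof.
move=> h; apply/seteqP; split=> B [hB e]; split=> //; last exact: equiv_trans h e.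
exact: equiv_trans (equiv_sym h) e.
Qed.

Definition nontg_singular A M := [/\ cohomogeneity_one A, singular_orbit A M & ~ totally_geodesic bergman M].

(** The outcome of the analysis of one action: [b] moves a point of the singular orbit to 0, after
    which the orbits are level sets of rho. *)
Definition classified A M s := exists b e (P : 'M[R]_(n + n)) c,
  [/\ [/\ Ghat b, level_data e P c, c < 1, (2 <= \rank P)%N & s = param c (\rank P)],
    forall x y, CH x -> CH y -> orbit A x y <-> rho e P (act b x) = rho e P (act b y),
    M = [set z | CH z /\ rho e P (act b z) = 0] & has_parameter M s].

Lemma nontg_classified A M : nontg_singular A M -> exists s, classified A M s.
Proof.
move=> [[hA [dim1 _]] [[z0 hz <-] [k hk hc]] ntg].
have [g0 ug gz] := transitive_CH hz; have Gg := uni_Ghat ug.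
pose b := invmx g0; have Gb : Ghat b by exact: GhatV.
have bz : act b z0 = 0 by rewrite -gz /b actK.
have HA := Hof_closed hA; have Hc := conj_closed Gb HA.
have Ht := conj_thin Gb HA (thin_of_dim hA dim1).
set H := conj_group b (Hof A) in Hc Ht.
have OC := orbit_CH hA hz.
have oE : orb0 H = act b @` orbit A z0 by rewrite /H (orb0_conj Gb HA bz) orbitE.
have hcH : has_codim (orb0 H) k by rewrite oE; exact: has_codim_act.
have ntgH : ~ totally_geodesic bergman (orb0 H) by rewrite oE => /(totally_geodesic_act Gb OC).
have [e [P [c [d c1 rP nuE lvl]]]] := orbit_classification Hc Ht hcH hk ntgH.
have [hP c0 _ _ _] := d.
have lv x y : CH x -> CH y -> orbit A x y <-> rho e P (act b x) = rho e P (act b y).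
  move=> hx hy; rewrite orbitE //; apply: iff_trans (lvl _ _ (act_CH Gb hx) (act_CH Gb hy)).
  exact: iff_sym (conj_orbit x y Gb HA).
have pH : has_parameter (orb0 H) (param c k).
  apply: (orb0_parameter Hc).
    by rewrite param_codimE; exact: hcH (orb00 Hc).
  apply: (angle_condition_base _ hP); first exact/andP.
  move=> w; apply: iff_trans (nuE w); split=> h v.
    by move/(tangent_orb0 Hc)/h; rewrite metric0 => /eqP; rewrite mulf_eq0 pnatr_eq0 /= => /eqP.
  by move/(tangent_orb0 Hc)/h; rewrite metric0 => ->; rewrite mulr0.
exists (param c k), b, e, P, c; split=> //; first by rewrite rP.
  apply/seteqP; split=> z; last by move=> [hzC rz]; apply/lv => //; rewrite bz rz rho_base.
  move=> oz; have hzC := OC _ oz; split=> //.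
  by have /(lv _ _ hz hzC) := oz; rewrite bz rho_base.
have := has_parameter_act (GhatV Gb) (orb0_CH Hc) pH; rewrite oE act_imageK //.
Qed.

Lemma singular_orbit_unique A M M' s : cohomogeneity_one A -> singular_orbit A M -> singular_orbit A M' ->
  classified A M s -> M' = M.
Proof.
move=> [hA [dim1 _]] [[z0 hz M0] _] [[y hy <-] [k hk hc]] [b [e [P [c [[Gb d c1 rP sE] lv ME _]]]]].
have HA := Hof_closed hA; have Hc := conj_closed Gb HA.
have Ht := conj_thin Gb HA (thin_of_dim hA dim1).
have OC := orbit_CH hA hy.
have lvl v w : CH v -> CH w -> same_orbit (conj_group b (Hof A)) v w <-> rho e P v = rho e P w.
  move=> hv hw; have Gi := GhatV Gb.
  have := lv _ _ (act_CH Gi hv) (act_CH Gi hw); rewrite !actKV // orbitE // => h.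
  apply: iff_trans h; rewrite -{1}(actKV v Gb) -{1}(actKV w Gb); exact: conj_orbit.
have hyb := act_CH Gb hy.
have hcb : has_codim [set z | same_orbit (conj_group b (Hof A)) (act b y) z] k.
  rewrite (_ : [set z | _] = act b @` orbit A y); first exact: has_codim_act.
  rewrite orbitE //; apply/seteqP; split=> [z hz'|_ [w hw <-]]; last exact/(conj_orbit _ _ Gb HA).
  by exists (act (invmx b) z); [apply/(conj_orbit _ _ Gb HA)|]; rewrite actKV.
have ry := singular_unique Hc Ht d lvl hyb hcb hk.
have hM : M y by rewrite ME.
by rewrite -M0 in hM *; exact: orbit_eq hM.
Qed.

Lemma singular_transport A A' M g : Ghat g -> isometric_action A -> [set act g @` M | M in orbits A] = orbits A' ->
  singular_orbit A M -> ~ totally_geodesic bergman M ->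
  singular_orbit A' (act g @` M) /\ ~ totally_geodesic bergman (act g @` M).
Proof.
move=> Gg hA gE [oM [k hk hc]] ntg; have MC : M `<=` CH by case: oM => z hz <-; exact: orbit_CH.
split; last by move/(totally_geodesic_act Gg MC).
by split; [rewrite -gE; exists M|exists k => //; exact: has_codim_act].
Qed.

Lemma classified_model A M s : classified A M s -> model_space R n s.
Proof. by move=> [b [e [P [c [[Gb d c1 rP ->] _ _ _]]]]]; exact: (param_model d c1 rP). Qed.

(** The parameter determines [c] and the rank, so [level_equiv] matches the two level functions; [h]
    composes this isometry with the two normalizations. *)
Lemma classified_equiv A A' M M' s : isometric_action A -> isometric_action A' ->
  classified A M s -> classified A' M' s -> orbit_equivalent A A'.
Proof.
move=> hA hA' [b [e [P [c [[Gb d c1 rP sE] lv _ _]]]]] [b' [e' [P' [c' [[Gb' d' c1' rP' sE'] lv' _ _]]]]].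
have [_ c0 _ _ _] := d; have [_ c0' _ _ _] := d'.
have cb : 0 <= c < 1 by rewrite c0. have cb' : 0 <= c' < 1 by rewrite c0'.
have [ec ek] := param_inj cb cb' (etrans (esym sE) sE'); rewrite -ec in d'.
have [g ug gE] := level_equiv d d' ek; have Gg := uni_Ghat ug.
pose h := b *m g *m invmx b'; have Gh : Ghat h by apply: GhatM; [exact: GhatM|exact: GhatV].
have hE z : CH z -> rho e' P' (act b' (act h z)) = rho e P (act b z).
  move=> hz; rewrite /h actM ?actKV ?actM //; [|exact: GhatM|exact: GhatV].
  by rewrite gE //; exact: act_CH.
have im x : CH x -> act h @` orbit A x = orbit A' (act h x).
  move=> hx; have hhx := act_CH Gh hx; apply/seteqP; split=> [_ [y hy <-]|y hy].
    have hyC := orbit_CH hA hx hy; apply/lv' => //; first exact: act_CH.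
    by rewrite !hE //; apply/lv.
  have hyC := orbit_CH hA' hhx hy; exists (act (invmx h) y); last by rewrite actKV.
  have hyC' := act_CH (GhatV Gh) hyC.
  by apply/lv => //; rewrite -!hE // actKV //; apply/lv'.
exists (act h); first exact: act_isometry.
apply/seteqP; split=> [_ [_ [x hx <-] <-]|_ [y hy <-]].
  by rewrite im //; exists (act h x) => //; exact: act_CH.
have hy' := act_CH (GhatV Gh) hy.
by exists (orbit A (act (invmx h) y)); [exists (act (invmx h) y)|rewrite im // actKV].
Qed.

(** The nonzero normal vector makes the angle conditions effective: a real normal space would have
    Kaehler angle pi / 2, which the range of phi excludes. *)
Lemma parameter_uniq M z v s s' : M z -> Defs.normal_space bergman M z v -> v != 0 ->
  model_space R n s -> model_space R n s' -> has_parameter M s -> has_parameter M s' -> s = s'.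
Proof.
move=> Mz Nv v0 ms ms' /has_parameterE[hc hp] /has_parameterE[hc' hp'].
have ek : param_codim s = param_codim s'.
  have [T [TE dT]] := hc z Mz; have [T' [TE' dT']] := hc' z Mz.
  have : T = T'.
    apply/vspaceP => w; apply/idP/idP => h.
      by have : [set` T'] w by rewrite TE' -TE.
    by have : [set` T] w by rewrite TE -TE'.
  by move=> e; move: dT dT'; rewrite e; lia.
have {}hp := hp z Mz; have {}hp' := hp' z Mz.
have rl (phi : R) : real_subspace z (Defs.normal_space bergman M z) ->
    constant_kahler_angle z (Defs.normal_space bergman M z) phi -> phi = pi / 2.
  move=> hr hk; rewrite -(hk v Nv v0) /kahler_angle /angle_to_subspace.
  rewrite (_ : image _ _ = [set pi / 2]) ?inf1 //; apply/seteqP; split=> [_ [w [Nw w0] <-]|_ ->].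
    by rewrite /angle /= (hr v w Nv Nw) mul0r acos0.
  by exists v => //; rewrite /angle (hr v v Nv Nv) mul0r acos0.
case: s s' ms ms' hp hp' ek {hc hc'} => [k|[phi k]] [k'|[phi' k']] /=.
- by move=> _ _ _ _ ->.
- by move=> _ [/andP[_ lt] _] h1 h2 _; move: lt; rewrite (rl _ h1 h2) ltxx.
- by move=> [/andP[_ lt] _] _ h1 h2 _; move: lt; rewrite (rl _ h2 h1) ltxx.
- by move=> _ _ h1 h2 ->; rewrite -(h1 v Nv v0) (h2 v Nv v0).
Qed.

Lemma model_exists s : model_space R n s -> exists A M v, [/\ nontg_singular A M, M 0,
  Defs.normal_space bergman M 0 v, v != 0 & has_parameter M s].
Proof.
move=> ms; have [c [k [[c0 c1] [k2 kn] ev sE]]] : exists (c : R) k, [/\ 0 <= c /\ c < 1, (2 <= k)%N /\ (k < n)%N,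
    c != 0 -> ~~ odd k & s = param c k].
  case: s ms => [k|[phi l]] /=.
    by move=> hk; exists 0, k; rewrite /param eqxx; split=> //; lia.
  move=> [/andP[p0 p1] [m lE hm]]; have pp : phi \in `[0, pi] by rewrite in_itv /=; apply/andP; split; have := pi_gt0 R; lra.
  have z0 : (0 : R) \in `[0, pi] by rewrite in_itv /= lexx pi_ge0.
  have h0 : pi / 2 \in `[(0 : R), pi] by rewrite in_itv /=; apply/andP; split; have := pi_gt0 R; lra.
  have cp : 0 < cos phi by rewrite -cos_pihalf ltr_cos.
  have cl : cos phi < 1 by rewrite -cos0 ltr_cos.
  exists (cos phi ^+ 2), l; split; [by rewrite sqr_ge0 expr_lt1 // ltW|lia|move=> _; lia|].
  by rewrite /param expf_eq0 /= gt_eqF // sqrtr_sqr gtr0_norm // cosK.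
have [d rP] := std_data c0 (ltW c1) (ltnW k2) kn ev.
move: d rP; move: (unitv _ _ _) (std_proj _ _ _) => e P d rP; have [hP _ k0 _ _] := d.
have hp := model_parameter d c1; rewrite rP -sE in hp.
have [u uP u1] := proj_unit hP c0 k0.
have hA := model_action d.
have oM : orb0 (Hof (model_group e P)) = orbit (model_group e P) 0 by rewrite orbitE.
exists (model_group e P), (orb0 (Hof (model_group e P))), u; split=> //.
- split; [exact: (model_cohomogeneity_one d)| |exact: (model_not_totally_geodesic d)].
  split; first by exists 0 => //; exact: CH0.
  by exists k => //; have /has_parameterE[] := hp; rewrite sE param_codimE.
- exact: (orb00 (Hof_closed hA)).
- by apply/(normal_base d (model_tangent d)).
- by rewrite -dot_eq0 u1 oner_eq0.
Qed.

Definition moduli_parameter (C : set (set (V -> V))) : nat + R * nat :=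
  xget (inl 0%N) [set s | exists A M, [/\ nontg_singular A M, C = orbit_class A & classified A M s]].

Lemma moduli_parameterP A M : nontg_singular A M -> exists A' M',
  [/\ nontg_singular A' M', orbit_class A = orbit_class A' & classified A' M' (moduli_parameter (orbit_class A))].
Proof.
move=> h; have [s hs] := nontg_classified h.
have ex : exists s, [set s | exists A' M', [/\ nontg_singular A' M', orbit_class A = orbit_class A' & classified A' M' s]] s.
  by exists s, A, M.
exact (xgetPex (inl 0%N) ex).
Qed.

(** The parameter may come from another representative. An isometry carries its singular orbit to a
    singular orbit of [A], which is [M] by uniqueness. *)
Lemma moduli_parameter_geometric A M : nontg_singular A M -> has_parameter M (moduli_parameter (orbit_class A)).
Proof.
move=> h; have [A' [M' [[cA' sM' nM'] eC hs]]] := moduli_parameterP h; have [cA sM ntg] := h.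
have [_ [f If fE]] : orbit_class A' A by rewrite -eC; split=> //; exact: equiv_refl.
have [g Gg gE] := isometry_mx If; rewrite gE in fE.
have [sg _] := singular_transport Gg cA'.1 fE sM' nM'.
have [s0 hs0] := nontg_classified h.
have <- : act g @` M' = M by exact: singular_orbit_unique cA sM sg hs0.
have [b [e [P [c [_ _ _ hp]]]]] := hs; apply: has_parameter_act => //.
by case: sM' => -[z hz <-] _; exact: orbit_CH cA'.1 hz.
Qed.
End Moduli.

Theorem theorem4p2 (R : realType) (n : nat) (hn : (2 <= n)%N) :
  exists Phi : set (set (realCn R n -> realCn R n)) -> (nat + R * nat)%type,
    set_bij (moduli_space R n) (model_space R n) Phi /\
    forall (A : set (realCn R n -> realCn R n)) (M : set (realCn R n)),
      cohomogeneity_one A -> singular_orbit A M ->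
      ~ totally_geodesic bergman M ->
      has_parameter M (Phi (orbit_class A)).
Proof.
exists (@moduli_parameter R n); split; last by move=> A M h1 h2 h3; exact: moduli_parameter_geometric.
split.
- move=> _ [A [hA [M [sM ntg]]] <-].
  have [A' [M' [_ _ hs]]] := moduli_parameterP (And3 hA sM ntg).
  exact: classified_model hs.
- move=> C C' /set_mem[A [hA [M [sM ntg]]] <-] /set_mem[B [hB [N [sN ntgN]]] <-] e.
  have [A' [M' [[hA' _ _] eA hs]]] := moduli_parameterP (And3 hA sM ntg).
  have [B' [N' [[hB' _ _] eB hs']]] := moduli_parameterP (And3 hB sN ntgN).
  rewrite -e in hs'; rewrite eA eB; apply: orbit_class_eq; exact: classified_equiv hA'.1 hB'.1 hs hs'.
(* The parameter chosen for the class of the model action and [s] both describe its singular orbit,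
   so they agree. *)
- move=> s ms; have [A [M [v [h M0 Nv v0 hp]]]] := model_exists ms; have [hA sM ntg] := h.
  exists (orbit_class A); first by exists A => //; split=> //; exists M.
  have [A' [M' [_ _ hs]]] := moduli_parameterP h.
  exact: parameter_uniq M0 Nv v0 (classified_model hs) ms (moduli_parameter_geometric h) hp.
Qed.
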